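(* Let $G$ be a strictly linear-recursive coarse-grained workflow specification, let $R$ be a (fixed) regular path query that is safe with respect to $G$, and let $g\in L(G)$ be a run whose nodes carry the labels $\psi_V$. Let $l_1,l_2$ be two input lists of nodes of $g$, given by the labels of their nodes. Then the all-pairs query $R$ over $l_1$ and $l_2$, i.e. the set of all $(u,v)\in l_1\times l_2$ with $u\stackrel{R}{\leadsto}v$, can be answered in time linear in $|l_1|$, $|l_2|$ and $N$ and polynomial in $|G|$, where $N$ is the number of pairs $(u,v)\in l_1\times l_2$ such that $v$ is reachable from $u$ in $g$. (Operations on two words of $\log n$ bits, $n$ the size of $g$, are assumed to take constant time.)
   Context: **Workflows.** A simple workflow $W=(V,E)$ is a finite acyclic directed multigraph. Each node (module) has a name in a finite set $\Sigma$ and each edge $e$ has a tag $\tau_E(e)$ in a finite set $\Gamma$; parallel edges carry different tags. A workflow specification is a graph grammar $G=(\Sigma,\Delta,S,P)$, where $\Delta\subseteq\Sigma$ are the composite modules, $\Sigma\setminus\Delta$ the atomic modules, $S\in\Sigma$ is the start module, and $P$ is a finite set of productions $M\to W$ with $M\in\Delta$ and $W$ a simple workflow with node names in $\Sigma$. $|G|$ denotes the size of the specification. Coarse-grained means that every module has a single input and a single output and the output depends on the input; so each right-hand side $W$ has a unique source and a unique sink. Replacing a composite node $v$ by $W$ (for a production $name(v)\to W$) deletes $v$, inserts a copy of $W$, redirects the edges entering $v$ to the source of $W$ and lets the edges leaving $v$ start at the sink of $W$, keeping tags. An execution of a module $M$ is a graph with only atomic nodes obtained from a single node named $M$ by a sequence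 of replacements; its input is its source node and its output is its sink node. A run of $G$ is an execution of $S$; $L(G)$ is the set of runs. **Strict linear recursion.** The production graph $\mathcal P(G)$ is the directed multigraph with vertex set $\Sigma$ having, for each production $M\to W$ and each node of $W$ named $M'$, one edge from $M$ to $M'$. $G$ is strictly linear-recursive if all cycles of $\mathcal P(G)$ are vertex-disjoint. A module is recursive if it lies on a cycle. **Queries.** A regular path query $R$ is a regular expression over $\Gamma$ (built from $\epsilon$, the single-symbol wildcard, symbols, concatenation, alternation, $^*$, $^+$) with language $L(R)\subseteq\Gamma^*$. For a path $p$ with edges $e_1,\dots,e_k$ let $\tau_P(p)=\tau_E(e_1)\cdots\tau_E(e_k)$. Write $u\stackrel{R}{\leadsto}v$ if there is a path $p$ from $u$ to $v$ in $g$ with $\tau_P(p)\in L(R)$. **Safety.** A DFA $\mathcal M=(Q,\Gamma,\delta,q_0,F)$ has a total transition function $\delta:Q\times\Gamma\to Q$, extended to $\delta^*:Q\times\Gamma^*\to Q$. $\mathcal M$ is safe with respect to $G$ if for every $(q_1,q_2)\in Q\times Q$, every $M\in\Sigma$ and any two executions $ex_1,ex_2$ of $M$: if some path $p$ from the input to the output of $M$ in $ex_1$ has $\delta^*(q_1,\tau_P(p))=q_2$, then some path $p'$ from the input to the output of $M$ in $ex_2$ has $\delta^*(q_1,\tau_P(p'))=q_2$. $R$ is safe with respect to $G$ if some DFA accepting $L(R)$ is safe with respect to $G$. **Labels $\psi_V$.** Fix an ordering of the productions, a topological ordering of the nodes of each right-hand side, an ordering of the cycles of $\mathcal P(G)$,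 and a first edge for each cycle. The edge of $\mathcal P(G)$ from $M$ to the $i$-th node of the right-hand side of the $k$-th production (with left-hand side $M$) is identified with the pair $(k,i)$. The compressed parse tree $T$ of a run records its derivation: leaves are the atomic nodes of the run, and internal nodes are composite nodes occurring in the derivation or special recursive nodes. The children of a composite node $x$ correspond to the nodes of the right-hand side that replaced $x$, with the following modification for recursion. Whenever a node $x_1$ with a recursive module name is created that does not continue an already started recursion, a recursive node is put in its place, whose children are $x_1,x_2,\dots,x_m$, where $x_{j+1}$ is the node in the replacement of $x_j$ corresponding to the next edge of the cycle (and $x_{j+1}$ is then not a child of $x_j$), the sequence ending when the production applied does not contain the next cycle edge. A tree edge from a composite node $x$ to its child is labeled $(k,i)$ if the child (or, for a recursive node, its first child $x_1$) is the $i$-th node of the right-hand side of the $k$-th production, used to replace $x$. A tree edge from a recursive node to its $i$-th child is labeled $(s,t,i)$ if the recursion unfolds the $s$-th cycle starting from the $t$-th edge of that cycle. The label $\psi_V(v)$ of a node $v$ is the sequence of edge labels on the path from the root of $T$ to $v$. *)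

(* Defs.v *)
From mathcomp Require Import all_boot.
From mathcomp Require Import boolp.

Set Implicit Arguments.
Unset Strict Implicit.
Unset Printing Implicit Defensive.

(* Sigma = 'I_m (module names) and Gamma = 'I_t (edge tags): the alphabets are
   numbered so that they can be written in the memory of a machine.  The
   numberings of productions, nodes, cycles, cycle edges and children of
   recursive nodes start from 0. *)

(** * Directed multigraphs with named nodes and tagged edges *)

Record graph (V : eqType) (m t : nat) := Graph {
  nodes : seq (V * 'I_m);
  edges : seq (V * 'I_t * V)   (* (origin, tag, target) *)
}.

Section Graphs.
Variables (V : eqType) (m t : nat).
Implicit Types (g : graph V m t) (e : V * 'I_t * V).

Definition esrc e := e.1.1.
Definition etag e := e.1.2.
Definition etgt e := e.2.

Definition node_ids g : seq V := [seq x.1 | x <- nodes g].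

Definition sources g : seq V :=
  [seq v <- node_ids g | all (fun e => etgt e != v) (edges g)].
Definition sinks g : seq V :=
  [seq v <- node_ids g | all (fun e => esrc e != v) (edges g)].

(* the source and the sink of a graph where these are unique; [v0] is only a
   default value *)
Definition source (v0 : V) g : V := head v0 (sources g).
Definition sink (v0 : V) g : V := head v0 (sinks g).

(* [p] is a path from [u] to [v]; the empty path goes from [u] to [u] *)
Fixpoint walk g (u : V) (p : seq (V * 'I_t * V)) (v : V) : bool :=
  if p is e :: p' then [&& e \in edges g, esrc e == u & walk g (etgt e) p' v]
  else u == v.

Definition tags (p : seq (V * 'I_t * V)) : seq 'I_t := map etag p.

Definition reachable g (u v : V) : Prop := exists p, walk g u p v.

End Graphs.

(** * Regular path queries *)

Inductive regex :=
  | Eps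
  | Wild
  | Sym of nat
  | Cat of regex & regex
  | Alt of regex & regex
  | Star of regex
  | Plus of regex.

Fixpoint regex_over (t : nat) (r : regex) : bool :=
  match r with
  | Eps | Wild => true
  | Sym a => a < t
  | Cat r1 r2 | Alt r1 r2 => regex_over t r1 && regex_over t r2
  | Star r1 | Plus r1 => regex_over t r1
  end.

Fixpoint lang (t : nat) (r : regex) (w : seq 'I_t) {struct r} : Prop :=
  match r with
  | Eps => w = [::]
  | Wild => exists a : 'I_t, w = [:: a]
  | Sym b => exists2 a : 'I_t, a = b :> nat & w = [:: a]
  | Cat r1 r2 => exists w1 w2, [/\ lang r1 w1, lang r2 w2 & w = w1 ++ w2]
  | Alt r1 r2 => lang r1 w \/ lang r2 w
  | Star r1 => exists2 ws : seq (seq 'I_t),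
      (forall x, x \in ws -> lang r1 x) & w = flatten ws
  | Plus r1 => exists ws : seq (seq 'I_t),
      [/\ ws <> [::], (forall x, x \in ws -> lang r1 x) & w = flatten ws]
  end.

Definition rpq (V : eqType) (m t : nat) (R : regex) (g : graph V m t)
  (u v : V) : Prop := exists2 p, walk g u p v & lang R (tags p).

Section AllPairs.
Variables (V : eqType) (m t : nat).
Implicit Types (g : graph V m t) (l : seq V).

Definition all_pairs l1 l2 : seq (V * V) := undup [seq (u, v) | u <- l1, v <- l2].

(* boolp's `[< P >] is the (classical) truth value of P *)
Definition rpq_answers (R : regex) g l1 l2 : seq (V * V) :=
  [seq uv <- all_pairs l1 l2 | `[< rpq R g uv.1 uv.2 >]].

Definition num_reachable g l1 l2 : nat :=
  size [seq uv <- all_pairs l1 l2 | `[< reachable g uv.1 uv.2 >]].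

End AllPairs.

(** * Workflow specifications *)

(* The productions are listed in the fixed ordering. *)
Record spec (m t : nat) := Spec {
  composite : {set 'I_m};
  start : 'I_m;
  prods : seq ('I_m * graph nat m t)
}.

(* The nodes of a right-hand side are numbered 0, 1, ... along the fixed
   topological ordering; parallel edges carry different tags. *)
Definition simple_workflow (m t : nat) (W : graph nat m t) : bool :=
  [&& node_ids W == iota 0 (size (nodes W)),
      all (fun e => esrc e < etgt e < size (nodes W)) (edges W)
    & uniq (edges W)].

Section Specs.
Variables (m t : nat).
Implicit Types (G : spec m t) (M : 'I_m).

Definition wf_spec G : bool :=
  all (fun p => (p.1 \in composite G) && simple_workflow p.2) (prods G).

Definition coarse_grained G : bool :=
  all (fun p => (size (sources p.2) == 1) && (size (sinks p.2) == 1)) (prods G).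

Definition spec_size G : nat :=
  m + t + \sum_(p <- prods G) (size (nodes p.2) + size (edges p.2)).+1.

Definition prod G (k : nat) : 'I_m * graph nat m t :=
  nth (start G, Graph [::] [::]) (prods G) k.
Definition lhs G k := (prod G k).1.
Definition rhs G k := (prod G k).2.

(* The edge of the production graph from the left-hand side of the k-th
   production to the i-th node of its right-hand side is (k, i). *)
Definition pg_edge G (e : nat * nat) : bool :=
  (e.1 < size (prods G)) && (e.2 < size (nodes (rhs G e.1))).
Definition pg_src G (e : nat * nat) : 'I_m := lhs G e.1.
Definition pg_tgt G (e : nat * nat) : 'I_m :=
  nth (start G) [seq x.2 | x <- nodes (rhs G e.1)] e.2.

Definition pg_cycle G (c : seq (nat * nat)) : bool :=
  [&& c != [::], all (pg_edge G) c,
      cycle (fun e f => pg_tgt G e == pg_src G f) c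
    & uniq [seq pg_src G e | e <- c]].

(* Two closed walks as above denote the same cycle when they are equal up to
   rotation, i.e. when they have the same edges. *)
Definition strictly_linear G : Prop :=
  forall c1 c2, pg_cycle G c1 -> pg_cycle G c2 ->
    c1 =i c2 \/ ~~ has (mem [seq pg_src G e | e <- c1]) [seq pg_src G e | e <- c2].

(* [cs] lists every cycle exactly once, each from its chosen first edge. *)
Definition cycle_ordering G (cs : seq (seq (nat * nat))) : Prop :=
  all (pg_cycle G) cs /\
  forall c, pg_cycle G c -> exists! s, s < size cs /\ nth [::] cs s =i c.

End Specs.

(** * Executions *)

(* A node of an execution is identified by its position in the derivation: the
   copy of the i-th node of the right-hand side of the k-th production inserted
   when node [a] is replaced is [(k, i) :: a]; the initial node is [[::]].  This
   fixes the names of the inserted copies, so that an execution determines its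
   derivation up to the order of the replacements. *)
Definition addr := seq (nat * nat).

Section Executions.
Variables (m t : nat) (G : spec m t).
Implicit Types (g : graph addr m t) (a : addr).

Definition replace g a (k : nat) : graph addr m t :=
  let W := rhs G k in
  let copy (i : nat) : addr := (k, i) :: a in
  Graph
    ([seq x <- nodes g | x.1 != a] ++ [seq (copy x.1, x.2) | x <- nodes W])
    ([seq (if esrc e == a then copy (sink 0 W) else esrc e, etag e,
           if etgt e == a then copy (source 0 W) else etgt e) | e <- edges g]
     ++ [seq (copy (esrc e), etag e, copy (etgt e)) | e <- edges W]).

Inductive derives : graph addr m t -> graph addr m t -> Prop :=
  | derives_refl g : derives g g
  | derives_step g a k g' :
      k < size (prods G) -> (a, lhs G k) \in nodes g ->
      derives (replace g a k) g' -> derives g g'.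

Definition execution (M : 'I_m) g : Prop :=
  derives (Graph [:: ([::], M)] [::]) g /\
  all (fun x => x.2 \notin composite G) (nodes g).

Definition run g : Prop := execution (start G) g.

End Executions.

Definition input_node (m t : nat) (g : graph addr m t) : addr := source [::] g.
Definition output_node (m t : nat) (g : graph addr m t) : addr := sink [::] g.

(** * Safety *)

Record dfa (t : nat) := Dfa {
  state : finType;
  trans : state -> 'I_t -> state;
  init_state : state;
  final : {set state}
}.

Definition run_dfa (t : nat) (D : dfa t) (q : state D) (w : seq 'I_t) : state D :=
  foldl (@trans t D) q w.

Definition dfa_accepts_lang (t : nat) (D : dfa t) (R : regex) : Prop :=
  forall w : seq 'I_t, run_dfa (init_state D) w \in final D <-> lang R w.

Definition safe_dfa (m t : nat) (D : dfa t) (G : spec m t) : Prop :=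
  forall (q1 q2 : state D) (M : 'I_m) (ex1 ex2 : graph addr m t),
    execution G M ex1 -> execution G M ex2 ->
    (exists2 p, walk ex1 (input_node ex1) p (output_node ex1)
              & run_dfa q1 (tags p) = q2) ->
    exists2 p', walk ex2 (input_node ex2) p' (output_node ex2)
              & run_dfa q1 (tags p') = q2.

Definition safe_query (m t : nat) (R : regex) (G : spec m t) : Prop :=
  exists2 D : dfa t, dfa_accepts_lang D R & safe_dfa D G.

(** * The compressed parse tree of a run and the labels psi_V *)

Inductive tlabel :=
  | ProdLabel of nat & nat          (* (k, i) *)
  | RecLabel of nat & nat & nat.    (* (s, t, i) *)

(* The nodes of the tree: [TNode a] is the composite or atomic node created at
   [a]; [TRec a] is the special recursive node whose first child is [TNode a]. *)
Inductive tnode :=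
  | TNode of addr
  | TRec of addr.

Section Labels.
Variables (m t : nat) (G : spec m t) (cs : seq (seq (nat * nat))).

Definition run_name (a : addr) : 'I_m :=
  if a is e :: _ then pg_tgt G e else start G.

Definition cycle_of (M : 'I_m) : nat :=
  find (fun c => M \in [seq pg_src G e | e <- c]) cs.

Definition recursive (M : 'I_m) : bool := cycle_of M < size cs.

(* [rec_first a] is the node x_1 of the recursion that [a] belongs to, and [a]
   is x_(rec_index a + 1).  A node continues the recursion of the node it was
   created from exactly when it was created along an edge of a cycle. *)
Fixpoint rec_first (a : addr) : addr :=
  if a is e :: b then if e \in flatten cs then rec_first b else a else a.

Fixpoint rec_index (a : addr) : nat :=
  if a is e :: b then if e \in flatten cs then (rec_index b).+1 else 0 else 0.

Definition rec_label (a : addr) : tlabel :=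
  let M := run_name (rec_first a) in
  let c := nth [::] cs (cycle_of M) in
  RecLabel (cycle_of M) (index M [seq pg_src G e | e <- c]) (rec_index a).

(* the parent of a tree node, with the label of the edge between them *)
Definition tparent (x : tnode) : option (tnode * tlabel) :=
  match x with
  | TNode a =>
      if recursive (run_name a) then Some (TRec (rec_first a), rec_label a)
      else if a is e :: b then Some (TNode b, ProdLabel e.1 e.2) else None
  | TRec a => if a is e :: b then Some (TNode b, ProdLabel e.1 e.2) else None
  end.

(* the labels on the path from the root to [x]; [n] bounds the depth of [x] *)
Fixpoint root_path (n : nat) (x : tnode) : seq tlabel :=
  if n is n'.+1 then
    if tparent x is Some (y, l) then rcons (root_path n' y) l else [::]
  else [::].

Definition psiV (a : addr) : seq tlabel := root_path (size a).+1.*2 (TNode a).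

End Labels.

(** * Machine: a word RAM

   Programs use registers and a memory of words, both initially 0 except for the
   input at the addresses 0, 1, ... of the memory, and an output tape.  Each
   occurrence of an operation takes one unit of time.  Every value (hence also
   every address) must be smaller than the bound [B], i.e. fit in a word of
   log B bits; a computation that exceeds [B] has no result. *)

Inductive binop := Add | Sub | Mul | Div | Mod | Lt | Eq.

Inductive expr :=
  | Cst of nat
  | Reg of nat
  | Read of expr
  | Op of binop & expr & expr.

Inductive cmd :=
  | Skip
  | Assign of nat & expr
  | Write of expr & expr            (* address, value *)
  | Emit of expr
  | Seq of cmd & cmd
  | If of expr & cmd & cmd
  | While of expr & cmd.

Record mstate := MState {
  regs : nat -> nat;
  mem : nat -> nat;
  out : seq nat
}.

Definition eval_op (o : binop) (x y : nat) : nat :=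
  match o with
  | Add => x + y
  | Sub => x - y
  | Mul => x * y
  | Div => x %/ y
  | Mod => x %% y
  | Lt => x < y
  | Eq => x == y
  end.

Definition word (B v : nat) : option nat := if v < B then Some v else None.

Fixpoint eval (B : nat) (s : mstate) (e : expr) : option nat :=
  match e with
  | Cst v => word B v
  | Reg r => word B (regs s r)
  | Read e1 => if eval B s e1 is Some x then word B (mem s x) else None
  | Op o e1 e2 =>
      if (eval B s e1, eval B s e2) is (Some x, Some y)
      then word B (eval_op o x y) else None
  end.

Fixpoint expr_cost (e : expr) : nat :=
  match e with
  | Cst _ | Reg _ => 1
  | Read e1 => (expr_cost e1).+1
  | Op _ e1 e2 => (expr_cost e1 + expr_cost e2).+1
  end.

Definition upd (f : nat -> nat) (x v : nat) : nat -> nat :=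
  fun y => if y == x then v else f y.

(* [exec B c s s' n]: started in [s], [c] stops in [s'] after time [n]. *)
Inductive exec (B : nat) : cmd -> mstate -> mstate -> nat -> Prop :=
  | exec_skip s : exec B Skip s s 1
  | exec_assign s r e v : eval B s e = Some v ->
      exec B (Assign r e) s (MState (upd (regs s) r v) (mem s) (out s))
        (expr_cost e).+1
  | exec_write s e1 e2 x v : eval B s e1 = Some x -> eval B s e2 = Some v ->
      exec B (Write e1 e2) s (MState (regs s) (upd (mem s) x v) (out s))
        (expr_cost e1 + expr_cost e2).+1
  | exec_emit s e v : eval B s e = Some v ->
      exec B (Emit e) s (MState (regs s) (mem s) (rcons (out s) v))
        (expr_cost e).+1
  | exec_seq s s1 s2 c1 c2 n1 n2 : exec B c1 s s1 n1 -> exec B c2 s1 s2 n2 ->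
      exec B (Seq c1 c2) s s2 (n1 + n2)
  | exec_if s s1 e v c1 c2 n : eval B s e = Some v ->
      exec B (if v != 0 then c1 else c2) s s1 n ->
      exec B (If e c1 c2) s s1 ((expr_cost e).+1 + n)
  | exec_while_stop s e c : eval B s e = Some 0 ->
      exec B (While e c) s s (expr_cost e).+1
  | exec_while_loop s s1 s2 e c v n1 n2 : eval B s e = Some v -> v != 0 ->
      exec B c s s1 n1 -> exec B (While e c) s1 s2 n2 ->
      exec B (While e c) s s2 ((expr_cost e).+1 + n1 + n2).

Definition start_state (inp : seq nat) : mstate :=
  MState (fun _ => 0) (fun x => nth 0 inp x) [::].

(** * Encoding of the input and of the output *)

Definition enc_seq (T : Type) (f : T -> seq nat) (s : seq T) : seq nat :=
  size s :: flatten (map f s).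

Definition enc_graph (m t : nat) (W : graph nat m t) : seq nat :=
  enc_seq (fun x : nat * 'I_m => [:: nat_of_ord x.2]) (nodes W) ++
  enc_seq (fun e => [:: esrc e; nat_of_ord (etag e); etgt e]) (edges W).

Definition enc_spec (m t : nat) (G : spec m t) (cs : seq (seq (nat * nat)))
    : seq nat :=
  [:: t; nat_of_ord (start G)] ++
  enc_seq (fun M => [:: nat_of_bool (M \in composite G)]) (enum 'I_m) ++
  enc_seq (fun p => nat_of_ord p.1 :: enc_graph p.2) (prods G) ++
  enc_seq (enc_seq (fun e => [:: e.1; e.2])) cs.

Definition enc_tlabel (l : tlabel) : seq nat :=
  match l with
  | ProdLabel k i => [:: 0; k; i]
  | RecLabel s u i => [:: 1; s; u; i]
  end.

Definition enc_label : seq tlabel -> seq nat := enc_seq enc_tlabel.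

Definition enc_input (m t : nat) (G : spec m t) cs (l1 l2 : seq (seq tlabel))
    : seq nat :=
  enc_spec G cs ++ enc_seq enc_label l1 ++ enc_seq enc_label l2.

Definition enc_output (ans : seq (seq tlabel * seq tlabel)) : seq nat :=
  flatten [seq enc_label p.1 ++ enc_label p.2 | p <- ans].

(* Words have O(log n) bits, the input being made of words: with productions
   whose right-hand side is a single node, and with lists that repeat nodes, an
   index in a label or the length of the input need not be polynomial in n. *)
Definition word_bound (w n : nat) (inp : seq nat) : nat :=
  (n + size inp + \max_(x <- inp) x + 2) ^ w.

(* Submission.v *)
Require Import Defs.
From mathcomp Require Import all_boot.
From mathcomp Require Import zify boolp.

(* Parsing [R] gives an automaton whose transition relations form a finite monoid: a label
   sequence of edges matters only through the relation it induces on the states.  By safety all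
   executions of a productive module have compatible relations between input and output, so one
   relation per module, computed by iterating over the productions, describes every execution,
   and one table per production gives the relation of the paths between two nodes of its
   right-hand side, which is empty exactly when there is no path.

   For two nodes of the run, the labels first differ either at two nodes of one right-hand side
   or at two members of one recursion.  The relation between the nodes is then a product of
   factors read off the two label suffixes, one table entry, and, for a recursion, a power along
   a cycle; in a finite monoid the powers are ultimately periodic, so a power has a period that
   depends on [R] only and costs polynomial time.

   To find the reachable pairs in time linear in their number, the labels are stored in a trie,
   and each label offers joins: at a production, the nodes reachable from it in the right-hand
   side; at a recursion, a key such that a left and a right join with the same name match when
   the sum of their keys is less than a bound.  Each reachable pair is matched by exactly one
   pair of joins.  In the lists of left and of right joins at a trie node, take the entry of the
   least key in the shorter list and scan the longer one: an entry either matches, which yields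
   an answer candidate, or matches nothing in the shorter list and is dropped for good.

   The algorithm is written for a machine with two-dimensional arrays and counted loops; its
   programs compile to the word RAM with a constant factor. *)

(** The program may depend on [R] only, whereas the automaton that witnesses safety depends on [G].
    The tables are therefore computed with an automaton built from [R] alone, on whose states two
    executions of the same module may well induce different relations. What is stored for a language
    is the relation of some other language that the safe automaton cannot tell from it. This
    suffices, because both automata accept the same words from their initial states, so that the
    substitution does not show in the answer.

    Work done per label or per pair has to be bounded in terms of [G]. The number of entries of a
    label is so bounded, since only the edges off the cycles lengthen it, but the recursion indices
    inside it are not; neither the comparison of two indices nor the product between them may take
    time that grows with the index.

    The machine is not told the length of its input. The input is read twice: the first pass only
    finds where the free memory begins, and the arrays are placed there before the second pass. *)

Set Implicit Arguments.
Unset Strict Implicit.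
Unset Printing Implicit Defensive.

(** * Automata of regular expressions *)

(* A deterministic automaton over the alphabet [nat] that does not distinguish the letters
   [cap], [cap + 1], ...; it reads words over every alphabet ['I_t]. *)
Record automaton := Automaton {
  astate : finType;
  astep : astate -> nat -> astate;
  ainit : astate;
  aaccept : pred astate;
  acap : nat
}.

Definition arun (A : automaton) (q : astate A) (w : seq nat) : astate A := foldl (@astep A) q w.

Definition recognizes (A : automaton) (r : regex) : Prop :=
  (forall q a, @astep A q a = @astep A q (minn a (acap A))) /\
  forall (t : nat) (w : seq 'I_t), aaccept (arun (ainit A) (map val w)) <-> lang r w.

Lemma arun_rcons A q w a : @arun A q (rcons w a) = astep (arun q w) a.
Proof. by rewrite /arun foldl_rcons. Qed.

Lemma arun_cat A q w1 w2 : @arun A q (w1 ++ w2) = arun (arun q w1) w2.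
Proof. by rewrite /arun foldl_cat. Qed.

Definition eps_automaton :=
  @Automaton bool (fun _ _ => false) true id 0.

Lemma eps_automatonP : recognizes eps_automaton Eps.
Proof.
split=> // t; elim/last_ind => [|w a _] //=.
by rewrite map_rcons arun_rcons /=; split=> //; case: w.
Qed.

Definition letter_automaton (P : pred nat) k :=
  @Automaton (option bool) (fun q a => if q is None then Some (P a) else Some false)
    None (fun q => q == Some true) k.

Lemma letter_automaton_run P k (w : seq nat) :
  arun (A := letter_automaton P k) None w == Some true =
  (if w is [:: a] then P a else false).
Proof.
by case: w => [|a [|b w]] //=; elim: w.
Qed.

Lemma wild_automatonP : recognizes (letter_automaton predT 0) Wild.
Proof.
split=> [[]//|t w] /=; rewrite letter_automaton_run.
by case: w => [|a [|b w]] /=; split=> //; try (by case); exists a.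
Qed.

(** The cap is [b.+1] and not [b]: all letters above [b] are identified with [b.+1] and stay
    different from [b]. *)
Lemma sym_automatonP b : recognizes (letter_automaton (pred1 b) b.+1) (Sym b).
Proof.
split=> [[]//= a|t w] /=.
  by congr Some; rewrite minnE; lia.
rewrite letter_automaton_run.
case: w => [|a [|c w]] /=; split=> //; try by case.
  by move/eqP => ab; exists a.
by case=> a' ab [->]; apply/eqP.
Qed.

Definition alt_automaton A1 A2 :=
  @Automaton (astate A1 * astate A2)%type
    (fun q a => (astep q.1 a, astep q.2 a)) (ainit A1, ainit A2)
    (fun q => aaccept q.1 || aaccept q.2) (maxn (acap A1) (acap A2)).

Lemma step_cap A r k q a : recognizes A r -> acap A <= k ->
  @astep A q (minn a k) = astep q a.
Proof.
by case=> h _ hk; rewrite h [RHS]h -minnA (minn_idPr hk).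
Qed.

Lemma alt_automatonP A1 A2 r1 r2 : recognizes A1 r1 -> recognizes A2 r2 ->
  recognizes (alt_automaton A1 A2) (Alt r1 r2).
Proof.
move=> h1 h2; split=> [[q1 q2] a|t w] /=.
  by rewrite (step_cap _ _ h1) ?(step_cap _ _ h2) ?leq_maxl ?leq_maxr.
have -> : forall w' q, arun (A := alt_automaton A1 A2) q w' = (arun q.1 w', arun q.2 w').
  by elim => [|a w' IH] [q1 q2] //=; rewrite /arun /= -!/(arun _ _) IH.
rewrite /= -(h1.2 _ w) -(h2.2 _ w); split; first by case/orP; [left|right].
by case=> ->; rewrite ?orbT.
Qed.

(** A subset construction on the second factor only. The set holds one state of [A2] for each point
    at which the word read so far may have been split, and [entry] opens a new split when [A1]
    accepts. *)
Definition cat_automaton A1 A2 :=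
  let entry (q1 : astate A1) := [set q | aaccept q1 & q == ainit A2] in
  @Automaton (astate A1 * {set astate A2})%type
    (fun q a => let q1 := astep q.1 a in
                (q1, [set astep x a | x in q.2] :|: entry q1))
    (ainit A1, entry (ainit A1))
    (fun q => [exists x in q.2, aaccept x]) (maxn (acap A1) (acap A2)).

Lemma cat_automatonP A1 A2 r1 r2 : recognizes A1 r1 -> recognizes A2 r2 ->
  recognizes (cat_automaton A1 A2) (Cat r1 r2).
Proof.
move=> h1 h2; split=> [[q1 q2] a|t w] /=.
  rewrite (step_cap _ _ h1) ?leq_maxl //; congr (_, _ :|: _).
  by apply: eq_imset => x; rewrite (step_cap _ _ h2) ?leq_maxr.
have inv : arun (ainit (cat_automaton A1 A2)) (map val w) =
    (arun (ainit A1) (map val w), [set q | `[< exists w1 w2 : seq 'I_t,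
        [/\ w = w1 ++ w2, lang r1 w1 & q = arun (ainit A2) (map val w2)] >]]).
  elim/last_ind: w => [|w a IH] /=.
    congr (_, _); apply/setP=> q; rewrite !inE; apply/andP/asboolP.
      by case=> /(h1.2 _ [::]) ? /eqP ->; exists [::], [::].
    by move=> [[|? ?] [[|? ?] [// _]]] /(h1.2 _ [::]) /= -> ->.
  rewrite map_rcons !arun_rcons IH /=; congr (_, _); apply/setP=> q.
  rewrite !inE; apply/orP/asboolP.
    case=> [/imsetP[x]|/andP[acc /eqP ->]].
      rewrite inE => /asboolP[w1 [w2 [-> l1 ->]] ->].
      by exists w1, (rcons w2 a); rewrite -rcons_cat map_rcons arun_rcons.
    exists (rcons w a), [::]; rewrite cats0; split=> //.
    by apply/h1.2; rewrite map_rcons arun_rcons.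
  move=> [w1 [w2]]; elim/last_ind: w2 => [|w2 b _] [].
    rewrite cats0 => <- /h1.2; rewrite map_rcons arun_rcons => acc ->; right.
    by rewrite acc eqxx.
  rewrite -rcons_cat => /rcons_inj[e1 e2] l1 ->; left; apply/imsetP.
  exists (arun (ainit A2) (map val w2)); first by rewrite inE; apply/asboolP; exists w1, w2.
  by rewrite map_rcons arun_rcons e2.
rewrite inv; split=> /=.
  case/exists_inP=> q; rewrite inE => /asboolP[w1 [w2 [-> l1 ->]]] /h2.2 l2.
  by exists w1, w2.
move=> [w1 [w2 [l1 l2 ->]]]; apply/exists_inP.
exists (arun (ainit A2) (map val w2)); last exact/h2.2.
by rewrite inE; apply/asboolP; exists w1, w2.
Qed.

(* The flag records whether the word read is in the starred language: the initial state of
   the inner automaton can also be reached by nonempty words. *)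
Definition star_automaton A :=
  @Automaton (bool * {set astate A})%type
    (fun q a => let S := [set astep x a | x in q.2] in
                let b := [exists x in S, aaccept x] in
                (b, S :|: [set x | b & x == ainit A]))
    (true, [set ainit A]) (fun q => q.1) (acap A).

Lemma star_rcons t r (w : seq 'I_t) a : lang (Star r) (rcons w a) <->
  exists w1 w2, [/\ w = w1 ++ w2, lang (Star r) w1 & lang r (rcons w2 a)].
Proof.
split=> [[ws hws]|[w1 [w2 [-> [ws hws ->] l2]]]]; last first.
  exists (rcons ws (rcons w2 a)).
    by move=> x; rewrite mem_rcons inE => /orP[/eqP->|/hws].
  by rewrite flatten_rcons rcons_cat.
elim/last_ind: ws hws => [|ws x IH] hws /=; first by case: w.
rewrite flatten_rcons; elim/last_ind: x hws => [|x b _] hws.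
  rewrite cats0 => e; apply: IH => // y hy; apply: hws.
  by rewrite mem_rcons inE hy orbT.
rewrite -rcons_cat => /rcons_inj[-> ->]; exists (flatten ws), x; split=> //.
  by exists ws => // y hy; apply: hws; rewrite mem_rcons inE hy orbT.
by apply: hws; rewrite mem_rcons mem_head.
Qed.

Lemma star_automatonP A r : recognizes A r -> recognizes (star_automaton A) (Star r).
Proof.
move=> h; split=> [[q1 q2] a|t w] /=.
  have -> : [set astep x a | x in q2] = [set astep x (minn a (acap A)) | x in q2] => //.
  by apply: eq_imset => x; rewrite (step_cap _ _ h).
have inv : arun (ainit (star_automaton A)) (map val w) =
    (`[< lang (Star r) w >], [set q | `[< exists w1 w2 : seq 'I_t,
        [/\ w = w1 ++ w2, lang (Star r) w1 & q = arun (ainit A) (map val w2)] >]]).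
  elim/last_ind: w => [|w a IH].
    rewrite /arun /=; congr (_, _); first by apply/esym/asboolP; exists [::].
    apply/setP=> q; rewrite !inE; apply/eqP/asboolP=> [->|].
      by exists [::], [::]; split=> //; exists [::].
    by move=> [[|? ?] [[|? ?] [// _ _ ->]]].
  rewrite map_rcons arun_rcons IH /=; set S := [set astep _ _ | _ in _].
  have SP q : q \in S <-> exists w1 w2 : seq 'I_t,
      [/\ w = w1 ++ w2, lang (Star r) w1 & q = arun (ainit A) (map val (rcons w2 a))].
    split=> [/imsetP[x]|[w1 [w2 [e l ->]]]].
      rewrite inE => /asboolP[w1 [w2 [-> l1 ->]] ->].
      by exists w1, w2; rewrite map_rcons arun_rcons.
    apply/imsetP; exists (arun (ainit A) (map val w2)).
      by rewrite inE; apply/asboolP; exists w1, w2.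
    by rewrite map_rcons arun_rcons.
  have -> : [exists x in S, aaccept x] = `[< lang (Star r) (rcons w a) >].
    apply/exists_inP/asboolP; rewrite star_rcons.
      by move=> [q /SP[w1 [w2 [e l ->]]] /h.2 l2]; exists w1, w2.
    move=> [w1 [w2 [e l l2]]]; exists (arun (ainit A) (map val (rcons w2 a))).
      by apply/SP; exists w1, w2.
    exact/h.2.
  congr (_, _); apply/setP=> q; rewrite !inE; apply/orP/asboolP.
    case=> [/SP[w1 [w2 [-> l ->]]]|/andP[/asboolP l /eqP ->]].
      by exists w1, (rcons w2 a); rewrite rcons_cat.
    by exists (rcons w a), [::]; rewrite cats0.
  move=> [w1 [w2]]; elim/last_ind: w2 => [|w2 b _] [].
    by rewrite cats0 => <- l ->; right; rewrite eqxx andbT; apply/asboolP.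
  rewrite -rcons_cat => /rcons_inj[e1 e2] l1 ->; left.
  by apply/SP; exists w1, w2; rewrite e2.
by rewrite inv; split=> /asboolP.
Qed.

Lemma plus_lang t r (w : seq 'I_t) : lang (Cat r (Star r)) w <-> lang (Plus r) w.
Proof.
split=> [[w1 [w2 [l1 [ws hws ->] ->]]]|[[|w1 ws] [// _ hws ->]]].
  exists (w1 :: ws); split=> // x; rewrite inE => /orP[/eqP->|/hws] //.
exists w1, (flatten ws); split=> //; first by apply: hws; rewrite mem_head.
by exists ws => // x hx; apply: hws; rewrite inE hx orbT.
Qed.

Theorem regex_automaton r : exists A, recognizes A r.
Proof.
elim: r.
- by exists eps_automaton; apply: eps_automatonP.
- by exists (letter_automaton predT 0); apply: wild_automatonP.
- by move=> b; exists (letter_automaton (pred1 b) b.+1); apply: sym_automatonP.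
- move=> r1 [A1 h1] r2 [A2 h2]; exists (cat_automaton A1 A2); exact: cat_automatonP.
- move=> r1 [A1 h1] r2 [A2 h2]; exists (alt_automaton A1 A2); exact: alt_automatonP.
- by move=> r [A h]; exists (star_automaton A); apply: star_automatonP.
- move=> r [A h]; exists (cat_automaton A (star_automaton A)).
  have [h1 h2] := cat_automatonP h (star_automatonP h).
  by split=> // t w; rewrite h2; apply: plus_lang.
Qed.

(** * Derivation trees of executions *)

Lemma cat_injl (T : eqType) (a p q : seq T) : p ++ a = q ++ a -> p = q.
Proof.
move=> e; have sz : size p = size q by have := congr1 size e; rewrite !size_cat; lia.
by move/eqP: e; rewrite eqseq_cat // => /andP[/eqP].
Qed.

Lemma suffix_child (c : nat * nat) (b x : addr) : suffix (c :: b) x -> suffix b x.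
Proof. by move/suffixP=> [p ->]; apply/suffixP; exists (rcons p c); rewrite cat_rcons. Qed.

(** Addresses are listed from the node upwards, so the ancestors of a node are the suffixes of its
    address, and a node lies below at most one child of [b]. *)
Lemma suffix_inj (c d : nat * nat) (b x : addr) : suffix (c :: b) x -> suffix (d :: b) x -> c = d.
Proof.
move=> /suffixP[p ->] /suffixP[q] e.
have sz : size (rcons p c) = size (rcons q d).
  by have := congr1 size e; rewrite !size_cat !size_rcons /=; lia.
move/eqP: e; rewrite -!cat_rcons eqseq_cat // => /andP[/eqP e _].
by have /eqP := e; rewrite eqseq_rcons => /andP[_ /eqP].
Qed.

Section Trees.
Variables (m t : nat) (G : spec m t).
Hypotheses (wfG : wf_spec G) (cgG : coarse_grained G).

Definition nn k := size (nodes (rhs G k)).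
Definition nm k i : 'I_m := pg_tgt G (k, i).

Section Production.
Variable k : nat.
Hypothesis kG : k < size (prods G).

Let wfk : (lhs G k \in composite G) && simple_workflow (rhs G k).
Proof. exact: (all_nthP (start G, Graph [::] [::]) wfG). Qed.

Let cgk : (size (sources (rhs G k)) == 1) && (size (sinks (rhs G k)) == 1).
Proof. exact: (all_nthP (start G, Graph [::] [::]) cgG). Qed.

Lemma lhs_composite : lhs G k \in composite G.
Proof. by have /andP[] := wfk. Qed.

Lemma rhs_ids : node_ids (rhs G k) = iota 0 (nn k).
Proof. by have /andP[_ /and3P[/eqP]] := wfk. Qed.

Lemma rhs_edge e : e \in edges (rhs G k) -> (esrc e < etgt e) && (etgt e < nn k).
Proof. by have /andP[_ /and3P[_ /allP h _]] := wfk => /h. Qed.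

Lemma rhs_sources : exists x, sources (rhs G k) = [:: x].
Proof.
have /andP[/eqP + _] := cgk.
by case: sources => [|x [|]] // _; exists x.
Qed.

Lemma rhs_sinks : exists x, sinks (rhs G k) = [:: x].
Proof.
have /andP[_ /eqP] := cgk.
by case: sinks => [|x [|]] // _; exists x.
Qed.

Lemma nn_gt0 : 0 < nn k.
Proof.
have [x e] := rhs_sources; have : x \in sources (rhs G k) by rewrite e mem_head.
by rewrite mem_filter rhs_ids mem_iota => /andP[_ /andP[_]]; lia.
Qed.

(** Edges go to greater numbers, so node 0 is a source, and the source is unique. The same argument
    from the other end identifies the sink. *)
Lemma source0 : source 0 (rhs G k) = 0.
Proof.
have [x e] := rhs_sources; rewrite /source e /=.
have : 0 \in sources (rhs G k).
  rewrite mem_filter rhs_ids mem_iota /= nn_gt0 andbT.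
  by apply/allP => y /rhs_edge; lia.
by rewrite e inE => /eqP.
Qed.

Lemma sink_last : sink 0 (rhs G k) = (nn k).-1.
Proof.
have [x e] := rhs_sinks; rewrite /sink e /=; have n0 := nn_gt0.
have : (nn k).-1 \in sinks (rhs G k).
  rewrite mem_filter rhs_ids mem_iota /=; apply/andP; split; last lia.
  by apply/allP => y /rhs_edge; lia.
by rewrite e inE => /eqP.
Qed.

Lemma rhs_entering i : 0 < i < nn k -> exists2 e, e \in edges (rhs G k) & etgt e = i.
Proof.
move=> hi; have [x e] := rhs_sources.
have s0 : source 0 (rhs G k) = 0 := source0; rewrite /source e /= in s0.
case: (boolP (all (fun e => etgt e != i) (edges (rhs G k)))) => h.
  have : i \in sources (rhs G k) by rewrite mem_filter h rhs_ids mem_iota; lia.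
  by rewrite e inE s0; lia.
by case/allPn: h => y hy /negPn/eqP yi; exists y.
Qed.

Lemma rhs_leaving i : i < (nn k).-1 -> exists2 e, e \in edges (rhs G k) & esrc e = i.
Proof.
move=> hi; have [x e] := rhs_sinks.
have s0 := sink_last; rewrite /sink e /= in s0.
case: (boolP (all (fun e => esrc e != i) (edges (rhs G k)))) => h.
  have : i \in sinks (rhs G k) by rewrite mem_filter h rhs_ids mem_iota; lia.
  by rewrite e inE s0; lia.
by case/allPn: h => y hy /negPn/eqP yi; exists y.
Qed.

Lemma rhs_nodes x : (x \in nodes (rhs G k)) = (x.1 < nn k) && (x.2 == nm k x.1).
Proof.
have e1 i : i < nn k -> (nth (0, start G) (nodes (rhs G k)) i) = (i, nm k i).
  move=> hi; rewrite /nm /pg_tgt /= (nth_map (0, start G)) //.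
  have := congr1 (fun s => nth 0 s i) rhs_ids.
  rewrite nth_iota // (nth_map (0, start G)) //=.
  by case: (nth _ _ _) => a b /= ->.
apply/idP/andP => [/(nthP (0, start G))[i hi <-]|[h1 /eqP h2]].
  by rewrite e1 /=.
by apply/(nthP (0, start G)); exists x.1 => //; rewrite e1 // -h2; case: x {h1 h2}.
Qed.

End Production.

(** The children form a function on all numbers, of which only the values below [nn k] count; trees
    are therefore compared by [same_tree] and not by equality. A [Leaf] may stand for a composite
    module that has not been replaced yet. *)
Inductive tree := Leaf | Exp of nat & (nat -> tree).

Implicit Types (T : tree) (a b x y : addr) (M N : 'I_m).

Fixpoint inA T a : addr := if T is Exp k ch then inA (ch 0) ((k, 0) :: a) else a.

Fixpoint outA T a : addr :=
  if T is Exp k ch then outA (ch (nn k).-1) ((k, (nn k).-1) :: a) else a.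

Fixpoint tnodes T M a (z : addr * 'I_m) : Prop :=
  if T is Exp k ch then exists2 i, i < nn k & tnodes (ch i) (nm k i) ((k, i) :: a) z
  else z = (a, M).

Fixpoint tedges T a (e : addr * 'I_t * addr) : Prop :=
  if T is Exp k ch then
    (exists2 d, d \in edges (rhs G k) &
       e = (outA (ch (esrc d)) ((k, esrc d) :: a), etag d, inA (ch (etgt d)) ((k, etgt d) :: a)))
    \/ (exists2 i, i < nn k & tedges (ch i) ((k, i) :: a) e)
  else False.

Fixpoint valid T M : Prop :=
  if T is Exp k ch then
    [/\ k < size (prods G), lhs G k = M & forall i, i < nn k -> valid (ch i) (nm k i)]
  else True.

Fixpoint complete T M : Prop :=
  if T is Exp k ch then forall i, i < nn k -> complete (ch i) (nm k i)
  else M \notin composite G.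

(** Nodes and edges are compared as sets, because their order in the lists depends on the order of
    the replacements. *)
Definition represents T M (g : graph addr m t) : Prop :=
  [/\ valid T M, forall z, z \in nodes g <-> tnodes T M [::] z
    & forall e, e \in edges g <-> tedges T [::] e].

Lemma tnodes_suffix T M a z : tnodes T M a z -> suffix a z.1.
Proof.
elim: T M a => [|k ch IH] M a /=; first by move=> ->; rewrite suffix_refl.
by move=> [i _ /IH/suffix_child].
Qed.

Lemma inA_suffix T a : suffix a (inA T a).
Proof.
by elim: T a => [|k ch IH] a /=; [rewrite suffix_refl | apply: suffix_child (IH _ _)].
Qed.

Lemma outA_suffix T a : suffix a (outA T a).
Proof.
by elim: T a => [|k ch IH] a /=; [rewrite suffix_refl | apply: suffix_child (IH _ _)].
Qed.

Lemma tedges_suffix T a e : tedges T a e -> suffix a e.1.1 && suffix a e.2.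
Proof.
elim: T a => [|k ch IH] a //= [[d _ -> /=]|[i _ /IH/andP[h1 h2]]].
  by rewrite (suffix_child (inA_suffix _ _)) (suffix_child (outA_suffix _ _)).
by rewrite (suffix_child h1) (suffix_child h2).
Qed.

Lemma inA_node T M a : valid T M -> exists N, tnodes T M a (inA T a, N).
Proof.
elim: T M a => [|k ch IH] M a /=; first by exists M.
move=> [kG _ /(_ 0 (nn_gt0 kG))/IH h]; have [N hN] := h ((k, 0) :: a).
by exists N, 0 => //; apply: nn_gt0.
Qed.

Lemma outA_node T M a : valid T M -> exists N, tnodes T M a (outA T a, N).
Proof.
elim: T M a => [|k ch IH] M a /=; first by exists M.
move=> [kG _ h]; have n0 := nn_gt0 kG; have lt : (nn k).-1 < nn k by lia.
by have [N hN] := IH _ _ ((k, (nn k).-1) :: a) (h _ lt); exists N, (nn k).-1.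
Qed.

(** The effect on the derivation tree of one replacement, at the node with address [x]. *)
Fixpoint graft T b x k' : tree :=
  if T is Exp k ch then Exp k (fun i => graft (ch i) ((k, i) :: b) x k')
  else if b == x then Exp k' (fun _ => Leaf) else Leaf.

Lemma inA_graft T b x k' :
  inA (graft T b x k') b = if inA T b == x then (k', 0) :: x else inA T b.
Proof. by elim: T b => [|k ch IH] b /=; [case: eqP => [->|] | rewrite IH]. Qed.

Lemma outA_graft T b x k' :
  outA (graft T b x k') b = if outA T b == x then (k', (nn k').-1) :: x else outA T b.
Proof. by elim: T b => [|k ch IH] b /=; [case: eqP => [->|] | rewrite IH]. Qed.

Lemma graft_id T b x k' : (forall y, suffix b y -> y != x) -> graft T b x k' = T.
Proof.
elim: T b => [|k ch IH] b hb /=; first by rewrite (negbTE (hb _ (suffix_refl _))).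
by congr Exp; apply: funext => l; apply: IH => y /suffix_child/hb.
Qed.

Lemma sibling_neq k i j b x y : i != j -> suffix ((k, i) :: b) x -> suffix ((k, j) :: b) y ->
  y != x.
Proof. by move=> ij hx hy; apply: contraNneq ij => e; rewrite e in hy; have [->] := suffix_inj hx hy. Qed.

Section Graft.
Variables (x : addr) (k' : nat).
Hypothesis kG' : k' < size (prods G).

Lemma valid_graft T M b : valid T M -> tnodes T M b (x, lhs G k') -> valid (graft T b x k') M.
Proof.
elim: T M b => [|k ch IH] M b /=.
  by move=> _ [<- <-]; rewrite eqxx.
move=> [kG eM hv] [i hi hx]; split=> // j hj.
have [<-|ij] := eqVneq i j; first by apply: IH => //; apply: hv.
rewrite graft_id; first exact: hv.
by move=> y; apply: sibling_neq ij (tnodes_suffix hx).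
Qed.

Lemma tnodes_graft T M b z : tnodes T M b (x, lhs G k') ->
  tnodes (graft T b x k') M b z <->
  (tnodes T M b z /\ z.1 <> x) \/ (exists2 i, i < nn k' & z = ((k', i) :: x, nm k' i)).
Proof.
elim: T M b => [|k ch IH] M b /=.
  move=> [<- <-]; rewrite eqxx /=; split=> [|[[-> //]|//]].
  by right.
move=> [i hi hx]; have sx := tnodes_suffix hx; rewrite /= in sx; split.
  move=> [j hj]; have [<-|ij] := eqVneq i j.
    by move/(IH _ _ _ hx) => [[h1 h2]|h]; [left; split=> //; exists i | right].
  rewrite graft_id; last by move=> y; apply: sibling_neq ij sx.
  move=> hz; left; split; first by exists j.
  by apply/eqP; apply: sibling_neq ij sx (tnodes_suffix hz).
case=> [[[j hj hz] nx]|h].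
  exists j => //; have [e|ij] := eqVneq i j.
    by subst j; apply/(IH _ _ _ hx); left.
  by rewrite graft_id // => y; apply: sibling_neq ij sx.
by exists i => //; apply/(IH _ _ _ hx); right.
Qed.

Definition redirect (e : addr * 'I_t * addr) : addr * 'I_t * addr :=
  (if e.1.1 == x then (k', (nn k').-1) :: x else e.1.1, e.1.2,
   if e.2 == x then (k', 0) :: x else e.2).

Lemma tedges_graft T M b e : tnodes T M b (x, lhs G k') ->
  tedges (graft T b x k') b e <->
  (exists2 e0, tedges T b e0 & e = redirect e0) \/
  (exists2 d, d \in edges (rhs G k') &
     e = ((k', esrc d) :: x, etag d, (k', etgt d) :: x)).
Proof.
elim: T M b e => [|k ch IH] M b e /=.
  move=> [<- _]; rewrite eqxx /=; split=> [[|[] //]|[[] //|]]; by [right | left].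
move=> [i hi hx]; have sx := tnodes_suffix hx; rewrite /= in sx; split.
  case=> [[d hd ->]|[j hj]].
    left; exists (outA (ch (esrc d)) ((k, esrc d) :: b), etag d, inA (ch (etgt d)) ((k, etgt d) :: b)).
      by left; exists d.
    by rewrite /redirect /= inA_graft outA_graft.
  have [<-|ij] := eqVneq i j.
    move/(IH _ _ _ _ hx) => [[e0 h1 h2]|h]; [left | by right].
    by exists e0 => //; right; exists i.
  rewrite graft_id; last by move=> y; apply: sibling_neq ij sx.
  move=> he; left; exists e; first by right; exists j.
  have /andP[h1 h2] := tedges_suffix he.
  rewrite /redirect (negbTE (sibling_neq ij sx h1)) (negbTE (sibling_neq ij sx h2)).
  by case: (e) => [[? ?] ?].
case=> [[e0 [[d hd ->]|[j hj he]] ->]|h].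
- by left; exists d => //; rewrite /redirect /= inA_graft outA_graft.
- right; exists j => //; have [ij|ij] := eqVneq i j.
    by subst j; apply/(IH _ _ _ _ hx); left; exists e0.
  rewrite graft_id; last by move=> y; apply: sibling_neq ij sx.
  have /andP[h1 h2] := tedges_suffix he.
  rewrite /redirect (negbTE (sibling_neq ij sx h1)) (negbTE (sibling_neq ij sx h2)).
  by case: (e0) he => [[? ?] ?].
- by right; exists i => //; apply/(IH _ _ _ _ hx); right.
Qed.

Lemma represents_replace T M g : represents T M g -> (x, lhs G k') \in nodes g ->
  represents (graft T [::] x k') M (replace G g x k').
Proof.
move=> [hv hn he] /hn hx; split; first exact: valid_graft.
  move=> z; rewrite (tnodes_graft _ hx) mem_cat mem_filter; split.
    case/orP=> [/andP[/eqP zx /hn hz]|/mapP[w hw ->]]; first by left.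
    by right; move: hw; rewrite rhs_nodes // => /andP[h1 /eqP ->]; exists w.1.
  case=> [[/hn -> /eqP ->] //|[i hi ->]]; apply/orP; right; apply/mapP.
  by exists (i, nm k' i) => //; rewrite rhs_nodes // hi /=.
move=> e; rewrite (tedges_graft _ hx) mem_cat sink_last // source0 //; split.
  case/orP=> /mapP[e0 h0 ->]; [left | right; exists e0 => //].
  by exists e0 => //; apply/he.
case=> [[e0 /he h0 ->]|[d hd ->]]; apply/orP; [left | right]; apply/mapP.
  by exists e0.
by exists d.
Qed.

End Graft.

Lemma derives_represents M g g' : derives G g g' -> forall T, represents T M g ->
  exists T', represents T' M g'.
Proof.
elim=> {g g'} [g T hT|g a k g' kG ha _ IH T hT]; first by exists T.
exact: IH (represents_replace kG hT ha).
Qed.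

Lemma execution_tree M g : execution G M g ->
  exists2 T, represents T M g & complete T M.
Proof.
case=> /derives_represents h /allP hc.
have [|T hT] := h M Leaf.
  by split=> // z /=; rewrite inE; split=> [/eqP|->].
exists T => //; case: hT => hv hn _.
have {}hc z : tnodes T M [::] z -> z.2 \notin composite G by move/hn/hc.
elim: T M [::] hv hc {h hn} => [|k ch IH] M b /=; first by move=> _ /(_ _ erefl).
move=> [_ _ hv] hc i hi; apply: IH (hv _ hi) _ => z hz.
by apply: hc; exists i; eauto.
Qed.

Fixpoint prefix_tree T S : Prop :=
  if T is Exp k ch then
    if S is Exp k' ch' then k = k' /\ forall i, i < nn k -> prefix_tree (ch i) (ch' i) else False
  else True.

Fixpoint tree_size T : nat :=
  if T is Exp k ch then (\sum_(i < nn k) tree_size (ch i)).+1 else 0.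

Lemma prefix_tree_size T S : prefix_tree T S -> tree_size T <= tree_size S.
Proof.
elim: T S => [|k ch IH] [|k' ch'] //= [<- h]; rewrite ltnS.
by apply: leq_sum => i _; apply: IH; apply: h.
Qed.

(** While [T] is strictly smaller than [S], some leaf of [T] is an inner node of [S]; replacing it
    by the production used in [S] is one step of a derivation that aims at [S]. *)
Lemma prefix_tree_step T S M b : valid S M -> prefix_tree T S -> tree_size T < tree_size S ->
  exists x k', [/\ k' < size (prods G), tnodes T M b (x, lhs G k'),
     prefix_tree (graft T b x k') S & tree_size (graft T b x k') = (tree_size T).+1].
Proof.
elim: T S M b => [|k ch IH] [|k' ch'] //= M b.
  move=> [kG <- _] _ _; exists b, k'; rewrite eqxx; split=> //=.
  by rewrite big1.
move=> [kG eM hv] [ek hp]; subst k'; rewrite ltnS => lt.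
have [i lti] : exists i : 'I_(nn k), tree_size (ch i) < tree_size (ch' i).
  apply/existsP; apply: contraLR lt; rewrite negb_exists -leqNgt => /forallP h.
  by apply: leq_sum => i _; rewrite leqNgt.
have [x [k' [k'G hx hp' e]]] := IH i _ _ ((k, nat_of_ord i) :: b) (hv _ (ltn_ord i)) (hp _ (ltn_ord i)) lti.
have sx := tnodes_suffix hx.
have other (j : nat) : j != i -> graft (ch j) ((k, j) :: b) x k' = ch j.
  by move=> ij; rewrite graft_id // => y; apply: sibling_neq sx; rewrite eq_sym.
exists x, k'; split=> //; first by exists i => //; exact: ltn_ord.
  split=> // j hj; have [->|ij] := eqVneq j i; first exact: hp'.
  by rewrite other //; apply: hp.
rewrite (bigD1 i) //= e (bigD1 i (P := predT)) //= addSn; congr (_ + _).+2.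
by apply: eq_bigr => j ij; rewrite other.
Qed.

Lemma derives_tree n T S M g : tree_size S - tree_size T = n -> valid S M ->
  prefix_tree T S -> represents T M g ->
  exists T' g', [/\ derives G g g', represents T' M g', prefix_tree T' S
                  & tree_size T' = tree_size S].
Proof.
elim: n T g => [|n IH] T g e hv hp hr.
  exists T, g; split=> //; first exact: derives_refl.
  by have := prefix_tree_size hp; lia.
have [|x [k' [kG hx hp' e']]] := @prefix_tree_step T S M [::] hv hp; first by lia.
have gx : (x, lhs G k') \in nodes g by case: hr => _ hn _; apply/hn.
have [|T' [g' [h1 h2 h3 h4]]] := IH _ _ _ hv hp' (represents_replace kG hr gx).
  by rewrite e'; lia.
by exists T', g'; split=> //; apply: derives_step gx h1.
Qed.

Fixpoint same_tree T S : Prop :=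
  match T, S with
  | Exp k ch, Exp k' ch' => k = k' /\ forall i, i < nn k -> same_tree (ch i) (ch' i)
  | Leaf, Leaf => True
  | _, _ => False
  end.

Lemma prefix_tree_same T S : prefix_tree T S -> tree_size T = tree_size S -> same_tree T S.
Proof.
elim: T S => [|k ch IH] [|k' ch'] //= [<- hp] [e]; split=> // i hi.
apply: IH; first exact: hp.
have le (j : 'I_(nn k)) : tree_size (ch j) <= tree_size (ch' j).
  by apply: prefix_tree_size; apply: hp.
have := leqif_sum (fun j _ => conj (le j) erefl) (P := predT).
by case=> _; rewrite e eqxx => /esym/forallP/(_ (Ordinal hi))/eqP.
Qed.

Lemma same_complete T S M : same_tree T S -> complete S M -> complete T M.
Proof.
elim: T S M => [|k ch IH] [|k' ch'] //= M [<- h] hc i hi.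
exact: IH (h _ hi) (hc _ hi).
Qed.

Lemma complete_nodes T M b z : complete T M -> tnodes T M b z -> z.2 \notin composite G.
Proof.
elim: T M b => [|k ch IH] M b /=; first by move=> hM ->.
by move=> h [i hi]; apply: IH; apply: h.
Qed.

(** The converse of [execution_tree]. Safety speaks of executions, while the proof chooses trees;
    the derivation is grown from a single leaf along [S]. *)
Lemma tree_execution S M : valid S M -> complete S M ->
  exists T g, [/\ execution G M g, represents T M g & same_tree T S].
Proof.
move=> hv hc; have h0 : represents Leaf M (Graph [:: ([::], M)] [::]).
  by split=> // z /=; rewrite inE; split=> [/eqP|->].
have [T [g [h1 h2 h3 h4]]] := derives_tree (T := Leaf) erefl hv I h0.
have h5 := prefix_tree_same h3 h4.
exists T, g; split=> //; split=> //; apply/allP => z; case: h2 => _ hn _ /hn.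
by apply: complete_nodes; apply: same_complete hc.
Qed.

End Trees.

(** * Paths as words of tags *)

Section Walks.
Variables (V : eqType) (t : nat).

Inductive wpath (E : V * 'I_t * V -> Prop) : V -> seq 'I_t -> V -> Prop :=
  | wpath_nil u : wpath E u [::] u
  | wpath_cons u a v w x : E (u, a, v) -> wpath E v w x -> wpath E u (a :: w) x.

Lemma wpath_cat E u w1 v w2 x : wpath E u w1 v -> wpath E v w2 x -> wpath E u (w1 ++ w2) x.
Proof.
move=> h; elim: h w2 x => //= {u w1 v} u a v w y e _ IH w2 x h2.
exact: wpath_cons e (IH _ _ h2).
Qed.

Lemma wpath_sub (E E' : V * 'I_t * V -> Prop) u w v : (forall e, E e -> E' e) ->
  wpath E u w v -> wpath E' u w v.
Proof.
move=> h; elim=> {u w v} [u|u a v w x /h e _ IH]; first exact: wpath_nil.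
exact: wpath_cons e IH.
Qed.

Lemma walk_wpath m (g : graph V m t) u v w :
  (exists2 p, walk g u p v & tags p = w) <-> wpath (fun e => e \in edges g) u w v.
Proof.
split=> [[p]|].
  elim: p u w => [|[[u' a] v'] p IH] u w /=; first by move=> /eqP -> <-; exact: wpath_nil.
  case/and3P=> he /eqP <- hw <-; apply: wpath_cons he _.
  exact: IH.
elim=> {u w v} [u|u a v w x he _ [p hp <-]]; first by exists [::] => /=.
by exists ((u, a, v) :: p); rewrite //= he /= eqxx.
Qed.

End Walks.

(** * Decomposition of paths along a derivation tree *)

Section Languages.
Variables (m t : nat) (G : spec m t).
Hypotheses (wfG : wf_spec G) (cgG : coarse_grained G).
Notation language := (seq 'I_t -> Prop).
Notation nn := (nn G).
Notation inA := (inA).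
Notation outA := (outA G).
Notation tedges := (tedges G).
Notation valid := (valid G).

(* [klang k io i w j]: the word [w] leads from the output of node [i] of the [k]-th right-hand
   side to the input of node [j] when [io l] is the language from the input to the output of
   what replaces node [l]. *)
Inductive klang k (io : nat -> language) : nat -> seq 'I_t -> nat -> Prop :=
  | klang_edge d : d \in edges (rhs G k) -> klang k io (esrc d) [:: etag d] (etgt d)
  | klang_step d w w' j : d \in edges (rhs G k) -> io (etgt d) w -> klang k io (etgt d) w' j ->
      klang k io (esrc d) (etag d :: w ++ w') j.

Lemma klang_sub k io io' i w j : (forall i w, i < nn k -> io i w -> io' i w) ->
  k < size (prods G) -> klang k io i w j -> klang k io' i w j.
Proof.
move=> h kG; elim=> {i w j} [d hd|d w w' j hd hw _ IH]; first exact: klang_edge.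
by apply: (klang_step hd _ IH); apply: h hw; have := rhs_edge wfG kG hd; lia.
Qed.

Lemma klang_lt k io i w j : k < size (prods G) -> klang k io i w j -> i < j < nn k.
Proof.
move=> kG; elim=> {i w j} [d|d w w' j] /(rhs_edge wfG kG); first by lia.
by move=> h1 _ _ h2; lia.
Qed.

Lemma klang_cat k io i w1 x w2 w3 j : klang k io i w1 x -> io x w2 -> klang k io x w3 j ->
  klang k io i (w1 ++ w2 ++ w3) j.
Proof.
elim=> {i w1 x} [d hd|d w w' x hd hw _ IH] h2 h3; first exact: klang_step hd h2 h3.
by rewrite /= -catA; apply: klang_step hd hw (IH h2 h3).
Qed.

(** The right-hand side with a single node is a case of its own: its only child is both source and
    sink and must be traversed once, not twice. *)
Fixpoint tlang (T : tree) : language :=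
  if T is Exp k ch then
    fun w => if nn k == 1 then tlang (ch 0) w else
      exists w1 w2 w3, [/\ tlang (ch 0) w1, klang k (fun i => tlang (ch i)) 0 w2 (nn k).-1,
                           tlang (ch (nn k).-1) w3 & w = w1 ++ w2 ++ w3]
  else fun w => w = [::].

Section Split.
Variables (k : nat) (ch : nat -> tree) (a : addr) (M : 'I_m).
Hypothesis hv : valid (Exp k ch) M.
Let kG : k < size (prods G). Proof. by case: hv. Qed.
Local Notation ci i := ((k, i) :: a).
Local Notation E := (tedges (Exp k ch) a).
Local Notation Ei i := (tedges (ch i) (ci i)).
Local Notation io := (fun i w => wpath (Ei i) (inA (ch i) (ci i)) w (outA (ch i) (ci i))).

(** What replaces a node of the right-hand side is entered only at its input and left only at its
    output. So a path either stays inside one child or consists of a way out of the first child, a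
    crossing described by [klang], and a way into the last child. *)
Lemma wpath_split u w v i j : wpath E u w v -> i < nn k -> suffix (ci i) u -> suffix (ci j) v ->
  (i = j /\ wpath (Ei i) u w v) \/
  (exists w1 w2 w3, [/\ w = w1 ++ w2 ++ w3, wpath (Ei i) u w1 (outA (ch i) (ci i)),
     klang k io i w2 j & wpath (Ei j) (inA (ch j) (ci j)) w3 v]).
Proof.
move=> h; elim: h i => {u w v} [u|u l v w x he hw IH] i hi su sx.
  by left; have [->] := suffix_inj su sx; split=> //; exact: wpath_nil.
case: he => [[d hd [eu -> ev]]|[i' hi' he]].
  have hd' := rhs_edge wfG kG hd.
  have si : suffix (ci (esrc d)) u by rewrite eu outA_suffix.
  have [ei] := suffix_inj su si; subst i.
  have sv : suffix (ci (etgt d)) v by rewrite ev inA_suffix.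
  have [|[ej hw']|[w1 [w2 [w3 [-> h1 h2 h3]]]]] := IH (etgt d) _ sv sx; first by lia.
    right; exists [::], [:: etag d], w; rewrite eu; split=> //; first exact: wpath_nil.
      by rewrite -ej; exact: klang_edge.
    by move: hw'; rewrite ev -ej.
  right; exists [::], (etag d :: w1 ++ w2), w3; rewrite eu; split=> //.
  - by rewrite /= catA.
  - exact: wpath_nil.
  - by apply: klang_step hd _ h2; move: h1; rewrite ev.
have /andP[/= s1 s2] := tedges_suffix he.
have [ei] := suffix_inj su s1; subst i'.
have [[ej hw']|[w1 [w2 [w3 [-> h1 h2 h3]]]]] := IH i hi s2 sx.
  by left; split=> //; exact: wpath_cons he hw'.
right; exists (l :: w1), w2, w3; split=> //; exact: wpath_cons he h1.
Qed.

Lemma wpath_child i u w v : i < nn k -> wpath (Ei i) u w v -> wpath E u w v.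
Proof. by move=> hi; apply: wpath_sub => e he; right; exists i. Qed.

Lemma klang_wpath i w j : klang k io i w j ->
  wpath E (outA (ch i) (ci i)) w (inA (ch j) (ci j)).
Proof.
elim=> {i w j} [d hd|d w w' j hd hw _ IH].
  by apply: wpath_cons (wpath_nil _ _); left; exists d.
apply: (@wpath_cons _ _ _ _ _ (inA (ch (etgt d)) (ci (etgt d)))); first by left; exists d.
apply: wpath_cat IH; apply: wpath_child hw.
by have := rhs_edge wfG kG hd; lia.
Qed.

(** A path that leaves a child cannot return to it, since the edges between children increase the
    index. *)
Lemma wpath_same u w v i : i < nn k -> suffix (ci i) u -> suffix (ci i) v ->
  wpath E u w v <-> wpath (Ei i) u w v.
Proof.
move=> hi su sv; split; last exact: wpath_child.
case/(wpath_split)/(_ hi su sv) => [[] //|[w1 [w2 [w3 [_ _ /(klang_lt kG)]]]]]; lia.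
Qed.

Lemma wpath_apart u w v i j : i < nn k -> i != j -> suffix (ci i) u -> suffix (ci j) v ->
  wpath E u w v <->
  (exists w1 w2 w3, [/\ w = w1 ++ w2 ++ w3, wpath (Ei i) u w1 (outA (ch i) (ci i)),
     klang k io i w2 j & wpath (Ei j) (inA (ch j) (ci j)) w3 v]).
Proof.
move=> hi ij su sv; split; first by case/wpath_split/(_ hi su sv) => [[/eqP]|//]; rewrite (negbTE ij).
move=> [w1 [w2 [w3 [-> h1 h2 h3]]]]; have := klang_lt kG h2 => lt.
apply: wpath_cat (wpath_child hi h1) (wpath_cat (klang_wpath h2) (wpath_child _ h3)).
by lia.
Qed.

End Split.

Lemma klang_ext k io io' i w j : k < size (prods G) ->
  (forall i w, i < nn k -> io i w <-> io' i w) -> klang k io i w j <-> klang k io' i w j.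
Proof. by move=> kG h; split; apply: klang_sub => // i' w' hi /h; apply. Qed.

Lemma tlangP T M a w : valid T M ->
  wpath (tedges T a) (inA T a) w (outA T a) <-> tlang T w.
Proof.
elim: T M a w => [|k ch IH] M a w hv.
  split=> /= [h|->]; last exact: wpath_nil.
  by inversion h.
have [kG _ hc] := hv; have n0 := nn_gt0 wfG cgG kG.
have io i w' : i < nn k -> wpath (tedges (ch i) ((k, i) :: a)) (inA (ch i) ((k, i) :: a)) w'
    (outA (ch i) ((k, i) :: a)) <-> tlang (ch i) w'.
  by move=> hi; apply: IH (hc _ hi).
rewrite [inA _ _]/= [outA _ _]/= [tlang _]/=; case: eqP => n1.
  have -> : (nn k).-1 = 0 by rewrite n1.
  apply: iff_trans (io _ _ n0).
  exact: (wpath_same hv w n0 (inA_suffix _ _) (outA_suffix _ _ _)).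
have lt0 : 0 != (nn k).-1 by lia.
have lt1 : (nn k).-1 < nn k by lia.
apply: (iff_trans (wpath_apart hv w n0 lt0 (inA_suffix _ _) (outA_suffix _ _ _))).
have ke w' : klang k (fun i w => wpath (tedges (ch i) ((k, i) :: a)) (inA (ch i) ((k, i) :: a)) w
    (outA (ch i) ((k, i) :: a))) 0 w' (nn k).-1 <->
    klang k (fun i => tlang (ch i)) 0 w' (nn k).-1 by apply: klang_ext.
split=> [[w1 [w2 [w3 [-> /io h1 /ke h2 /io h3]]]]|[w1 [w2 [w3 [/io h1 /ke h2 /io h3 ->]]]]];
  exists w1, w2, w3; split=> //; by [apply: h1 | apply: h3].
Qed.

Lemma same_tlang T S M w : same_tree G T S -> valid S M -> tlang T w <-> tlang S w.
Proof.
elim: T S M w => [|k ch IH] [|k' ch'] //= M w [<- h] [kG _ hv]; have n0 := nn_gt0 wfG cgG kG.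
have ih i w' : i < nn k -> tlang (ch i) w' <-> tlang (ch' i) w'.
  by move=> hi; apply: IH (h _ hi) (hv _ hi).
have lt1 : (nn k).-1 < nn k by lia.
case: ifP => _; first exact: ih.
have ke w' : klang k (fun i => tlang (ch i)) 0 w' (nn k).-1 <->
    klang k (fun i => tlang (ch' i)) 0 w' (nn k).-1 by apply: klang_ext.
split=> [[w1 [w2 [w3 [/ih h1 /ke h2 /ih h3 ->]]]]|[w1 [w2 [w3 [/ih h1 /ke h2 /ih h3 ->]]]]];
  exists w1, w2, w3; split=> //; by [apply: h1 | apply: h3].
Qed.

End Languages.

(** * Transition relations *)

Section Relations.
Variable A : automaton.
Notation Q := (astate A).
Definition relation := {set Q * Q}.
Implicit Types c d e : relation.

Definition rone : relation := [set q | q.1 == q.2].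
Definition rmul c d : relation := [set q | [exists x, ((q.1, x) \in c) && ((x, q.2) \in d)]].
Definition rletter (a : nat) : relation := [set q | astep q.1 a == q.2].
Definition raccept c := [exists q, ((ainit A, q) \in c) && aaccept q].

Lemma rmulA : associative rmul.
Proof.
move=> c d e; apply/setP=> -[p q]; rewrite !inE /=; apply/existsP/existsP => -[x].
  case/andP=> hc; rewrite inE /= => /existsP[y /andP[hd he]].
  by exists y; rewrite he inE andbT; apply/existsP; exists x; rewrite hc hd.
rewrite inE /= => /andP[/existsP[y /andP[hc hd]] he].
by exists y; rewrite hc inE /=; apply/existsP; exists x; rewrite hd he.
Qed.

Lemma rmul1 c : rmul c rone = c.
Proof.
apply/setP=> -[p q]; rewrite !inE /=; apply/existsP/idP => [[x]|h].
  by rewrite inE /= => /andP[h /eqP <-].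
by exists q; rewrite h inE /= eqxx.
Qed.

Lemma r1mul c : rmul rone c = c.
Proof.
apply/setP=> -[p q]; rewrite !inE /=; apply/existsP/idP => [[x]|h].
  by rewrite inE /= => /andP[/eqP -> h].
by exists p; rewrite h inE /= eqxx.
Qed.

Variables (t : nat).
Notation language := (seq 'I_t -> Prop).
Implicit Types S : language.

Definition lrel S : relation :=
  [set q | `[< exists2 w, S w & arun q.1 (map val w) = q.2 >]].

Definition lcat S1 S2 : language := fun w => exists w1 w2, [/\ S1 w1, S2 w2 & w = w1 ++ w2].

Lemma lrel_cat S1 S2 : lrel (lcat S1 S2) = rmul (lrel S1) (lrel S2).
Proof.
apply/setP=> -[p q]; rewrite !inE /=; apply/asboolP/existsP.
  move=> [w [w1 [w2 [h1 h2 ->]]]]; rewrite map_cat arun_cat => <-.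
  by exists (arun p (map val w1)); rewrite !inE; apply/andP; split; apply/asboolP;
    [exists w1 | exists w2].
move=> [x]; rewrite !inE /= => /andP[/asboolP[w1 h1 <-] /asboolP[w2 h2 <-]].
by exists (w1 ++ w2); [exists w1, w2 | rewrite map_cat arun_cat].
Qed.

Lemma lrel_or S1 S2 : lrel (fun w => S1 w \/ S2 w) = lrel S1 :|: lrel S2.
Proof.
apply/setP=> -[p q]; rewrite !inE /=; apply/asboolP/orP.
  by move=> [w [h|h] <-]; [left | right]; apply/asboolP; exists w.
by case=> /asboolP[w h <-]; exists w => //; [left | right].
Qed.

Lemma lrel_nil : lrel (fun w => w = [::]) = rone.
Proof.
apply/setP=> -[p q]; rewrite !inE /=; apply/asboolP/eqP => [[w -> <-] //|->].
by exists [::].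
Qed.

Lemma lrel_letter (a : 'I_t) : lrel (fun w => w = [:: a]) = rletter a.
Proof.
apply/setP=> -[p q]; rewrite !inE /=; apply/asboolP/eqP => [[w -> <-] //|<-].
by exists [:: a].
Qed.

(** The automaton is total, so every word contributes a pair. Hence the empty relation means the
    absence of paths, and the tables of relations answer reachability as well. *)
Lemma lrel_empty S : lrel S = set0 <-> ~ exists w, S w.
Proof.
split=> [e [w hw]|h].
  have : (ainit A, arun (ainit A) (map val w)) \in lrel S.
    by rewrite inE; apply/asboolP; exists w.
  by rewrite e inE.
by apply/setP=> q; rewrite !inE; apply/asboolP => -[w hw _]; apply: h; exists w.
Qed.

Variable D : dfa t.

Definition simulated S S' := forall q w, S w ->
  exists2 w', S' w' & run_dfa (D := D) q w' = run_dfa q w.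

(* [has_code S c]: [c] is the relation of some language with the same transitions as [S] in the
   safe automaton [D]; the automaton [A] of the program need not be safe itself. *)
Definition has_code S c := exists S', [/\ simulated S S', simulated S' S & c = lrel S'].

Lemma simulated_trans S1 S2 S3 : simulated S1 S2 -> simulated S2 S3 -> simulated S1 S3.
Proof.
by move=> h1 h2 q w /(h1 q)[w' /(h2 q)[w'' hw e2] e1]; exists w''; rewrite ?e2.
Qed.

Lemma has_code_sim S S' c : simulated S S' -> simulated S' S -> has_code S c -> has_code S' c.
Proof.
move=> h1 h2 [S1 [h3 h4 ->]]; exists S1; split=> //; first exact: simulated_trans h2 h3.
exact: simulated_trans h4 h1.
Qed.

Lemma simulated_sub S S' : (forall w, S w -> S' w) -> simulated S S'.
Proof. by move=> h q w /h hw; exists w. Qed.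

Lemma has_code_ext S S' c : (forall w, S w <-> S' w) -> has_code S c -> has_code S' c.
Proof. by move=> h; apply: has_code_sim; apply: simulated_sub => w /h. Qed.

Lemma simulated_cat S1 S1' S2 S2' : simulated S1 S1' -> simulated S2 S2' ->
  simulated (lcat S1 S2) (lcat S1' S2').
Proof.
move=> h1 h2 q w [w1 [w2 [hw1 hw2 ->]]].
have [w1' hw1' e1] := h1 q w1 hw1; have [w2' hw2' e2] := h2 (run_dfa q w1) w2 hw2.
exists (w1' ++ w2'); first by exists w1', w2'.
by rewrite /run_dfa !foldl_cat -!/(run_dfa _ _) e1 e2.
Qed.

Lemma has_code_cat S1 S2 c1 c2 : has_code S1 c1 -> has_code S2 c2 ->
  has_code (lcat S1 S2) (rmul c1 c2).
Proof.
move=> [S1' [h1 h1' ->]] [S2' [h2 h2' ->]]; exists (lcat S1' S2').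
by split; rewrite ?lrel_cat //; apply: simulated_cat.
Qed.

Lemma has_code_or S1 S2 c1 c2 : has_code S1 c1 -> has_code S2 c2 ->
  has_code (fun w => S1 w \/ S2 w) (c1 :|: c2).
Proof.
move=> [S1' [h1 h1' ->]] [S2' [h2 h2' ->]]; exists (fun w => S1' w \/ S2' w).
split; rewrite ?lrel_or // => q w [] h.
- by have [w' hw e] := h1 q w h; exists w' => //; left.
- by have [w' hw e] := h2 q w h; exists w' => //; right.
- by have [w' hw e] := h1' q w h; exists w' => //; left.
- by have [w' hw e] := h2' q w h; exists w' => //; right.
Qed.

Lemma has_code_self S : has_code S (lrel S).
Proof. by exists S; split=> //; apply: simulated_sub. Qed.

Lemma has_code_nil : has_code (fun w => w = [::]) rone.
Proof. by rewrite -lrel_nil; apply: has_code_self. Qed.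

Lemma has_code_letter (a : 'I_t) : has_code (fun w => w = [:: a]) (rletter a).
Proof. by rewrite -lrel_letter; apply: has_code_self. Qed.

Lemma has_code0 S : (forall w, ~ S w) -> has_code S set0.
Proof.
move=> h; have <- : lrel S = set0 by apply/lrel_empty => -[w /h].
exact: has_code_self.
Qed.

Lemma has_code_nonempty S c : has_code S c -> (exists w, S w) <-> c <> set0.
Proof.
move=> [S' [h1 h2 ->]]; have q := init_state D; split=> [[w hw] /lrel_empty[]|h].
  by have [w' h _] := h1 q w hw; exists w'.
apply: contrapT => ne; apply: h; apply/lrel_empty => -[w hw]; apply: ne.
by have [w' h _] := h2 q w hw; exists w'.
Qed.

(** A word of [S] and its substitute in [S'] lead [D] from its initial state to the same state. As
    [D] and [A] accept the same words, the acceptance read off the relation of [S'] is the one of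
    [S]. *)
Lemma has_code_accept (R : regex) S c : recognizes A R -> dfa_accepts_lang D R ->
  has_code S c -> (exists2 w, S w & lang R w) <-> raccept c.
Proof.
move=> hA hD [S' [h1 h2 ->]]; split.
  move=> [w hw /hD hl]; have [w' hw' e] := h1 (init_state D) w hw.
  have /hD/hA.2 hacc : run_dfa (init_state D) w' \in final D by rewrite e.
  apply/existsP; exists (arun (ainit A) (map val w')); rewrite hacc andbT inE.
  by apply/asboolP; exists w'.
case/existsP=> q; rewrite inE /= => /andP[/asboolP[w' hw' <-] /hA.2/hD hacc].
have [w hw e] := h2 (init_state D) w' hw'.
by exists w => //; apply/hD; rewrite e.
Qed.

End Relations.

(** * Input and output of an execution; safety in terms of trees *)

Section Endpoints.
Variables (m t : nat) (G : spec m t).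
Hypotheses (wfG : wf_spec G) (cgG : coarse_grained G).
Implicit Types (T : tree) (M : 'I_m) (a : addr).

Lemma inA_entered T M a e : valid G T M -> tedges G T a e -> e.2 <> inA T a.
Proof.
elim: T M a => [|k ch IH] M a //= [kG _ hv].
case=> [[d hd ->] /= e0|[i hi he] e0].
  have lt := rhs_edge wfG kG hd.
  have h1 := inA_suffix (ch (etgt d)) ((k, etgt d) :: a).
  have h2 := inA_suffix (ch 0) ((k, 0) :: a); rewrite -e0 in h2.
  by have [e1] := suffix_inj h1 h2; rewrite e1 in lt; lia.
have [i0|ni] := eqVneq i 0; first by subst i; exact: IH (hv _ hi) he e0.
have /andP[_ h1] := tedges_suffix he.
have h2 := inA_suffix (ch 0) ((k, 0) :: a); rewrite -e0 in h2.
by have [ei] := suffix_inj h1 h2; rewrite ei eqxx in ni.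
Qed.

Lemma outA_left T M a e : valid G T M -> tedges G T a e -> e.1.1 <> outA G T a.
Proof.
elim: T M a => [|k ch IH] M a //= [kG _ hv].
case=> [[d hd ->] /= e0|[i hi he] e0].
  have lt := rhs_edge wfG kG hd.
  have h1 := outA_suffix G (ch (esrc d)) ((k, esrc d) :: a).
  have h2 := outA_suffix G (ch (nn G k).-1) ((k, (nn G k).-1) :: a); rewrite -e0 in h2.
  by have [e1] := suffix_inj h1 h2; rewrite e1 in lt; lia.
have [i0|ni] := eqVneq i (nn G k).-1; first by subst i; exact: IH (hv _ hi) he e0.
have /andP[h1 _] := tedges_suffix he.
have h2 := outA_suffix G (ch (nn G k).-1) ((k, (nn G k).-1) :: a); rewrite -e0 in h2.
by have [ei] := suffix_inj h1 h2; rewrite ei eqxx in ni.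
Qed.

Lemma tnodes_entered T M a z : valid G T M -> tnodes G T M a z -> z.1 != inA T a ->
  exists2 e, tedges G T a e & e.2 = z.1.
Proof.
elim: T M a => [|k ch IH] M a /=; first by move=> _ ->; rewrite eqxx.
move=> [kG _ hv] [i hi hz] ne.
have [e0|n0] := eqVneq z.1 (inA (ch i) ((k, i) :: a)).
  have i0 : 0 < i < nn G k.
    by rewrite hi andbT lt0n; apply: contraNneq ne => i0; rewrite e0 i0.
  have [d hd ed] := rhs_entering wfG cgG kG i0.
  eexists; first by left; exists d => //.
  by rewrite /= ed e0.
have [e he ez] := IH _ _ _ (hv _ hi) hz n0.
by exists e => //; right; exists i.
Qed.

Lemma tnodes_left T M a z : valid G T M -> tnodes G T M a z -> z.1 != outA G T a ->
  exists2 e, tedges G T a e & e.1.1 = z.1.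
Proof.
elim: T M a => [|k ch IH] M a /=; first by move=> _ ->; rewrite eqxx.
move=> [kG _ hv] [i hi hz] ne.
have [e0|n0] := eqVneq z.1 (outA G (ch i) ((k, i) :: a)).
  have i0 : i < (nn G k).-1.
    suff : i != (nn G k).-1 by lia.
    by apply: contraNneq ne => i0; rewrite e0 i0.
  have [d hd ed] := rhs_leaving wfG cgG kG i0.
  eexists; first by left; exists d => //.
  by rewrite /= ed e0.
have [e he ez] := IH _ _ _ (hv _ hi) hz n0.
by exists e => //; right; exists i.
Qed.

Lemma head_unique (V : eqType) (v0 x : V) s : (forall v, v \in s <-> v = x) -> head v0 s = x.
Proof.
case: s => [|y s] h /=; first by have := (h x).2 erefl.
by apply: (h y).1; rewrite mem_head.
Qed.

Lemma input_nodeE T M g : represents G T M g -> input_node g = inA T [::].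
Proof.
move=> [hv hn he]; apply: head_unique => v; rewrite mem_filter; split.
  case/andP=> /allP h /mapP[z /hn hz ev]; apply/eqP; apply: contraT; rewrite ev => ne.
  have [e /he he' ez] := tnodes_entered hv hz ne.
  by have := h _ he'; rewrite /etgt ez ev eqxx.
move=> ->; apply/andP; split.
  apply/allP => e /he he'; apply/eqP; exact: (inA_entered hv he').
have [N /hn hN] := inA_node wfG cgG [::] hv.
by apply/mapP; exists (inA T [::], N).
Qed.

Lemma output_nodeE T M g : represents G T M g -> output_node g = outA G T [::].
Proof.
move=> [hv hn he]; apply: head_unique => v; rewrite mem_filter; split.
  case/andP=> /allP h /mapP[z /hn hz ev]; apply/eqP; apply: contraT; rewrite ev => ne.
  have [e /he he' ez] := tnodes_left hv hz ne.
  by have := h _ he'; rewrite /esrc ez ev eqxx.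
move=> ->; apply/andP; split.
  by apply/allP => e /he he'; apply/eqP; exact: (outA_left hv he').
have [N /hn hN] := outA_node wfG cgG [::] hv.
by apply/mapP; exists (outA G T [::], N).
Qed.

Lemma represents_walk T M g u w v : represents G T M g ->
  (exists2 p, walk g u p v & tags p = w) <-> wpath (tedges G T [::]) u w v.
Proof.
move=> [_ _ he]; apply: iff_trans (walk_wpath _ _ _ _) _.
by split; apply: wpath_sub => e /he.
Qed.

Lemma represents_io T M g w : represents G T M g ->
  (exists2 p, walk g (input_node g) p (output_node g) & tags p = w) <-> tlang G T w.
Proof.
move=> hr; apply: iff_trans (represents_walk _ _ _ hr) _.
rewrite (input_nodeE hr) (output_nodeE hr); apply: tlangP => //.
by case: hr => h _ _; exact: h.
Qed.

(** Each tree is replaced by an execution with the same tree, to which safety applies. Complete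
    trees of one module thus have languages that [D] cannot distinguish, and one representative
    stands for all of them. *)
Lemma safe_simulated (D : dfa t) T1 T2 M : safe_dfa D G ->
  valid G T1 M -> complete G T1 M -> valid G T2 M -> complete G T2 M ->
  simulated D (tlang G T1) (tlang G T2).
Proof.
move=> hs v1 c1 v2 c2 q w hw.
have [S1 [g1 [x1 r1 s1]]] := tree_execution wfG cgG v1 c1.
have [S2 [g2 [x2 r2 s2]]] := tree_execution wfG cgG v2 c2.
have /(represents_io _ r1)[p hp ep] := (same_tlang wfG cgG w s1 v1).2 hw.
have [|p' hp' ep'] := hs q (run_dfa q w) M _ _ x1 x2; first by exists p; rewrite ?ep.
exists (tags p') => //; apply/(same_tlang wfG cgG _ s2 v2)/(represents_io _ r2).
by exists p'.
Qed.

End Endpoints.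

(** * Relations of modules, right-hand sides and pairs of nodes *)

Section Codes.
Variables (m t : nat) (G : spec m t).
Hypotheses (wfG : wf_spec G) (cgG : coarse_grained G).
Variables (A : automaton) (D : dfa t).
Hypothesis safeD : safe_dfa D G.
Notation language := (seq 'I_t -> Prop).
Notation nn := (nn G).
Notation nm := (nm G).
Notation has_code := (@has_code A t D).
Implicit Types (T : tree) (M : 'I_m) (a : addr).

Lemma klang_inv k io i w j : k < size (prods G) -> klang G k io i w j ->
  exists d w', [/\ d \in edges (rhs G k), esrc d = i, w = etag d :: w'
    & (etgt d = j /\ w' = [::]) \/
      (etgt d <> j /\ exists w1 w2, [/\ io (etgt d) w1, klang G k io (etgt d) w2 j & w' = w1 ++ w2])].
Proof.
move=> kG; case=> {i w j} [d hd|d w w' j hd hw hw'].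
  by exists d, [::]; split=> //; left.
exists d, (w ++ w'); split=> //; right; split; last by exists w, w'.
by have := klang_lt wfG cgG kG hw'; lia.
Qed.

(** The sink being unique, every other node has a leaving edge, and edges go to greater numbers.
    With its mirror image [klang_from_source] this is how coarse-grained specifications reduce
    reachability between two nodes of the run to reachability inside one right-hand side. *)
Lemma klang_to_sink k io : k < size (prods G) -> (forall l, l < nn k -> exists w, io l w) ->
  forall i, i < (nn k).-1 -> exists w, klang G k io i w (nn k).-1.
Proof.
move=> kG hio i; move: {2}(nn k - i) (leqnn (nn k - i)) => n.
elim: n i => [|n IH] i hn hi; first by lia.
have [d hd ei] := rhs_leaving wfG cgG kG hi; have := rhs_edge wfG kG hd; rewrite ei => lt.
have [e|ne] := eqVneq (etgt d) (nn k).-1.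
  by exists [:: etag d]; rewrite -ei -e; exact: klang_edge.
have [||w hw] := IH (etgt d); try by lia.
have [|w' hw'] := hio (etgt d); first by lia.
by exists (etag d :: w' ++ w); rewrite -ei; exact: klang_step hd hw' hw.
Qed.

Lemma klang_from_source k io : k < size (prods G) -> (forall l, l < nn k -> exists w, io l w) ->
  forall j, 0 < j < nn k -> exists w, klang G k io 0 w j.
Proof.
move=> kG hio j; elim: j {-2}j (leqnn j) => [|n IH] j hn hj; first by lia.
have [d hd ej] := rhs_entering wfG cgG kG hj; have := rhs_edge wfG kG hd; rewrite ej => lt.
have [e|ne] := eqVneq (esrc d) 0.
  by exists [:: etag d]; rewrite -ej -e; exact: klang_edge.
have [||w hw] := IH (esrc d); try by lia.
have [|w' hw'] := hio (esrc d); first by lia.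
by exists (w ++ w' ++ [:: etag d]); apply: (klang_cat hw hw'); rewrite -ej; exact: klang_edge.
Qed.

Lemma tlang_nonempty T M : valid G T M -> exists w, tlang G T w.
Proof.
elim: T M => [|k ch IH] M /=; first by exists [::].
move=> [kG _ hv]; have n0 := nn_gt0 wfG cgG kG.
have io l : l < nn k -> exists w, tlang G (ch l) w by move=> hl; apply: IH (hv _ hl).
have [w0 h0] := io 0 n0.
case: eqP => n1; first by exists w0.
have [w1 h1] : exists w, tlang G (ch (nn k).-1) w by apply: io; lia.
have [|w2 h2] := klang_to_sink kG io (i := 0); first by lia.
by exists (w0 ++ w2 ++ w1), w0, w2, w1.
Qed.

Definition productive M := exists2 T, valid G T M & complete G T M.

Variables (L : 'I_m -> relation A) (K : nat -> nat -> nat -> relation A).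

(** The contribution of the paths whose first edge is [d]. In the table [K] only rows of greater
    nodes are consulted, since [etgt d] exceeds [i]. *)
Definition edge_code k i j acc (d : nat * 'I_t * nat) :=
  if esrc d == i then
    acc :|: rmul (rletter A (etag d))
                 (if etgt d == j then rone A else rmul (L (nm k (etgt d))) (K k (etgt d) j))
  else acc.

Definition paths_code k i j := foldl (edge_code k i j) set0 (edges (rhs G k)).

(** The relation from the output of node [i] to the output of the whole right-hand side. Dually,
    [entry_code] leads from the input of the whole right-hand side to the input of node [j]. *)
Definition exit_code k i :=
  if i == (nn k).-1 then rone A else rmul (K k i (nn k).-1) (L (nm k (nn k).-1)).

Definition entry_code k j :=
  if j == 0 then rone A else rmul (L (nm k 0)) (K k 0 j).

Definition production_code k := rmul (L (nm k 0)) (exit_code k 0).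

(** The value [set0] marks a module for which no execution has been found yet; a correct code is
    never empty, because input and output of an execution are connected. So the table of codes also
    records the set of productive modules found so far. *)
Definition codes_sound := forall M, L M != set0 ->
  productive M /\ forall T, valid G T M -> complete G T M -> has_code (tlang G T) (L M).

Section OneProduction.
Variables (k : nat) (io : nat -> language).
Hypothesis kG : k < size (prods G).
Hypothesis HK : forall i j, i < nn k -> j < nn k -> K k i j = paths_code k i j.
Hypothesis Hio : forall l, l < nn k -> has_code (io l) (L (nm k l)).

Lemma klang_code i j : i < nn k -> j < nn k ->
  has_code (fun w => klang G k io i w j) (K k i j).
Proof.
move: {2}(nn k - i) (leqnn (nn k - i)) => n.
elim: n i => [|n IH] i hn hi hj; first by lia.
pose Sd (d : nat * 'I_t * nat) : language := lcat (fun w => w = [:: etag d])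
  (if etgt d == j then (fun w => w = [::]) else lcat (io (etgt d)) (fun w => klang G k io (etgt d) w j)).
pose S0 : language := fun _ => False.
apply: (@has_code_ext _ _ _ (fun w => S0 w \/ exists d, [/\ d \in edges (rhs G k), esrc d = i & Sd d w])).
  move=> w; split=> [[//|[d [hd <- [w1 [w2 [-> hw ->]]]]]]|].
    move: hw; case: eqP => [ej ->|_ [w3 [w4 [h3 h4 ->]]]].
      by rewrite -ej; exact: klang_edge.
    exact: klang_step hd h3 h4.
  move=> /(klang_inv kG)[d [w' [hd ei -> hw]]]; right; exists d; split=> //.
  exists [:: etag d], w'; split=> //; case: hw => [[-> ->]|[ne [w1 [w2 [h1 h2 ->]]]]].
    by rewrite eqxx.
  by rewrite ifN; [exists w1, w2 | apply/eqP].
rewrite (HK hi hj) /paths_code.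
(* The fold is generalized to any list of edges of the right-hand side and to any accumulated
   language; the initial accumulator is the empty language [S0]. *)
have sub d : d \in edges (rhs G k) -> d \in edges (rhs G k) by [].
move: {1 3 4}(edges (rhs G k)) sub => ds sub.
have : has_code S0 set0 by apply: has_code0 => w [].
move: S0 (set0) => S c; elim: ds S c sub => [|d ds IHd] S c sub hc /=.
  apply: has_code_ext hc => w; split=> [h|]; first by left.
  by case=> [//|[d [h _ _]]]; rewrite in_nil in h.
have sub' d' : d' \in ds -> d' \in edges (rhs G k) by move=> h; apply: sub; rewrite inE h orbT.
have hd := rhs_edge wfG kG (sub _ (mem_head _ _)).
rewrite {2}/edge_code; case: eqP => ed; last first.
  apply: has_code_ext (IHd _ _ sub' hc) => w; split=> -[h|[d' [h1 h2 h3]]]; try (by left);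
    right; exists d'; split=> //; first by rewrite inE h1 orbT.
  by move: h1; rewrite inE => /orP[/eqP e|//]; rewrite e in h2.
have hSd : has_code (Sd d) (rmul (rletter A (etag d))
                 (if etgt d == j then rone A else rmul (L (nm k (etgt d))) (K k (etgt d) j))).
  apply: has_code_cat; first exact: has_code_letter.
  case: eqP => _; first exact: has_code_nil.
  have [hd1 hd2] : i < etgt d /\ etgt d < nn k by rewrite -ed; case/andP: hd.
  apply: has_code_cat; first exact: Hio.
  by apply: IH => //; move: (etgt d) hd1 hn => x; lia.
apply: has_code_ext (IHd _ _ sub' (has_code_or hc hSd)) => w; split.
  case=> [[h|h]|[d' [h1 h2 h3]]]; first by left.
    by right; exists d; split; rewrite ?mem_head.
  by right; exists d'; split=> //; rewrite inE h1 orbT.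
case=> [h|[d' [h1 h2 h3]]]; first by left; left.
move: h1; rewrite inE => /orP[/eqP e|h1]; first by left; right; rewrite -e.
by right; exists d'.
Qed.

Lemma exit_has_code i : i < nn k -> has_code (if i == (nn k).-1 then (fun w => w = [::])
  else lcat (fun w => klang G k io i w (nn k).-1) (io (nn k).-1)) (exit_code k i).
Proof.
move=> hi; rewrite /exit_code; case: eqP => _; first exact: has_code_nil.
by apply: has_code_cat; [apply: klang_code; lia | apply: Hio; lia].
Qed.

End OneProduction.

(** Complete trees chosen for the nodes of the right-hand side are joined to one complete tree for
    the left-hand side, whose code is computed; safety transfers it to every other complete tree of
    that module. *)
Lemma production_sound k : k < size (prods G) -> codes_sound ->
    (forall i j, i < nn k -> j < nn k -> K k i j = paths_code k i j) ->
    (forall l, l < nn k -> L (nm k l) != set0) ->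
  [/\ production_code k != set0, productive (lhs G k)
    & forall T, valid G T (lhs G k) -> complete G T (lhs G k) ->
        has_code (tlang G T) (production_code k)].
Proof.
move=> kG hs HK hL; have n0 := nn_gt0 wfG cgG kG.
pose ch l := if pselect (exists2 T, valid G T (nm k l) & complete G T (nm k l)) is left h
  then projT1 (cid2 h) else Leaf.
have hch l : l < nn k -> valid G (ch l) (nm k l) /\ complete G (ch l) (nm k l).
  move=> hl; rewrite /ch; case: pselect => [h|[]]; last by have [h _] := hs _ (hL l hl).
  by case: (cid2 h).
have v1 : valid G (Exp k ch) (lhs G k) by split=> // l /hch[].
have c1 : complete G (Exp k ch) (lhs G k) by move=> l /hch[].
have hio l : l < nn k -> has_code (tlang G (ch l)) (L (nm k l)).
  by move=> hl; have [_ h] := hs _ (hL l hl); have [? ?] := hch l hl; apply: h.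
have hc : has_code (tlang G (Exp k ch)) (production_code k).
  apply: has_code_ext (has_code_cat (hio 0 n0) (exit_has_code kG HK hio n0)) => w.
  rewrite /=; have -> : (0 == (nn k).-1) = (nn k == 1) by lia.
  case: eqP => n1; split.
  - by move=> [w1 [w2 [h1 -> ->]]]; rewrite cats0.
  - by move=> h; exists w, [::]; rewrite cats0.
  - by move=> [w1 [w' [h1 [w2 [w3 [h2 h3 ->]]] ->]]]; exists w1, w2, w3.
  - move=> [w1 [w2 [w3 [h1 h2 h3 ->]]]]; exists w1, (w2 ++ w3); split=> //.
    by exists w2, w3.
split.
- by apply/eqP/(has_code_nonempty hc); apply: tlang_nonempty v1.
- by exists (Exp k ch).
- move=> T vT cT; apply: has_code_sim hc; first exact: (safe_simulated wfG cgG safeD v1 c1 vT cT).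
  exact: (safe_simulated wfG cgG safeD vT cT v1 c1).
Qed.

Hypothesis L_sound : codes_sound.
Hypothesis L_total : forall M, productive M -> L M != set0.
Hypothesis K_def : forall k i j, k < size (prods G) -> i < nn k -> j < nn k ->
  K k i j = paths_code k i j.

(** The relative address [p] starts at the node. The way out leaves the innermost right-hand side
    first and multiplies along [p]; the way in enters the outermost one first and multiplies against
    [p]. *)
Fixpoint out_code (p : addr) := if p is e :: q then rmul (exit_code e.1 e.2) (out_code q) else rone A.
Fixpoint in_code (p : addr) := if p is e :: q then rmul (in_code q) (entry_code e.1 e.2) else rone A.

Lemma out_code_cat p q : out_code (p ++ q) = rmul (out_code p) (out_code q).
Proof. by elim: p => [|e p IH] /=; rewrite ?r1mul // IH rmulA. Qed.

Lemma in_code_cat p q : in_code (p ++ q) = rmul (in_code q) (in_code p).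
Proof. by elim: p => [|e p IH] /=; rewrite ?rmul1 // IH rmulA. Qed.

Lemma tlang_code T M : valid G T M -> complete G T M -> has_code (tlang G T) (L M).
Proof. by move=> hv hc; apply: (L_sound (L_total _)).2 => //; exists T. Qed.

Lemma child_code k ch M a l : valid G (Exp k ch) M -> complete G (Exp k ch) M -> l < nn k ->
  has_code (fun w => wpath (tedges G (ch l) ((k, l) :: a)) (inA (ch l) ((k, l) :: a)) w
     (outA G (ch l) ((k, l) :: a))) (L (nm k l)).
Proof.
move=> [kG _ hv] hc hl; have vl := hv _ hl.
apply: has_code_ext (tlang_code vl (hc _ hl)) => w; apply: iff_sym; exact: (tlangP wfG cgG _ _ vl).
Qed.

Lemma out_has_code T M a p N : valid G T M -> complete G T M -> tnodes G T M a (p ++ a, N) ->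
  has_code (fun w => wpath (tedges G T a) (p ++ a) w (outA G T a)) (out_code p).
Proof.
elim: T M a p => [|k ch IH] M a p hvT hcT.
  case=> e _; have -> : p = [::].
    by apply: size0nil; have := congr1 size e; rewrite size_cat; lia.
  apply: has_code_ext (has_code_nil A D) => w /=.
  by split=> [->|h]; [exact: wpath_nil | inversion h].
have [kG _ hv] := hvT; move=> [i hi hn].
have /suffixP[p' e] := tnodes_suffix hn; rewrite /= in e.
have ep : p = rcons p' (k, i) by apply: (@cat_injl _ a); rewrite cat_rcons.
subst p; rewrite cat_rcons in hn *.
have IHi := IH _ _ _ _ (hv _ hi) (hcT _ hi) hn.
have su : suffix ((k, i) :: a) (p' ++ (k, i) :: a) by rewrite suffix_suffix.
rewrite -cats1 out_code_cat /= rmul1 /exit_code.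
have n0 := nn_gt0 wfG cgG kG; have hl : (nn k).-1 < nn k by lia.
case: eqP => [ei|ni].
  rewrite rmul1; apply: has_code_ext IHi => w; rewrite ei in su *.
  apply: iff_sym; exact: (wpath_same wfG cgG hvT w hl su (outA_suffix _ _ _)).
apply: has_code_ext (has_code_cat IHi (has_code_cat (klang_code kG _ _ hi hl) _)) => [w| |l hl'|]; last 3 first.
- by move=> *; apply: K_def.
- exact: child_code hvT hcT hl'.
- exact: child_code hvT hcT hl.
have ne : i != (nn k).-1 by apply/eqP.
apply: iff_sym; apply: iff_trans (wpath_apart wfG cgG hvT w hi ne su (outA_suffix _ _ _)) _.
split.
  by move=> [w1 [w2 [w3 [-> h1 h2 h3]]]]; exists w1, (w2 ++ w3); split=> //; exists w2, w3.
by move=> [w1 [w' [h1 [w2 [w3 [h2 h3 ->]]] ->]]]; exists w1, w2, w3.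
Qed.

Lemma in_has_code T M a p N : valid G T M -> complete G T M -> tnodes G T M a (p ++ a, N) ->
  has_code (fun w => wpath (tedges G T a) (inA T a) w (p ++ a)) (in_code p).
Proof.
elim: T M a p => [|k ch IH] M a p hvT hcT.
  case=> e _; have -> : p = [::].
    by apply: size0nil; have := congr1 size e; rewrite size_cat; lia.
  apply: has_code_ext (has_code_nil A D) => w /=.
  by split=> [->|h]; [exact: wpath_nil | inversion h].
have [kG _ hv] := hvT; move=> [i hi hn].
have /suffixP[p' e] := tnodes_suffix hn; rewrite /= in e.
have ep : p = rcons p' (k, i) by apply: (@cat_injl _ a); rewrite cat_rcons.
subst p; rewrite cat_rcons in hn *.
have IHi := IH _ _ _ _ (hv _ hi) (hcT _ hi) hn.
have su : suffix ((k, i) :: a) (p' ++ (k, i) :: a) by rewrite suffix_suffix.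
rewrite -cats1 in_code_cat /= r1mul /entry_code.
have hl := nn_gt0 wfG cgG kG.
case: eqP => [ei|ni].
  rewrite r1mul; apply: has_code_ext IHi => w; rewrite ei in su *.
  apply: iff_sym; exact: (wpath_same wfG cgG hvT w hl (inA_suffix _ _) su).
rewrite -rmulA.
apply: has_code_ext (has_code_cat _ (has_code_cat (klang_code kG _ _ hl hi) IHi)) => [w| | |l hl']; last 3 first.
- exact: child_code hvT hcT hl.
- by move=> *; apply: K_def.
- exact: child_code hvT hcT hl'.
have ne : 0 != i by apply/eqP => e0; rewrite -e0 in ni.
apply: iff_sym; apply: iff_trans (wpath_apart wfG cgG hvT w hl ne (inA_suffix _ _) su) _.
split.
  by move=> [w1 [w2 [w3 [-> h1 h2 h3]]]]; exists w1, (w2 ++ w3); split=> //; exists w2, w3.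
by move=> [w1 [w' [h1 [w2 [w3 [h2 h3 ->]]] ->]]]; exists w1, w2, w3.
Qed.

Lemma child_nonempty k ch M a l : valid G (Exp k ch) M -> l < nn k ->
  exists w, wpath (tedges G (ch l) ((k, l) :: a)) (inA (ch l) ((k, l) :: a)) w
     (outA G (ch l) ((k, l) :: a)).
Proof.
move=> [kG _ hv] hl; have vl := hv _ hl; have [w hw] := tlang_nonempty vl.
by exists w; apply/(tlangP wfG cgG _ _ vl).
Qed.

Lemma out_nonempty T M a z : valid G T M -> tnodes G T M a z ->
  exists w, wpath (tedges G T a) z.1 w (outA G T a).
Proof.
elim: T M a => [|k ch IH] M a hvT; first by move=> ->; exists [::]; exact: wpath_nil.
have [kG _ hv] := hvT; move=> [i hi hn]; have su := tnodes_suffix hn.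
have [w hw] := IH _ _ _ (hv _ hi) hn.
have n0 := nn_gt0 wfG cgG kG; have hl : (nn k).-1 < nn k by lia.
have [ei|ni] := eqVneq i (nn k).-1.
  subst i; exists w.
  by apply/(wpath_same wfG cgG hvT w hl su (outA_suffix _ _ _)).
have hi' : i < (nn k).-1 by lia.
have [w2 h2] := klang_to_sink kG (fun l hl => child_nonempty a hvT hl) hi'.
have [w3 h3] := child_nonempty a hvT hl.
exists (w ++ w2 ++ w3).
by apply/(wpath_apart wfG cgG hvT _ hi ni su (outA_suffix _ _ _)); exists w, w2, w3.
Qed.

Lemma in_nonempty T M a z : valid G T M -> tnodes G T M a z ->
  exists w, wpath (tedges G T a) (inA T a) w z.1.
Proof.
elim: T M a => [|k ch IH] M a hvT; first by move=> ->; exists [::]; exact: wpath_nil.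
have [kG _ hv] := hvT; move=> [i hi hn]; have su := tnodes_suffix hn.
have [w hw] := IH _ _ _ (hv _ hi) hn.
have hl := nn_gt0 wfG cgG kG.
have [ei|ni] := eqVneq 0 i.
  subst i; exists w.
  by apply/(wpath_same wfG cgG hvT w hl (inA_suffix _ _) su).
have hi' : 0 < i < nn k by lia.
have [w2 h2] := klang_from_source kG (fun l hl => child_nonempty a hvT hl) hi'.
have [w3 h3] := child_nonempty a hvT hl.
exists (w3 ++ w2 ++ w).
by apply/(wpath_apart wfG cgG hvT _ hl ni (inA_suffix _ _) su); exists w3, w2, w.
Qed.

(* The tree is cut at the deepest node [c] above both [u] and [v]. *)
Lemma pair_has_code T M a u v : valid G T M -> complete G T M ->
  (exists N, tnodes G T M a (u, N)) -> (exists N, tnodes G T M a (v, N)) -> u != v ->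
  exists c k i j pu pv, [/\ u = pu ++ (k, i) :: c, v = pv ++ (k, j) :: c,
    [&& i != j, k < size (prods G), i < nn k & j < nn k],
    has_code (fun w => wpath (tedges G T a) u w v)
      (rmul (out_code pu) (rmul (K k i j) (in_code pv)))
    & ((exists w, wpath (tedges G T a) u w v) <-> K k i j <> set0)].
Proof.
elim: T M a => [|k ch IH] M a hvT hcT.
  by move=> [N [-> _]] [N' [-> _]]; rewrite eqxx.
have [kG _ hv] := hvT; move=> [N [i hi hu]] [N' [j hj hw]] uv.
have su := tnodes_suffix hu; have sv := tnodes_suffix hw; rewrite /= in su sv.
have [ij|ij] := eqVneq i j.
  subst j; have [||c [k' [i' [j' [pu [pv [e1 e2 lt hc hr]]]]]]] :=
    IH _ _ ((k, i) :: a) (hv _ hi) (hcT _ hi) _ _ uv.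
  - by exists N.
  - by exists N'.
  have ws w := wpath_same wfG cgG hvT w hi su sv.
  exists c, k', i', j', pu, pv; split=> //.
    by apply: has_code_ext hc => w; apply: iff_sym; apply: ws.
  by apply: iff_trans hr; split=> -[w /ws h]; exists w.
have /suffixP[pu eu] := su; have /suffixP[pv ev] := sv.
rewrite eu in hu; rewrite ev in hw.
have hcu := out_has_code (hv _ hi) (hcT _ hi) hu.
have hcv := in_has_code (hv _ hj) (hcT _ hj) hw.
have hck := klang_code kG (fun i j => @K_def k i j kG)
   (fun l hl => child_code a hvT hcT hl) hi hj.
exists a, k, i, j, pu, pv; split=> //; first by rewrite ij kG hi.
  apply: has_code_ext (has_code_cat hcu (has_code_cat hck hcv)) => w; rewrite -eu -ev.
  apply: iff_sym; apply: iff_trans (wpath_apart wfG cgG hvT w hi ij su sv) _; split.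
    by move=> [w1 [w2 [w3 [-> h1 h2 h3]]]]; exists w1, (w2 ++ w3); split=> //; exists w2, w3.
  by move=> [w1 [w' [h1 [w2 [w3 [h2 h3 ->]]] ->]]]; exists w1, w2, w3.
apply: iff_trans (has_code_nonempty hck); split.
  move=> [w /(wpath_apart wfG cgG hvT w hi ij su sv)[w1 [w2 [w3 [_ _ h2 _]]]]].
  by exists w2.
move=> [w2 h2].
have [w1 h1] := out_nonempty (hv _ hi) hu; have [w3 h3] := in_nonempty (hv _ hj) hw.
exists (w1 ++ w2 ++ w3); apply/(wpath_apart wfG cgG hvT _ hi ij su sv).
by exists w1, w2, w3; rewrite eu ev.
Qed.

End Codes.

(** * Cycles and labels *)

Section Cycles.
Variables (m t : nat) (G : spec m t) (cs : seq (seq (nat * nat))).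
Hypotheses (slG : strictly_linear G) (co : cycle_ordering G cs).
Implicit Types (M N : 'I_m) (e : nat * nat) (a b p q : addr).

Notation srcs s := [seq pg_src G e | e <- nth [::] cs s].

Lemma nth_cycle s : s < size cs -> pg_cycle G (nth [::] cs s).
Proof. by case: co => /all_nthP h _ /h. Qed.

Lemma mem_cycles e : reflect (exists2 s, s < size cs & e \in nth [::] cs s) (e \in flatten cs).
Proof.
apply: (iffP flattenP) => [[c /(nthP [::])[s hs <-] he]|[s hs he]]; first by exists s.
by exists (nth [::] cs s) => //; rewrite mem_nth.
Qed.

Lemma cycle_unique M s s' : s < size cs -> s' < size cs -> M \in srcs s -> M \in srcs s' -> s = s'.
Proof.
move=> hs hs' h h'; case: (slG (nth_cycle hs) (nth_cycle hs')) => [e|/hasPn/(_ _ h')]; last first.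
  by rewrite /= h.
have [s0 [_ u]] := co.2 _ (nth_cycle hs).
by rewrite -(u s) // -(u s') //; split=> // x; rewrite e.
Qed.

Lemma cycle_ofE M s : s < size cs -> M \in srcs s -> cycle_of G cs M = s.
Proof.
move=> hs h; have hh : has (fun c => M \in [seq pg_src G e | e <- c]) cs.
  by apply/hasP; exists (nth [::] cs s) => //; rewrite mem_nth.
have := nth_find [::] hh; rewrite -/(cycle_of G cs M) => h'.
by apply: cycle_unique h' h => //; rewrite -has_find.
Qed.

Lemma recursiveP M : reflect (exists2 s, s < size cs & M \in srcs s) (recursive G cs M).
Proof.
rewrite /recursive -has_find; apply: (iffP hasP) => [[c /(nthP [::])[s hs <-] h]|[s hs h]].
  by exists s.
by exists (nth [::] cs s) => //; rewrite mem_nth.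
Qed.

Lemma mem_cycle_of M : recursive G cs M -> M \in srcs (cycle_of G cs M).
Proof. by case/recursiveP=> s hs h; rewrite (cycle_ofE hs h). Qed.

Lemma cycle_src e : e \in flatten cs -> recursive G cs (pg_src G e).
Proof.
case/mem_cycles=> s hs he; apply/recursiveP; exists s => //.
by apply/mapP; exists e.
Qed.

Lemma cycle_edge_valid e : e \in flatten cs -> pg_edge G e.
Proof. by case/mem_cycles=> s /nth_cycle/and4P[_ /allP h _ _] /h. Qed.

(** A module has at most one outgoing cycle edge: the cycle through it is unique by strict
    linearity, and a cycle visits each module once. So the next edge of a recursion is determined by
    the module. *)
Lemma cycle_src_inj e e' : e \in flatten cs -> e' \in flatten cs -> pg_src G e = pg_src G e' -> e = e'.
Proof.
move=> /mem_cycles[s hs he] /mem_cycles[s' hs' he'] es.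
have ss : s = s'.
  apply: (cycle_unique (M := pg_src G e)) => //; first by apply/mapP; exists e.
  by apply/mapP; exists e'.
subst s'; have /and4P[_ _ _ u] := nth_cycle hs.
rewrite -(nth_index (0, 0) he) -(nth_index (0, 0) he').
congr nth; apply/eqP; rewrite -(nth_uniq (start G) _ _ u) ?size_map ?index_mem //.
by rewrite !(nth_map (0, 0)) ?index_mem // !nth_index // es.
Qed.

Definition cycle_edge s r := nth (0, 0) (nth [::] cs s) (r %% size (nth [::] cs s)).

Lemma cycle_edge_next s r : s < size cs ->
  cycle_edge s r \in nth [::] cs s /\
  pg_tgt G (cycle_edge s r) = pg_src G (cycle_edge s r.+1).
Proof.
move=> hs; have /and4P[ne _ hc _] := nth_cycle hs.
rewrite /cycle_edge; move: (nth [::] cs s) ne hc => c ne hc.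
have c0 : 0 < size c by case: (c) ne.
have lt : r %% size c < size c by rewrite ltn_mod.
split; first by rewrite mem_nth.
case: c ne hc c0 lt => [|x c] //= _ hc c0 lt.
move/(pathP (0, 0)): hc => /(_ (r %% (size c).+1)); rewrite size_rcons => /(_ lt).
rewrite -[r.+1]addn1 -modnDml addn1.
move: (r %% _) lt => r' lt; rewrite -rcons_cons !nth_rcons /= lt.
move: lt; rewrite ltnS leq_eqVlt => /orP[/eqP->|lt].
  by rewrite ltnn eqxx modnn => /eqP.
by rewrite lt modn_small // => /eqP.
Qed.

Lemma cycle_tgt e : e \in flatten cs -> recursive G cs (pg_tgt G e).
Proof.
case/mem_cycles=> s hs he; apply/recursiveP; exists s => //.
have c0 : 0 < size (nth [::] cs s) by case: (nth _ _ _) he.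
have ee : e = cycle_edge s (index e (nth [::] cs s)).
  by rewrite /cycle_edge modn_small ?index_mem // nth_index.
rewrite ee (cycle_edge_next _ hs).2; apply/mapP.
by exists (cycle_edge s (index e (nth [::] cs s)).+1) => //; exact: (cycle_edge_next _ hs).1.
Qed.

Definition pg_step M N := `[< exists e, [/\ pg_edge G e, pg_src G e = M & pg_tgt G e = N] >].

Lemma path_edges M (p : seq 'I_m) : path pg_step M p -> exists es,
  [/\ [seq pg_src G e | e <- es] = belast M p, all (pg_edge G) es
    & forall e, pg_tgt G e = M -> path (fun e f => pg_tgt G e == pg_src G f) e es /\
        pg_tgt G (last e es) = last M p].
Proof.
elim: p M => [|N p IH] M /=; first by exists [::]; split.
case/andP=> /asboolP[e [he es et]] /IH[es' [h1 h2 h3]]; exists (e :: es').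
split=> /=; first by rewrite es h1.
  by rewrite he.
by move=> e' et'; rewrite et' es eqxx /=; apply: h3.
Qed.

(* An edge on a closed walk lies on a cycle: shorten the way back to a simple path. *)
Lemma closed_walk_cycle e : pg_edge G e -> connect pg_step (pg_tgt G e) (pg_src G e) ->
  e \in flatten cs.
Proof.
move=> he /connectP[p hp ep]; case: (shortenP hp) ep => p' hp' up' _ ep.
have [es [h1 h2 h3]] := path_edges hp'; have [h4 h5] := h3 e erefl.
have hc : pg_cycle G (e :: es).
  apply/and4P; split=> //=; first by rewrite he.
    by rewrite rcons_path h4 h5 ep eqxx.
  by rewrite h1 ep -rcons_uniq -lastI.
have [s [[hs ei] _]] := co.2 _ hc; apply/mem_cycles; exists s => //.
by rewrite ei mem_head.
Qed.

Fixpoint addr_ok a : bool :=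
  if a is e :: b then [&& pg_edge G e, pg_src G e == run_name G b & addr_ok b] else true.

Lemma addr_ok_cat p a : addr_ok (p ++ a) -> addr_ok a.
Proof. by elim: p => //= e p IH /and3P[_ _ /IH]. Qed.

Lemma addr_ok_connect p e a : addr_ok (p ++ e :: a) ->
  connect pg_step (pg_tgt G e) (run_name G (p ++ e :: a)).
Proof.
elim: p => [|e' p IH] //=; case/and3P=> he /eqP es /IH h.
apply: connect_trans h (connect1 _); apply/asboolP; exists e'.
by split.
Qed.

(** If two edges off the cycles had the same source, the derivation between them would close a walk
    through one of them, and that edge would lie on a cycle. Hence a derivation path has at most [m]
    such edges, however long its recursions are. *)
Lemma addr_ok_noncycle a : addr_ok a ->
  uniq [seq pg_src G e | e <- a & e \notin flatten cs].
Proof.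
elim: a => //= e a IH /and3P[he /eqP es ha]; case: ifP => [ne|_] /=; last exact: IH.
rewrite IH // andbT; apply/negP => /mapP[e']; rewrite mem_filter => /andP[ne' he'] ee.
move/negP: ne'; apply; case/splitPr: he' es ha => p q es ha.
have /and3P[he' _ _] := addr_ok_cat ha.
by apply: closed_walk_cycle he' _; rewrite -ee es; apply: addr_ok_connect.
Qed.

Lemma size_noncycle a : addr_ok a -> size [seq e <- a | e \notin flatten cs] <= m.
Proof.
move/addr_ok_noncycle => u; rewrite -(size_map (pg_src G)) -(card_uniqP u).
by apply: leq_trans (max_card _) _; rewrite card_ord.
Qed.

Lemma tnodes_addr_ok T M a z : valid G T M -> run_name G a = M -> addr_ok a ->
  tnodes G T M a z -> addr_ok z.1.
Proof.
elim: T M a => [|k ch IH] M a /=; first by move=> _ _ ha ->.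
move=> [kG eM hv] na ha [i hi]; apply: IH (hv _ hi) _ _ => //=.
by rewrite /pg_edge kG hi /pg_src eM na eqxx.
Qed.

Definition first_label M : seq tlabel :=
  if recursive G cs M then
    [:: RecLabel (cycle_of G cs M)
                 (index M [seq pg_src G e | e <- nth [::] cs (cycle_of G cs M)]) 0]
  else [::].

Fixpoint bump_last (ls : seq tlabel) : seq tlabel :=
  match ls with
  | [:: RecLabel s u i] => [:: RecLabel s u i.+1]
  | l :: ls => l :: bump_last ls
  | [::] => [::]
  end.

(** An edge on a cycle continues the recursion in progress and only increments the last index. Any
    other edge appends its own label and, at a recursive module, opens a new recursion with index
    0. *)
Definition extend (ls : seq tlabel) (e : nat * nat) :=
  if e \in flatten cs then bump_last ls else ls ++ ProdLabel e.1 e.2 :: first_label (pg_tgt G e).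

Fixpoint labels M p := if p is e :: q then extend (labels M q) e else first_label M.

Lemma bump_last_rcons ls s u i : bump_last (rcons ls (RecLabel s u i)) = rcons ls (RecLabel s u i.+1).
Proof.
elim: ls => //= l ls ->; case: l => // *.
by case: ls.
Qed.

Definition tdepth (x : tnode) := match x with TNode a => (size a).*2.+1 | TRec a => (size a).*2 end.

Lemma rec_first_size a : size (rec_first cs a) <= size a.
Proof. by elim: a => //= e a IH; case: ifP => // _; apply: leqW. Qed.

Lemma root_path_fuel n n' x : tdepth x < n -> tdepth x < n' ->
  root_path G cs n x = root_path G cs n' x.
Proof.
elim: n n' x => // n IH [|n'] // x; rewrite !ltnS /=.
case: x => [a|[|e b]] //=; last by rewrite doubleS => h h'; rewrite (IH n') //=; lia.
case: ifP => _.
  by move=> h h'; rewrite (IH n') //=; have := rec_first_size a; lia.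
by case: a => // e b /=; rewrite doubleS => h h'; rewrite (IH n') //=; lia.
Qed.

Definition base_path a := if a is e :: b then rcons (psiV G cs b) (ProdLabel e.1 e.2) else [::].

Lemma psiV_base a : psiV G cs a =
  if recursive G cs (run_name G a) then rcons (base_path (rec_first cs a)) (rec_label G cs a)
  else base_path a.
Proof.
have fuel n b : (size b).*2.+1 < n -> root_path G cs n (TNode b) = psiV G cs b.
  by move=> h; apply: root_path_fuel => /=; lia.
have [n [-> hn]] : exists n, psiV G cs a = root_path G cs n.+2 (TNode a) /\ (size a).*2 <= n.
  by exists (size a).*2.
have le := rec_first_size a; rewrite [LHS]/=; case: ifP => _.
  congr rcons; case: (rec_first cs a) le => [|e b] //= le.
  by congr rcons; apply: fuel; move: le hn; rewrite -ltnS; lia.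
case: a hn {le} => [|e b] // hn; rewrite [RHS]/= -(fuel n.+1) //=.
by move: hn => /=; lia.
Qed.

(** The path to the root runs through special nodes that skip whole recursions; this turns it into a
    recursion on the address, one derivation step at a time. *)
Lemma psiV_labels a : addr_ok a -> psiV G cs a = labels (start G) a.
Proof.
elim: a => [|e a IH] /=.
  move=> _; rewrite psiV_base /= /first_label; case: ifP => //= r.
case/and3P=> he /eqP es /IH <-; rewrite /extend [LHS]psiV_base /= /rec_label /=.
case: (boolP (e \in flatten cs)) => hc.
  have r1 : recursive G cs (run_name G a) by rewrite -es cycle_src.
  by rewrite (cycle_tgt hc) [in RHS]psiV_base r1 bump_last_rcons.
rewrite /first_label /=; case: ifP => _; rewrite -!cats1 -?catA //.
Qed.

End Cycles.

(** * Reading the derivation off a label *)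

Section LabelStructure.
Variables (m t : nat) (G : spec m t) (cs : seq (seq (nat * nat))).
Hypotheses (slG : strictly_linear G) (co : cycle_ordering G cs).
Implicit Types (M N : 'I_m) (e : nat * nat) (a b c p q : addr).
Notation labels := (labels G cs).
Notation extend := (extend G cs).
Notation cycle_edge := (cycle_edge cs).

Definition name_from M p := if p is e :: _ then pg_tgt G e else M.

Fixpoint path_ok M p : bool :=
  if p is e :: q then [&& pg_edge G e, pg_src G e == name_from M q & path_ok M q] else true.

Lemma path_ok_cat p a : addr_ok G (p ++ a) -> path_ok (run_name G a) p.
Proof.
elim: p => //= e p IH /and3P[-> /eqP-> h]; rewrite IH // andbT.
by case: p {IH h} => *; rewrite /= eqxx.
Qed.

Lemma first_label_rec M : recursive G cs M -> exists s u,
  [/\ first_label G cs M = [:: RecLabel s u 0], s < size cs & pg_src G (cycle_edge s u) = M].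
Proof.
move=> r; rewrite /first_label r; have hM := mem_cycle_of slG co r.
exists (cycle_of G cs M), (index M [seq pg_src G e | e <- nth [::] cs (cycle_of G cs M)]).
split=> //; rewrite /cycle_edge modn_small; last by rewrite -(size_map (pg_src G)) index_mem.
by rewrite -(nth_map _ (start G)) ?nth_index // -(size_map (pg_src G)) index_mem.
Qed.

Lemma cycle_edge_mem s r : s < size cs -> cycle_edge s r \in flatten cs.
Proof. by move=> hs; apply/(mem_cycles cs); exists s => //; have [] := cycle_edge_next co r hs. Qed.

(** The invariant that makes the compression reversible: starting at edge [u] of cycle [s], after
    [i] steps the recursion stands at the source of edge [u + i], counted around the cycle. *)
Lemma labels_last M p : path_ok M p -> recursive G cs (name_from M p) ->
  exists ls s u i, [/\ labels M p = rcons ls (RecLabel s u i), s < size cs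
    & pg_src G (cycle_edge s (u + i)) = name_from M p].
Proof.
elim: p => [|e q IH] /= ok.
  move=> /first_label_rec[s [u [-> hs hM]]]; exists [::], s, u, 0; split=> //.
  by rewrite addn0.
move: ok => /and3P[he /eqP es /IH{}IH] r; rewrite /extend.
case: (boolP (e \in flatten cs)) => hc.
  have [|ls [s [u [i [-> hs hM]]]]] := IH; first by rewrite -es cycle_src.
  exists ls, s, u, i.+1; rewrite bump_last_rcons; split=> //.
  rewrite addnS -(cycle_edge_next co _ hs).2; congr pg_tgt.
  by apply: (cycle_src_inj slG co); rewrite ?cycle_edge_mem // hM.
have [s [u [-> hs hM]]] := first_label_rec r.
exists (rcons (labels M q) (ProdLabel e.1 e.2)), s, u, 0; rewrite addn0; split=> //.
by rewrite -!cats1 -catA.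
Qed.

Lemma labels_cycle_edge M e q : path_ok M (e :: q) -> e \in flatten cs ->
  exists ls s u i, [/\ labels M q = rcons ls (RecLabel s u i), s < size cs
    & e = cycle_edge s (u + i)].
Proof.
move=> /= /and3P[he /eqP es ok] hc.
have [|ls [s [u [i [-> hs hM]]]]] := labels_last ok; first by rewrite -es cycle_src.
exists ls, s, u, i; split=> //; apply: (cycle_src_inj slG co); rewrite ?cycle_edge_mem //.
by rewrite hM.
Qed.

(** Below an edge off the cycles the prefix is never changed again: a later increment acts on the
    last label, which belongs to a recursion opened at or below the target of [e]. *)
Lemma labels_noncycle p e c : addr_ok G (p ++ e :: c) -> e \notin flatten cs ->
  labels (start G) (p ++ e :: c) =
  labels (start G) c ++ ProdLabel e.1 e.2 :: labels (pg_tgt G e) p.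
Proof.
move=> ok hc; elim: p ok => [|e' p IH] ok; first by rewrite /= /extend (negbTE hc).
have ok' := path_ok_cat ok; rewrite cat_cons /= in ok *; have /and3P[_ _ /IH{IH}->] := ok.
rewrite /extend; case: (boolP (e' \in flatten cs)) => hc'; last by rewrite -catA.
have [ls [s [u [i [-> _ _]]]]] := labels_cycle_edge ok' hc'.
by rewrite bump_last_rcons -!rcons_cons -!rcons_cat bump_last_rcons.
Qed.

Section Values.
Variables (A : Type) (op : A -> A -> A) (one : A) (f : nat * nat -> A).
Hypotheses (opA : associative op) (op1 : right_id one op) (opl1 : left_id one op).

(** Products along labels are formed in an arbitrary monoid, because exits and entries have to be
    multiplied in opposite orders; the exits use the opposite monoid. *)
Definition cycle_value s r n : A :=
  foldl (fun acc x => op acc (f (cycle_edge s (r + x)))) one (iota 0 n).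

Definition label_value (l : tlabel) : A :=
  match l with ProdLabel k i => f (k, i) | RecLabel s u i => cycle_value s u i end.

Definition labels_value (ls : seq tlabel) : A :=
  foldl (fun acc l => op acc (label_value l)) one ls.

Fixpoint path_value p : A := if p is e :: q then op (path_value q) (f e) else one.

Lemma cycle_valueS s r n : cycle_value s r n.+1 = op (cycle_value s r n) (f (cycle_edge s (r + n))).
Proof. by rewrite /cycle_value -[n.+1]addn1 iotaD foldl_cat /= add0n. Qed.

Lemma labels_value_cat ls1 ls2 :
  labels_value (ls1 ++ ls2) = op (labels_value ls1) (labels_value ls2).
Proof.
rewrite /labels_value foldl_cat; elim/last_ind: ls2 => [|ls l IH] /=; first by rewrite op1.
by rewrite !foldl_rcons IH opA.
Qed.

Lemma labels_value1 l : labels_value [:: l] = label_value l.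
Proof. by rewrite /labels_value /= opl1. Qed.

Lemma labels_value_bump ls s u i :
  labels_value (rcons ls (RecLabel s u i.+1)) =
  op (labels_value (rcons ls (RecLabel s u i))) (f (cycle_edge s (u + i))).
Proof. by rewrite -!cats1 !labels_value_cat !labels_value1 /= cycle_valueS opA. Qed.

Lemma first_label_value M : labels_value (first_label G cs M) = one.
Proof. by rewrite /first_label; case: ifP => _ //; rewrite labels_value1. Qed.

Lemma path_valueE M p : path_ok M p -> labels_value (labels M p) = path_value p.
Proof.
elim: p => [|e q IH] ok /=; first exact: first_label_value.
have ok' := ok; case/and3P: ok' => _ _ /IH <-; rewrite /extend.
case: (boolP (e \in flatten cs)) => hc.
  have [ls [s [u [i [-> _ ->]]]]] := labels_cycle_edge ok hc.
  by rewrite bump_last_rcons labels_value_bump.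
rewrite labels_value_cat -cat1s labels_value_cat labels_value1 first_label_value op1 /=.
by case: (e).
Qed.

(** The descendant through the cycle edge [e] keeps the prefix [P] and shows the same recursion at a
    greater index [y]. The product starts at [x.+1] and not at [x], because the step along [e]
    itself belongs to the right-hand side in which two nodes part and is covered by its table
    entry. *)
Lemma labels_cycle p e c : addr_ok G (p ++ e :: c) -> e \in flatten cs ->
  exists P s u x y r, [/\ labels (start G) c = rcons P (RecLabel s u x),
    labels (start G) (p ++ e :: c) = P ++ RecLabel s u y :: r,
    (x < y) && (s < size cs), e = cycle_edge s (u + x)
    & path_value p = op (cycle_value s (u + x.+1) (y - x.+1)) (labels_value r)].
Proof.
move=> ok hc; have okc := addr_ok_cat ok.
have okp : path_ok (start G) (p ++ e :: c).
  by have := @path_ok_cat (p ++ e :: c) [::]; rewrite cats0; apply.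
have okc' : path_ok (start G) (e :: c).
  by have := @path_ok_cat (e :: c) [::]; rewrite cats0; apply.
have [P [s [u [a [eP hs ee]]]]] := labels_cycle_edge okc' hc.
exists P, s, u, a; elim: p ok okp => [|e' p IH] ok okp.
  exists a.+1, [::]; split=> //; last by rewrite /= subnn op1.
    by rewrite /= /extend hc eP bump_last_rcons cats1.
  by rewrite ltnSn hs.
have ok2 : addr_ok G (p ++ e :: c) by case/and3P: ok.
have okp2 : path_ok (start G) (p ++ e :: c) by case/and3P: okp.
have [b [r [_ eL /andP[lt _] _ ev]]] := IH ok2 okp2.
rewrite cat_cons /= eL /extend; case: (boolP (e' \in flatten cs)) => hc'; last first.
  exists b, (r ++ ProdLabel e'.1 e'.2 :: first_label G cs (pg_tgt G e')).
  split=> //; [by rewrite -catA | by rewrite lt hs | ].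
  rewrite labels_value_cat opA ev -[_ :: first_label _ _ _]cat1s.
  rewrite labels_value_cat labels_value1 first_label_value op1 /=.
  by case: (e').
have [ls [s' [u' [i [eL' _ ee']]]]] := labels_cycle_edge okp hc'; rewrite eL in eL'.
elim/last_ind: r eL eL' ev => [|r l _] eL eL' ev.
  move: eL'; rewrite cats1 => /rcons_inj[_ e1 e2 e3]; subst s' u' i.
  exists b.+1, [::]; split=> //; first by rewrite bump_last_rcons cats1.
    by rewrite (ltn_trans lt) // hs.
  rewrite /= ev subSn // cycle_valueS !op1; congr (op _ (f _)); rewrite ee'; congr cycle_edge.
  by lia.
move: eL'; rewrite -rcons_cons -rcons_cat => /rcons_inj[_ el]; subst l.
exists b, (rcons r (RecLabel s' u' i.+1)); split=> //; last by rewrite /= labels_value_bump opA -ev ee'.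
  by rewrite -!rcons_cons -!rcons_cat bump_last_rcons.
by rewrite lt hs.
Qed.

End Values.

(** An edge off the cycles adds at most two labels, a cycle edge none, and the start module at most
    one; with [size_noncycle] the length is bounded by the number of modules. *)
Lemma size_labels a : size (labels (start G) a) <= 2 * size [seq e <- a | e \notin flatten cs] + 1.
Proof.
have h1 M : size (first_label G cs M) <= 1 by rewrite /first_label; case: ifP.
have hb ls : size (bump_last ls) = size ls.
  by elim: ls => //= l ls IH; case: l => [k i|s u i] /=; [rewrite IH | case: ls IH => //= l ls ->].
elim: a => [|e a IH] /=; first exact: h1.
rewrite /extend; case: (boolP (e \in flatten cs)) => /= _; first by rewrite hb.
rewrite size_cat /= mulnS -addnA [leqRHS]addnC; apply: leq_add IH _; exact: h1.
Qed.

End LabelStructure.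

(** * Two labels and the relation between their nodes *)

Section LabelPairs.
Variables (m t : nat) (G : spec m t) (cs : seq (seq (nat * nat))).
Variables (A : automaton) (L : 'I_m -> relation A) (K : nat -> nat -> nat -> relation A).

Definition exit_of (e : nat * nat) := exit_code G L K e.1 e.2.
Definition entry_of (e : nat * nat) := entry_code G L K e.1 e.2.
Definition rmul_rev (c d : relation A) := rmul d c.

Definition labels_out := labels_value cs rmul_rev (rone A) exit_of.
Definition labels_in := labels_value cs (@rmul A) (rone A) entry_of.
Definition cycle_out := cycle_value cs rmul_rev (rone A) exit_of.
Definition cycle_in := cycle_value cs (@rmul A) (rone A) entry_of.

(** The indices are the relation from the first node to the second one, and whether the second is
    reachable. In [LabelDown] the second label follows the recursion beyond the member at which the
    first one branches off: the node [j] of the right-hand side that it passes does not occur in it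
    and is supplied by the cycle. [LabelUp] is the mirror image. *)
Inductive label_pair (ls1 ls2 : seq tlabel) : relation A -> bool -> Prop :=
  | LabelSame of ls1 = ls2 : label_pair ls1 ls2 (rone A) true
  | LabelProd P k i j r1 r2 of ls1 = P ++ ProdLabel k i :: r1 & ls2 = P ++ ProdLabel k j :: r2
      & i != j & [&& k < size (prods G), i < nn G k & j < nn G k] :
      label_pair ls1 ls2 (rmul (labels_out r1) (rmul (K k i j) (labels_in r2))) (K k i j != set0)
  | LabelDown P s u x y k i j r1 r2 of
      ls1 = P ++ RecLabel s u x :: ProdLabel k i :: r1 & ls2 = P ++ RecLabel s u y :: r2
      & (x < y) && (s < size cs) & cycle_edge cs s (u + x) = (k, j)
      & [&& k < size (prods G), i < nn G k & j < nn G k] :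
      label_pair ls1 ls2
        (rmul (labels_out r1)
              (rmul (K k i j) (rmul (cycle_in s (u + x.+1) (y - x.+1)) (labels_in r2))))
        (K k i j != set0)
  | LabelUp P s u x y k i j r1 r2 of
      ls1 = P ++ RecLabel s u x :: r1 & ls2 = P ++ RecLabel s u y :: ProdLabel k j :: r2
      & (y < x) && (s < size cs) & cycle_edge cs s (u + y) = (k, i)
      & [&& k < size (prods G), i < nn G k & j < nn G k] :
      label_pair ls1 ls2
        (rmul (rmul (labels_out r1) (cycle_out s (u + y.+1) (x - y.+1)))
              (rmul (K k i j) (labels_in r2)))
        (K k i j != set0).

Lemma cat_cons_head (X : Type) (P : seq X) x1 r1 x2 r2 : P ++ x1 :: r1 = P ++ x2 :: r2 -> x1 = x2.
Proof. by elim: P => [[]|x P IH [/IH]]. Qed.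

Hypotheses (wfG : wf_spec G) (cgG : coarse_grained G).
Hypotheses (slG : strictly_linear G) (co : cycle_ordering G cs).
Variables (D : dfa t) (R : regex).
Hypotheses (safeD : safe_dfa D G) (RA : recognizes A R) (RD : dfa_accepts_lang D R).
Hypothesis L_sound : codes_sound G D L.
Hypothesis L_total : forall M, productive G M -> L M != set0.
Hypothesis K_def : forall k i j, k < size (prods G) -> i < nn G k -> j < nn G k ->
  K k i j = paths_code G L K k i j.
Variable g : graph addr m t.
Hypothesis runG : run G g.

Lemma run_addr_ok u : u \in node_ids g -> addr_ok G u.
Proof.
have [T [hv hn _] _] := execution_tree wfG cgG runG.
by case/mapP=> z /hn hz ->; apply: tnodes_addr_ok hv _ _ hz.
Qed.

(** For a node paired with itself the query asks whether the empty word is accepted, which is what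
    the identity relation in [LabelSame] expresses. *)
Lemma wpath_loop T M a z w : valid G T M -> tnodes G T M a z ->
  wpath (tedges G T a) z.1 w z.1 -> w = [::].
Proof.
elim: T M a => [|k ch IH] M a hvT; first by move=> _ h; inversion h.
have [kG _ hv] := hvT; move=> [i hi hn]; have su := tnodes_suffix hn.
by move/(wpath_same wfG cgG hvT w hi su su); apply: IH (hv _ hi) hn.
Qed.

Lemma rpq_wpath T M u v : represents G T M g ->
  rpq R g u v <-> exists2 w, wpath (tedges G T [::]) u w v & lang R w.
Proof.
move=> hr; split=> [[p hp hl]|[w /(represents_walk _ _ _ hr)[p hp <-] hl]]; last by exists p.
by exists (tags p) => //; apply/(represents_walk _ _ _ hr); exists p.
Qed.

Lemma reachable_wpath T M u v : represents G T M g ->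
  reachable g u v <-> exists w, wpath (tedges G T [::]) u w v.
Proof.
move=> hr; split=> [[p hp]|[w /(represents_walk _ _ _ hr)[p hp _]]]; last by exists p.
by exists (tags p); apply/(represents_walk _ _ _ hr); exists p.
Qed.

Let rmul_revA : associative rmul_rev.
Proof. by move=> x y z; rewrite /rmul_rev rmulA. Qed.
Let rmul_rev1 : right_id (rone A) rmul_rev.
Proof. by move=> x; rewrite /rmul_rev r1mul. Qed.
Let rmul_1rev : left_id (rone A) rmul_rev.
Proof. by move=> x; rewrite /rmul_rev rmul1. Qed.

Lemma path_value_out p : path_value rmul_rev (rone A) exit_of p = out_code G L K p.
Proof. by elim: p => //= e p ->. Qed.

Lemma path_value_in p : path_value (@rmul A) (rone A) entry_of p = in_code G L K p.
Proof. by elim: p => //= e p ->. Qed.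

Lemma pg_tgt_path p e c : addr_ok G (p ++ e :: c) -> path_ok G (pg_tgt G e) p.
Proof. exact: path_ok_cat. Qed.

(** The relation and reachability are functions of the two labels alone. The last clause, that
    labels identify nodes, allows nodes to be handled by their labels throughout the program. *)
Theorem label_pairP u v : u \in node_ids g -> v \in node_ids g -> exists c b,
  [/\ label_pair (psiV G cs u) (psiV G cs v) c b, rpq R g u v <-> raccept c,
      reachable g u v <-> b & (psiV G cs u = psiV G cs v -> u = v)].
Proof.
move=> hu hv; have oku := run_addr_ok hu; have okv := run_addr_ok hv.
have [T hr hc] := execution_tree wfG cgG runG; have [hvT hn _] := hr.
rewrite !(psiV_labels co) //.
have [N hN] : exists N, tnodes G T (start G) [::] (u, N).
  by case/mapP: hu => z /hn hz ->; exists z.2; case: (z) hz.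
have [uv|uv] := eqVneq u v.
  subst v; exists (rone A), true; split=> //; first exact: LabelSame.
    apply: iff_trans (rpq_wpath _ _ hr) _.
    apply: iff_trans (has_code_accept RA RD (has_code_nil A D)); split=> -[w hw hl]; exists w => //.
      exact: wpath_loop hvT hN hw.
    by rewrite hw; exact: wpath_nil.
  by split=> // _; exists [::] => /=.
have [N' hN'] : exists N, tnodes G T (start G) [::] (v, N).
  by case/mapP: hv => z /hn hz ->; exists z.2; case: (z) hz.
have [c [k [i [j [pu [pv [eu ev bnd hcode hreach]]]]]]] :=
  pair_has_code wfG cgG L_sound L_total K_def hvT hc (ex_intro _ N hN) (ex_intro _ N' hN') uv.
have /and4P[ij kG hi hj] := bnd.
have {}hcode : rpq R g u v <-> raccept (rmul (out_code G L K pu) (rmul (K k i j) (in_code G L K pv))).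
  apply: iff_trans (rpq_wpath _ _ hr) _; exact: has_code_accept RA RD hcode.
have {}hreach : reachable g u v <-> K k i j != set0.
  apply: iff_trans (reachable_wpath _ _ hr) (iff_trans hreach _).
  by split=> /eqP.
have {}bnd : [&& k < size (prods G), i < nn G k & j < nn G k] by rewrite kG hi.
suff [c' [hl ne ec]] : exists c', [/\ label_pair (labels G cs (start G) u)
     (labels G cs (start G) v) c' (K k i j != set0),
     labels G cs (start G) u <> labels G cs (start G) v
     & c' = rmul (out_code G L K pu) (rmul (K k i j) (in_code G L K pv))].
  exists c', (K k i j != set0); rewrite ec; split=> //; first by rewrite -ec.
subst u v; have [ci|ci] := boolP ((k, i) \in flatten cs); have [cj|cj] := boolP ((k, j) \in flatten cs).
(* The two nodes cannot both continue along a cycle: both edges leave the module of [c], which has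
   only one outgoing cycle edge. *)
- have := cycle_src_inj slG co ci cj erefl => -[e]; by rewrite e eqxx in ij.
- have [P [s [u [x [y [r [e1 e2 /andP[lt hs] e3 e4]]]]]]] :=
    labels_cycle slG co exit_of rmul_revA rmul_rev1 rmul_1rev oku ci.
  have e5 := labels_noncycle slG co okv cj; rewrite e1 cat_rcons /= in e5.
  rewrite e2 e5; eexists; split.
  + by apply: (@LabelUp _ _ P s u y x) => //; rewrite ?lt // e3.
  + by move=> h; have [e] := cat_cons_head h; rewrite e ltnn in lt.
  + by rewrite -path_value_out e4 -path_value_in -(path_valueE slG co entry_of (@rmulA A) (@rmul1 A) (@r1mul A) (pg_tgt_path okv)).
- have [P [s [u [x [y [r [e1 e2 /andP[lt hs] e3 e4]]]]]]] :=
    labels_cycle slG co entry_of (@rmulA A) (@rmul1 A) (@r1mul A) okv cj.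
  have e5 := labels_noncycle slG co oku ci; rewrite e1 cat_rcons /= in e5.
  rewrite e2 e5; eexists; split.
  + by apply: (@LabelDown _ _ P s u x y) => //; rewrite ?lt // e3.
  + by move=> h; have [e] := cat_cons_head h; rewrite e ltnn in lt.
  + by rewrite -path_value_in e4 -path_value_out -(path_valueE slG co exit_of rmul_revA rmul_rev1 rmul_1rev (pg_tgt_path oku)).
- have e1 := labels_noncycle slG co oku ci; have e2 := labels_noncycle slG co okv cj.
  rewrite e1 e2 /=; eexists; split.
  + by apply: (@LabelProd _ _ (labels G cs (start G) c) k i j).
  + by move=> h; have [e] := cat_cons_head h; rewrite e eqxx in ij.
  + rewrite -path_value_out -path_value_in.
    rewrite -(path_valueE slG co entry_of (@rmulA A) (@rmul1 A) (@r1mul A) (pg_tgt_path okv)).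
    by rewrite -(path_valueE slG co exit_of rmul_revA rmul_rev1 rmul_1rev (pg_tgt_path oku)).
Qed.

Lemma size_psiV u : u \in node_ids g -> size (psiV G cs u) <= 2 * m + 1.
Proof.
move=> hu; have oku := run_addr_ok hu; rewrite (psiV_labels co) //.
by apply: leq_trans (size_labels _ _ _) _; have := size_noncycle co oku; lia.
Qed.

End LabelPairs.

(** * A machine with arrays and counted loops *)

(* [EG] reads a register, [EI] the input, [EA] a two-dimensional array, and [ET] a constant
   table with [P] rows and columns. *)
Inductive hexpr :=
  | EC of nat
  | EG of nat
  | EI of hexpr
  | EA of nat & hexpr & hexpr
  | EO of binop & hexpr & hexpr
  | ET of (nat -> nat -> nat) & hexpr & hexpr
  | EIf of hexpr & hexpr & hexpr.

(* [CFor cl r rn e p] runs [p] for each value of the counter [r] below the number of iterations,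
   which is kept in the register [rn]. *)
Inductive hcmd :=
  | CSkip
  | CSet of nat & hexpr
  | CArr of nat & hexpr & hexpr & hexpr
  | CEmit of hexpr
  | CSeq of hcmd & hcmd
  | CIf of hexpr & hcmd & hcmd
  | CFor of bool & nat & nat & hexpr & hcmd.

Record hstate := HState {
  rg : nat -> nat;
  ar : nat -> nat -> nat -> nat;
  ou : seq nat;
  tm : nat
}.

(* The register that caps the number of iterations of the loops flagged [true]. *)
Definition rcap := 0.

Section Semantics.
Variables (inp : seq nat) (P : nat).

Definition tabulated (f : nat -> nat -> nat) x y :=
  if (x < P) && (y < P) then f x y else 0.

Fixpoint ev (s : hstate) (e : hexpr) : nat :=
  match e with
  | EC v => v
  | EG r => rg s r
  | EI a => nth 0 inp (ev s a)
  | EA k a b => ar s k (ev s a) (ev s b)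
  | EO o a b => eval_op o (ev s a) (ev s b)
  | ET f a b => tabulated f (ev s a) (ev s b)
  | EIf c a b => if ev s c != 0 then ev s a else ev s b
  end.

Definition tick s := HState (rg s) (ar s) (ou s) (tm s).+1.
Definition setr s r v := HState (upd (rg s) r v) (ar s) (ou s) (tm s).
Definition upd3 (a : nat -> nat -> nat -> nat) k x y v :=
  fun k' x' y' => if [&& k' == k, x' == x & y' == y] then v else a k' x' y'.

Definition for_count (cl : bool) s e := if cl then minn (rg s rcap) (ev s e) else ev s e.

(** After a loop the counter holds the number of iterations, as it does after the [While] to which
    the loop is compiled. The time counts commands; the cost of expressions enters as a constant
    factor of the compilation. *)
Fixpoint hrun (p : hcmd) (s : hstate) {struct p} : hstate :=
  match p with
  | CSkip => tick s
  | CSet r e => tick (setr s r (ev s e))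
  | CArr k a b e => tick (HState (rg s) (upd3 (ar s) k (ev s a) (ev s b) (ev s e)) (ou s) (tm s))
  | CEmit e => tick (HState (rg s) (ar s) (rcons (ou s) (ev s e)) (tm s))
  | CSeq p q => hrun q (hrun p s)
  | CIf e p q => if ev s e != 0 then hrun p (tick s) else hrun q (tick s)
  | CFor cl r rn e p =>
      let n := for_count cl s e in
      setr (foldl (fun s i => hrun p (tick (setr s r i)))
                  (tick (setr s rn n)) (iota 0 n)) r n
  end.

Lemma run_seqE p q s : hrun (CSeq p q) s = hrun q (hrun p s).
Proof. by []. Qed.

Lemma run_forE cl r rn e p s : hrun (CFor cl r rn e p) s =
  setr (foldl (fun s i => hrun p (tick (setr s r i))) (tick (setr s rn (for_count cl s e)))
              (iota 0 (for_count cl s e))) r (for_count cl s e).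
Proof. by []. Qed.

Lemma run_for_inv (I : nat -> hstate -> Prop) r p s n :
    I 0 s ->
    (forall i s', i < n -> I i s' -> I i.+1 (hrun p (tick (setr s' r i)))) ->
  I n (foldl (fun s i => hrun p (tick (setr s r i))) s (iota 0 n)).
Proof.
elim: n => [|n IH] // I0 IS.
rewrite -addn1 iotaD foldl_cat /= add0n addn1; apply: (IS n) => //.
by apply: IH => // i s' lt_in; apply: IS; apply: ltnW.
Qed.

Fixpoint modr (p : hcmd) : seq nat :=
  match p with
  | CSet r _ => [:: r]
  | CSeq p q | CIf _ p q => modr p ++ modr q
  | CFor _ r rn _ p => r :: rn :: modr p
  | _ => [::]
  end.

Fixpoint moda (p : hcmd) : seq nat :=
  match p with
  | CArr k _ _ _ => [:: k]
  | CSeq p q | CIf _ p q => moda p ++ moda q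
  | CFor _ _ _ _ p => moda p
  | _ => [::]
  end.

Fixpoint silent (p : hcmd) : bool :=
  match p with
  | CEmit _ => false
  | CSeq p q | CIf _ p q => silent p && silent q
  | CFor _ _ _ _ p => silent p
  | _ => true
  end.

Lemma run_rg p s r : r \notin modr p -> rg (hrun p s) r = rg s r.
Proof.
elim: p s => //=.
- by move=> r' e s; rewrite inE /upd => /negbTE ->.
- by move=> p IHp q IHq s; rewrite mem_cat negb_or => /andP[hp hq]; rewrite IHq // IHp.
- move=> e p IHp q IHq s; rewrite mem_cat negb_or => /andP[hp hq].
  by case: ifP => _; [rewrite IHp | rewrite IHq].
- move=> cl r' rn e p IHp s; rewrite !inE !negb_or => /and3P[h1 h2 h3].
  rewrite /upd (negbTE h1).
  apply: (run_for_inv (I := fun i s' => rg s' r = rg s r)).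
    by rewrite /= /upd (negbTE h2).
  by move=> i s' _ <-; rewrite IHp //= /upd (negbTE h1).
Qed.

Lemma run_ar p s k : k \notin moda p -> ar (hrun p s) k = ar s k.
Proof.
elim: p s => //=.
- by move=> k' a b e s; rewrite inE /upd3 => /negbTE ->.
- by move=> p IHp q IHq s; rewrite mem_cat negb_or => /andP[hp hq]; rewrite IHq // IHp.
- move=> e p IHp q IHq s; rewrite mem_cat negb_or => /andP[hp hq].
  by case: ifP => _; [rewrite IHp | rewrite IHq].
- move=> cl r' rn e p IHp s hp.
  apply: (run_for_inv (I := fun i s' => ar s' k = ar s k)) => // i s' _ <-.
  by rewrite IHp.
Qed.

Lemma run_ou p s : silent p -> ou (hrun p s) = ou s.
Proof.
elim: p s => //=.
- by move=> p IHp q IHq s /andP[hp hq]; rewrite IHq // IHp.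
- move=> e p IHp q IHq s /andP[hp hq].
  by case: ifP => _; [rewrite IHp | rewrite IHq].
- move=> cl r' rn e p IHp s hp.
  apply: (run_for_inv (I := fun i s' => ou s' = ou s)) => // i s' _ <-.
  by rewrite IHp.
Qed.

Fixpoint capped (p : hcmd) : bool :=
  match p with
  | CSeq p q | CIf _ p q => capped p && capped q
  | CFor cl _ _ _ p => cl && capped p
  | _ => true
  end.

End Semantics.

(** When every loop is cut off at [rcap], a polynomial bound whose degree grows with the nesting can
    be read off the syntax, whatever the program computes. That the cap never shortens a loop in
    fact is part of the correctness proofs. *)
Lemma capped_time P p : capped p -> rcap \notin modr p ->
  exists d, forall inp s, tm (hrun inp P p s) <= tm s + d * (rg s rcap).+1 ^ d.
Proof.
elim: p => /=; try (by move=> *; exists 1 => inp s /=; lia).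
- move=> p IHp q IHq /andP[cp cq]; rewrite mem_cat negb_or => /andP[hp hq].
  have [d1 H1] := IHp cp hp; have [d2 H2] := IHq cq hq.
  exists (d1 + d2) => inp s; apply: leq_trans (H2 inp _) _; rewrite (run_rg _ _ _ hp).
  have := H1 inp s; set x := (rg s rcap).+1 => H.
  have e1 : x ^ d1 <= x ^ (d1 + d2) by rewrite leq_pexp2l // leq_addr.
  have e2 : x ^ d2 <= x ^ (d1 + d2) by rewrite leq_pexp2l // leq_addl.
  rewrite mulnDl.
  have := leq_mul (leqnn d1) e1; have := leq_mul (leqnn d2) e2; lia.
- move=> e p IHp q IHq /andP[cp cq]; rewrite mem_cat negb_or => /andP[hp hq].
  have [d1 H1] := IHp cp hp; have [d2 H2] := IHq cq hq.
  exists (d1 + d2).+1 => inp s; set x := (rg s rcap).+1.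
  have e0 : 0 < x ^ (d1 + d2).+1 by rewrite expn_gt0.
  have e1 : x ^ d1 <= x ^ (d1 + d2).+1 by rewrite leq_pexp2l //; lia.
  have e2 : x ^ d2 <= x ^ (d1 + d2).+1 by rewrite leq_pexp2l //; lia.
  have f1 := leq_mul (leqnn d1) e1; have f2 := leq_mul (leqnn d2) e2.
  rewrite mulSn mulnDl; case: ifP => _.
    by have := H1 inp (tick s); rewrite /= -/x; lia.
  by have := H2 inp (tick s); rewrite /= -/x; lia.
- move=> [] // r rn e p IHp /= cp; rewrite !inE !negb_or => /and3P[h1 h2 hp].
  have [d H] := IHp cp hp; exists d.+2 => inp s; set x := (rg s rcap).+1.
  pose n := for_count inp P true s e; rewrite -/n.
  have le_n : n < x by rewrite /n /for_count /x ltnS geq_minl.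
  have [] : let s' := foldl (fun s i => hrun inp P p (tick (setr s r i)))
                  (tick (setr s rn n)) (iota 0 n) in
       tm s' <= (tm s).+1 + n * (d * x ^ d).+1 /\ rg s' rcap = rg s rcap.
    apply: (run_for_inv (I := fun i s' => tm s' <= (tm s).+1 + i * (d * x ^ d).+1 /\
          rg s' rcap = rg s rcap)) => //=.
      by split; [lia | rewrite /upd (negbTE h2)].
    move=> i s' _ [Ht Hr]; rewrite run_rg //= /upd (negbTE h1) Hr; split=> //.
    have := H inp (tick (setr s' r i)); rewrite /= /upd (negbTE h1) Hr -/x; lia.
  move=> Ht _; apply: leq_trans Ht _.
  have e1 : d * x ^ d < d.+1 * x ^ d.+1.
    rewrite mulSn -addn1 addnC; apply: leq_add; first by rewrite expn_gt0.
    by rewrite leq_mul2l leq_pexp2l ?orbT.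
  have e2 : n * (d * x ^ d).+1 <= x * (d.+1 * x ^ d.+1) by apply: leq_mul => //; apply: ltnW.
  have e3 : x * (d.+1 * x ^ d.+1) = d.+1 * x ^ d.+2 by rewrite [in RHS]expnS; lia.
  have : 0 < x ^ d.+2 by rewrite expn_gt0.
  rewrite [d.+2 * _]mulSn; lia.
Qed.

(** * Compilation to the word RAM *)

(** The code lies between the square of [x + y] and the next square, so it determines [x + y] and
    then [x]. Unlike a row-major numbering it requires no bound on the indices. *)
Lemma pair_inj x y x' y' :
  (x + y) * (x + y) + x = (x' + y') * (x' + y') + x' -> x = x' /\ y = y'.
Proof.
move=> e; case: (ltngtP (x + y) (x' + y')) => h.
- have := leq_mul h h; rewrite mulSn mulnS; lia.
- have := leq_mul h h; rewrite mulSn mulnS; lia.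
- by move: e; rewrite h => /addnI; lia.
Qed.

Section Compilation.
Variables (inp : seq nat) (P W : nat) (g : bool) (L0 B : nat).
Hypotheses (inp_L0 : size inp <= L0) (L0_gt0 : 0 < L0).

(* The array cells live above the input, at addresses interleaved modulo [W]; the pair of
   indices [(x, y)] is coded by [(x + y)^2 + x]. *)
Definition cell (k x y : nat) := L0 + (((x + y) * (x + y) + x) * W + k).

Definition cell_expr k a b :=
  Op Add (Reg 0)
    (Op Add (Op Mul (Op Add (Op Mul (Op Add a b) (Op Add a b)) a) (Cst W)) (Cst k)).

Definition indices := [seq (i, j) | i <- iota 0 P, j <- iota 0 P].

(** A lookup becomes a sum over all pairs of indices of the entry times an indicator. Its length is
    a constant, since [P] depends on [R] only. *)
Definition table_expr (f : nat -> nat -> nat) a b (l : seq (nat * nat)) :=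
  foldr (fun ij acc => Op Add (Op Mul (Op Mul (Op Eq a (Cst ij.1)) (Op Eq b (Cst ij.2)))
                                      (Cst (f ij.1 ij.2))) acc) (Cst 0) l.

(* Register 0 of the machine holds the address [L0] of the arrays.  While [g] is false it is
   not yet known: then the arrays are not used and the memory is still the input. *)
Fixpoint compile (e : hexpr) : expr :=
  match e with
  | EC v => Cst v
  | EG r => Reg r.+1
  | EI a => if g then Op Mul (Op Lt (compile a) (Reg 0))
                         (Read (Op Mul (Op Lt (compile a) (Reg 0)) (compile a)))
            else Read (compile a)
  | EA k a b => Read (cell_expr k (compile a) (compile b))
  | EO o a b => Op o (compile a) (compile b)
  | ET f a b => table_expr f (compile a) (compile b) indices
  | EIf c a b => Op Add (Op Mul (Op Lt (Cst 0) (compile c)) (compile a))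
                        (Op Mul (Op Eq (compile c) (Cst 0)) (compile b))
  end.

(** With truncated subtraction, [x - (x - y)] is the minimum of [x] and [y]. *)
Definition count_expr (cl : bool) e :=
  if cl then Op Defs.Sub (Reg rcap.+1) (Op Defs.Sub (Reg rcap.+1) (compile e)) else compile e.

Fixpoint compile_cmd (p : hcmd) : cmd :=
  match p with
  | CSkip => Skip
  | CSet r e => Assign r.+1 (compile e)
  | CArr k a b e => Write (cell_expr k (compile a) (compile b)) (compile e)
  | CEmit e => Emit (compile e)
  | CSeq p q => Seq (compile_cmd p) (compile_cmd q)
  | CIf e p q => If (compile e) (compile_cmd p) (compile_cmd q)
  | CFor cl r rn e p =>
      Seq (Assign rn.+1 (count_expr cl e))
        (Seq (Assign r.+1 (Cst 0))
           (While (Op Lt (Reg r.+1) (Reg rn.+1))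
              (Seq (compile_cmd p) (Assign r.+1 (Op Add (Reg r.+1) (Cst 1))))))
  end.

Definition table_weight (f : nat -> nat -> nat) (l : seq (nat * nat)) :=
  sumn [seq ij.1 + ij.2 + f ij.1 ij.2 | ij <- l].

(* A number that exceeds the degree of the values of [e] as a polynomial in the contents of
   the state, the constants of [e] and the cost of its compilation. *)
Fixpoint weight (e : hexpr) : nat :=
  match e with
  | EC v => v.+2
  | EG r => 2
  | EI a => 3 * weight a + 10
  | EA k a b => 3 * (weight a + weight b) + k + 20
  | EO o a b => weight a + weight b + 1
  | ET f a b => size indices * (weight a + weight b + 10) + table_weight f indices
                + weight a + weight b + 3
  | EIf c a b => 2 * weight c + weight a + weight b + 10
  end.

Fixpoint degree (e : hexpr) : nat :=
  match e with
  | EC _ | EG _ => 1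
  | EI a => degree a
  | EA k a b => 3 * (degree a + degree b) + 3
  | EO o a b => degree a + degree b
  | ET f a b => degree a + degree b
  | EIf c a b => degree c + degree a + degree b
  end.

Fixpoint weight_cmd (p : hcmd) : nat :=
  match p with
  | CSkip => 1
  | CSet r e => weight e + 2
  | CArr k a b e => 3 * (weight a + weight b) + k + 20 + weight e + 2
  | CEmit e => weight e + 2
  | CSeq p q => weight_cmd p + weight_cmd q
  | CIf e p q => weight e + weight_cmd p + weight_cmd q + 1
  | CFor cl r rn e p => weight e + weight_cmd p + 30
  end.

(* Stored values grow by at most a constant at each step: [short e] has a constant bound, and
   [tame e] exceeds the contents of the state by at most a constant. *)
Fixpoint short (e : hexpr) : bool :=
  match e with
  | EC _ => true
  | EO Lt _ _ | EO Eq _ _ => true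
  | ET _ _ _ => true
  | EIf c a b => short a && short b
  | _ => false
  end.

Fixpoint tame (e : hexpr) : bool :=
  match e with
  | EC _ | EG _ | EI _ | EA _ _ _ | ET _ _ _ => true
  | EO Add a b => tame a && short b
  | EO Mul _ _ => false
  | EO Lt _ _ | EO Eq _ _ => true
  | EO _ a b => tame a
  | EIf c a b => tame a && tame b
  end.

Fixpoint arrayless (e : hexpr) : bool :=
  match e with
  | EC _ | EG _ => true
  | EI a => arrayless a
  | EA _ _ _ => false
  | EO _ a b | ET _ a b => arrayless a && arrayless b
  | EIf c a b => [&& arrayless c, arrayless a & arrayless b]
  end.

Definition ok_expr e := g || arrayless e.

Fixpoint ok_cmd (p : hcmd) : bool :=
  match p with
  | CSkip => true
  | CSet r e => tame e && ok_expr e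
  | CArr k a b e => [&& g, ok_expr a, ok_expr b, tame e & ok_expr e]
  | CEmit e => ok_expr e
  | CSeq p q => ok_cmd p && ok_cmd q
  | CIf e p q => [&& ok_expr e, ok_cmd p & ok_cmd q]
  | CFor cl r rn e p =>
      [&& cl || tame e, ok_expr e, r != rn, r \notin modr p, rn \notin modr p & ok_cmd p]
  end.

Definition simulates (s : hstate) (x : mstate) : Prop :=
  [/\ forall r, regs x r.+1 = rg s r,
      out x = ou s
    & if g then [/\ regs x 0 = L0, forall a, a < L0 -> Defs.mem x a = nth 0 inp a
                  & forall k a b, k < W -> Defs.mem x (cell k a b) = ar s k a b]
      else forall a, Defs.mem x a = nth 0 inp a].

Definition bounded (s : hstate) (M : nat) : Prop :=
  (forall r, rg s r <= M) /\ (forall k x y, ar s k x y <= M).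

Lemma degree_gt0 e : 0 < degree e.
Proof. by elim: e => //= *; lia. Qed.

Lemma degree_weight e : degree e <= weight e.
Proof. by elim: e => //= *; lia. Qed.

Lemma cost_weight e : expr_cost (compile e) < weight e.
Proof.
elim: e => //=; try by (move=> *; lia).
- by move=> a IHa; case: g => /=; lia.
- move=> f a IHa b IHb.
  have H l : expr_cost (table_expr f (compile a) (compile b) l)
             <= size l * (weight a + weight b + 10) + 1.
    by elim: l => //= ij l IHl; lia.
  by have := H indices; lia.
Qed.

Lemma table_sum f x y :
  tabulated P f x y =
  sumn [seq (x == ij.1) * (y == ij.2) * f ij.1 ij.2 | ij <- indices].
Proof.
rewrite /tabulated sumnE big_map.
have un : uniq indices.
  by apply: allpairs_uniq; rewrite ?iota_uniq // => [[? ?] [? ?] _ _ [-> ->]].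
have mem_ind i j : ((i, j) \in indices) = (i < P) && (j < P).
  apply/allpairsP/andP => [[[i' j'] /= [hi hj [-> ->]]]|[hi hj]].
    by rewrite !mem_iota in hi hj.
  by exists (i, j); rewrite !mem_iota.
case: ifPn => hxy.
  rewrite (bigD1_seq (x, y)) ?mem_ind //= !eqxx !mul1n big1_seq ?addn0 //.
  move=> [i j] /andP[/= ne _]; move: ne; rewrite xpair_eqE [i == x]eq_sym [j == y]eq_sym.
  by case: (x == i); case: (y == j).
rewrite big1_seq // => -[i j] /=; rewrite mem_ind => hij.
case: eqP => [xi|_ //]; case: eqP => [yj|_ //].
by move: hxy; rewrite xi yj hij.
Qed.

Lemma table_le f x y : tabulated P f x y <= table_weight f indices.
Proof.
rewrite table_sum /table_weight; elim: indices => //= ij l IHl.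
apply: leq_add => //; case: eqP => _; case: eqP => _ /=; lia.
Qed.

Lemma pow_add_le Z a b : 1 < Z -> 0 < a -> 0 < b -> Z ^ a + Z ^ b <= Z ^ (a + b).
Proof.
move=> hZ ha hb; rewrite expnD.
have h1 : 2 <= Z ^ a by apply: leq_trans (leq_pexp2l _ ha) => //; lia.
have h2 : 2 <= Z ^ b by apply: leq_trans (leq_pexp2l _ hb) => //; lia.
nia.
Qed.

Lemma nth_inp_le M a : (forall x, x \in inp -> x <= M) -> nth 0 inp a <= M.
Proof.
move=> h; case: (ltnP a (size inp)) => ha; last by rewrite nth_default.
by apply: h; rewrite mem_nth.
Qed.

Section Bounds.
Variables (s : hstate) (M : nat).
Hypotheses (bs : bounded s M) (bi : forall x, x \in inp -> x <= M).
Let Z := M + W + 2.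

Let Z1 : 1 < Z. Proof. by rewrite /Z; lia. Qed.
Let Zp d : 0 < d -> Z <= Z ^ d.
Proof. by move=> d0; rewrite -{1}(expn1 Z) leq_pexp2l //; lia. Qed.

Lemma ev_degree e : weight e <= W -> ev inp P s e < Z ^ degree e.
Proof.
elim: e => /=.
- by move=> v; rewrite expn1 /Z; lia.
- by move=> r _; rewrite expn1 /Z; have := bs.1 r; lia.
- move=> a IHa wa; apply: leq_trans (Zp (degree_gt0 a)).
  by have := nth_inp_le (ev inp P s a) bi; rewrite /Z; lia.
- move=> k a IHa b IHb _; apply: leq_trans (Zp _); last by lia.
  by have := bs.2 k (ev inp P s a) (ev inp P s b); rewrite /Z; lia.
- move=> o a IHa b IHb wab.
  have {IHa} ha : ev inp P s a < Z ^ degree a by apply: IHa; lia.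
  have {IHb} hb : ev inp P s b < Z ^ degree b by apply: IHb; lia.
  have := pow_add_le Z1 (degree_gt0 a) (degree_gt0 b).
  have h3 : 2 <= Z ^ degree a by apply: leq_trans (Zp (degree_gt0 a)).
  have := leq_div (ev inp P s a) (ev inp P s b).
  have := leq_mod (ev inp P s a) (ev inp P s b).
  by case: o => /=; first [lia | by rewrite expnD ltn_mul].
- move=> f a IHa b IHb wf.
  apply: leq_trans (Zp _); last by have := degree_gt0 a; lia.
  by have := table_le f (ev inp P s a) (ev inp P s b); rewrite /Z; lia.
- move=> c IHc a IHa b IHb wab; have := degree_gt0 c => dc.
  case: ifP => _.
    by apply: leq_trans (IHa _) _; [lia | rewrite leq_pexp2l //; lia].
  by apply: leq_trans (IHb _) _; [lia | rewrite leq_pexp2l //; lia].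
Qed.

Lemma ev_short e : short e -> ev inp P s e <= weight e.
Proof.
elim: e => //=.
- by move=> *; lia.
- by case=> //= a _ b _ _; case: (_ < _) => //; try (case: eqP => //=); lia.
- by move=> f a _ b _ _; have := table_le f (ev inp P s a) (ev inp P s b); lia.
- move=> c _ a IHa b IHb /andP[/IHa ha /IHb hb]; case: ifP => _; lia.
Qed.

Lemma ev_tame e : tame e -> ev inp P s e <= M + weight e.
Proof.
elim: e => //=.
- by move=> v _; lia.
- by move=> r _; have := bs.1 r; lia.
- by move=> a _ _; have := nth_inp_le (ev inp P s a) bi; lia.
- by move=> k a _ b _ _; have := bs.2 k (ev inp P s a) (ev inp P s b); lia.
- move=> o a IHa b IHb.
  have := leq_div (ev inp P s a) (ev inp P s b).
  have := leq_mod (ev inp P s a) (ev inp P s b).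
  case: o => //= h1 h2; try (by move/IHa; lia).
  + by move=> /andP[/IHa ha /ev_short hb]; lia.
  + by case: (_ < _) => //=; lia.
  + by case: (_ == _) => //=; lia.
- by move=> f a _ b _ _; have := table_le f (ev inp P s a) (ev inp P s b); lia.
- move=> c _ a IHa b IHb /andP[/IHa ha /IHb hb]; case: ifP => _; lia.
Qed.

Hypotheses (bL : L0 <= M).
Variable x : mstate.
Hypothesis (sx : simulates s x).

(** The exponent leaves room for the square in the pairing of the indices, for the factor [W], and
    for the offsets [k] and [L0]. *)
Lemma eval_cell k ea eb va vb d d' : 0 < d -> 0 < d' -> k < W ->
    Z ^ (3 * (d + d') + 3) <= B ->
    g -> eval B x ea = Some va -> eval B x eb = Some vb -> va < Z ^ d -> vb < Z ^ d' ->
  eval B x (cell_expr k ea eb) = Some (cell k va vb).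
Proof.
move=> d0 d'0 kW hB hg ha hb lta ltb; move: sx => [_ _]; rewrite hg => -[h0 _ _].
have h1 := pow_add_le Z1 d0 d'0.
have h2 : 2 <= Z ^ d by apply: leq_trans (Zp d0).
have h3 : (va + vb) < Z ^ (d + d') by lia.
have h4 : (va + vb) * (va + vb) + va < Z ^ (2 * (d + d') + d).
  apply: leq_trans (pow_add_le Z1 _ d0); last by lia.
  by rewrite mulSn mul1n expnD -addSn leq_add //; [exact: ltn_mul | exact: ltnW].
have WZ : W < Z by rewrite /Z; lia.
have h5 : ((va + vb) * (va + vb) + va) * W + k < Z ^ (2 * (d + d') + d + 2).
  rewrite addn2 !expnSr; move: h4 WZ kW; move: (Z ^ _) (_ + va) => u v h4 WZ kW.
  have e1 : v.+1 * W <= u * Z by apply: leq_mul => //; apply: ltnW.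
  have e2 : u * Z <= u * Z * Z by apply: leq_pmulr; lia.
  by move: e1; rewrite mulSn; lia.
have h6 : L0 + (((va + vb) * (va + vb) + va) * W + k) < Z ^ (2 * (d + d') + d + 3).
  rewrite addnS expnSr; have LZ : L0 < Z by rewrite /Z; lia.
  have h7 : Z <= Z ^ (2 * (d + d') + d + 2) by apply: Zp; lia.
  move: h5 h7 LZ Z1; move: (Z ^ _) (_ + k) => u v h5 h7 LZ _.
  have e1 : u * 2 <= u * Z by rewrite leq_mul2l Z1 orbT.
  by lia.
have h7 : L0 + (((va + vb) * (va + vb) + va) * W + k) < B.
  apply: leq_trans h6 _; apply: leq_trans hB; rewrite leq_pexp2l //; lia.
have WB : W < B by apply: leq_trans hB; apply: leq_trans WZ (Zp _); lia.
have q0 : va + vb <= (va + vb) * (va + vb) by case: (va + vb) => // n; apply: leq_pmulr.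
have q1 : (va + vb) * (va + vb) + va <= ((va + vb) * (va + vb) + va) * W.
  by apply: leq_pmulr; lia.
rewrite /cell_expr /= ha hb h0 /word /cell.
move: q0 q1 h7; clear - WB kW; set z := (_ * W); set y := ((va + vb) * (va + vb)) => q0 q1 h7.
have -> : va + vb < B by lia.
have -> : k < B by lia.
have -> : L0 < B by lia.
rewrite WB /=.
have -> : y < B by lia.
rewrite /=; have -> : y + va < B by lia.
rewrite /=; have -> : z < B by lia.
rewrite /=; have -> : z + k < B by lia.
by rewrite /= h7.
Qed.

Lemma eval_table f ea eb e1 e2 l :
    Z <= B -> (forall ij, ij \in l -> [/\ ij.1 < Z, ij.2 < Z & f ij.1 ij.2 < Z]) ->
    sumn [seq f ij.1 ij.2 | ij <- l] < Z ->
    eval B x ea = Some e1 -> eval B x eb = Some e2 ->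
  eval B x (table_expr f ea eb l) =
  Some (sumn [seq (e1 == ij.1) * (e2 == ij.2) * f ij.1 ij.2 | ij <- l]).
Proof.
move=> ZB hl hs ha hb; elim: l hl hs => [|[i j] l IHl] hl hs /=.
  by rewrite /word; case: ltnP => //; lia.
have [hi hj hf] := hl (i, j) (mem_head _ _).
rewrite ha hb IHl; last 2 first.
- by move=> ij hij; apply: hl; rewrite inE hij orbT.
- by move: hs => /=; lia.
have hle l' : sumn [seq (e1 == ij.1) * (e2 == ij.2) * f ij.1 ij.2 | ij <- l']
         <= sumn [seq f ij.1 ij.2 | ij <- l'].
  by elim: l' => //= ij l' IH; apply: leq_add => //; case: eqP; case: eqP => _ _ /=; lia.
have {hle} := hle l; move: hs hi hj hf => /=.
set u := sumn _; set v := sumn _ => hs hi hj hf hle'.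
have iB : i < B by lia.
have jB : j < B by lia.
have fB : f i j < B by lia.
have sB : f i j + v < B by lia.
have vB : v < B by lia.
have oB (b : bool) : b < B by case: b; lia.
have oB' (b c : bool) : b * c < B by case: b; case: c => /=; lia.
have pB (b c : bool) : b * c * f i j < B by case: b; case: c => /=; lia.
have qB (b c : bool) : b * c * f i j + v < B by case: b; case: c => /=; lia.
by rewrite /word iB jB fB /= !oB /= oB' /= pB /= qB.
Qed.

Lemma eval_compile e : weight e <= W -> ok_expr e -> Z ^ degree e <= B ->
  eval B x (compile e) = Some (ev inp P s e).
Proof.
have small v d : v < Z -> 0 < d -> Z ^ d <= B -> v < B.
  by move=> hv hd hB; apply: leq_trans hv (leq_trans (Zp hd) hB).
elim: e => /=.
- move=> v hv _ hB; rewrite /word (small _ _ _ _ hB) //; rewrite /Z; lia.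
- move=> r hv _ hB; case: sx => -> _ _; rewrite /word (small _ _ _ _ hB) //.
  by have := bs.1 r; rewrite /Z; lia.
- move=> a IHa wa oa hB; have ha := IHa ltac:(lia) oa hB.
  have BZ : Z <= B by apply: leq_trans hB; apply: Zp; apply: degree_gt0.
  have va : ev inp P s a < B by apply: leq_trans (ev_degree _) hB; lia.
  have lei := nth_inp_le (ev inp P s a) bi.
  have EB : nth 0 inp (ev inp P s a) < B by rewrite /Z in BZ; lia.
  move: sx => [_ _]; rewrite /word; case: g => [[h0 hm _]|hm] /=; last first.
    by rewrite ha hm /word EB.
  rewrite ha h0 /word.
  have -> : L0 < B by rewrite /Z in BZ; lia.
  have B1 : 1 < B by lia.
  (* Beyond the input the memory holds array cells, whereas the input has to read as 0 there: the
     guard redirects the access to address 0 and multiplies the result by 0. *)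
  case: (ltnP (ev inp P s a) L0) => hL /=.
    by rewrite B1 /= mul1n va (hm _ hL) EB mul1n EB.
  rewrite (ltnW B1) /= mul0n (ltnW B1) (hm _ L0_gt0).
  have -> : nth 0 inp 0 < B by have := nth_inp_le 0 bi; rewrite /Z in BZ; lia.
  by rewrite mul0n nth_default //; apply: leq_trans hL.
- move=> k a IHa b IHb wab oab hB.
  have gT : g by move: oab; rewrite /ok_expr /= orbF.
  have oe e : ok_expr e by rewrite /ok_expr gT.
  have da := degree_gt0 a; have db := degree_gt0 b.
  have hBa : Z ^ degree a <= B by apply: leq_trans hB; rewrite leq_pexp2l //; lia.
  have hBb : Z ^ degree b <= B by apply: leq_trans hB; rewrite leq_pexp2l //; lia.
  have wa : weight a <= W by lia.
  have wb : weight b <= W by lia.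
  have kW : k < W by lia.
  move: (eval_cell da db kW hB gT (IHa wa (oe _) hBa) (IHb wb (oe _) hBb) (ev_degree wa) (ev_degree wb)) => /= ->.
  move: sx => [_ _]; rewrite gT => -[_ _ hm]; rewrite hm // /word (small _ _ _ _ hB) //; last lia.
  by have := bs.2 k (ev inp P s a) (ev inp P s b); rewrite /Z; lia.
- move=> o a IHa b IHb wab oab hB.
  have da := degree_gt0 a; have db := degree_gt0 b.
  have hBa : Z ^ degree a <= B by apply: leq_trans hB; rewrite leq_pexp2l //; lia.
  have hBb : Z ^ degree b <= B by apply: leq_trans hB; rewrite leq_pexp2l //; lia.
  have [oa ob] : ok_expr a /\ ok_expr b.
    by move: oab; rewrite /ok_expr; case: g => //= /andP.
  rewrite IHa ?IHb //; try lia.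
  rewrite /word (_ : eval_op _ _ _ < B) //.
  apply: leq_trans (@ev_degree (EO o a b) _) hB => /=; lia.
- move=> f a IHa b IHb wab oab hB.
  have da := degree_gt0 a; have db := degree_gt0 b.
  have hBa : Z ^ degree a <= B by apply: leq_trans hB; rewrite leq_pexp2l //; lia.
  have hBb : Z ^ degree b <= B by apply: leq_trans hB; rewrite leq_pexp2l //; lia.
  have [oa ob] : ok_expr a /\ ok_expr b.
    by move: oab; rewrite /ok_expr; case: g => //= /andP.
  have ZB : Z <= B by apply: leq_trans (Zp da) hBa.
  have tw l ij : ij \in l -> ij.1 + ij.2 + f ij.1 ij.2 <= table_weight f l.
    elim: l => //= ij' l IHl; rewrite inE => /orP[/eqP->|/IHl]; rewrite /table_weight /=; lia.
  rewrite table_sum; apply: eval_table => //; try (by [apply: IHa; lia | apply: IHb; lia]).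
    by move=> ij /tw; rewrite /Z; split; lia.
  have : sumn [seq f ij.1 ij.2 | ij <- indices] <= table_weight f indices.
    by rewrite /table_weight; elim: indices => //= ij l IHl; lia.
  by rewrite /Z; lia.
- move=> c IHc a IHa b IHb wab oab hB.
  have dc := degree_gt0 c; have da := degree_gt0 a; have db := degree_gt0 b.
  have hBc : Z ^ degree c <= B by apply: leq_trans hB; rewrite leq_pexp2l //; lia.
  have hBa : Z ^ degree a <= B by apply: leq_trans hB; rewrite leq_pexp2l //; lia.
  have hBb : Z ^ degree b <= B by apply: leq_trans hB; rewrite leq_pexp2l //; lia.
  have [oc oa ob] : [/\ ok_expr c, ok_expr a & ok_expr b].
    by move: oab; rewrite /ok_expr; case: g => //= /and3P.
  have ea : ev inp P s a < B by apply: leq_trans (ev_degree _) hBa; lia.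
  have eb : ev inp P s b < B by apply: leq_trans (ev_degree _) hBb; lia.
  have B1 : 1 < B by apply: leq_trans hBa; apply: leq_trans (Zp da).
  rewrite (IHc ltac:(lia) oc hBc) (IHa ltac:(lia) oa hBa) (IHb ltac:(lia) ob hBb).
  rewrite /word (ltnW B1) /= lt0n; case: eqP => _ /=.
    by rewrite (ltnW B1) /= mul0n (ltnW B1) B1 /= mul1n eb add0n eb.
  by rewrite B1 /= mul1n ea (ltnW B1) /= mul0n (ltnW B1) addn0 ea.
Qed.

Lemma eval_count cl e :
    weight e + 10 <= W -> ok_expr e -> Z ^ W <= B -> cl || tame e ->
  eval B x (count_expr cl e) = Some (for_count inp P cl s e) /\
  for_count inp P cl s e <= M + weight e.
Proof.
move=> we oe hB hc.
have hBe : Z ^ degree e <= B.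
  by apply: leq_trans hB; rewrite leq_pexp2l //; have := degree_weight e; lia.
have ve : ev inp P s e < B by apply: leq_trans (ev_degree _) hBe; lia.
case: cl hc => /= [_|te]; last first.
  by rewrite eval_compile // ?ev_tame //; lia.
have rM := bs.1 rcap; rewrite geq_min.
split; last by apply/orP; left; lia.
have rB : rg s rcap < B.
  by apply: leq_trans hBe; apply: leq_trans (Zp (degree_gt0 e)); rewrite /Z; lia.
case: sx => -> _ _; rewrite eval_compile //; last lia.
rewrite /word rB /= (_ : _ - _ < B); last by lia.
rewrite (_ : rg s rcap - (rg s rcap - ev inp P s e) < B); last by lia.
by congr Some; lia.
Qed.
End Bounds.

Lemma run_tm_le p s : tm s <= tm (hrun inp P p s).
Proof.
elim: p s => //= [p IHp q IHq|e p IHp q IHq|cl r rn e p IHp] s.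
- exact: leq_trans (IHq _).
- by case: ifP => _; [have := IHp (tick s) | have := IHq (tick s)] => /=; lia.
- apply: (run_for_inv (I := fun i s' => tm s <= tm s')) => //= i s' _ h.
  by have := IHp (tick (setr s' r i)) => /=; lia.
Qed.

Lemma cell_inj k x y k' x' y' : k < W -> k' < W ->
  cell k x y = cell k' x' y' -> [/\ k = k', x = x' & y = y'].
Proof.
move=> kW k'W /addnI e.
have ek : k = k'.
  by have := congr1 (modn^~ W) e; rewrite !modnMDl !modn_small.
by move: e; rewrite ek => /addIn/eqP; rewrite eqn_pmul2r; [move/eqP/pair_inj => [-> ->] | lia].
Qed.

Lemma simulates_tick s x : simulates s x -> simulates (tick s) x.
Proof. by []. Qed.

Lemma simulates_setr s x r v : simulates s x ->
  simulates (setr s r v) (MState (upd (regs x) r.+1 v) (Defs.mem x) (out x)).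
Proof.
by move=> [h1 h2 h3]; split=> //= r'; rewrite /upd eqSS h1.
Qed.

Lemma bounded_le s M M' : M <= M' -> bounded s M -> bounded s M'.
Proof. by move=> le [h1 h2]; split=> *; apply: leq_trans le; [apply: h1 | apply: h2]. Qed.

Lemma bounded_tick s M : bounded s M -> bounded (tick s) M.
Proof. by []. Qed.

Lemma bounded_setr s M r v : bounded s M -> v <= M -> bounded (setr s r v) M.
Proof. by move=> [h1 h2] hv; split=> //= r'; rewrite /upd; case: ifP. Qed.

Lemma exec_set s x r v e :
    simulates s x -> eval B x e = Some v ->
  exists2 x', exec B (Assign r.+1 e) x x' (expr_cost e).+1 &
     simulates (setr s r v) x'.
Proof.
move=> sx he; exists (MState (upd (regs x) r.+1 v) (Defs.mem x) (out x)).
  exact: exec_assign.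
exact: simulates_setr.
Qed.

Lemma mul_sub_split w a b c : a <= b -> b <= c -> w * (c - a) = w * (b - a) + w * (c - b).
Proof. by move=> ab bc; rewrite -mulnDr; congr (_ * _); lia. Qed.

(** Time and sizes are bounded together. A stored value exceeds the previous contents by at most
    [W], because stored expressions and the bounds of uncapped loops are [tame]; so the contents
    grow linearly with the time. Intermediate results are polynomials of degree at most [W] in the
    contents, whence the power in the hypothesis on [B]. *)
Theorem simulation p :
    weight_cmd p <= W -> ok_cmd p ->
  forall s x M, simulates s x -> bounded s M -> (forall a, a \in inp -> a <= M) -> L0 <= M ->
    (M + W * (tm (hrun inp P p s) - tm s) + W + 2) ^ W <= B ->
  exists x' n, [/\ exec B (compile_cmd p) x x' n, simulates (hrun inp P p s) x',
    n <= W * (tm (hrun inp P p s) - tm s)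
    & bounded (hrun inp P p s) (M + W * (tm (hrun inp P p s) - tm s))].
Proof.
have pow_le a b d : a <= b -> b ^ d <= B -> a ^ d <= B.
  by move=> ab; apply: leq_trans; case: d => [|d]; [rewrite !expn0 | rewrite leq_exp2r].
have degB M e : weight e <= W -> (M + W + 2) ^ W <= B -> (M + W + 2) ^ degree e <= B.
  move=> we; apply: leq_trans; rewrite leq_pexp2l //; first lia.
  exact: leq_trans (degree_weight e) we.
have tick1 n : n.+1 - n = 1 by lia.
elim: p => /=.
- move=> w1 _ s x M sx bs bi bL hB; exists x, 1.
  by rewrite tick1; split=> //; [exact: exec_skip | lia | apply: bounded_le bs; lia].
- move=> r e wp /andP[te oe] s x M sx bs bi bL; rewrite tick1 muln1 => hB.
  have hB' : (M + W + 2) ^ W <= B by apply: pow_le hB; lia.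
  have we : weight e <= W by lia.
  have he := eval_compile bs bi bL sx we oe (degB _ _ we hB').
  have tv := ev_tame bs bi te.
  have bs' : bounded s (M + W) by apply: bounded_le bs; lia.
  have [x' hx sx'] := exec_set r sx he.
  exists x', (expr_cost (compile e)).+1; split=> //; first by have := cost_weight e; lia.
  by apply: bounded_setr => //; lia.
- move=> k a b e wp /and5P[gT oa ob te oe] s x M sx bs bi bL; rewrite tick1 muln1 => hB.
  have hB' : (M + W + 2) ^ W <= B by apply: pow_le hB; lia.
  have we : weight e <= W by lia.
  have he := eval_compile bs bi bL sx we oe (degB _ _ we hB').
  have wa : weight a <= W by lia.
  have ha := eval_compile bs bi bL sx wa oa (degB _ _ wa hB').
  have wb : weight b <= W by lia.
  have hb := eval_compile bs bi bL sx wb ob (degB _ _ wb hB').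
  have kW : k < W by lia.
  have hcB : (M + W + 2) ^ (3 * (degree a + degree b) + 3) <= B.
    apply: leq_trans hB'; rewrite leq_pexp2l //; first lia.
    by have := degree_weight a; have := degree_weight b; lia.
  have hc := eval_cell bL sx (degree_gt0 a) (degree_gt0 b) kW hcB gT ha hb
    (ev_degree bs bi wa) (ev_degree bs bi wb).
  have tv := ev_tame bs bi te.
  eexists; eexists; split; first exact: exec_write hc he.
  + move: sx; rewrite /simulates gT /= => -[h1 h2 [h3 h4 h5]]; split=> //; split=> //.
      move=> c cL; rewrite /upd ifN ?h4 //; apply/eqP => ec; move: cL.
      by rewrite ec /cell; lia.
    move=> k' a' b' k'W; rewrite /upd /upd3; case: eqP => [/(cell_inj k'W kW)[-> -> ->]|ne].
      by rewrite !eqxx.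
    rewrite h5 //; case: ifP => // /and3P[/eqP e1 /eqP e2 /eqP e3].
    by case: ne; rewrite e1 e2 e3.
  + by have := cost_weight a; have := cost_weight b; have := cost_weight e => /=; lia.
  + split=> [r|k' a' b'] /=; first by apply: leq_trans (bs.1 r) _; lia.
    by rewrite /upd3; case: ifP => _; [lia | apply: leq_trans (bs.2 _ _ _) _; lia].
- move=> e wp oe s x M sx bs bi bL; rewrite tick1 muln1 => hB.
  have hB' : (M + W + 2) ^ W <= B by apply: pow_le hB; lia.
  have we : weight e <= W by lia.
  have he := eval_compile bs bi bL sx we oe (degB _ _ we hB').
  eexists; eexists; split; first exact: exec_emit he.
  + by move: sx => [h1 h2 h3]; split=> //=; rewrite h2.
  + by have := cost_weight e => /=; lia.
  + by apply: bounded_le bs; lia.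
- move=> p IHp q IHq wpq /andP[op oq] s x M sx bs bi bL hB.
  have t1 := run_tm_le p s; have t2 := run_tm_le q (hrun inp P p s).
  have hB' : (M + W * (tm (hrun inp P p s) - tm s) + W + 2) ^ W <= B.
    by apply: pow_le hB; rewrite !leq_add2r leq_add2l leq_mul2l leq_sub2r ?orbT.
  have [|x1 [n1 [e1 s1 c1 b1]]] := IHp _ op s x M sx bs bi bL hB'; first lia.
  set M1 := M + _ in b1.
  have eW : W * (tm (hrun inp P q (hrun inp P p s)) - tm s) =
        W * (tm (hrun inp P p s) - tm s) +
        W * (tm (hrun inp P q (hrun inp P p s)) - tm (hrun inp P p s)).
    by rewrite -mulnDr; congr (_ * _); lia.
  have [||||x2 [n2 [e2 s2 c2 b2]]] := IHq _ oq _ x1 M1 s1 b1; try (by rewrite /M1; lia).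
  + by move=> a /bi; rewrite /M1; lia.
  + by apply: pow_le hB; rewrite /M1 eW; lia.
  exists x2, (n1 + n2); split; [exact: exec_seq e1 e2 | exact: s2 | lia |].
  by apply: bounded_le b2; rewrite /M1; lia.
- move=> e p IHp q IHq wp /and3P[oe op oq] s x M sx bs bi bL hB.
  have tB : tm s < tm (hrun inp P (CIf e p q) s).
    by rewrite /=; case: ifP => _; [have := run_tm_le p (tick s) | have := run_tm_le q (tick s)].
  have hB' : (M + W + 2) ^ W <= B.
    apply: pow_le hB; rewrite -[in leqLHS](muln1 W) -addnA -[leqRHS]addnA.
    by rewrite !addnA -/(hrun _ _ _ _); move: tB => /=; nia.
  have we : weight e <= W by lia.
  have he := eval_compile bs bi bL sx we oe (degB _ _ we hB').
  have aux c : weight_cmd c <= W -> 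
      (forall s x M, simulates s x -> bounded s M -> (forall a, a \in inp -> a <= M) -> L0 <= M ->
    (M + W * (tm (hrun inp P c s) - tm s) + W + 2) ^ W <= B ->
  exists x' n, [/\ exec B (compile_cmd c) x x' n, simulates (hrun inp P c s) x',
    n <= W * (tm (hrun inp P c s) - tm s)
    & bounded (hrun inp P c s) (M + W * (tm (hrun inp P c s) - tm s))]) ->
     (if ev inp P s e != 0 then compile_cmd p else compile_cmd q) = compile_cmd c ->
     hrun inp P (CIf e p q) s = hrun inp P c (tick s) ->
     exists x' n, [/\ exec B (If (compile e) (compile_cmd p) (compile_cmd q)) x x' n,
       simulates (hrun inp P c (tick s)) x',
    n <= W * (tm (hrun inp P c (tick s)) - tm s)
    & bounded (hrun inp P c (tick s)) (M + W * (tm (hrun inp P c (tick s)) - tm s))].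
    move=> wc IH ec er; move: hB tB; rewrite -/(hrun inp P (CIf e p q) s) er => hB tB.
    have t1 := run_tm_le c (tick s); rewrite /= in t1.
    have eW : W * (tm (hrun inp P c (tick s)) - tm s) =
        W + W * (tm (hrun inp P c (tick s)) - (tm s).+1).
      by rewrite -[X in X + _]muln1 -mulnDr; congr (_ * _); lia.
    have [|x' [n [h1 h2 h3 h4]]] := IH (tick s) x M sx bs bi bL.
      by apply: pow_le hB; rewrite eW /=; lia.
    exists x', ((expr_cost (compile e)).+1 + n); split=> //.
    + by apply: exec_if he _; rewrite ec.
    + by rewrite eW; have := cost_weight e; move: h3 => /=; lia.
    + by apply: bounded_le h4; rewrite eW /=; lia.
  case c0: (ev inp P s e != 0).
    by apply: (aux p) => //=; [lia | apply: IHp => //; lia | rewrite c0 | rewrite c0].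
  by apply: (aux q) => //=; [lia | apply: IHq => //; lia | rewrite c0 | rewrite c0].
- move=> cl r rn e p IHp we /and5P[te oe rrn rp /andP[rnp op]] s x M sx bs bi bL.
  set n := for_count _ _ _ _ _; set s1 := tick _.
  set sN := foldl _ _ _ => hB.
  (* The [While] with counter [i] and [j] iterations to go. The additional 4 is the cost of the
     final test that fails. *)
  have loop j : forall i s x M, i + j = n -> simulates (setr s r i) x -> rg s rn = n ->
      bounded s M -> n <= M -> (forall a, a \in inp -> a <= M) -> L0 <= M ->
      let s' := foldl (fun s i => hrun inp P p (tick (setr s r i))) s (iota i j) in
      (M + W * (tm s' - tm s) + W + 2) ^ W <= B ->
      exists x' k, [/\ exec B (While (Op Lt (Reg r.+1) (Reg rn.+1))
                (Seq (compile_cmd p) (Assign r.+1 (Op Add (Reg r.+1) (Cst 1))))) x x' k,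
         simulates (setr s' r n) x', tm s <= tm s', k <= W * (tm s' - tm s) + 4
         & bounded s' (M + W * (tm s' - tm s))].
    have MB M0 d : (M0 + d + W + 2) ^ W <= B -> M0 + 2 < B.
      by apply: leq_trans; rewrite -[X in X < _]expn1 (leq_trans _ (leq_pexp2l _ (_ : 1 <= W))) ?expn1; lia.
    elim: j => [|j IHj] i s0 x0 M0 ij sx0 rn0 bs0 nM bi0 bL0.
      rewrite /= => hB0; exists x0, 4.
      have rE : regs x0 r.+1 = i by case: sx0 => -> _ _; rewrite /= /upd eqxx.
      have rnE : regs x0 rn.+1 = n by case: sx0 => -> _ _; rewrite /= /upd eq_sym (negbTE rrn).
      have := MB _ _ hB0 => MB0.
      split=> //; [|by have <- : i = n by lia|lia|by apply: bounded_le bs0; lia].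
      apply: (@exec_while_stop _ _ (Op Lt (Reg r.+1) (Reg rn.+1))).
      have en : i = n by lia.
      have nB : n < B by lia.
      by rewrite /= rE rnE en /word nB ltnn /= ifT //; lia.
    move=> s'; rewrite {}/s' /=; set s1' := hrun _ _ _ _ => hB0.
    set s' := foldl _ _ _ in hB0 *.
    have := MB _ _ hB0 => MB0.
    have t1 : tm s0 < tm s1' by have := run_tm_le p (tick (setr s0 r i)) => /=.
    have t2 : tm s1' <= tm s'.
      rewrite /s'; elim: (iota _ _) (s1') => //= a l IHl u; apply: leq_trans (IHl _).
      by have := run_tm_le p (tick (setr u r a)) => /=; lia.
    have rE : regs x0 r.+1 = i by case: sx0 => -> _ _; rewrite /= /upd eqxx.
    have rnE : regs x0 rn.+1 = n by case: sx0 => -> _ _; rewrite /= /upd eq_sym (negbTE rrn).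
    have eW1 := mul_sub_split W (leqnSn (tm s0)) t1; rewrite tick1 muln1 in eW1.
    have eW2 := mul_sub_split W (ltnW t1) t2.
    rewrite eW1 in eW2; move: hB0 eW1 eW2; rewrite -/s1'.
    set u := W * (tm s1' - (tm s0).+1); set v := W * (tm s' - tm s1') => hB0 eW1 eW2.
    rewrite eW2 in hB0; rewrite eW2.
    have [| | | |x1 [n1 [e1 sx1 c1 b1]]] := IHp _ op (tick (setr s0 r i)) x0 M0 _ _ bi0 bL0.
    - by clear -we; lia.
    - by apply: simulates_tick.
    - by apply: bounded_tick; apply: bounded_setr => //; clear - ij nM; lia.
    - by apply: pow_le hB0; rewrite -/s1' /= -/u; clear; lia.
    rewrite -/s1' /= -/u in sx1 c1 b1.
    have r1E : rg s1' r = i by rewrite /s1' run_rg //= /upd eqxx.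
    have iB : i.+1 < B by clear - ij nM MB0; lia.
    have [|x2 ex2 sx2] := exec_set (e := Op Add (Reg r.+1) (Cst 1)) (v := i.+1) r sx1.
      by case: sx1 => h _ _; rewrite /= h r1E /word !ifT ?addn1 //; clear - iB; lia.
    have := IHj i.+1 s1' x2 (M0 + (W + u)) _ sx2.
    rewrite -/s' -/v; case.
    - by clear - ij; lia.
    - by rewrite /s1' run_rg //= /upd eq_sym (negbTE rrn).
    - by apply: bounded_le b1; clear; lia.
    - by clear - nM; lia.
    - by move=> a /bi0; clear; lia.
    - by clear - bL0; lia.
    - by apply: pow_le hB0; clear; lia.
    move=> x3 [k [e3 sx3 _ c3 b3]]; exists x3, (4 + (n1 + 4) + k); split=> //.
    - apply: (@exec_while_loop _ x0 x2 x3 (Op Lt (Reg r.+1) (Reg rn.+1)) _ 1) => //.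
        have nB : n < B by clear - nM MB0; lia.
        have i_n : i < n by clear - ij; lia.
        by rewrite /= rE rnE /word (ltnW iB) nB i_n /= ifT //; clear - iB; lia.
      exact: exec_seq e1 ex2.
    - by apply: leq_trans t2; apply: ltnW.
    - by move: c1 c3; clear - we; lia.
    - by apply: bounded_le b3; clear; lia.
  have tN : (tm s).+1 <= tm sN.
    rewrite /sN -[X in X <= _]/(tm s1); elim: (iota _ _) (s1) => //= a l IHl u; apply: leq_trans (IHl _).
    by have := run_tm_le p (tick (setr u r a)) => /=; lia.
  have eW1 := mul_sub_split W (leqnSn (tm s)) tN; rewrite tick1 muln1 in eW1.
  move: hB; rewrite /= eW1; set u := W * _ => hB.
  have hB' : (M + W + 2) ^ W <= B by apply: pow_le hB; clear; lia.
  have we' : weight e + 10 <= W by clear -we; lia.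
  have [he hn] := eval_count bs bi bL sx (cl := cl) (e := e) we' oe hB' te.
  rewrite -/n in he hn.
  have [x1 e1 sx1] := exec_set rn sx he.
  have M2B : 2 < B.
    apply: leq_trans hB'; apply: leq_trans (leq_pexp2l _ (_ : 1 <= W)); rewrite ?expn1; clear -we; lia.
  have [|x2 e2 sx2] := exec_set (e := Cst 0) (v := 0) r sx1.
    by rewrite /= /word ifT //; clear - M2B; lia.
  have := loop n 0 s1 x2 (M + W) _ sx2; rewrite -/sN; case=> //.
  - by rewrite /s1 /= /upd eqxx.
  - apply: bounded_tick; apply: bounded_setr; [apply: bounded_le bs | ]; move: hn; clear -we; lia.
  - by move: hn; clear -we; lia.
  - by move=> a /bi; clear; lia.
  - by clear -bL; lia.
  - by apply: pow_le hB; rewrite /= -/u; clear; lia.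
  rewrite /= -/u; move=> x3 [k [e3 sx3 _ c3 b3]]; exists x3.
  exists ((expr_cost (count_expr cl e)).+1 + (2 + k)); split=> //.
  - by apply: exec_seq e1 _; apply: exec_seq e2 _.
  - have : expr_cost (count_expr cl e) <= weight e + 5.
      by have := cost_weight e; case: (cl) => /=; clear; lia.
    by move: c3; clear -we; lia.
  - by apply: bounded_setr; [apply: bounded_le b3; clear; lia | move: hn; clear -we; lia].
Qed.

End Compilation.

(** * Reading the input *)

Notation "p ;; q" := (CSeq p q) (at level 90, right associativity).
Notation "a :+ b" := (EO Add a b) (at level 50, left associativity).
Notation "a :- b" := (EO Defs.Sub a b) (at level 50, left associativity).
Notation "a :** b" := (EO Mul a b) (at level 40, left associativity).
Notation "a :< b" := (EO Lt a b) (at level 70).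
Notation "a :=? b" := (EO Eq a b) (at level 70).
Notation "r ::= e" := (CSet r e) (at level 85).

Notation rcur := 1.
Notation rlab := 2.
Notation rtop := 3.
Notation rspec := 4.
Notation rleft := 5.

(* Addresses in the input of the productions, of their lists of edges, of the cycles, of the
   labels, of the items of each label, and of the ends of the labels. *)
Notation aPP := 0.
Notation aPE := 1.
Notation aCP := 2.
Notation aLP := 3.
Notation aLT := 4.
Notation aEP := 5.

Definition skip_by n := rcur ::= EG rcur :+ EC n.
Definition store (b : bool) k x y e := if b then CArr k x y e else CSkip.

(* Reads an [enc_seq]: its length, then its elements by [body]. *)
Definition read_seq r rn body :=
  skip_by 1 ;; CFor false r rn (EI (EG rcur :- EC 1)) body.

(** [rtop] is raised above every recursion index that occurs; it becomes the bound [T] on the sums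
    of keys. The tag of an item tells whether it has three or four words. *)
Definition read_label b :=
  store b aLP (EG rlab) (EC 0) (EG rcur) ;;
  read_seq 8 9
    (store b aLT (EG rlab) (EG 8) (EG rcur) ;;
     rtop ::= EIf (EI (EG rcur))
       (EIf (EG rtop :< (EI (EG rcur :+ EC 3) :+ EC 1)) (EI (EG rcur :+ EC 3) :+ EC 1) (EG rtop))
       (EG rtop) ;;
     rcur ::= (EG rcur :+ EC 3) :+ (EC 0 :< EI (EG rcur))) ;;
  store b aEP (EG rlab) (EC 0) (EG rcur) ;;
  rlab ::= EG rlab :+ EC 1.

(** With [b] false nothing is stored: this is the pass that measures the input before the arrays
    have a place. [rtop] starts from 1, so that the bound [T] is positive even when no recursion
    occurs. *)
Definition read_input b :=
  rcur ::= EC 2 ;;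
  read_seq 6 7 (skip_by 1) ;;
  read_seq 6 7
    (store b aPP (EG 6) (EC 0) (EG rcur) ;; skip_by 1 ;; read_seq 8 9 (skip_by 1) ;;
     store b aPE (EG 6) (EC 0) (EG rcur) ;; read_seq 8 9 (skip_by 3)) ;;
  read_seq 6 7 (store b aCP (EG 6) (EC 0) (EG rcur) ;; read_seq 8 9 (skip_by 2)) ;;
  rspec ::= EG rcur ;; rlab ::= EC 0 ;; rtop ::= EC 1 ;;
  read_seq 6 7 (read_label b) ;; rleft ::= EG rlab ;; read_seq 6 7 (read_label b).

Section Reading.
Variables (inp : seq nat) (P : nat).
Notation hrun := (hrun inp P).

Definition at_ p (s : seq nat) := forall i, i < size s -> nth 0 inp (p + i) = nth 0 s i.

Lemma at_cat p s1 s2 : at_ p (s1 ++ s2) <-> at_ p s1 /\ at_ (p + size s1) s2.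
Proof.
split=> [h|[h1 h2] i].
  split=> i hi; first by rewrite h ?nth_cat ?hi // size_cat; lia.
  rewrite -addnA h ?size_cat; last by lia.
  by rewrite nth_cat ltnNge leq_addr /= addKn.
move=> lt; rewrite nth_cat; case: ltnP => hi; first exact: h1.
rewrite size_cat in lt.
by rewrite -h2; [congr nth; lia | lia].
Qed.

Lemma at_cons p x s : at_ p (x :: s) <-> nth 0 inp p = x /\ at_ p.+1 s.
Proof.
rewrite -cat1s at_cat addn1; split=> -[h1 h2]; split=> //.
  by have := h1 0 isT; rewrite addn0.
by case=> // _; rewrite addn0.
Qed.

Lemma at_flatten (T : Type) (f : T -> seq nat) l p i y0 : i < size l ->
  at_ p (flatten (map f l)) ->
  at_ (p + size (flatten (map f (take i l)))) (f (nth y0 l i)).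
Proof.
elim: l p i => // y l IH p [|i] hi /= /at_cat[h1 h2]; first by rewrite addn0.
by rewrite size_cat addnA; apply: IH.
Qed.

(** Each element occupies at least one word, so the overhead of an iteration is charged to the words
    it consumes, and nested readings stay linear in the length of the input. *)
Lemma run_read_seq (T : Type) (f : T -> seq nat) (l : seq T) c body r rn s0
    (I : nat -> hstate -> Prop) :
    [&& r != rn, r != rcur, rn != rcur, r \notin modr body & rn \notin modr body] ->
    at_ (rg s0 rcur) (enc_seq f l) -> (forall y, 0 < size (f y)) ->
    (forall i s s', ar s' = ar s -> (forall x, x \notin [:: rcur; r; rn] -> rg s' x = rg s x) ->
       I i s -> I i s') ->
    I 0 s0 ->
    (forall i y s, i < size l -> nth y l i = y -> I i s -> rg s r = i -> at_ (rg s rcur) (f y) ->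
       let s' := hrun body s in
       [/\ I i.+1 s', rg s' rcur = rg s rcur + size (f y) & tm s' <= tm s + c * size (f y)]) ->
  let s' := hrun (read_seq r rn body) s0 in
  [/\ I (size l) s', rg s' rcur = rg s0 rcur + size (enc_seq f l)
    & tm s' <= tm s0 + c.+2 * size (enc_seq f l)].
Proof.
move=> /and5P[rrn rc rnc rb rnb] hat f0 stable I0 step.
move: hat; rewrite /enc_seq => /at_cons[hn hl].
pose s1 := hrun (skip_by 1) s0.
have r1 : rg s1 rcur = (rg s0 rcur).+1 by rewrite /= /upd /= addn1.
have cnt : for_count inp P false s1 (EI (EG rcur :- EC 1)) = size l.
  by rewrite /for_count /= /upd /= addn1 subn1 /= hn.
rewrite /read_seq run_seqE -/s1 run_forE cnt.
set s2 := tick (setr s1 rn (size l)).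
pose J i s := [/\ I i s, rg s rcur = (rg s0 rcur).+1 + size (flatten (map f (take i l)))
  & tm s <= tm s0 + 2 + c.+1 * size (flatten (map f (take i l)))].
have : J (size l) (foldl (fun s i => hrun body (tick (setr s r i))) s2 (iota 0 (size l))).
  apply: run_for_inv.
    split; last by rewrite take0 /= muln0 addn0 addn2.
      apply: stable I0 => // x; rewrite !inE !negb_or => /and3P[h1 h2 h3].
      by rewrite /= /upd (negbTE h3) (negbTE h1).
    by rewrite take0 addn0 -r1 /= /upd eq_sym (negbTE rnc).
  move=> i s hi [h1 h2 h3]; set s' := tick _.
  have [y0 ey0] : exists y, nth y l i = y.
    case: (l) hi => // y l' hi; exists (nth y (y :: l') i); exact: set_nth_default.
  have hat : at_ (rg s' rcur) (f y0).
    by rewrite /s' /= /upd eq_sym (negbTE rc) h2 -{1}ey0; apply: at_flatten.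
  have [||h4 h5 h6] := step i y0 s' hi ey0 _ _ hat.
  - apply: stable h1 => // x; rewrite !inE !negb_or => /and3P[_ h1 _].
    by rewrite /= /upd (negbTE h1).
  - by rewrite /= /upd eqxx.
  rewrite /J (take_nth y0 hi) ey0 map_rcons flatten_rcons size_cat; split=> //.
    by rewrite h5 addnA /s' /= /upd eq_sym (negbTE rc) h2.
  apply: leq_trans h6 _; rewrite /s' /=; have := f0 y0.
  move: (size (f _)) (size (flatten _)) h3 => u v; rewrite mulnDr !mulSn; lia.
case; set s3 := foldl _ _ _; rewrite take_size => h1 h2 h3; split.
- apply: stable h1 => // x; rewrite !inE !negb_or => /and3P[_ hx _].
  by rewrite /= /upd (negbTE hx).
- by rewrite /= /upd eq_sym (negbTE rc) h2 /=; lia.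
- by rewrite /=; move: h3; rewrite !mulSn; lia.
Qed.

Definition tlabel0 := ProdLabel 0 0.

Definition index_lt (l : tlabel) n := if l is RecLabel _ _ i then i < n else true.

Definition label_at (s : hstate) x (ls : seq tlabel) :=
  [/\ at_ (ar s aLP x 0) (enc_label ls), ar s aEP x 0 = ar s aLP x 0 + size (enc_label ls)
    & forall q, q < size ls -> at_ (ar s aLT x q) (enc_tlabel (nth tlabel0 ls q))].

Lemma size_enc_tlabel l : size (enc_tlabel l) = 3 + (if l is RecLabel _ _ _ then 1 else 0).
Proof. by case: l. Qed.

Lemma read_labelP b s x ls : rg s rlab = x -> at_ (rg s rcur) (enc_label ls) ->
  let s' := hrun (read_label b) s in
  [/\ rg s' rlab = x.+1 /\ rg s' rcur = rg s rcur + size (enc_label ls),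
      forall k y z, (k \notin [:: aLP; aLT; aEP]) || (y != x) -> ar s' k y z = ar s k y z,
      b -> label_at s' x ls,
      rg s rtop <= rg s' rtop /\ (forall q, q < size ls -> index_lt (nth tlabel0 ls q) (rg s' rtop))
    & tm s' <= tm s + 8 * size (enc_label ls)].
Proof.
move=> ex hat; rewrite /read_label; do 3 rewrite run_seqE.
set body := (X in read_seq 8 9 X).
set s1 := hrun (store b aLP _ _ _) s.
have [r1 t1 a1] : [/\ rg s1 = rg s, tm s1 = (tm s).+1
   & ar s1 = if b then upd3 (ar s) aLP x 0 (rg s rcur) else ar s].
  by rewrite /s1 /store; case: (b); rewrite /= ?ex.
pose I i s := [/\ (forall k y z, (k != aLT) || (y != x) -> ar s k y z = ar s1 k y z),
   (b -> forall q, q < i -> at_ (ar s aLT x q) (enc_tlabel (nth tlabel0 ls q))),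
   rg s1 rtop <= rg s rtop /\ (forall q, q < i -> index_lt (nth tlabel0 ls q) (rg s rtop))
   & rg s rlab = x].
have hat1 : at_ (rg s1 rcur) (enc_seq enc_tlabel ls) by rewrite r1.
have [|||||[h1 h2 [h3 h3'] h4] h5 h6] := run_read_seq (c := 3) (body := body) (r := 8) (rn := 9)
   (I := I) _ hat1.
- by rewrite /body /store; case: (b).
- by case.
- move=> i u u' ea er [i1 i2 [i3 i3'] i4]; split=> //.
  + by move=> *; rewrite ea i1.
  + by move=> hb q hq; rewrite ea; apply: i2.
  + by rewrite er.
  + by rewrite er.
- by split=> //; rewrite r1.
- move=> i l u hi el [i1 i2 [i3 i3'] i4] e8 hatu u'.
  have {}el : nth tlabel0 ls i = l by rewrite (set_nth_default l).
  have tag : nth 0 inp (rg u rcur) = if l is RecLabel _ _ _ then 1 else 0.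
    by move: hatu; case: (l) => [k j|s0 u0 j] /at_cons[].
  have idx : if l is RecLabel _ _ j then nth 0 inp (rg u rcur + 3) = j else True.
    by move: hatu; case: (l) => // ? ? j /(_ 3 isT).
  have [ru tu au] : [/\ forall v, rg u' v = if v == rcur then rg u rcur + size (enc_tlabel l)
         else if v == rtop then (if l is RecLabel _ _ j then maxn (rg u rtop) j.+1 else rg u rtop)
         else rg u v, tm u' = (tm u) + 3
       & ar u' = if b then upd3 (ar u) aLT x i (rg u rcur) else ar u].
    rewrite /u' /body !run_seqE; set u1 := hrun (store _ _ _ _ _) u.
    have [ru1 tu1 au1] : [/\ rg u1 = rg u, tm u1 = (tm u).+1
      & ar u1 = if b then upd3 (ar u) aLT x i (rg u rcur) else ar u].
      by rewrite /u1 /store; case: (b); rewrite /= ?i4 ?e8.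
    split; [|by rewrite /= tu1; lia | by rewrite /= au1].
    move=> v; rewrite /= /upd /= ru1 tag size_enc_tlabel.
    case: (l) idx => [k j|s0 u0 j] /= idx.
      by rewrite addn0; case: (v == 1) => //; case: (v =P 3) => [->|].
    rewrite idx addn1 !addnA; case: (v == 1); first by lia.
    case: (v == 3) => //; rewrite addn1 /maxn; by case: (rg u 3 < j.+1).
  rewrite ru eqxx tu; split=> //; last by have := size_enc_tlabel l; lia.
  have tge : rg u rtop <= rg u' rtop by rewrite ru /=; case: (l) => // *; rewrite leq_maxl.
  split.
  + move=> k y z hk; rewrite au; case: (b) => //; last exact: i1.
    rewrite /upd3 ifN ?i1 //; apply: contraL hk => /and3P[/eqP-> /eqP-> _].
    by rewrite !eqxx.
  + move=> hb q; rewrite au hb ltnS leq_eqVlt => /orP[/eqP->|hq].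
      by rewrite /upd3 !eqxx /= el; move: hatu.
    rewrite /upd3 !eqxx /= ifN; [exact: i2 | by apply/eqP; lia].
  + split; first exact: leq_trans tge.
    move=> q; rewrite ltnS leq_eqVlt => /orP[/eqP->|hq].
      by rewrite el ru /=; case: (l) => // *; rewrite /= leq_maxr.
    have := i3' q hq; case: (nth _ _ q) => //= _ _ j lt; exact: leq_trans lt tge.
  + by rewrite ru /=.
set s2 := hrun (read_seq _ _ _) s1 in h1 h2 h3 h3' h4 h5 h6 *.
clearbody s2; set s3 := hrun (store b aEP _ _ _) s2.
have [r3 t3 a3] : [/\ rg s3 = rg s2, tm s3 = (tm s2).+1
   & ar s3 = if b then upd3 (ar s2) aEP x 0 (rg s2 rcur) else ar s2].
  by rewrite /s3 /store; case: (b); rewrite /= ?h4.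
clearbody s3; rewrite r1 in h5; split=> /=.
- by rewrite /upd /= r3 h4 h5 addn1.
- move=> k y z hk; rewrite a3; have e1 : ar s2 k y z = ar s1 k y z.
    by apply: h1; move: hk; rewrite !inE; case: (k =P aLT) => //= ->.
  have hk' a : a \in [:: aLP; aLT; aEP] -> [&& k == a, y == x & z == 0] = false.
    by move=> ha; apply/negbTE; apply: contraL hk => /and3P[/eqP-> /eqP-> _]; rewrite ha eqxx.
  by case: (b) a1 => a1; rewrite /upd3 ?hk' // e1 a1 // /upd3 hk'.
- move=> hb; rewrite hb in a1 a3; split.
  + rewrite /= a3 /upd3 /= h1 // a1 /upd3 !eqxx /=; exact: hat.
  + by rewrite /= a3 /upd3 !eqxx /= h5 h1 // a1 /upd3 !eqxx.
  + by move=> q hq; rewrite /= a3 /upd3 /=; apply: h2.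
- by rewrite /upd /= r3; split=> //; rewrite r1 in h3.
- by rewrite t3; move: h6; rewrite t1 /enc_label /enc_seq /=; lia.
Qed.

Lemma run_skip_seq (T : Type) (f : T -> seq nat) (l : seq T) n r rn s0 :
    [&& r != rn, r != rcur & rn != rcur] -> 0 < n -> (forall y, size (f y) = n) ->
    at_ (rg s0 rcur) (enc_seq f l) ->
  let s' := hrun (read_seq r rn (skip_by n)) s0 in
  [/\ ar s' = ar s0, forall v, v \notin [:: rcur; r; rn] -> rg s' v = rg s0 v,
      rg s' rcur = rg s0 rcur + size (enc_seq f l)
    & tm s' <= tm s0 + 3 * size (enc_seq f l)].
Proof.
move=> /and3P[h1 h2 h3] n0 hf hat.
have [|||||[i1 i2] i3 i4] := run_read_seq (c := 1) (body := skip_by n) (r := r) (rn := rn)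
   (I := fun _ s => ar s = ar s0 /\ forall v, v \notin [:: rcur; r; rn] -> rg s v = rg s0 v)
   _ hat.
- by rewrite h1 h2 h3 /= !inE h2 h3.
- by move=> y; rewrite hf.
- by move=> _ u u' ea er [j1 j2]; split; [rewrite ea | move=> v hv; rewrite er // j2].
- by [].
- move=> i y u _ _ [j1 j2] _ _ u'; split=> /=; last by rewrite hf; lia.
    split=> // v hv; rewrite /upd; have := hv; rewrite !inE => /norP[/negbTE-> _].
    exact: j2.
  by rewrite /upd /= hf.
- by split.
Qed.

Variables (m t : nat) (G : spec m t) (cs : seq (seq (nat * nat))).
Variables (labs1 labs2 : seq (seq tlabel)).
Hypothesis inpE : inp = enc_spec G cs ++ enc_seq enc_label labs1 ++ enc_seq enc_label labs2.

Definition enc_prod (p : 'I_m * graph nat m t) := nat_of_ord p.1 :: enc_graph p.2.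
Definition enc_cycle (c : seq (nat * nat)) := enc_seq (fun e => [:: e.1; e.2]) c.

Definition prod_at s k :=
  at_ (ar s aPP k 0) (enc_prod (prod G k)) /\
  ar s aPE k 0 = ar s aPP k 0 + 2 + size (nodes (rhs G k)).

Definition cycle_at s c := at_ (ar s aCP c 0) (enc_cycle (nth [::] cs c)).

Definition read_prod b :=
  store b aPP (EG 6) (EC 0) (EG rcur) ;; skip_by 1 ;; read_seq 8 9 (skip_by 1) ;;
  store b aPE (EG 6) (EC 0) (EG rcur) ;; read_seq 8 9 (skip_by 3).

Lemma read_prodP b s k : rg s 6 = k -> at_ (rg s rcur) (enc_prod (prod G k)) ->
  let s' := hrun (read_prod b) s in
  [/\ forall a y z, (a \notin [:: aPP; aPE]) || (y != k) -> ar s' a y z = ar s a y z,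
      b -> prod_at s' k,
      rg s' rcur = rg s rcur + size (enc_prod (prod G k))
    & tm s' <= tm s + 3 * size (enc_prod (prod G k))].
Proof.
move=> ek hat; rewrite /read_prod; do 4 rewrite run_seqE.
set s1 := hrun (skip_by 1) _.
have [r1 t1 a1] : [/\ rg s1 = upd (rg s) rcur (rg s rcur).+1, tm s1 = tm s + 2
   & ar s1 = if b then upd3 (ar s) aPP k 0 (rg s rcur) else ar s].
  by rewrite /s1 /store; case: (b); rewrite /= ?ek addn1 addn2.
clearbody s1; have := hat; rewrite /enc_prod => /at_cons[_ /at_cat[hat1 hat2]].
have e1 : rg s1 rcur = (rg s rcur).+1 by rewrite r1 /upd eqxx.
rewrite -e1 in hat1 hat2.
have [//|//|//|a2 r2 c2 t2] := run_skip_seq (r := 8) (rn := 9) (s0 := s1) (n := 1) _ _ _ hat1.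
set s2 := hrun (read_seq 8 9 (skip_by 1)) s1 in a2 r2 c2 t2 *; clearbody s2.
set s3 := hrun (store b aPE _ _ _) s2.
have e6 : rg s2 6 = k by rewrite r2 // r1 /upd.
have [r3 t3 a3] : [/\ rg s3 = rg s2, tm s3 = (tm s2).+1
   & ar s3 = if b then upd3 (ar s2) aPE k 0 (rg s2 rcur) else ar s2].
  by rewrite /s3 /store; case: (b); rewrite /= ?e6.
clearbody s3; rewrite -c2 -r3 in hat2.
have [//|//|//|a4 r4 c4 t4] := run_skip_seq (r := 8) (rn := 9) (s0 := s3) (n := 3) _ _ _ hat2.
set s4 := hrun (read_seq 8 9 (skip_by 3)) s3 in a4 r4 c4 t4 *; clearbody s4.
set A1 := (X in rg s2 rcur = _ + X) in c2 t2; set A2 := (X in rg s4 rcur = _ + X) in c4 t4.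
have eAB : size (enc_prod (prod G k)) = (A1 + A2).+1.
  by rewrite /A1 /A2 /enc_prod /enc_graph [size (_ :: _)]/= size_cat.
have es : rg s4 rcur = rg s rcur + size (enc_prod (prod G k)).
  by rewrite c4 r3 c2 e1 eAB; lia.
split=> //.
- move=> a y z hk.
  have hk' d : d \in [:: aPP; aPE] -> [&& a == d, y == k & z == 0] = false.
    by move=> hd; apply/negbTE; apply: contraL hk => /and3P[/eqP-> /eqP-> _]; rewrite hd eqxx.
  by rewrite a4 a3; case: (b) a1 => a1; rewrite /upd3 ?hk' // a2 a1 // /upd3 hk'.
- move=> hb; rewrite hb in a1 a3; split; first by rewrite a4 a3 /upd3 /= a2 a1 /upd3 !eqxx.
  rewrite a4 a3 /upd3 !eqxx /= a2 a1 /upd3 !eqxx /= c2 e1.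
  have eA : A1 = (size (nodes (rhs G k))).+1.
    by rewrite /A1 /enc_seq /=; congr _.+1; rewrite -/(rhs G k); elim: (nodes _) => //= ? ? ->.
  by rewrite eA addSn addnS addnAC addn2.
- by rewrite -/(enc_prod _) eAB; move: t4; rewrite t3; move: t2; rewrite t1; lia.
Qed.

Definition read_cycle b :=
  store b aCP (EG 6) (EC 0) (EG rcur) ;; read_seq 8 9 (skip_by 2).

Lemma read_cycleP b s k : rg s 6 = k -> at_ (rg s rcur) (enc_cycle (nth [::] cs k)) ->
  let s' := hrun (read_cycle b) s in
  [/\ forall a y z, (a != aCP) || (y != k) -> ar s' a y z = ar s a y z,
      b -> cycle_at s' k,
      rg s' rcur = rg s rcur + size (enc_cycle (nth [::] cs k))
    & tm s' <= tm s + 4 * size (enc_cycle (nth [::] cs k))].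
Proof.
move=> ek hat; rewrite /read_cycle run_seqE.
set s1 := hrun (store _ _ _ _ _) _.
have [r1 t1 a1] : [/\ rg s1 = rg s, tm s1 = (tm s).+1
   & ar s1 = if b then upd3 (ar s) aCP k 0 (rg s rcur) else ar s].
  by rewrite /s1 /store; case: (b); rewrite /= ?ek.
clearbody s1; have := hat; rewrite -r1 => hat1.
have [//|//|//|a2 r2 c2 t2] := run_skip_seq (r := 8) (rn := 9) (s0 := s1) (n := 2) _ _ _ hat1.
set s2 := hrun (read_seq 8 9 (skip_by 2)) s1 in a2 r2 c2 t2 *; clearbody s2.
split=> //.
- move=> a y z hk; rewrite a2 a1; case: (b) => //; rewrite /upd3 ifN //.
  by apply: contraL hk => /and3P[/eqP-> /eqP-> _]; rewrite !eqxx.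
- by move=> hb; rewrite /cycle_at a2 a1 hb /upd3 !eqxx.
- by move: t2; rewrite t1 /enc_cycle /=; lia.
Qed.

Lemma read_labelsP b s x0 (ls : seq (seq tlabel)) :
  rg s rlab = x0 -> at_ (rg s rcur) (enc_seq enc_label ls) ->
  let s' := hrun (read_seq 6 7 (read_label b)) s in
  [/\ rg s' rlab = x0 + size ls /\ rg s' rcur = rg s rcur + size (enc_seq enc_label ls),
      forall k y z, (k \notin [:: aLP; aLT; aEP]) || (y < x0) -> ar s' k y z = ar s k y z,
      b -> forall x, x < size ls -> label_at s' (x0 + x) (nth [::] ls x),
      rg s rtop <= rg s' rtop /\ (forall x q, x < size ls -> q < size (nth [::] ls x) ->
         index_lt (nth tlabel0 (nth [::] ls x) q) (rg s' rtop))
    & tm s' <= tm s + 10 * size (enc_seq enc_label ls)].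
Proof.
move=> ex hat.
pose I i s' := [/\ rg s' rlab = x0 + i,
   forall k y z, (k \notin [:: aLP; aLT; aEP]) || (y < x0) -> ar s' k y z = ar s k y z,
   b -> forall x, x < i -> label_at s' (x0 + x) (nth [::] ls x)
   & rg s rtop <= rg s' rtop /\ (forall x q, x < i -> q < size (nth [::] ls x) ->
         index_lt (nth tlabel0 (nth [::] ls x) q) (rg s' rtop))].
have [|||||[i1 i2 i3 i4] i5 i6] := run_read_seq (c := 8) (body := read_label b) (r := 6) (rn := 7)
   (I := I) _ hat.
- by rewrite /read_label /store; case: (b).
- by [].
- move=> i u u' ea er [j1 j2 j3 [j4 j5]]; split; rewrite ?er //.
  + by move=> *; rewrite ea j2.
  + by move=> hb x hx; rewrite /label_at ea; apply: j3.
- by split=> //; rewrite addn0.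
- move=> i l u hi el [j1 j2 j3 [j4 j5]] e6 hatu u'.
  have {}el : nth [::] ls i = l by rewrite (set_nth_default l).
  have [[k1 k2] k3 k4 [k5 k6] k7] := read_labelP b j1 hatu; rewrite -/u' in k1 k2 k3 k4 k5 k6 k7.
  split=> //; split.
  + by rewrite k1 addnS.
  + move=> k y z hk; rewrite k3 ?j2 //; case/orP: hk => [->//|hy].
    by apply/orP; right; lia.
  + move=> hb x; rewrite ltnS leq_eqVlt => /orP[/eqP->|hx]; first by rewrite el; apply: k4.
    have [l1 l2 l3] := j3 hb x hx; have ne : x0 + x != x0 + i by lia.
    by split; rewrite ?k3 ?ne ?orbT // => q hq; rewrite k3 ?ne ?orbT //; apply: l3.
  + split; first exact: leq_trans k5.
    move=> x q; rewrite ltnS leq_eqVlt => /orP[/eqP->|hx] hq; first by rewrite el in hq *; apply: k6.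
    have := j5 x q hx hq; case: (nth _ _ q) => //= _ _ v lt; exact: leq_trans lt k5.
by split.
Qed.

Theorem read_inputP b s : let s' := hrun (read_input b) s in
  [/\ rg s' rcur = size inp /\ rg s' rspec = size (enc_spec G cs),
      rg s' rleft = size labs1 /\ rg s' rlab = size labs1 + size labs2,
      b -> [/\ forall k, k < size (prods G) -> prod_at s' k,
               forall c, c < size cs -> cycle_at s' c
             & forall x, x < size (labs1 ++ labs2) -> label_at s' x (nth [::] (labs1 ++ labs2) x)],
      0 < rg s' rtop /\ (forall x q, x < size (labs1 ++ labs2) ->
         q < size (nth [::] (labs1 ++ labs2) x) ->
         index_lt (nth tlabel0 (nth [::] (labs1 ++ labs2) x) q) (rg s' rtop))
    & tm s' <= tm s + 10 * size inp + 20].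
Proof.
have [hin1 hin2] : [/\ at_ 2 (enc_seq (fun M => [:: nat_of_bool (M \in composite G)]) (enum 'I_m) ++
    enc_seq enc_prod (prods G) ++ enc_seq enc_cycle cs) &
    at_ (size (enc_spec G cs)) (enc_seq enc_label labs1 ++ enc_seq enc_label labs2)].
  have : at_ 0 inp by [].
  rewrite inpE => /at_cat[h1 h2]; split=> //.
  by move: h1; rewrite /enc_spec => /at_cat[_ h1].
have sz : size inp = size (enc_spec G cs) + (size (enc_seq enc_label labs1) + size (enc_seq enc_label labs2)).
  by rewrite inpE !size_cat.
have sze : size (enc_spec G cs) = 2 + (size (enc_seq (fun M => [:: nat_of_bool (M \in composite G)]) (enum 'I_m)) +
   (size (enc_seq enc_prod (prods G)) + size (enc_seq enc_cycle cs))).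
  by rewrite /enc_spec !size_cat.
move: hin1 hin2 => /at_cat[hA /at_cat[hB hC]] /at_cat[hD hE].
rewrite /read_input -/(read_prod b) -/(read_cycle b); do 9 rewrite run_seqE.
set A := size (enc_seq _ (enum _)) in hB hC sze; set B := size (enc_seq enc_prod _) in hC sze.
set C := size (enc_seq enc_cycle _) in sze; set L1 := size (enc_seq enc_label labs1) in sz hE.
set L2 := size (enc_seq enc_label labs2) in sz.
set s0 := hrun (rcur ::= EC 2) s.
have c0 : rg s0 rcur = 2 by [].
have t0 : tm s0 = (tm s).+1 by [].
clearbody s0; rewrite -c0 in hA hB hC.
have [//|//|//|a1 r1 c1 t1] := run_skip_seq (r := 6) (rn := 7) (s0 := s0) (n := 1) _ _ _ hA.
set s1 := hrun (read_seq 6 7 (skip_by 1)) s0 in a1 r1 c1 t1 *; clearbody s1.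
rewrite -c1 in hB hC.
have [|||||i1 c2 t2] := run_read_seq (c := 3) (body := read_prod b) (r := 6) (rn := 7)
  (I := fun i s => b -> forall k, k < i -> prod_at s k) _ hB.
- by rewrite /read_prod /store; case: (b).
- by [].
- by move=> i u u' ea er hi hb k hk; rewrite /prod_at ea; apply: hi.
- by [].
- move=> i p u hi ep IH e6 hat u'.
  have {}ep : prod G i = p by rewrite /prod (set_nth_default p).
  rewrite -ep in hat *; have [k1 k2 k3 k4] := read_prodP b e6 hat.
  split=> // hb k; rewrite ltnS leq_eqVlt => /orP[/eqP->|hk]; first exact: k2.
  have [l1 l2] := IH hb k hk; have ne : k != i by lia.
  by split; rewrite !k1 ?ne ?orbT.
set s2 := hrun (read_seq 6 7 (read_prod b)) s1 in i1 c2 t2 *; clearbody s2.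
rewrite -c2 in hC.
have [|||||[i2 i3] c3 t3] := run_read_seq (c := 4) (body := read_cycle b) (r := 6) (rn := 7)
  (I := fun i s => (b -> forall k, k < size (prods G) -> prod_at s k) /\
                   (b -> forall k, k < i -> cycle_at s k)) _ hC.
- by rewrite /read_cycle /store; case: (b).
- by [].
- by move=> i u u' ea er [hi hj]; split=> hb k hk; rewrite /prod_at /cycle_at ea; [apply: hi | apply: hj].
- by split.
- move=> i c u hi ec [IH1 IH2] e6 hat u'.
  have {}ec : nth [::] cs i = c by rewrite (set_nth_default c).
  rewrite -ec in hat *; have [k1 k2 k3 k4] := read_cycleP b e6 hat.
  split=> //; split=> hb k.
    by move=> /(IH1 hb)[l1 l2]; split; rewrite !k1.
  rewrite ltnS leq_eqVlt => /orP[/eqP->|hk]; first exact: k2.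
  have ne : k != i by lia.
  by rewrite /cycle_at k1 ?ne ?orbT //; apply: IH2.
set s3 := hrun (read_seq 6 7 (read_cycle b)) s2 in i2 i3 c3 t3 *; clearbody s3.
have {}c3 : rg s3 rcur = size (enc_spec G cs) by rewrite c3 c2 c1 c0 sze -!addnA.
set s4 := hrun (rtop ::= EC 1) _.
have [c4 p4 l4 T4] : [/\ rg s4 rcur = size (enc_spec G cs), rg s4 rspec = size (enc_spec G cs),
   rg s4 rlab = 0 & rg s4 rtop = 1] by rewrite /s4 /= /upd /= c3.
have [a4 t4] : ar s4 = ar s3 /\ tm s4 = tm s3 + 3 by rewrite /= /s4 /= !addnS addn0.
clearbody s4; rewrite -c4 in hD hE.
have [[l5 c5] a5 i5 [T5 T5'] t5] := read_labelsP b l4 hD.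
have r5 := run_rg inp P (p := read_seq 6 7 (read_label b)) (r := rspec) s4.
set s5 := hrun (read_seq 6 7 (read_label b)) s4 in l5 c5 a5 i5 T5 T5' t5 r5 *; clearbody s5.
have {}r5 : rg s5 rspec = size (enc_spec G cs) by rewrite r5 ?p4 // /read_label /store; case: (b).
set s6 := hrun (rleft ::= EG rlab) s5.
have [c6 p6 l6 T6 f6] : [/\ rg s6 rcur = rg s5 rcur, rg s6 rspec = rg s5 rspec,
   rg s6 rlab = rg s5 rlab, rg s6 rtop = rg s5 rtop & rg s6 rleft = rg s5 rlab] by [].
have [a6 t6] : ar s6 = ar s5 /\ tm s6 = (tm s5).+1 by [].
clearbody s6; rewrite -c5 -c6 in hE; rewrite l5 in l6.
have [[l7 c7] a7 i7 [T7 T7'] t7] := read_labelsP b l6 hE.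
have r7 := run_rg inp P (p := read_seq 6 7 (read_label b)) (r := rspec) s6.
have f7 := run_rg inp P (p := read_seq 6 7 (read_label b)) (r := rleft) s6.
set s7 := hrun (read_seq 6 7 (read_label b)) s6 in l7 c7 a7 i7 T7 T7' t7 r7 f7 *; clearbody s7.
have {}r7 : rg s7 rspec = size (enc_spec G cs).
  by rewrite r7 ?p6 // /read_label /store; case: (b).
have {}f7 : rg s7 rleft = size labs1.
  by rewrite f7 ?f6 ?l5 // /read_label /store; case: (b).
split=> //.
- by rewrite c7 c6 c5 c4 sz -!addnA.
- move=> hb; split.
  + move=> k hk; have [h1 h2] := i2 hb k hk.
    by rewrite /prod_at !a7 // a6 !a5 // a4.
  + by move=> c hc; have h := i3 hb c hc; rewrite /cycle_at !a7 // a6 !a5 // a4.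
  + move=> x; rewrite size_cat nth_cat; case: (ltnP x (size labs1)) => [hx _|hx lt].
      have [h1 h2 h3] := i5 hb x hx; rewrite add0n in h1 h2 h3.
      have lt : x < 0 + size labs1 by lia.
      by split; rewrite ?a7 ?lt ?orbT ?a6 // => q hq; rewrite a7 ?lt ?orbT // a6; apply: h3.
    have := i7 hb (x - size labs1); rewrite add0n subnKC //; apply; lia.
- split; first by rewrite (leq_trans _ T7) // T6 (leq_trans _ T5) // T4.
  move=> x q; rewrite size_cat nth_cat; case: (ltnP x (size labs1)) => [hx _ hq|hx lt hq].
    have := T5' x q hx hq; rewrite -T6; case: (nth _ _ q) => //= _ _ v h; exact: leq_trans h T7.
  by apply: T7' => //; lia.
- move: t1 t2 t3 t5 t7; rewrite -/A -/B -/C -/L1 -/L2 sz sze t4 t6 t0; lia.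
Qed.

End Reading.

(* Codes of the relations of the modules, of the paths in the right-hand sides, and of the paths
   there from the source and to the sink. *)
Notation aLam := 6.
Notation aK := 7.
Notation aKI := 8.
Notation aKO := 9.

(** * Relations as machine words, their operations as constant tables *)

Section Codes.
Variable A : automaton.

(* The empty relation has code 0, so that it is the initial value of every cell. *)
Definition code (c : relation A) : nat := if c == set0 then 0 else (enum_rank c).+1.
Definition decode (n : nat) : relation A := if n is n'.+1 then nth set0 (enum {: relation A}) n' else set0.
(** The same tables are indexed by codes of relations and by letters cut off at the cap of the
    automaton; the size accommodates both. *)
Definition table_size := maxn #|{: relation A}|.+1 (acap A).+1.

Lemma codeK : cancel code decode.
Proof.
move=> c; rewrite /code; case: eqP => [->|_] //=.
exact: nth_enum_rank.
Qed.

Lemma code_lt c : code c < table_size.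
Proof.
rewrite /code /table_size leq_max; case: eqP => // _; apply/orP; left.
by rewrite ltnS ltn_ord.
Qed.

Lemma code_eq0 c : (code c == 0) = (c == set0).
Proof. by rewrite /code; case: (c == set0). Qed.

Definition tmul x y := code (rmul (decode x) (decode y)).
Definition tjoin x y := code (decode x :|: decode y).
Definition tletter x (_ : nat) := code (rletter A x).
Definition taccept x (_ : nat) := nat_of_bool (raccept (decode x)).

Definition emul a b := ET tmul a b.
Definition ejoin a b := ET tjoin a b.
Definition eletter a := ET tletter (a :- (a :- EC (acap A))) (EC 0).
Definition eaccept a := ET taccept a (EC 0).
Definition eone := EC (code (rone A)).

Variable inp : seq nat.
Notation ev := (ev inp table_size).

Lemma ev_emul s a b c d : ev s a = code c -> ev s b = code d -> ev s (emul a b) = code (rmul c d).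
Proof. by move=> /= -> ->; rewrite /tabulated !code_lt /tmul !codeK. Qed.

Lemma ev_ejoin s a b c d : ev s a = code c -> ev s b = code d -> ev s (ejoin a b) = code (c :|: d).
Proof. by move=> /= -> ->; rewrite /tabulated !code_lt /tjoin !codeK. Qed.

Lemma ev_eaccept s a c : ev s a = code c -> ev s (eaccept a) = raccept c.
Proof.
move=> /= ->; rewrite /tabulated code_lt /taccept codeK /=.
by rewrite ifT // /table_size leq_max.
Qed.

Lemma ev_eletter s a x R : recognizes A R -> ev s a = x -> ev s (eletter a) = code (rletter A x).
Proof.
move=> [h _] /= ->; have -> : x - (x - acap A) = minn x (acap A) by lia.
rewrite /tabulated /tletter ifT; last by rewrite /table_size !leq_max !ltnS geq_minr orbT.
by congr code; apply/setP => -[p q]; rewrite !inE /= [in RHS]h.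
Qed.

End Codes.

(** * Reasoning rules for loops *)

Section Loops.
Variables (inp : seq nat) (P : nat).
Notation ev := (ev inp P).
Notation hrun := (hrun inp P).

Definition acc_loop cl r rn ra ecnt einit ebody :=
  ra ::= einit ;; CFor cl r rn ecnt (ra ::= ebody).

Lemma iota_rcons i : iota 0 i.+1 = rcons (iota 0 i) i.
Proof. by rewrite -addn1 iotaD cats1. Qed.

Lemma run_acc (X : Type) (h : X -> nat) (F : X -> nat -> X) (x0 : X) n cl r rn ra ecnt einit ebody s :
    [&& r != rn, r != ra & rn != ra] ->
    ev s einit = h x0 ->
    for_count inp P cl (tick (setr s ra (h x0))) ecnt = n ->
    (forall x i s', i < n -> rg s' r = i -> rg s' ra = h x -> ar s' = ar s ->
       (forall v, v \notin [:: r; rn; ra] -> rg s' v = rg s v) -> ev s' ebody = h (F x i)) ->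
  let s' := hrun (acc_loop cl r rn ra ecnt einit ebody) s in
  [/\ rg s' ra = h (foldl F x0 (iota 0 n)), ar s' = ar s, ou s' = ou s
    & forall v, v \notin [:: r; rn; ra] -> rg s' v = rg s v].
Proof.
move=> /and3P[h1 h2 h3] e0 en step; rewrite /acc_loop run_seqE run_forE.
have -> : hrun (ra ::= einit) s = tick (setr s ra (h x0)) by rewrite /= e0.
rewrite en; set s1 := tick _.
pose I i s' := [/\ rg s' ra = h (foldl F x0 (iota 0 i)), ar s' = ar s, ou s' = ou s
    & forall v, v \notin [:: r; rn; ra] -> rg s' v = rg s v].
have : I n (foldl (fun s i => hrun (ra ::= ebody) (tick (setr s r i))) s1 (iota 0 n)).
  apply: run_for_inv.
    split=> // [|v]; first by rewrite /= /upd eq_sym (negbTE h3) eqxx.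
    by rewrite !inE !negb_or /= /upd => /and3P[_ /negbTE-> /negbTE->].
  move=> i s' hi [i1 i2 i3 i4]; split=> // [|v].
    rewrite iota_rcons foldl_rcons [rg _ _]/= /upd eqxx; apply: step => //=.
    - by rewrite /upd eqxx.
    - by rewrite /upd eq_sym (negbTE h2).
    - move=> v hv; rewrite /upd ifN ?i4 //.
      by move: hv; rewrite !inE !negb_or => /and3P[].
  move=> hv; rewrite /= /upd; move: (hv); rewrite !inE !negb_or => /and3P[/negbTE-> _ /negbTE->].
  exact: i4.
case=> i1 i2 i3 i4; split=> //= [|v hv]; first by rewrite /upd eq_sym (negbTE h2).
rewrite /upd ifN ?i4 //.
by move: hv; rewrite !inE !negb_or => /and3P[].
Qed.

Lemma foldl_iota_nth (X Y : Type) (F : X -> Y -> X) (l : seq Y) (y0 : Y) x0 :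
  foldl F x0 l = foldl (fun x i => F x (nth y0 l i)) x0 (iota 0 (size l)).
Proof.
elim/last_ind: l => // l y IH; rewrite foldl_rcons size_rcons iota_rcons foldl_rcons.
rewrite nth_rcons ltnn eqxx IH; congr F.
have : forall i, i \in iota 0 (size l) -> i < size l by move=> i; rewrite mem_iota.
elim: (iota 0 (size l)) x0 {IH} => //= i s IH x0 hs; rewrite nth_rcons hs ?mem_head // IH // => j hj.
by apply: hs; rewrite inE hj orbT.
Qed.

Lemma run_acc_seq (X Y : Type) (h : X -> nat) (F : X -> Y -> X) (l : seq Y) (x0 : X) cl r rn ra ecnt einit ebody s :
    [&& r != rn, r != ra & rn != ra] ->
    ev s einit = h x0 ->
    for_count inp P cl (tick (setr s ra (h x0))) ecnt = size l ->
    (forall x i y s', i < size l -> (forall y0, nth y0 l i = y) -> rg s' r = i -> rg s' ra = h x ->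
       ar s' = ar s -> (forall v, v \notin [:: r; rn; ra] -> rg s' v = rg s v) -> ev s' ebody = h (F x y)) ->
  let s' := hrun (acc_loop cl r rn ra ecnt einit ebody) s in
  [/\ rg s' ra = h (foldl F x0 l), ar s' = ar s, ou s' = ou s
    & forall v, v \notin [:: r; rn; ra] -> rg s' v = rg s v].
Proof.
move=> hr e0 en step; case: l en step => [|y0 l] en step.
  exact: (@run_acc X h (fun x _ => x) x0 0).
rewrite (foldl_iota_nth _ _ y0); apply: run_acc => // x i s' hi *; apply: (step _ i) => // y.
exact: set_nth_default.
Qed.

Lemma for_count_capped s e n : ev s e = n -> n <= rg s rcap -> for_count inp P true s e = n.
Proof. by move=> <- h; apply/minn_idPr. Qed.

(** That registers and arrays outside the body keep their values is derived here from the syntax, so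
    an invariant has to mention only what changes. It must be stable under writes to the counter and
    to the register of the loop bound. *)
Lemma run_loop (J : nat -> hstate -> Prop) cl r rn e p n s :
    for_count inp P cl s e = n -> [&& r != rn, r \notin modr p & rn \notin modr p] ->
    (forall i s s', ar s' = ar s -> ou s' = ou s ->
       (forall v, v \notin [:: r; rn] -> rg s' v = rg s v) -> J i s -> J i s') ->
    J 0 s ->
    (forall i s', i < n -> rg s' r = i -> (forall v, v \notin r :: rn :: modr p -> rg s' v = rg s v) ->
       (forall a, a \notin moda p -> ar s' a = ar s a) -> J i s' -> J i.+1 (hrun p s')) ->
  J n (hrun (CFor cl r rn e p) s).
Proof.
move=> en /and3P[h1 h2 h3] st J0 step; rewrite run_forE en; set s1 := tick _.
pose I i s' := [/\ J i s', forall v, v \notin r :: rn :: modr p -> rg s' v = rg s v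
  & forall a, a \notin moda p -> ar s' a = ar s a].
have : I n (foldl (fun s i => hrun p (tick (setr s r i))) s1 (iota 0 n)).
  apply: run_for_inv.
    split=> // [|v].
      apply: st J0 => // v; rewrite !inE negb_or => /andP[_ hv].
      by rewrite /= /upd (negbTE hv).
    by rewrite !inE !negb_or => /and3P[_ hv _]; rewrite /= /upd (negbTE hv).
  move=> i s' hi [i1 i2 i3]; set s2 := tick _.
  have j2 v : v \notin r :: rn :: modr p -> rg s2 v = rg s v.
    by move=> hv; rewrite -(i2 v hv) /= /upd ifN //; move: hv; rewrite !inE !negb_or => /and3P[].
  split.
  - apply: step => //; first by rewrite /= /upd eqxx.
    apply: st i1 => // v; rewrite !inE negb_or => /andP[hv _].
    by rewrite /= /upd (negbTE hv).
  - by move=> v hv; rewrite run_rg ?j2 //; move: hv; rewrite !inE !negb_or => /and3P[].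
  - by move=> a ha; rewrite run_ar ?i3.
case=> i1 i2 i3; apply: st i1 => // v; rewrite !inE negb_or => /andP[hv _].
by rewrite /= /upd (negbTE hv).
Qed.

Lemma ev_if s c a b : ev s (EIf c a b) = if ev s c != 0 then ev s a else ev s b.
Proof. by []. Qed.

Lemma ev_ifeq s a b c d :
  ev s (EIf (a :=? b) c d) = if ev s a == ev s b then ev s c else ev s d.
Proof. by rewrite ev_if -[ev s (a :=? b)]/(nat_of_bool (ev s a == ev s b)); case: (ev s a == ev s b). Qed.

Lemma run_if e p q s : hrun (CIf e p q) s = if ev s e != 0 then hrun p (tick s) else hrun q (tick s).
Proof. by []. Qed.

Lemma run_if1 e p q s : ev s e != 0 -> hrun (CIf e p q) s = hrun p (tick s).
Proof. by rewrite run_if => ->. Qed.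

Lemma run_if0 e p q s : ev s e = 0 -> hrun (CIf e p q) s = hrun q (tick s).
Proof. by rewrite run_if => ->. Qed.

End Loops.

(** * Relations of modules and of right-hand sides *)

Section ModuleCodes.
Variables (m t : nat) (G : spec m t).
Hypotheses (wfG : wf_spec G) (cgG : coarse_grained G).
Variables (A : automaton) (D : dfa t).
Hypothesis safeD : safe_dfa D G.
Notation nn := (nn G).
Notation nm := (nm G).
Implicit Types (L : 'I_m -> relation A) (K : nat -> nat -> nat -> relation A).

Lemma paths_code_ext L K K' k i j : k < size (prods G) ->
  (forall x, i < x < nn k -> K k x j = K' k x j) -> paths_code G L K k i j = paths_code G L K' k i j.
Proof.
move=> kG h; rewrite /paths_code.
have : {subset edges (rhs G k) <= edges (rhs G k)} by [].
elim: {1 3 4}(edges (rhs G k)) set0 => //= d l IH x hs.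
have hd := rhs_edge wfG kG (hs d (mem_head _ _)).
rewrite IH; last by move=> y hy; apply: hs; rewrite inE hy orbT.
congr foldl; rewrite /edge_code; case: eqP => // e; rewrite e in hd.
by case: eqP => // _; rewrite h.
Qed.

(** A well-founded recursion written with fuel: row [i] depends on later rows only, so [nn k]
    unfoldings reach the solution of the equation [K = paths_code K]. *)
Fixpoint kfix L n k i j : relation A := if n is n'.+1 then paths_code G L (kfix L n') k i j else set0.

Definition path_table L k := kfix L (nn k) k.

Lemma kfix_stable L k i j n n' : k < size (prods G) -> i < nn k -> nn k - i <= n -> nn k - i <= n' ->
  kfix L n k i j = kfix L n' k i j.
Proof.
move=> kG; elim: n n' i => [|n IH] [|n'] i hi; try lia.
move=> h1 h2 /=; apply: paths_code_ext => // x hx; apply: IH; lia.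
Qed.

Lemma path_tableE L k i j : k < size (prods G) -> i < nn k ->
  path_table L k i j = paths_code G L (path_table L) k i j.
Proof.
move=> kG hi; rewrite /path_table; case e: (nn k) => [|n]; first by lia.
rewrite -e {1}e /=; apply: paths_code_ext => // x hx; rewrite /path_table; apply: kfix_stable; lia.
Qed.

(** A module receives a code once and keeps it; by safety any production with known codes yields an
    equally valid one. So a round can only enlarge the set of modules with a code. *)
Definition updates L k := all (fun i => L (nm k i) != set0) (iota 0 (nn k)) && (L (lhs G k) == set0).
Definition update L k M :=
  if updates L k && (M == lhs G k) then production_code G L (path_table L) k else L M.
Definition round L := foldl update L (iota 0 (size (prods G))).
Definition atomic_code M : relation A := if M \in composite G then set0 else rone A.
Definition module_code := iter m round atomic_code.

Lemma update_stable L k M : L M != set0 -> update L k M = L M.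
Proof. by rewrite /update => h; case: andP => // -[/andP[_ h'] /eqP e]; rewrite e (eqP h') eqxx in h. Qed.

Lemma atomic_codes_sound : codes_sound G D atomic_code.
Proof.
rewrite /atomic_code => M; case: ifP; rewrite ?eqxx // => hM _; split; first by exists Leaf; rewrite //= hM.
move=> [|k ch] /=; first by move=> _ _; apply: has_code_ext (has_code_nil A D).
by move=> [kG e _]; have := lhs_composite wfG kG; rewrite e hM.
Qed.

Lemma update_sound L k : k < size (prods G) -> codes_sound G D L -> codes_sound G D (update L k).
Proof.
move=> kG hs M; rewrite /update; case: ifP => [/andP[/andP[h1 h2] /eqP->]|_]; last exact: hs.
have hK i j : i < nn k -> j < nn k -> path_table L k i j = paths_code G L (path_table L) k i j.
  by move=> hi _; apply: path_tableE.
have hL l : l < nn k -> L (nm k l) != set0 by move=> hl; apply: (allP h1); rewrite mem_iota.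
by have [] := production_sound wfG cgG safeD kG hs hK hL.
Qed.

Lemma updates_sound L ks : {subset ks <= iota 0 (size (prods G))} ->
  codes_sound G D L -> codes_sound G D (foldl update L ks).
Proof.
elim: ks L => //= k ks IH L hk hL; apply: IH => [k' hk'|]; first by apply: hk; rewrite inE hk' orbT.
by apply: update_sound => //; have := hk k (mem_head _ _); rewrite mem_iota.
Qed.

Lemma iter_round_sound r : codes_sound G D (iter r round atomic_code).
Proof. by elim: r => [|r IH]; [exact: atomic_codes_sound | exact: updates_sound]. Qed.

Definition closed_codes L := forall k, k < size (prods G) ->
  (forall i, i < nn k -> L (nm k i) != set0) -> L (lhs G k) != set0.

Lemma round_stable L M : L M != set0 -> round L M = L M.
Proof.
rewrite /round; elim: (iota _ _) L => //= k l IH L h.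
by rewrite IH update_stable.
Qed.

Lemma iter_round_stable L M r : L M != set0 -> iter r round L M != set0.
Proof. by move=> h; elim: r => // r IH; rewrite iterS round_stable. Qed.

(* A round that adds no module to the support leaves it closed under the productions. *)
Lemma round_closed L : codes_sound G D L ->
  (forall M, round L M != set0 -> L M != set0) -> closed_codes L.
Proof.
move=> hs h k kG hk; apply/negP => e.
suff : round L (lhs G k) != set0 by move/h; rewrite e.
have [p1 [p2 e12]] : exists p1 p2, iota 0 (size (prods G)) = p1 ++ k :: p2.
  have : k \in iota 0 (size (prods G)) by rewrite mem_iota.
  by case/splitPr => p1 p2; exists p1, p2.
rewrite /round e12 foldl_cat /=.
have st l L' M : L' M != set0 -> foldl update L' l M != set0.
  by elim: l L' => //= k' l IH L' h'; apply: IH; rewrite update_stable.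
apply: (st); set L' := foldl _ _ _.
have hs' : codes_sound G D L'.
  by apply: updates_sound => // k' hk'; rewrite e12 mem_cat hk'.
have hL l : l < nn k -> L' (nm k l) != set0 by move=> hl; apply: st; apply: hk.
have hK i j : i < nn k -> j < nn k -> path_table L' k i j = paths_code G L' (path_table L') k i j.
  by move=> hi _; apply: path_tableE.
have [hp _ _] := production_sound wfG cgG safeD kG hs' hK hL.
rewrite /update; case: ifP => // /negbT; rewrite eqxx andbT /updates => /nandP[/allPn[i]|//].
by rewrite mem_iota => /hL ->.
Qed.

Lemma closed_total L : closed_codes L -> (forall M, M \notin composite G -> L M != set0) ->
  forall M, productive G M -> L M != set0.
Proof.
move=> hc ha M [T]; elim: T M => [|k ch IH] M /=; first by move=> _; apply: ha.
move=> [kG <- hv] hcm; apply: hc => // i hi; apply: (IH i); [exact: hv | exact: hcm].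
Qed.

(** The set of modules with a code either grows in a round or is already closed under the
    productions and then contains all productive modules. It has at most [m] elements, so [m] rounds
    are enough. *)
Lemma module_code_total M : productive G M -> module_code M != set0.
Proof.
have ha L r : (forall M, M \notin composite G -> L M != set0) ->
   forall M, M \notin composite G -> iter r round L M != set0.
  by move=> h M' /h; apply: iter_round_stable.
have h0 M' : M' \notin composite G -> atomic_code M' != set0.
  move=> /negbTE h; rewrite /atomic_code h; apply/set0Pn; exists (ainit A, ainit A).
  by rewrite inE.
pose supp r := [set M | iter r round atomic_code M != set0].
have key r : r <= #|supp r| \/ (forall M, productive G M -> iter r round atomic_code M != set0).
  elim: r => [|r [IH|IH]]; first by left.
    case: (pselect (forall M, round (iter r round atomic_code) M != set0 -> iter r round atomic_code M != set0)).
      move=> h; right => N hN; have hc := round_closed (@iter_round_sound r) h.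
      rewrite iterS; have hn : iter r round atomic_code N != set0.
        by apply: (closed_total hc) hN => N' hN'; apply: ha.
      by rewrite round_stable.
    move=> /existsNP[N /not_implyP[h1 h2]]; left; apply: leq_ltn_trans IH _; apply: proper_card.
    apply/properP; split; last by exists N; rewrite inE //; apply/negP.
    by apply/subsetP => N'; rewrite !inE iterS => h; rewrite round_stable.
  by right => N /IH h; rewrite iterS round_stable.
case: (key m) => [hm hM|h]; last exact: h.
have : M \in supp m; last by rewrite inE.
suff -> : supp m = setT by rewrite inE.
apply/eqP; rewrite eqEcard subsetT cardsT card_ord; exact: hm.
Qed.

End ModuleCodes.

(** Word 2 of the input is [m]; the [m] flags of the composite modules follow, and then the number
    of productions. *)
Definition eNP := EI (EC 3 :+ EI (EC 2)).
Definition ePP k := EA aPP k (EC 0).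
Definition ePE k := EA aPE k (EC 0).
Definition eNN k := EI (ePP k :+ EC 1).
Definition eName k i := EI (ePP k :+ EC 2 :+ i).
Definition eNE k := EI (ePE k).
Definition eEdge k c i := EI (ePE k :+ EC c :+ (i :+ i :+ i)).
Definition eLam a := EA aLam a (EC 0).
(** Arrays have two indices; the two nodes of a right-hand side are packed into the second one. *)
Definition pair_expr a b := ((a :+ b) :** (a :+ b)) :+ a.
Definition pair_code x y := (x + y) * (x + y) + x.
Definition eK k i j := EA aK k (pair_expr i j).

Lemma size_enc_seq (T : Type) (f : T -> seq nat) l : (forall y, 0 < size (f y)) ->
  size l <= size (enc_seq f l).
Proof.
move=> hf; rewrite /enc_seq /= ltnW // ltnS; elim: l => //= y l IH.
by rewrite size_cat; have := hf y; lia.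
Qed.

Lemma size_enc_nth (T : Type) (f : T -> seq nat) l y0 i : i < size l ->
  size (f (nth y0 l i)) <= size (enc_seq f l).
Proof.
rewrite /enc_seq /= => hi; apply: leqW; elim: l i hi => // y l IH [|i] /= hi; rewrite size_cat; first lia.
by have := IH i hi; lia.
Qed.

Lemma size_flatten_const (T : Type) (f : T -> seq nat) c l : (forall y, size (f y) = c) ->
  size (flatten (map f l)) = c * size l.
Proof. by move=> hf; elim: l => [|y l IH]; rewrite ?muln0 //= size_cat IH hf mulnS. Qed.

(** * Reading the specification back from the input *)

Section Layout.
Variables (m t : nat) (G : spec m t) (cs : seq (seq (nat * nat))).
Variables (labs1 labs2 : seq (seq tlabel)) (inp : seq nat) (P : nat).
Hypothesis inpE : inp = enc_input G cs labs1 labs2.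
Notation ev := (ev inp P).
Notation nn := (nn G).
Notation nm := (nm G).
Notation S := (size (enc_spec G cs)).

Definition layout s :=
  [/\ forall k, k < size (prods G) -> prod_at inp G s k,
      forall c, c < size cs -> cycle_at inp cs s c
    & forall x, x < size (labs1 ++ labs2) -> label_at inp s x (nth [::] (labs1 ++ labs2) x)].

Lemma layout_frame s s' : (forall a, a < 6 -> ar s' a = ar s a) -> layout s -> layout s'.
Proof.
move=> h [h1 h2 h3]; split=> [k /h1|c /h2|x /h3].
- by rewrite /prod_at !h.
- by rewrite /cycle_at !h.
- by rewrite /label_at !h.
Qed.

Lemma at_enc_seq (T : Type) (f : T -> seq nat) l p c y0 i : at_ inp p (enc_seq f l) ->
  i < size l -> (forall y, size (f y) = c) -> at_ inp (p + 1 + c * i) (f (nth y0 l i)).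
Proof.
rewrite /enc_seq addn1 => /at_cons[_ h] hi hf; have := at_flatten (y0 := y0) hi h.
by rewrite (size_flatten_const _ hf) size_takel // ltnW.
Qed.

Lemma at_size (T : Type) (f : T -> seq nat) l p : at_ inp p (enc_seq f l) -> nth 0 inp p = size l.
Proof. by move/at_cons => []. Qed.

Let hinp : at_ inp 0 (enc_spec G cs).
Proof. by have : at_ inp 0 inp by []; rewrite {2}inpE => /at_cat[]. Qed.

Let hcomp : at_ inp 2 (enc_seq (fun M => [:: nat_of_bool (M \in composite G)]) (enum 'I_m)) /\
  at_ inp (3 + m) (enc_seq (@enc_prod m t) (prods G)).
Proof.
have := hinp; rewrite /enc_spec => /at_cat[_ /at_cat[h1 /at_cat[h2 _]]]; split=> //.
by move: h2; rewrite /enc_seq /= (size_flatten_const (c := 1)) // size_enum_ord mul1n.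
Qed.

Lemma inp_m : nth 0 inp 2 = m.
Proof. by rewrite (at_size hcomp.1) size_enum_ord. Qed.

Lemma inp_composite (M : 'I_m) : nth 0 inp (3 + M) = (M \in composite G).
Proof.
have hM : M < size (enum 'I_m) by rewrite size_enum_ord.
have := at_enc_seq (c := 1) (y0 := M) hcomp.1 hM (fun=> erefl) => /(_ 0 isT).
by rewrite /= nth_ord_enum mul1n addn0.
Qed.

Lemma ev_np s : ev s eNP = size (prods G).
Proof. by rewrite /= inp_m (at_size hcomp.2). Qed.

Section Production.
Variables (s : hstate) (k : hexpr) (kv : nat).
Hypotheses (ls : layout s) (ek : ev s k = kv) (kG : kv < size (prods G)).

Let hp : at_ inp (ar s aPP kv 0) (enc_prod (prod G kv)) /\
  ar s aPE kv 0 = ar s aPP kv 0 + 2 + nn kv.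
Proof. by have [h _ _] := ls; apply: h. Qed.

Let hp2 : [/\ nth 0 inp (ar s aPP kv 0) = lhs G kv,
  at_ inp (ar s aPP kv 0 + 1) (enc_seq (fun x : nat * 'I_m => [:: nat_of_ord x.2]) (nodes (rhs G kv)))
  & at_ inp (ar s aPE kv 0) (enc_seq (fun e => [:: esrc e; nat_of_ord (etag e); etgt e]) (edges (rhs G kv)))].
Proof.
have [h1 h2] := hp; move: h1; rewrite /enc_prod /enc_graph => /at_cons[h1 /at_cat[h3 h4]].
split=> //; first by rewrite addn1.
move: h4; rewrite h2 -/(rhs G kv) /enc_seq /= (size_flatten_const (c := 1)) // mul1n.
by rewrite addSnnS -addn2 -addnA [2 + _]addnC.
Qed.

Lemma ev_lhs : ev s (EI (ePP k)) = lhs G kv.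
Proof. by rewrite /= ek; have [] := hp2. Qed.

Lemma ev_nn : ev s (eNN k) = nn kv.
Proof. by rewrite /= ek; have [_ h _] := hp2; rewrite (at_size h). Qed.

Lemma ev_ne : ev s (eNE k) = size (edges (rhs G kv)).
Proof. by rewrite /= ek; have [_ _ h] := hp2; rewrite (at_size h). Qed.

Lemma ev_name a i : ev s a = i -> i < nn kv -> ev s (eName k a) = nm kv i.
Proof.
move=> /= -> hi; rewrite ek; have [_ h _] := hp2.
have := at_enc_seq (c := 1) (y0 := (0, start G)) h hi (fun=> erefl) => /(_ 0 isT).
rewrite /= mul1n addn0 => h2; rewrite /nm /pg_tgt /= (nth_map (0, start G)) // -h2; congr nth; lia.
Qed.

Lemma ev_edge a i d0 : ev s a = i -> i < size (edges (rhs G kv)) ->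
  let d := nth d0 (edges (rhs G kv)) i in
  [/\ ev s (eEdge k 1 a) = esrc d, ev s (eEdge k 2 a) = etag d & ev s (eEdge k 3 a) = etgt d].
Proof.
move=> /= -> hi; rewrite ek; have [_ _ h] := hp2.
have := at_enc_seq (c := 3) (y0 := d0) h hi (fun=> erefl) => h'.
have := h' 0 isT; have := h' 1 isT; have := h' 2 isT => /= <- <- <-.
by split; congr nth; lia.
Qed.

End Production.

Lemma size_enc_spec : [/\ size (enc_seq (fun M => [:: nat_of_bool (M \in composite G)]) (enum 'I_m)) <= S,
  size (enc_seq (@enc_prod m t) (prods G)) <= S & size (enc_seq enc_cycle cs) <= S].
Proof.
have h a b c d : [/\ a <= d + (a + (b + c)), b <= d + (a + (b + c)) & c <= d + (a + (b + c))].
  by split; lia.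
by rewrite /enc_spec !size_cat; apply: h.
Qed.

Lemma size_m_spec : m <= S.
Proof.
have [h _ _] := size_enc_spec; apply: leq_trans h; rewrite -{1}(size_enum_ord m).
exact: size_enc_seq.
Qed.

Lemma size_prods_spec : size (prods G) <= S.
Proof. by have [_ h _] := size_enc_spec; apply: leq_trans h; apply: size_enc_seq. Qed.

Lemma size_prod_spec k : k < size (prods G) ->
  size (nodes (rhs G k)) <= S /\ size (edges (rhs G k)) <= S.
Proof.
move=> kG; have [_ h _] := size_enc_spec.
have := leq_trans (size_enc_nth (@enc_prod m t) (start G, Graph [::] [::]) kG) h.
rewrite -/(prod G k) -/(rhs G k) /enc_prod /enc_graph [size (_ :: _)]/= size_cat -/(rhs G k).
have h1 := @size_enc_seq _ (fun x : nat * 'I_m => [:: nat_of_ord x.2]) (nodes (rhs G k)) (fun=> isT).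
have h2 := @size_enc_seq _ (fun e : nat * 'I_t * nat => [:: esrc e; nat_of_ord (etag e); etgt e]) (edges (rhs G k)) (fun=> isT).
move=> h3; split; [apply: leq_trans h1 (leq_trans _ h3) | apply: leq_trans h2 (leq_trans _ h3)].
  by apply: leqW; exact: (leq_addr _ (size _).+1).
by apply: leqW; apply: leqW; apply: leq_addl.
Qed.

Lemma size_cycle_spec c : c < size cs -> size (nth [::] cs c) <= S.
Proof.
move=> hc; have [_ _ h] := size_enc_spec.
apply: leq_trans (leq_trans (size_enc_nth enc_cycle [::] hc) h).
exact: size_enc_seq.
Qed.

End Layout.

(** * The program that fills the tables *)

Section TableProgram.
Variable A : automaton.

Definition edge_step :=
  EIf (eEdge (EG 10) 1 (EG 17) :=? EG 13)
    (ejoin A (EG 19)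
       (emul A (eletter A (eEdge (EG 10) 2 (EG 17)))
          (EIf (eEdge (EG 10) 3 (EG 17) :=? EG 15) (eone A)
             (emul A (eLam (eName (EG 10) (eEdge (EG 10) 3 (EG 17))))
                     (eK (EG 10) (eEdge (EG 10) 3 (EG 17)) (EG 15))))))
    (EG 19).

Definition fill_row :=
  CFor true 15 16 (eNN (EG 10))
    (acc_loop true 17 18 19 (eNE (EG 10)) (EC 0) edge_step ;;
     CArr aK (EG 10) (pair_expr (EG 13) (EG 15)) (EG 19)).

(* The rows are filled in from the last one, as the edges go to greater nodes. *)
Definition fill_paths :=
  CFor true 20 14 (eNN (EG 10)) (13 ::= eNN (EG 10) :- (EG 20 :+ EC 1) ;; fill_row).

Definition entry_expr := EIf (EG 15) (emul A (eLam (eName (EG 10) (EC 0))) (eK (EG 10) (EC 0) (EG 15))) (eone A).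
Definition exit_expr :=
  EIf (EG 15 :+ EC 1 :< eNN (EG 10))
    (emul A (eK (EG 10) (EG 15) (eNN (EG 10) :- EC 1)) (eLam (eName (EG 10) (eNN (EG 10) :- EC 1))))
    (eone A).

Definition fill_ends :=
  CFor true 15 16 (eNN (EG 10))
    (CArr aKI (EG 10) (EG 15) entry_expr ;; CArr aKO (EG 10) (EG 15) exit_expr).

Definition fill_production := fill_paths ;; fill_ends.

Definition update_module :=
  acc_loop true 15 16 19 (eNN (EG 10)) (EC 1) (EIf (eLam (eName (EG 10) (EG 15))) (EG 19) (EC 0)) ;;
  CIf (EIf (eLam (EI (ePP (EG 10)))) (EC 0) (EG 19))
    (CArr aLam (EI (ePP (EG 10))) (EC 0)
       (emul A (eLam (eName (EG 10) (EC 0))) (EA aKO (EG 10) (EC 0))))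
    CSkip.

(** The path tables depend on the codes of the modules, which change between two visits of a
    production. Within a round they are recomputed before each use, and at the end once more for all
    productions with the final codes. *)
Definition fill_tables :=
  CFor true 10 11 (EI (EC 2)) (CArr aLam (EG 10) (EC 0) (EIf (EI (EC 3 :+ EG 10)) (EC 0) (eone A))) ;;
  CFor true 22 23 (EI (EC 2)) (CFor true 10 11 eNP (fill_production ;; update_module)) ;;
  CFor true 10 11 eNP fill_production.

Variables (m t : nat) (G : spec m t) (cs : seq (seq (nat * nat))).
Variables (labs1 labs2 : seq (seq tlabel)) (inp : seq nat).
Hypothesis inpE : inp = enc_input G cs labs1 labs2.
Hypotheses (wfG : wf_spec G) (cgG : coarse_grained G).
Variable R : regex.
Hypothesis RA : recognizes A R.
Notation P := (table_size A).
Notation ev := (ev inp P).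
Notation hrun := (hrun inp P).
Notation nn := (nn G).
Notation nm := (nm G).
Notation S := (size (enc_spec G cs)).
Notation layout := (layout G cs labs1 labs2 inp).
Implicit Types (L : 'I_m -> relation A).

Definition module_table L s := forall M : 'I_m, ar s aLam M 0 = code (L M).
Definition row_table L k i s := forall j, j < nn k -> ar s aK k (pair_code i j) = code (path_table G L k i j).
Definition end_table L k s := forall j, j < nn k ->
  ar s aKI k j = code (entry_code G L (path_table G L) k j) /\
  ar s aKO k j = code (exit_code G L (path_table G L) k j).
Definition capped_spec s := S <= rg s rcap.

Let nn_le k : k < size (prods G) -> nn k <= S.
Proof. by move=> kG; have [] := size_prod_spec cs kG. Qed.

Lemma count_nn s k : layout s -> capped_spec s -> rg s 10 = k -> k < size (prods G) ->
  for_count inp P true s (eNN (EG 10)) = nn k.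
Proof.
move=> lay cap e10 kG; apply: for_count_capped; first exact: (ev_nn (k := EG 10) lay).
by apply: leq_trans cap; apply: nn_le.
Qed.

Lemma fill_rowP L k i s : layout s -> capped_spec s -> module_table L s -> k < size (prods G) ->
    i < nn k -> rg s 10 = k -> rg s 13 = i ->
    (forall i', i < i' < nn k -> row_table L k i' s) ->
  let s' := hrun fill_row s in
  [/\ forall i', i <= i' < nn k -> row_table L k i' s'
    & forall k' c, k' != k -> ar s' aK k' c = ar s aK k' c].
Proof.
move=> lay cap hL kG hi e10 e13 rows.
pose J j s' := [/\ forall i', i < i' < nn k -> row_table L k i' s',
   forall j', j' < j -> ar s' aK k (pair_code i j') = code (path_table G L k i j')
   & forall k' c, k' != k -> ar s' aK k' c = ar s aK k' c].
suff : J (nn k) (hrun fill_row s).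
  case=> h1 h2 h3; split=> // i' /andP[]; rewrite leq_eqVlt => /orP[/eqP<-|lt] hi' j hj; first exact: h2.
  by apply: h1 => //; rewrite lt.
apply: (run_loop (n := nn k)) => //.
- exact: count_nn.
- by move=> j u u' ea _ _ [j1 j2 j3]; split=> [i' hi' j' hj'|j' hj'|k' c hk]; rewrite ea; [apply: j1|apply: j2|apply: j3].
move=> j u hj e15 er ea [j1 j2 j3].
have lay' : layout u by apply: layout_frame lay => a ha; apply: ea; case: a ha => [|[|[|[|[|[|]]]]]].
have e10' : rg u 10 = k by rewrite er.
have e13' : rg u 13 = i by rewrite er.
have hL' : module_table L u by move=> M; rewrite ea.
rewrite run_seqE; set acc := acc_loop _ _ _ _ _ _ _.
have [|||v1 v2 _ v4] := run_acc_seq (inp := inp) (P := P) (h := @code A)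
   (F := edge_code G L (path_table G L) k i j)
   (x0 := set0) (l := edges (rhs G k)) (cl := true) (r := 17) (rn := 18) (ra := 19) (ecnt := eNE (EG 10))
   (einit := EC 0) (ebody := edge_step) (s := u) isT.
- by rewrite /= /code eqxx.
- apply: for_count_capped; last first.
    by rewrite /= /upd /= er //; apply: leq_trans cap; have [] := size_prod_spec cs kG.
  have lay2 : layout (tick (setr u 19 (@code A set0))) by apply: layout_frame lay'.
  have e2 : ev (tick (setr u 19 (@code A set0))) (EG 10) = k by [].
  exact: ev_ne lay2 e2 kG.
- move=> x e d u' he dd e17 e19 ea' er'.
  have lay'' : layout u' by apply: layout_frame lay' => a _; rewrite ea'.
  have hd : d \in edges (rhs G k) by rewrite -(dd d) mem_nth.
  have lt := rhs_edge wfG kG hd.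
  have ek10 : ev u' (EG 10) = k by rewrite /= er'.
  have [x1 x2 x3] := ev_edge lay'' ek10 kG d (e17 : ev u' (EG 17) = e) he.
  rewrite dd in x1 x2 x3.
  have /andP[slt tlt] := lt.
  have xn : ev u' (eName (EG 10) (eEdge (EG 10) 3 (EG 17))) = nm k (etgt d).
    by apply: (ev_name lay'' _ kG) => //=; rewrite er'.
  have c1 : ev u' (EG 19) = code x by [].
  have c2 := ev_eletter RA x2.
  have c4 : etgt d != j -> i < etgt d -> ev u' (emul A (eLam (eName (EG 10) (eEdge (EG 10) 3 (EG 17))))
                     (eK (EG 10) (eEdge (EG 10) 3 (EG 17)) (EG 15))) =
       code (rmul (L (nm k (etgt d))) (path_table G L k (etgt d) j)).
    move=> dj hid; apply: ev_emul; rewrite [ev _ _]/=.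
      by rewrite -[nth 0 inp _]/(ev u' (eName (EG 10) (eEdge (EG 10) 3 (EG 17)))) xn ea' hL'.
    rewrite -[nth 0 inp _]/(ev u' (eEdge (EG 10) 3 (EG 17))) x3 ea' !er' // e15 e10'.
    by apply: j1 => //; rewrite hid.
  rewrite /edge_step ev_ifeq x1 [ev u' (EG 13)]/= er' // e13' /edge_code; case: eqP => [ei|//].
  have c3 : ev u' (EIf (eEdge (EG 10) 3 (EG 17) :=? EG 15) (eone A)
             (emul A (eLam (eName (EG 10) (eEdge (EG 10) 3 (EG 17))))
                     (eK (EG 10) (eEdge (EG 10) 3 (EG 17)) (EG 15)))) = code
     (if etgt d == j then rone A else rmul (L (nm k (etgt d))) (path_table G L k (etgt d) j)).
    rewrite ev_ifeq x3 [ev u' (EG 15)]/= er' // e15 /edge_code; case: (altP eqP) => // dj.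
    by apply: c4 => //; rewrite -ei.
  exact: ev_ejoin c1 (ev_emul c2 c3).
set u1 := hrun acc u in v1 v2 v4 *; clearbody u1.
have eqs : ar (hrun (CArr aK (EG 10) (pair_expr (EG 13) (EG 15)) (EG 19)) u1) =
   upd3 (ar u) aK k (pair_code i j) (code (path_table G L k i j)).
  by rewrite /= v1 v2 !v4 // e10' e13' e15 path_tableE.
set u2 := hrun (CArr _ _ _ _) u1 in eqs *; clearbody u2; split.
- move=> i' hi' j' hj'; rewrite eqs /upd3 !eqxx ifN; first exact: j1.
  by apply/eqP => /pair_inj[]; lia.
- move=> j'; rewrite ltnS leq_eqVlt eqs /upd3 !eqxx => /orP[/eqP->|hj']; first by rewrite eqxx.
  by rewrite ifN; [apply: j2 | apply/eqP => /pair_inj[]; lia].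
- by move=> k' c hk; rewrite eqs /upd3 (negbTE hk) andbF; apply: j3.
Qed.

Lemma fill_pathsP L k s : layout s -> capped_spec s -> module_table L s -> k < size (prods G) ->
    rg s 10 = k ->
  let s' := hrun fill_paths s in
  [/\ forall i, i < nn k -> row_table L k i s'
    & forall k' c, k' != k -> ar s' aK k' c = ar s aK k' c].
Proof.
move=> lay cap hL kG e10.
pose J x s' := [/\ forall i, nn k - x <= i < nn k -> row_table L k i s'
   & forall k' c, k' != k -> ar s' aK k' c = ar s aK k' c].
suff : J (nn k) (hrun fill_paths s).
  by case=> h1 h2; split=> // i hi; apply: h1; rewrite subnn.
apply: (run_loop (n := nn k)) => //.
- exact: count_nn.
- by move=> j u u' ea _ _ [j1 j2]; split=> [i hi j' hj'|k' c hk]; rewrite ea; [apply: j1|apply: j2].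
- by split=> // i; rewrite subn0 => /andP[]; lia.
move=> x u hx e20 er ea [j1 j2]; rewrite run_seqE.
set u1 := hrun (13 ::= _) u.
have lay' : layout u by apply: layout_frame lay => a ha; apply: ea; case: a ha => [|[|[|[|[|[|]]]]]].
have e10' : rg u 10 = k by rewrite er.
have e13 : rg u1 13 = nn k - (x + 1).
  rewrite -[LHS]/(ev u (eNN (EG 10)) - (rg u 20 + 1)).
  by rewrite (ev_nn (k := EG 10) lay' e10' kG) e20.
have ea1 : ar u1 = ar u by [].
have er1 v : v != 13 -> rg u1 v = rg u v by move=> hv; rewrite /= /upd (negbTE hv).
clearbody u1.
have lay1 : layout u1 by apply: layout_frame lay' => a _; rewrite ea1.
have [|||||||h1 h2] := @fill_rowP L k (nn k - (x + 1)) u1 lay1.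
- by rewrite /capped_spec er1 // er.
- by move=> M; rewrite ea1 ea.
- by [].
- by lia.
- by rewrite er1.
- by [].
- by move=> i' hi'; rewrite /row_table ea1; apply: j1; lia.
split=> [i hi|k' c hk]; last by rewrite h2 // ea1 j2.
by apply: h1; lia.
Qed.

Lemma ev_ends L k x u : layout u -> module_table L u -> k < size (prods G) -> rg u 10 = k ->
    (forall i, i < nn k -> row_table L k i u) -> x < nn k -> rg u 15 = x ->
  ev u entry_expr = code (entry_code G L (path_table G L) k x) /\
  ev u exit_expr = code (exit_code G L (path_table G L) k x).
Proof.
move=> lay hL kG e10 hK hx e15; have e10' : ev u (EG 10) = k by [].
have n0 := nn_gt0 wfG cgG kG; have en := ev_nn lay e10' kG.
have nlast : ev u (eNN (EG 10) :- EC 1) = (nn k).-1.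
  by rewrite -[LHS]/(ev u (eNN (EG 10)) - 1) en subn1.
have lam a i : ev u a = i -> i < nn k -> ev u (eLam (eName (EG 10) a)) = code (L (nm k i)).
  move=> hi1 hi2; rewrite -[LHS]/(ar u aLam (ev u (eName (EG 10) a)) 0).
  by rewrite (ev_name lay e10' kG hi1 hi2) hL.
have kk a b i j : ev u a = i -> ev u b = j -> i < nn k -> j < nn k ->
    ev u (eK (EG 10) a b) = code (path_table G L k i j).
  move=> hi1 hj1 hi2 hj2; rewrite -[LHS]/(ar u aK (ev u (EG 10)) (pair_code (ev u a) (ev u b))).
  by rewrite hi1 hj1 e10' hK.
split.
  rewrite /entry_expr ev_if -[ev u (EG 15)]/(rg u 15) e15 /entry_code; case: (altP eqP) => // _.
  exact: ev_emul (lam (EC 0) 0 erefl n0) (kk (EC 0) (EG 15) 0 x erefl e15 n0 hx).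
rewrite /exit_expr ev_if -[ev u (_ :< _)]/(nat_of_bool (rg u 15 + 1 < ev u (eNN (EG 10)))) en e15 /exit_code.
have -> : (x == (nn k).-1) = ~~ (x + 1 < nn k) by lia.
case: ltnP => hx1; last by [].
have lt : (nn k).-1 < nn k by lia.
exact: ev_emul (kk (EG 15) _ x _ e15 nlast hx lt) (lam _ _ nlast lt).
Qed.

Lemma fill_endsP L k s : layout s -> capped_spec s -> module_table L s -> k < size (prods G) ->
    rg s 10 = k -> (forall i, i < nn k -> row_table L k i s) ->
  let s' := hrun fill_ends s in
  [/\ end_table L k s'
    & forall a k' c, k' != k -> ar s' a k' c = ar s a k' c].
Proof.
move=> lay cap hL kG e10 hK.
pose J x s' := [/\ forall j, j < x -> ar s' aKI k j = code (entry_code G L (path_table G L) k j) /\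
  ar s' aKO k j = code (exit_code G L (path_table G L) k j)
   & forall a k' c, k' != k -> ar s' a k' c = ar s a k' c].
suff : J (nn k) (hrun fill_ends s) by case=> h1 h2; split.
apply: (run_loop (n := nn k)) => //.
- exact: count_nn.
- by move=> j u u' ea _ _ [j1 j2]; split=> [i hi|a k' c hk]; rewrite ea; [apply: j1|apply: j2].
move=> x u hx e15 er ea [j1 j2].
have lay' : layout u by apply: layout_frame lay => a ha; apply: ea; case: a ha => [|[|[|[|[|[|]]]]]].
have e10' : rg u 10 = k by rewrite er.
have hK' i : i < nn k -> row_table L k i u by move=> hi j hj; rewrite ea //; apply: hK.
have hL' : module_table L u by move=> M; rewrite ea.
rewrite run_seqE; have [w1 _] := ev_ends lay' hL' kG e10' hK' hx e15.
set u1 := hrun (CArr aKI _ _ _) u.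
have g1 : rg u1 = rg u by [].
have a1 : ar u1 = upd3 (ar u) aKI k x (code (entry_code G L (path_table G L) k x)).
  by rewrite -[LHS]/(upd3 (ar u) aKI (rg u 10) (rg u 15) (ev u entry_expr)) w1 e10' e15.
clearbody u1.
have [|||||||_ w2] := @ev_ends L k x u1; rewrite ?g1 //.
- by apply: layout_frame lay' => a ha; rewrite a1; case: a ha => [|[|[|[|[|[|]]]]]].
- by move=> M; rewrite a1; apply: hL'.
- by move=> i hi j hj; rewrite a1; apply: hK'.
have a2 : ar (hrun (CArr aKO (EG 10) (EG 15) exit_expr) u1) =
   upd3 (ar u1) aKO k x (code (exit_code G L (path_table G L) k x)).
  by rewrite -[LHS]/(upd3 (ar u1) aKO (rg u1 10) (rg u1 15) (ev u1 exit_expr)) w2 g1 e10' e15.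
rewrite /J a2 a1 /upd3 /=; split.
- move=> j; rewrite ltnS leq_eqVlt !eqxx /= => /orP[/eqP->|hj]; first by rewrite eqxx.
  have -> : (j == x) = false by lia.
  exact: j1.
- move=> a k' c hk; rewrite (negbTE hk) !andbF /=; exact: j2.
Qed.

Lemma fill_productionP L k s : layout s -> capped_spec s -> module_table L s -> k < size (prods G) ->
    rg s 10 = k ->
  let s' := hrun fill_production s in
  [/\ forall i, i < nn k -> row_table L k i s', end_table L k s'
    & forall a k' c, k' != k -> ar s' a k' c = ar s a k' c].
Proof.
move=> lay cap hL kG e10; rewrite /fill_production run_seqE.
have [h1 h2] := fill_pathsP lay cap hL kG e10.
have a1 := run_ar inp P (p := fill_paths) s.
have r1 := run_rg inp P (p := fill_paths) s.
set s1 := hrun fill_paths s in h1 h2 a1 r1 *; clearbody s1.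
have [||||||h3 h4] := @fill_endsP L k s1.
- by apply: layout_frame lay => a ha; apply: a1; case: a ha => [|[|[|[|[|[|]]]]]].
- by rewrite /capped_spec r1.
- by move=> M; rewrite a1.
- by [].
- by rewrite r1.
- by [].
split=> //.
- by move=> i hi j hj; rewrite run_ar // h1.
- move=> a k' c hk; rewrite h4 //.
  by have [->|ha] := eqVneq a aK; [apply: h2 | rewrite a1 //; rewrite /= !inE].
Qed.

Lemma foldl_all (p : pred nat) l : foldl (fun b i => if p i then b else false) true l = all p l.
Proof. by elim/last_ind: l => //= l i IH; rewrite foldl_rcons all_rcons IH; case: (p i). Qed.

Lemma update_moduleP L k s : layout s -> capped_spec s -> module_table L s -> k < size (prods G) ->
  rg s 10 = k -> end_table L k s -> module_table (update G L k) (hrun update_module s).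
Proof.
move=> lay cap hL kG e10 hE; have n0 := nn_gt0 wfG cgG kG.
have e10' : ev s (EG 10) = k by [].
rewrite /update_module run_seqE.
have [|||v1 v2 _ v4] := run_acc (inp := inp) (P := P) (h := nat_of_bool)
   (F := fun (b : bool) i => if L (nm k i) != set0 then b else false) (x0 := true) (n := nn k) (cl := true)
   (r := 15) (rn := 16) (ra := 19) (ecnt := eNN (EG 10)) (einit := EC 1)
   (ebody := EIf (eLam (eName (EG 10) (EG 15))) (EG 19) (EC 0)) (s := s) isT.
- by [].
- by apply: count_nn => //; apply: layout_frame lay.
- move=> b i u hi e15 e19 ea er.
  have layu : layout u by apply: layout_frame lay => a _; rewrite ea.
  have e10u : ev u (EG 10) = k by rewrite /= er.
  rewrite ev_if -[ev u (eLam _)]/(ar u aLam (ev u (eName (EG 10) (EG 15))) 0).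
  by rewrite (ev_name (i := i) layu e10u kG) // ea hL code_eq0; case: eqP.
set u := hrun (acc_loop _ _ _ _ _ _ _) s in v1 v2 v4 *; clearbody u.
rewrite foldl_all in v1.
have layu : layout u by apply: layout_frame lay => a _; rewrite v2.
have e10u : ev u (EG 10) = k by rewrite /= v4.
have hl : ev u (EI (ePP (EG 10))) = lhs G k by apply: ev_lhs layu e10u kG.
have hlam : ev u (eLam (EI (ePP (EG 10)))) = code (L (lhs G k)).
  by rewrite -[LHS]/(ar u aLam (ev u (EI (ePP (EG 10)))) 0) hl v2 hL.
have hn : ev u (eLam (eName (EG 10) (EC 0))) = code (L (nm k 0)).
  rewrite -[LHS]/(ar u aLam (ev u (eName (EG 10) (EC 0))) 0).
  by rewrite (ev_name (i := 0) layu e10u kG) // v2 hL.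
have ho : ev u (EA aKO (EG 10) (EC 0)) = code (exit_code G L (path_table G L) k 0).
  by rewrite -[LHS]/(ar u aKO (ev u (EG 10)) 0) e10u v2; have [] := hE 0 n0.
have hm := ev_emul hn ho.
rewrite run_if ev_if hlam code_eq0.
rewrite /module_table /update /updates /production_code => M.
case: (altP (L (lhs G k) =P set0)) => hl0; last first.
  by rewrite !andbF /= v2 hL.
rewrite [ev u (EG 19)]/= v1 andbT; case: (all _ _) => /=; last by rewrite v2 hL.
rewrite /upd3 /=; have [->|ne] := eqVneq M (lhs G k).
  by rewrite -[nth 0 inp _]/(ev u (EI (ePP (EG 10)))) hl eqxx -[LHS]/(ev u (emul A (eLam (eName (EG 10) (EC 0))) (EA aKO (EG 10) (EC 0)))) hm.
rewrite -[nth 0 inp (ar u 0 _ _)]/(ev u (EI (ePP (EG 10)))) hl ifN ?v2 ?hL //.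
by rewrite andbT; apply: contra ne => /eqP /val_inj ->.
Qed.

Lemma table_moves : (forall a, a < 6 -> a \notin moda (fill_production ;; update_module)) /\
  rcap \notin modr (fill_production ;; update_module).
Proof. by split=> // a; case: a => [|[|[|[|[|[|]]]]]]. Qed.

Definition full_tables L s := module_table L s /\ forall k, k < size (prods G) ->
  (forall i, i < nn k -> row_table L k i s) /\ end_table L k s.

Lemma count_np s : capped_spec s -> for_count inp P true s eNP = size (prods G).
Proof.
move=> cap; apply: for_count_capped; first exact: (ev_np _ inpE).
by apply: leq_trans cap; apply: size_prods_spec.
Qed.

Lemma count_m s : capped_spec s -> for_count inp P true s (EI (EC 2)) = m.
Proof.
move=> cap; apply: for_count_capped; first exact: (inp_m inpE).
by apply: leq_trans cap; apply: size_m_spec.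
Qed.

Lemma fill_tablesP s : layout s -> capped_spec s ->
  full_tables (@module_code _ _ G A) (hrun fill_tables s).
Proof.
move=> lay cap; rewrite /fill_tables; do 2 rewrite run_seqE.
set p1 := CFor _ 10 11 (EI (EC 2)) _.
have h1 : module_table (@atomic_code _ _ G A) (hrun p1 s).
  pose J x s' := forall M : 'I_m, M < x -> ar s' aLam M 0 = code (@atomic_code _ _ G A M).
  suff : J m (hrun p1 s) by move=> h M; apply: h.
  apply: (run_loop (n := m)) => //.
  - exact: count_m.
  - by move=> i u u' ea _ _ hi M; rewrite ea; apply: hi.
  move=> x u hx e10 er ea hJ M; rewrite ltnS => hM.
  rewrite -[LHS]/(upd3 (ar u) aLam (rg u 10) 0 (ev u (EIf (EI (EC 3 :+ EG 10)) (EC 0) (eone A))) aLam M 0).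
  rewrite /upd3 !eqxx /= e10 andbT; case: eqP => [eM|neM]; last by apply: hJ; lia.
  by rewrite -eM (inp_composite inpE) /atomic_code; case: (_ \in _); rewrite /= /code ?eqxx.
have c1 : capped_spec (hrun p1 s) by rewrite /capped_spec run_rg.
have l1 : layout (hrun p1 s).
  by apply: layout_frame lay => a ha; rewrite run_ar //; case: a ha => [|[|[|[|[|[|]]]]]].
set s1 := hrun p1 s in h1 c1 l1 *; clearbody s1; set p2 := CFor _ 22 23 _ _.
have h2 : module_table (@module_code _ _ G A) (hrun p2 s1).
  pose J x s' := [/\ layout s', capped_spec s' & module_table (iter x (@round _ _ G A) (@atomic_code _ _ G A)) s'].
  suff : J m (hrun p2 s1) by case.
  apply: (run_loop (n := m)) => //.
  - exact: count_m.
  - move=> i u u' ea _ er [j1 j2 j3]; split.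
    + by apply: layout_frame j1 => a _; rewrite ea.
    + by rewrite /capped_spec er.
    + by move=> M; rewrite ea.
  move=> x u hx e22 er ea [j1 j2 j3]; rewrite /J iterS; set L := iter x _ _ in j3 *.
  pose J' x s' := [/\ layout s', capped_spec s' & module_table (foldl (@update _ _ G A) L (iota 0 x)) s'].
  apply: (run_loop (J := J') (n := size (prods G))) => //.
  - exact: count_np.
  - move=> i u1 u2 ea' _ er' [i1 i2 i3]; split.
    + by apply: layout_frame i1 => a _; rewrite ea'.
    + by rewrite /capped_spec er'.
    + by move=> M; rewrite ea'.
  move=> k v kG e10 erv eav [i1 i2 i3]; have [mv1 mv2] := table_moves; split.
  + by apply: layout_frame i1 => a ha; rewrite run_ar // mv1.
  + by rewrite /capped_spec run_rg.
  rewrite iota_rcons foldl_rcons run_seqE.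
  have [f1 f2 f3] := fill_productionP i1 i2 i3 kG e10.
  apply: update_moduleP => //.
  + by apply: layout_frame i1 => a ha; rewrite run_ar //; case: a ha => [|[|[|[|[|[|]]]]]].
  + by rewrite /capped_spec run_rg.
  + by move=> M; rewrite run_ar.
  + by rewrite run_rg.
have c2 : capped_spec (hrun p2 s1) by rewrite /capped_spec run_rg.
have l2 : layout (hrun p2 s1).
  by apply: layout_frame l1 => a ha; rewrite run_ar //; case: a ha => [|[|[|[|[|[|]]]]]].
set s2 := hrun p2 s1 in h2 c2 l2 *; clearbody s2.
pose J x s' := [/\ layout s', capped_spec s', module_table (@module_code _ _ G A) s' &
   forall k, k < x -> (forall i, i < nn k -> row_table (@module_code _ _ G A) k i s') /\ end_table (@module_code _ _ G A) k s'].
suff : J (size (prods G)) (hrun (CFor true 10 11 eNP fill_production) s2) by case=> _ _ ? ?; split.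
apply: (run_loop (J := J) (n := size (prods G))) => //.
- exact: count_np.
- move=> i u1 u2 ea' _ er' [i1 i2 i3 i4]; split.
  + by apply: layout_frame i1 => a _; rewrite ea'.
  + by rewrite /capped_spec er'.
  + by move=> M; rewrite ea'.
  + by move=> k /i4 [k1 k2]; split=> [i' hi' j hj|j hj]; rewrite ea'; [apply: k1|apply: k2].
move=> k v kG e10 erv eav [i1 i2 i3 i4].
have [f1 f2 f3] := fill_productionP i1 i2 i3 kG e10; split.
- by apply: layout_frame i1 => a ha; rewrite run_ar //; case: a ha => [|[|[|[|[|[|]]]]]].
- by rewrite /capped_spec run_rg.
- by move=> M; rewrite run_ar.
move=> k'; rewrite ltnS leq_eqVlt => /orP[/eqP->|hk]; first by split.
have [k1 k2] := i4 k' hk; have ne : k' != k by lia.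
by split=> [i hi j hj|j hj]; rewrite !f3 //; [apply: k1 | apply: k2].
Qed.

End TableProgram.

(** * Powers along a cycle *)

Section PowerPeriod.
Variables (T : finType) (op : T -> T -> T) (pw : nat -> T).
Hypothesis pwD : forall a b, pw (a + b) = op (pw a) (pw b).

(** By the pigeonhole principle [pw i = pw j] for some [i < j] with [j] at most the order of [T].
    The factorial of this order is a multiple of the period [j - i] and at least the preperiod [i],
    so it serves for all elements at once. *)
Lemma power_period q q' : #|T|`! <= q -> #|T|`! <= q' -> q = q' %[mod #|T|`!] -> pw q = pw q'.
Proof.
set N := #|T|`! => hq hq' e.
have [i [j [ij hj eij]]] : exists i j, [/\ i < j, j <= #|T| & pw i = pw j].
  have /injectivePn : ~~ injectiveb (fun i : 'I_(#|T|.+1) => pw i).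
    by apply/negP => /injectiveP /leq_card; rewrite card_ord ltnn.
  case=> x [y ne exy]; case: (ltngtP x y) => h.
  - by exists x, y; split=> //; rewrite -ltnS.
  - by exists y, x; split=> //; rewrite -ltnS.
  - by rewrite (val_inj h) eqxx in ne.
have step a : i <= a -> pw (a + (j - i)) = pw a.
  move=> ia; have -> : a + (j - i) = j + (a - i) by lia.
  by rewrite pwD -eij -pwD subnKC.
have steps c a : i <= a -> pw (a + c * (j - i)) = pw a.
  by move=> ia; elim: c => [|c IH]; rewrite ?addn0 // mulSn addnCA addnC step ?IH //; lia.
have dv : j - i %| N by apply: dvdn_fact; lia.
have iN : i <= N.
  by apply: leq_trans (leq_trans (ltnW ij) hj) _; rewrite /N; case: #|T| => // n; apply: fact_geq.
have key a : N <= a -> pw a = pw (N + a %% N).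
  move=> ha; have N0 : 0 < N by rewrite fact_gt0.
  have ea : a = (N + a %% N) + (a %/ N).-1 * N.
    by rewrite {1}(divn_eq a N) -{1}(prednK (n := a %/ N)) ?divn_gt0 // mulSn; lia.
  have [d ed] := dvdnP dv; have eN : (a %/ N).-1 * N = (a %/ N).-1 * d * (j - i) by rewrite -mulnA -ed.
  rewrite {1}ea eN steps //.
  exact: leq_trans iN (leq_addr _ _).
by rewrite key // [RHS]key // e.
Qed.

End PowerPeriod.

Section Cycles.
Variable A : automaton.
Definition period := #|{: relation A}|`!.

(** A large [n] is replaced by a bounded number congruent to it modulo [period * l]. Adding
    [period * l] to the remainder keeps the number of turns around the cycle within the periodic
    range. *)
Definition reduce_count l n := if n < period * l then n else period * l + n %% (period * l).

Lemma reduce_count_le l n : 0 < l -> reduce_count l n <= 2 * (period * l).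
Proof.
move=> l0; rewrite /reduce_count; case: ltnP => h; first by lia.
have := @ltn_pmod n (period * l); rewrite muln_gt0 l0 fact_gt0 => /(_ isT); lia.
Qed.

Variables (m t : nat) (G : spec m t) (cs : seq (seq (nat * nat))).
Hypotheses (co : cycle_ordering G cs).
Variables (op : relation A -> relation A -> relation A) (one : relation A) (f : nat * nat -> relation A).
Hypotheses (opA : associative op) (op1 : right_id one op) (opl1 : left_id one op).
Notation cycle_value := (cycle_value cs op one f).

Lemma cycle_valueD s r a b : cycle_value s r (a + b) = op (cycle_value s r a) (cycle_value s (r + a) b).
Proof.
elim: b => [|b IH]; first by rewrite addn0 op1.
by rewrite addnS !cycle_valueS IH opA addnA.
Qed.

Lemma cycle_value_mod s r n q : cycle_value s (r + q * size (nth [::] cs s)) n = cycle_value s r n.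
Proof.
elim: n => // n IH; rewrite !cycle_valueS IH /cycle_edge; congr (op _ (f (nth _ _ _))).
by rewrite -addnA addnCA modnMDl.
Qed.

(** The product over [q] full turns is the [q]-th power of the product over one turn. The reduction
    keeps the remainder modulo the length of the cycle, and the numbers of turns before and after
    are congruent and both at least [period]. *)
Lemma cycle_value_reduce s r n : s < size cs ->
  cycle_value s r (reduce_count (size (nth [::] cs s)) n) = cycle_value s r n.
Proof.
move=> hs; set l := size _; have l0 : 0 < l by rewrite lt0n size_eq0; have /and4P[] := nth_cycle co hs.
pose pw q := cycle_value s r (q * l).
have pwD a b : pw (a + b) = op (pw a) (pw b) by rewrite /pw mulnDl cycle_valueD cycle_value_mod.
have dec k : cycle_value s r k = op (pw (k %/ l)) (cycle_value s r (k %% l)).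
  by rewrite {1}(divn_eq k l) cycle_valueD cycle_value_mod.
rewrite /reduce_count; case: ltnP => // h; have N0 : 0 < period by rewrite fact_gt0.
rewrite dec [RHS]dec; have -> : (period * l + n %% (period * l)) %% l = n %% l.
  by rewrite modnMDl modn_dvdm // dvdn_mull.
congr (op _ _); apply: (power_period pwD).
- by rewrite leq_divRL //; rewrite -/period; lia.
- by rewrite leq_divRL.
- rewrite -/period divnMDl // modnDl.
  by rewrite [period * l]mulnC modn_divl ?[l * _]mulnC // modn_divl mulnC modn_mod.
Qed.

End Cycles.

(** * The program for products along a cycle *)

Section CycleProgram.
Variable A : automaton.
Notation P := (table_size A).

Definition eLength := EI (EA aCP (EG 30) (EC 0)).
Definition ePeriod := EC (period A) :** eLength.
Definition cycle_count :=
  EIf (EG 32 :< ePeriod) (EG 32) (ePeriod :+ EO Mod (EG 32) ePeriod).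
Definition cycle_index r := EO Mod r eLength.
Definition cycle_field c r := EI (EA aCP (EG 30) (EC 0) :+ EC c :+ (cycle_index r :+ cycle_index r)).

(** The flag is true for the right node of a pair, which is reached through entries in the order of
    its label, and false for the left node, which is left through exits in the reverse order. *)
Definition ordered_mul (b : bool) x y := if b then emul A x y else emul A y x.
Definition step_array (b : bool) := if b then aKI else aKO.

Definition cycle_product_from e b :=
  acc_loop true 34 35 33 cycle_count (eone A)
    (ordered_mul b (EG 33)
       (EA (step_array b) (cycle_field 1 (e :+ EG 34)) (cycle_field 2 (e :+ EG 34)))).
Definition cycle_product := cycle_product_from (EG 31).

Variables (m t : nat) (G : spec m t) (cs : seq (seq (nat * nat))).
Variables (labs1 labs2 : seq (seq tlabel)) (inp : seq nat).
Hypotheses (co : cycle_ordering G cs).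
Notation ev := (ev inp P).
Notation hrun := (hrun inp P).
Notation S := (size (enc_spec G cs)).
Notation layout := (layout G cs labs1 labs2 inp).
Variable L : 'I_m -> relation A.
Notation K := (path_table G L).

Definition ordered_op (b : bool) : relation A -> relation A -> relation A :=
  if b then @rmul A else @rmul_rev A.
Definition step_value (b : bool) := if b then entry_of G L K else exit_of G L K.
Definition cycle_val b := cycle_value cs (ordered_op b) (rone A) (step_value b).
Definition labels_val b := labels_value cs (ordered_op b) (rone A) (step_value b).

Lemma ordered_opA b : associative (ordered_op b).
Proof. by case: b => x y z; rewrite /= /rmul_rev rmulA. Qed.
Lemma ordered_op1 b : right_id (rone A) (ordered_op b).
Proof. by case: b => x; rewrite /= /rmul_rev ?rmul1 ?r1mul. Qed.
Lemma ordered_opl1 b : left_id (rone A) (ordered_op b).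
Proof. by case: b => x; rewrite /= /rmul_rev ?rmul1 ?r1mul. Qed.

Lemma ev_ordered_mul b s x y c d : ev s x = code c -> ev s y = code d ->
  ev s (ordered_mul b x y) = code (ordered_op b c d).
Proof. by case: b => hx hy; apply: ev_emul. Qed.

Lemma ev_cycle_field s c r : layout s -> c < size cs -> rg s 30 = c ->
  let e := cycle_edge cs c (ev s r) in
  [/\ ev s eLength = size (nth [::] cs c), ev s (cycle_field 1 r) = e.1 & ev s (cycle_field 2 r) = e.2].
Proof.
move=> [_ h _] hc e30; have hat := h c hc.
have l0 : 0 < size (nth [::] cs c) by rewrite lt0n size_eq0; have /and4P[] := nth_cycle co hc.
have el : ev s eLength = size (nth [::] cs c) by rewrite /= e30 (at_size hat).
have h' := at_enc_seq (y0 := (0, 0)) (c := 2) hat (ltn_pmod (ev s r) l0) (fun=> erefl).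
have := h' 0 isT; have := h' 1 isT => /= <- <-; rewrite e30 (at_size hat); split=> //; congr nth; lia.
Qed.

Lemma cycle_product_fromP e0 x0 b s c : layout s -> full_tables G L s -> 2 * period A * S <= rg s rcap ->
    c < size cs -> rg s 30 = c ->
    (forall u, ar u = ar s -> (forall v, v \notin [:: 34; 35; 33] -> rg u v = rg s v) -> ev u e0 = x0) ->
  let s' := hrun (cycle_product_from e0 b) s in
  [/\ rg s' 33 = code (cycle_val b c x0 (rg s 32)), ar s' = ar s, ou s' = ou s
    & forall v, v \notin [:: 34; 35; 33] -> rg s' v = rg s v].
Proof.
move=> lay [_ hT] cap hc e30 e0E.
have l0 : 0 < size (nth [::] cs c) by rewrite lt0n size_eq0; have /and4P[] := nth_cycle co hc.
have lS := size_cycle_spec G hc.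
have [|||h1 h2 h3 h4] := run_acc (inp := inp) (P := P) (h := @code A)
   (F := fun acc x => ordered_op b acc (step_value b (cycle_edge cs c (x0 + x))))
   (x0 := rone A) (n := reduce_count A (size (nth [::] cs c)) (rg s 32)) (cl := true)
   (r := 34) (rn := 35) (ra := 33) (ecnt := cycle_count) (einit := eone A)
   (ebody := ordered_mul b (EG 33)
       (EA (step_array b) (cycle_field 1 (e0 :+ EG 34)) (cycle_field 2 (e0 :+ EG 34)))) (s := s) isT.
- by [].
- set s1 := tick _; apply: for_count_capped; last first.
    apply: leq_trans (reduce_count_le _ _ l0) _; apply: leq_trans cap.
    by rewrite mulnA leq_mul2l lS orbT.
  have lay1 : layout s1 by apply: layout_frame lay.
  have [el _ _] := ev_cycle_field (EC 0) lay1 hc e30.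
  rewrite /cycle_count ev_if -[ev s1 (EG 32 :< _)]/(nat_of_bool (rg s 32 < period A * ev s1 eLength)).
  rewrite el /reduce_count; case: ltnP => _ //.
  by rewrite -[LHS]/(period A * ev s1 eLength + (rg s 32 %% (period A * ev s1 eLength))) el.
- move=> x i u hi e34 e33 ea er.
  have layu : layout u by apply: layout_frame lay => a _; rewrite ea.
  have e30u : rg u 30 = c by rewrite er.
  have [_] := ev_cycle_field (e0 :+ EG 34) layu hc e30u.
  have -> : ev u (e0 :+ EG 34) = x0 + i by rewrite -[LHS]/(ev u e0 + rg u 34) e34 e0E.
  set e := cycle_edge _ _ _ => f1 f2.
  have /(cycle_edge_valid co)/andP[kG hj] := cycle_edge_mem co (x0 + i) hc.
  apply: ev_ordered_mul; first by rewrite /= e33.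
  rewrite -[LHS]/(ar u (step_array b) (ev u (cycle_field 1 (e0 :+ EG 34))) (ev u (cycle_field 2 (e0 :+ EG 34)))).
  rewrite f1 f2 ea; have [_ /(_ _ hj)[k1 k2]] := hT _ kG.
  by case: (b).
split=> //; rewrite h1 -[foldl _ _ _]/(cycle_value cs (ordered_op b) (rone A) (step_value b) c x0
   (reduce_count A (size (nth [::] cs c)) (rg s 32))).
rewrite (cycle_value_reduce co) //; [exact: ordered_opA | exact: ordered_op1].
Qed.

Lemma cycle_productP b s c : layout s -> full_tables G L s -> 2 * period A * S <= rg s rcap ->
    c < size cs -> rg s 30 = c ->
  let s' := hrun (cycle_product b) s in
  [/\ rg s' 33 = code (cycle_val b c (rg s 31) (rg s 32)), ar s' = ar s, ou s' = ou s
    & forall v, v \notin [:: 34; 35; 33] -> rg s' v = rg s v].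
Proof. by move=> lay ft cap hc e30; apply: cycle_product_fromP => // u _ h; rewrite /= h. Qed.

End CycleProgram.

(** * The trie of labels and the joins *)

(* Children in the trie; trie node of each prefix of each label; nodes at which a label of the
   given side has ended; values of the suffixes of the labels; fields of the joins; for each
   trie node and side, the list of its joins and the size of this list. *)
Notation aNX := 10.
Notation aCUR := 11.
Notation aSEEN := 12.
Notation aLV := 13.
Notation aEF := 14.
Notation aLS := 15.
Notation aCT := 16.

Definition word4 := (nat * nat * nat * nat)%type.

Definition word_code (w : word4) :=
  pair_code (pair_code w.1.1.1 w.1.1.2) (pair_code w.1.2 w.2).

Lemma word_code_inj : injective word_code.
Proof.
move=> [[[a b] c] d] [[[a' b'] c'] d'] /pair_inj /= [] /pair_inj[-> ->] /pair_inj[-> ->].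
by [].
Qed.

(** The tags 0 and 1 differ from the tags 2 to 5 of the joins, so the children for labels and those
    for names of joins share one table. *)
Definition label_word (l : tlabel) : word4 :=
  match l with ProdLabel k i => (0, k, i, 0) | RecLabel s u a => (1, s, u, a) end.

Lemma label_word_inj : injective label_word.
Proof. by case=> [k i|s u a] [k' i'|s' u' a'] [] // -> -> // ->. Qed.

Definition eWord := pair_expr (pair_expr (EG 36) (EG 37)) (pair_expr (EG 38) (EG 39)).

(* The child of node [EG 42] along the word in registers 36 to 39, created if it is missing. *)
Definition intern :=
  CIf (EA aNX (EG 42) eWord) CSkip
    (40 ::= EG 40 :+ EC 1 ;; CArr aNX (EG 42) eWord (EG 40)) ;;
  43 ::= EA aNX (EG 42) eWord.

Definition eLabel := EA aLT (EG 24) (EG 27).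
Definition eSize := EI (EA aLP (EG 24) (EC 0)).

Definition load_label :=
  36 ::= EI eLabel ;; 37 ::= EI (eLabel :+ EC 1) ;; 38 ::= EI (eLabel :+ EC 2) ;;
  39 ::= EIf (EI eLabel) (EI (eLabel :+ EC 3)) (EC 0).

Definition trace_step :=
  load_label ;; intern ;; 42 ::= EG 43 ;; CArr aCUR (EG 24) (EG 27 :+ EC 1) (EG 42).

Definition trace :=
  42 ::= EC 0 ;; CArr aCUR (EG 24) (EC 0) (EC 0) ;; CFor true 27 28 eSize trace_step.

Definition word_at (s : hstate) (w : word4) :=
  [/\ rg s 36 = w.1.1.1, rg s 37 = w.1.1.2, rg s 38 = w.1.2 & rg s 39 = w.2].

Definition child (s : hstate) v (w : word4) := ar s aNX v (word_code w).

(** Every nonzero node is the child of only one node along only one word, and register 40 bounds all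
    nodes, so the next number is fresh. The value 0 is the root and at the same time the mark of a
    missing child, which is consistent because the root is never a child. *)
Definition trie_ok (s : hstate) :=
  (forall v c, ar s aNX v c <= rg s 40) /\
  (forall v c v' c', ar s aNX v c != 0 -> ar s aNX v c = ar s aNX v' c' -> v = v' /\ c = c').

Definition trie_le (s s' : hstate) := forall v c, ar s aNX v c != 0 -> ar s' aNX v c = ar s aNX v c.

Lemma trie_le_refl s s' : ar s' aNX = ar s aNX -> trie_le s s'.
Proof. by move=> e v c _; rewrite e. Qed.

Lemma trie_le_trans s2 s1 s3 : trie_le s1 s2 -> trie_le s2 s3 -> trie_le s1 s3.
Proof. by move=> h1 h2 v c hc; rewrite h2 ?h1. Qed.

Lemma trie_ok_frame s s' : ar s' aNX = ar s aNX -> rg s' 40 = rg s 40 -> trie_ok s -> trie_ok s'.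
Proof. by move=> e1 e2 [h1 h2]; split; rewrite e1 ?e2. Qed.

Definition traced (s : hstate) x (ls : seq tlabel) :=
  ar s aCUR x 0 = 0 /\ forall q, q < size ls ->
    ar s aCUR x q.+1 != 0 /\ child s (ar s aCUR x q) (label_word (nth tlabel0 ls q)) = ar s aCUR x q.+1.

Lemma traced_le s s' x ls : trie_le s s' -> ar s' aCUR x = ar s aCUR x -> traced s x ls -> traced s' x ls.
Proof.
move=> le e [h1 h2]; split; first by rewrite e.
by move=> q hq; have [h3 h4] := h2 q hq; rewrite e; split=> //; rewrite /child le // -/(child _ _ _) h4.
Qed.

(** Climbing from a common node, the injectivity in [trie_ok] recovers one label after the other. A
    comparison of prefixes thereby becomes a comparison of two numbers. *)
Lemma traced_prefix s x y ls ls' q q' : trie_ok s -> traced s x ls -> traced s y ls' ->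
  q <= size ls -> q' <= size ls' -> ar s aCUR x q = ar s aCUR y q' ->
  q = q' /\ take q ls = take q' ls'.
Proof.
move=> [_ inj] [x0 hx] [y0 hy]; elim: q q' => [|q IH] [|q'] hq hq'.
- by rewrite !take0.
- by rewrite x0 => e; have [] := hy q' hq'; rewrite -e.
- by rewrite y0 => e; have [] := hx q hq; rewrite e.
have [n1 e1] := hx q hq; have [n2 e2] := hy q' hq' => e.
have [] := inj _ _ _ _ _ (etrans e1 (etrans e (esym e2))); first by rewrite -/(child _ _ _) e1.
move=> /IH[||eqq et]; try exact: ltnW.
move=> /word_code_inj/label_word_inj el; subst q'; split=> //.
by rewrite (take_nth tlabel0 hq) (take_nth tlabel0 hq') et el.
Qed.

Lemma traced_same s x y ls : trie_ok s -> traced s x ls -> traced s y ls ->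
  forall q, q <= size ls -> ar s aCUR x q = ar s aCUR y q.
Proof.
move=> _ [x0 hx] [y0 hy]; elim=> [|q IH] hq; first by rewrite x0.
by have [_ <-] := hx q hq; have [_ <-] := hy q hq; rewrite IH // ltnW.
Qed.

Section Trie.
Variables (m t : nat) (G : spec m t) (cs : seq (seq (nat * nat))).
Variables (labs1 labs2 : seq (seq tlabel)) (inp : seq nat) (P : nat).
Notation ev := (ev inp P).
Notation hrun := (hrun inp P).
Notation layout := (layout G cs labs1 labs2 inp).
Notation lab := (nth [::] (labs1 ++ labs2)).
Notation nlabs := (size (labs1 ++ labs2)).

Lemma ev_word s w : word_at s w -> ev s eWord = word_code w.
Proof. by move=> [h1 h2 h3 h4]; rewrite /= h1 h2 h3 h4. Qed.

Lemma internP s w : trie_ok s -> word_at s w ->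
  let s' := hrun intern s in
  [/\ trie_ok s', trie_le s s', rg s' 43 = child s' (rg s 42) w & rg s' 43 != 0].
Proof.
move=> [le inj] hw; rewrite /intern run_seqE.
have ew := ev_word hw; set c := word_code w in ew *.
have ex : ev s (EA aNX (EG 42) eWord) = ar s aNX (rg s 42) c by rewrite -ew.
have last s1 : rg s1 42 = rg s 42 -> word_at s1 w ->
   let s' := hrun (43 ::= EA aNX (EG 42) eWord) s1 in
   [/\ rg s' 43 = ar s1 aNX (rg s 42) c, ar s' = ar s1 & rg s' 40 = rg s1 40].
  move=> e42 /ev_word ew1; split=> //.
  by rewrite -[LHS]/(ar s1 aNX (rg s1 42) (ev s1 eWord)) ew1 e42.
set p2 := CSet 43 _ in last *.
have [h0|h0] := eqVneq (ar s aNX (rg s 42) c) 0; last first.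
  rewrite run_if1 ?ex //; set s0 := hrun CSkip (tick s).
  have [a0 r0] : ar s0 = ar s /\ rg s0 = rg s by [].
  clearbody s0; have [||e1 e2 e3] := last s0; rewrite /word_at ?r0 //.
  set s' := hrun p2 s0 in e1 e2 e3 *; clearbody s'.
  by split; rewrite /trie_ok /trie_le /child ?e1 ?e2 ?e3 ?a0 ?r0.
rewrite run_if0 ?ex //; set s1 := hrun (CSeq _ _) (tick s).
have a1 : ar s1 = upd3 (ar s) aNX (rg s 42) c (rg s 40).+1.
  have e : ev (hrun (40 ::= EG 40 :+ EC 1) (tick s)) eWord = c by apply: ev_word.
  by rewrite /s1 -[LHS]/(upd3 (ar s) aNX (rg s 42) (ev (hrun (40 ::= EG 40 :+ EC 1) (tick s)) eWord) (rg s 40 + 1)) e addn1.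
have r1 : rg s1 40 = (rg s 40).+1 by rewrite /s1 /= /upd /= addn1.
have w1 : word_at s1 w by [].
have [e1 e2 e3] := last s1 erefl w1.
set s' := hrun _ s1 in e1 e2 e3 *; clearbody s' s1.
have nz : rg s' 43 = (rg s 40).+1 by rewrite e1 a1 /upd3 !eqxx.
split; last by rewrite nz.
- rewrite /trie_ok e2 e3 r1 a1 /upd3 /=; split=> [v d|v d v' d'].
    by case: ifP => // _; apply: leqW.
  case: ifP => [/andP[/eqP-> /eqP->]|_]; case: ifP => [/andP[/eqP-> /eqP->]|_] //.
  + by move=> _ e; have := le v' d'; rewrite -e ltnn.
  + by move=> _ e; have := le v d; rewrite e ltnn.
  + exact: inj.
- move=> v d hd; rewrite e2 a1 /upd3 /=; case: ifP => // /andP[/eqP e4 /eqP e5].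
  by rewrite e4 e5 h0 in hd.
- by rewrite nz /child e2 a1 /upd3 !eqxx.
Qed.

Lemma ev_size s x : layout s -> rg s 24 = x -> x < nlabs -> ev s eSize = size (lab x).
Proof. by move=> [_ _ h] e24 hx; have [h1 _ _] := h x hx; rewrite /= e24 (at_size h1). Qed.

Lemma load_labelP s x q : layout s -> rg s 24 = x -> rg s 27 = q -> x < nlabs -> q < size (lab x) ->
  word_at (hrun load_label s) (label_word (nth tlabel0 (lab x) q)).
Proof.
move=> [_ _ h] e24 e27 hx hq; have [_ _ h3] := h x hx; have := h3 q hq.
rewrite /load_label /word_at /= /upd /= e24 e27.
by case: (nth _ _ q) => [k i|c u a] hat; have := hat 0 isT; have := hat 1 isT; have := hat 2 isT;
   rewrite ?addn0 => -> -> -> //=; have := hat 3 isT => ->.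
Qed.

Lemma traceP s x : layout s -> trie_ok s -> rg s 24 = x -> x < nlabs -> size (lab x) <= rg s rcap ->
  let s' := hrun trace s in
  [/\ trie_ok s', trie_le s s', traced s' x (lab x) & forall y, y != x -> ar s' aCUR y = ar s aCUR y].
Proof.
move=> lay tr e24 hx cap; rewrite /trace; do 2 rewrite run_seqE.
set s1 := hrun (CArr _ _ _ _) _.
have a1 : ar s1 = upd3 (ar s) aCUR x 0 0 by rewrite /s1 /= /upd /= e24.
have r1 v : v != 42 -> rg s1 v = rg s v by move=> hv; rewrite /s1 /= /upd (negbTE hv).
have z1 : rg s1 42 = 0 by [].
clearbody s1.
have lay1 : layout s1 by apply: layout_frame lay => a ha; rewrite a1; case: a ha => [|[|[|[|[|[|]]]]]].
pose J q s' := [/\ trie_ok s' /\ trie_le s s', ar s' aCUR x 0 = 0,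
  forall q', q' < q -> ar s' aCUR x q'.+1 != 0 /\
    child s' (ar s' aCUR x q') (label_word (nth tlabel0 (lab x) q')) = ar s' aCUR x q'.+1,
  rg s' 42 = ar s' aCUR x q & forall y, y != x -> ar s' aCUR y = ar s aCUR y].
suff : J (size (lab x)) (hrun (CFor true 27 28 eSize trace_step) s1).
  by case=> -[h1 h2] h3 h4 _ h5; split.
apply: (run_loop (J := J) (n := size (lab x))) => //.
- by apply: for_count_capped; rewrite ?r1 //; apply: (ev_size lay1); rewrite ?r1.
- move=> i u u' ea _ er [[j1 j1'] j2 j3 j4 j5]; split; rewrite /child ?ea ?er //.
  by split; [apply: trie_ok_frame j1; rewrite ?ea ?er | move=> v c hc; rewrite ea j1'].
- split=> //.
  + split; first by apply: trie_ok_frame tr; rewrite ?a1 ?r1.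
    by apply: trie_le_refl; rewrite a1.
  + by rewrite a1 /upd3 !eqxx.
  + by rewrite z1 a1 /upd3 !eqxx.
  + move=> y hy; rewrite a1 /upd3 /=; apply: boolp.funext => z; by rewrite (negbTE hy).
move=> q u hq e27 er ea [[j1 j1'] j2 j3 j4 j5].
have e24u : rg u 24 = x by rewrite er // r1.
have layu : layout u.
  by apply: layout_frame lay1 => a ha; rewrite ea //; case: a ha => [|[|[|[|[|[|]]]]]].
rewrite /trace_step; do 3 rewrite run_seqE.
have hw := load_labelP layu e24u e27 hx hq.
have ra := run_ar inp P (p := load_label) u; have rr := run_rg inp P (p := load_label) u.
set u1 := hrun load_label u in hw ra rr *; clearbody u1.
have tr1 : trie_ok u1 by apply: trie_ok_frame j1; rewrite ?ra ?rr.
have [k1 k2 k3 k4] := internP tr1 hw.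
have ra2 := run_ar inp P (p := intern) u1; have rr2 := run_rg inp P (p := intern) u1.
set u2 := hrun intern u1 in k1 k2 k3 k4 ra2 rr2 *; clearbody u2.
set u3 := hrun _ _.
have a3 : ar u3 = upd3 (ar u2) aCUR x q.+1 (rg u2 43).
  by rewrite /u3 /= /upd /= (rr2 24) // (rr2 27) // (rr 24) // (rr 27) // e24u e27 addn1.
have [r40 r42] : rg u3 40 = rg u2 40 /\ rg u3 42 = rg u2 43 by [].
clearbody u3.
have le : trie_le u u3.
  move=> v c hc; rewrite a3 /upd3 /= k2; by rewrite ra.
have cur q' : q' <= q -> ar u3 aCUR x q' = ar u aCUR x q'.
  by move=> hq'; rewrite a3 /upd3 !eqxx /= ifN ?ra2 // ?ra // neq_ltn ltnS hq'.
have cur1 : ar u3 aCUR x q.+1 = rg u2 43 by rewrite a3 /upd3 !eqxx.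
split.
- split; first by apply: trie_ok_frame k1; rewrite ?a3.
  exact: trie_le_trans j1' le.
- by rewrite cur.
- move=> q'; rewrite ltnS leq_eqVlt => /orP[/eqP->|hq'].
    rewrite cur1 cur //; split=> //; rewrite k3 /child a3 /upd3 /= rr // j4; exact: erefl.
  have [i1 i2] := j3 q' hq'; rewrite !cur //; last exact: ltnW.
  by split=> //; rewrite /child le // -/(child _ _ _) i2.
- by rewrite r42 cur1.
- move=> y hy; rewrite -j5 // a3 /upd3 /=; apply: boolp.funext => z.
  by rewrite (negbTE hy) /= ra2 // ra.
Qed.

End Trie.

(** * Joins and the matching of two labels *)

Section Joins.
Variables (m t : nat) (G : spec m t) (cs : seq (seq (nat * nat))).
Hypotheses (wfG : wf_spec G) (co : cycle_ordering G cs).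
Variables (A : automaton) (L : 'I_m -> relation A) (T : nat).
Hypothesis T0 : 0 < T.
Notation K := (path_table G L).
Notation nn := (nn G).
Notation labels_val := (labels_val G cs L).
Notation cycle_val := (cycle_val G cs L).
Notation op := (@ordered_op A).

Lemma paths_code_edge K' k i j : paths_code G L K' k i j != set0 ->
  exists2 d, d \in edges (rhs G k) & esrc d = i /\ (etgt d = j \/ K' k (etgt d) j != set0).
Proof.
rewrite /paths_code; elim/last_ind: (edges (rhs G k)) => [|l d IH] /=; first by rewrite eqxx.
rewrite foldl_rcons {1}/edge_code; case: (esrc d =P i) => [ed|_]; last first.
  by move=> h; have [d' hd h'] := IH h; exists d' => //; rewrite mem_rcons inE hd orbT.
have [h|h _] := boolP (foldl (edge_code G L K' k i j) set0 l == set0); last first.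
  by have [d' hd h'] := IH h; exists d' => //; rewrite mem_rcons inE hd orbT.
rewrite (eqP h) set0U => hn; exists d; first by rewrite mem_rcons mem_head.
split=> //; case: (altP (etgt d =P j)) hn => [->|_ hn]; first by left.
right; apply: contraNneq hn => ->; apply/eqP/setP => x; rewrite !inE.
by apply/existsP => -[y]; rewrite !inE => /andP[_ /existsP[z]]; rewrite !inE andbF.
Qed.

Lemma path_table_lt k i j : k < size (prods G) -> K k i j != set0 -> i < j.
Proof.
move=> kG; rewrite /path_table; elim: (nn k) i => [|n IH] i /=; first by rewrite eqxx.
move=> /paths_code_edge[d hd [ei hj]]; have /andP[lt _] := rhs_edge wfG kG hd.
by case: hj => [<-|/IH h]; rewrite -ei //; apply: ltn_trans h.
Qed.

(* Depth, name, key and value.  The name starts with 2 for the end of the label, 3 for a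
   production, 4 or 5 for a recursion in which the right or the left label is the deeper one. *)
Definition join := (nat * word4 * nat * relation A)%type.

Definition path_rel (b : bool) k i j := if b then K k j i else K k i j.

(** The label branches off the recursion at member [a]. Another label can go deeper in the same
    recursion only through the cycle edge [e] of that member; so the production used must be the one
    of [e], and the two nodes involved are [i], read off the label, and [e.2]. *)
Definition deep_joins (b : bool) q s u a (r : seq tlabel) : seq join :=
  if r is ProdLabel k i :: r' then
    let e := cycle_edge cs s (u + a) in
    if (e.1 == k) && (path_rel b k i e.2 != set0)
    then [:: (q, (4 + b, s, u, 0), a, op b (path_rel b k i e.2) (labels_val b r'))] else [::]
  else [::].

(** For indices below [T] the sum of the keys [a] and [T - b] is less than [T] exactly when [a < b].
    The order of two indices becomes a threshold on a sum, which has the same form whichever side is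
    the deeper one. *)
Definition shallow_join (b : bool) q s u a (r : seq tlabel) : join :=
  (q, (4 + ~~ b, s, u, 0), T - a, labels_val b r).

(** The name lists the nodes in the order left, right for both sides, so that the two joins of a
    pair agree. Only the left one carries the table entry, which is thus multiplied once. The keys
    are 0 because the name alone decides. *)
Definition prod_join (b : bool) q k i (r : seq tlabel) j : join :=
  (q, (3, k, if b then j else i, if b then i else j), 0,
   if b then labels_val b r else op b (path_rel b k i j) (labels_val b r)).

Definition prod_joins (b : bool) q k i (r : seq tlabel) n : seq join :=
  [seq prod_join b q k i r j | j <- iota 0 n & path_rel b k i j != set0].

Definition end_join q : join := (q, (2, 0, 0, 0), 0, rone A).

Definition joins_at (b : bool) (ls : seq tlabel) q : seq join :=
  match drop q ls with
  | [::] => [::]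
  | ProdLabel k i :: r => prod_joins b q k i r (nn k)
  | RecLabel s u a :: r => rcons (deep_joins b q s u a r) (shallow_join b q s u a r)
  end.

Definition joins b ls := rcons (flatten [seq joins_at b ls q | q <- iota 0 (size ls)]) (end_join (size ls)).

Inductive join_at (b : bool) (ls : seq tlabel) : join -> Prop :=
  | JoinEnd : join_at b ls (end_join (size ls))
  | JoinProd X k i r j of ls = X ++ ProdLabel k i :: r & j < nn k & path_rel b k i j != set0 :
      join_at b ls (prod_join b (size X) k i r j)
  | JoinDeep X s u a k i r j of ls = X ++ RecLabel s u a :: ProdLabel k i :: r
      & cycle_edge cs s (u + a) = (k, j) & path_rel b k i j != set0 :
      join_at b ls (size X, (4 + b, s, u, 0), a, op b (path_rel b k i j) (labels_val b r))
  | JoinShallow X s u a r of ls = X ++ RecLabel s u a :: r :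
      join_at b ls (shallow_join b (size X) s u a r).

Lemma joins_at_depth b ls q j : j \in joins_at b ls q -> j.1.1.1 = q.
Proof.
rewrite /joins_at; case: (drop q ls) => // -[k i|s u a] r.
  by case/mapP=> j' _ ->.
rewrite mem_rcons inE => /orP[/eqP-> //|].
by rewrite /deep_joins; case: r => // -[] // k i r; case: ifP => // _; rewrite inE => /eqP->.
Qed.

Lemma joinsP b ls j : j \in joins b ls -> join_at b ls j.
Proof.
rewrite mem_rcons inE => /orP[/eqP->|]; first exact: JoinEnd.
case/flattenP=> js /mapP[q]; rewrite mem_iota /= add0n => hq ->; rewrite /joins_at.
have := cat_take_drop q ls; have := size_takel (ltnW hq); move: (take q ls) => X eX.
case: (drop q ls) => [|[k i|s u a] r] els; first by [].
all: rewrite -eX.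
  case/mapP=> j'; rewrite mem_filter mem_iota /= add0n => /andP[h1 h2] ->.
  exact: JoinProd (esym els) h2 h1.
rewrite mem_rcons inE => /orP[/eqP->|]; first exact: JoinShallow (esym els).
case: r els => // -[] // k i r els; rewrite /deep_joins; case: ifP => // /andP[/eqP h1 h2].
rewrite inE => /eqP->; apply: JoinDeep (esym els) _ h2.
by rewrite -h1; case: (cycle_edge _ _ _).
Qed.

Lemma mem_joins b ls j : join_at b ls j -> j \in joins b ls.
Proof.
have key X l r j' : ls = X ++ l :: r -> j' \in joins_at b ls (size X) -> j' \in joins b ls.
  move=> e h; rewrite mem_rcons inE; apply/orP; right; apply/flattenP.
  exists (joins_at b ls (size X)) => //; apply: map_f.
  by rewrite mem_iota e size_cat /= addnS ltnS leq_addr.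
case=> [|X k i r j' e h1 h2|X s u a k i r j' e h1 h2|X s u a r e].
- by rewrite mem_rcons mem_head.
- apply: key (e) _; rewrite /joins_at e drop_size_cat //.
  by apply: map_f; rewrite mem_filter h2 mem_iota.
- apply: key (e) _; rewrite /joins_at e drop_size_cat // /deep_joins h1 /= eqxx h2.
  by rewrite mem_rcons !inE eqxx orbT.
- by apply: key (e) _; rewrite /joins_at e drop_size_cat // mem_rcons mem_head.
Qed.

Lemma joins_uniq b ls : uniq (joins b ls).
Proof.
have uat q : uniq (joins_at b ls q).
  rewrite /joins_at; case: (drop q ls) => // -[k i|s u a] r.
    rewrite map_inj_uniq; first by rewrite filter_uniq // iota_uniq.
    by move=> x y; rewrite /prod_join; case: (b) => -[].
  rewrite rcons_uniq; case: r => //= -[] //= k i r; case: ifP => // _.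
  by rewrite inE /shallow_join; apply/andP; split=> //; apply/eqP => -[]; case: (b).
rewrite rcons_uniq; apply/andP; split.
  apply/flattenP => -[js /mapP[q]]; rewrite mem_iota add0n /= => hq -> /joins_at_depth /= e.
  by rewrite e ltnn in hq.
elim: (size ls) 0 => //= n IH q; rewrite cat_uniq uat IH andbT /=.
apply/hasPn => j /flattenP[js /mapP[q']]; rewrite mem_iota => hq -> /joins_at_depth e.
by apply/negP => /joins_at_depth; rewrite e; lia.
Qed.

Definition valid_label (l : tlabel) :=
  match l with
  | ProdLabel k i => (k < size (prods G)) && (i < nn k)
  | RecLabel s u a => (s < size cs) && (a < T)
  end.

(** The keys [a] and [T - b] give [(T - (k1 + k2)).-1 = b - a.+1], the number of cycle steps below
    the one in which the two labels part. This factor depends on both labels and cannot be stored in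
    either join. *)
Definition middle (w : word4) k1 k2 : relation A :=
  if w.1.1.1 == 4 then cycle_val true w.1.1.2 (w.1.2 + k1.+1) (T - (k1 + k2)).-1
  else if w.1.1.1 == 5 then cycle_val false w.1.1.2 (w.1.2 + k2.+1) (T - (k1 + k2)).-1
  else rone A.

Definition pair_value (j1 j2 : join) : relation A :=
  rmul (rmul j1.2 (middle j1.1.1.2 j1.1.2 j2.1.2)) j2.2.

Definition matched ls1 ls2 (j1 j2 : join) :=
  [/\ j1 \in joins false ls1, j2 \in joins true ls2,
      j1.1.1.1 = j2.1.1.1 /\ take j1.1.1.1 ls1 = take j2.1.1.1 ls2, j1.1.1.2 = j2.1.1.2
    & j1.1.2 + j2.1.2 < T].

Inductive match_at ls1 ls2 : join -> join -> Prop :=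
  | MatchEnd of ls1 = ls2 : match_at ls1 ls2 (end_join (size ls1)) (end_join (size ls2))
  | MatchProd X k i j r1 r2 of ls1 = X ++ ProdLabel k i :: r1 & ls2 = X ++ ProdLabel k j :: r2 & K k i j != set0 :
      match_at ls1 ls2 (prod_join false (size X) k i r1 j) (prod_join true (size X) k j r2 i)
  | MatchDown X s u a b k i j r1 r2 of ls1 = X ++ RecLabel s u a :: ProdLabel k i :: r1
      & ls2 = X ++ RecLabel s u b :: r2 & a < b & cycle_edge cs s (u + a) = (k, j) & K k i j != set0 :
      match_at ls1 ls2 (size X, (4, s, u, 0), a, rmul (labels_val false r1) (K k i j))
        (shallow_join true (size X) s u b r2)
  | MatchUp X s u a b k i j r1 r2 of ls1 = X ++ RecLabel s u a :: r1
      & ls2 = X ++ RecLabel s u b :: ProdLabel k j :: r2 & b < a & cycle_edge cs s (u + b) = (k, i) & K k i j != set0 :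
      match_at ls1 ls2 (shallow_join false (size X) s u a r1)
        (size X, (5, s, u, 0), b, rmul (K k i j) (labels_val true r2)).

Lemma same_prefix (X1 X2 : seq tlabel) r1 r2 : size X1 = size X2 ->
  take (size X1) (X1 ++ r1) = take (size X2) (X2 ++ r2) -> X1 = X2.
Proof. by move=> _; rewrite !take_size_cat. Qed.

(** On each side the tag of the name determines the kind of the join, and equal tags bring
    corresponding kinds together: a deep join on one side meets a shallow one on the other. The
    strict order of the indices comes from the sum of the keys. *)
Lemma matchedP ls1 ls2 j1 j2 : all valid_label ls1 -> all valid_label ls2 ->
  matched ls1 ls2 j1 j2 -> match_at ls1 ls2 j1 j2.
Proof.
move=> v1 v2 [/joinsP h1 /joinsP h2 [eq et] ew hk].
case: h1 eq et ew hk => [|X k i r j e hj hK|X s u a k i r j e hc hK|X s u a r e] /=.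
- case: h2 => [|X' k' i' r' j' e' hj' hK'|X' s' u' a' k' i' r' j' e' hc' hK'|X' s' u' a' r' e'] //=.
  by move=> eq; rewrite !take_size => et _ _; exact: MatchEnd.
- case: h2 => [|X' k' i' r' j' e' hj' hK'|X' s' u' a' k' i' r' j' e' hc' hK'|X' s' u' a' r' e'] //=.
  rewrite {1}e {1}e' => eq /(same_prefix eq) eX [] ek ei ej _; subst X' k' i' j'.
  exact: MatchProd e e' hK.
- case: h2 => [|X' k' i' r' j' e' hj' hK'|X' s' u' a' k' i' r' j' e' hc' hK'|X' s' u' a' r' e'] //=.
  rewrite {1}e {1}e' => eq /(same_prefix eq) eX [] es eu hk; subst X' s' u'.
  apply: (MatchDown e e' _ hc hK).
  by move: v2; rewrite e' all_cat /= => /andP[_ /andP[/andP[_ h] _]]; lia.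
- case: h2 => [|X' k' i' r' j' e' hj' hK'|X' s' u' a' k' i' r' j' e' hc' hK'|X' s' u' a' r' e'] //=.
  rewrite {1}e {1}e' => eq /(same_prefix eq) eX [] es eu hk; subst X' s' u'.
  apply: (MatchUp e e' _ hc' hK').
  by move: v1; rewrite e all_cat /= => /andP[_ /andP[/andP[_ h] _]]; lia.
Qed.

Lemma match_pair ls1 ls2 j1 j2 : all valid_label ls1 -> all valid_label ls2 ->
  match_at ls1 ls2 j1 j2 -> label_pair G cs L K ls1 ls2 (pair_value j1 j2) true.
Proof.
move=> v1 v2; have tr c (b : bool) : b -> label_pair G cs L K ls1 ls2 c true = label_pair G cs L K ls1 ls2 c b.
  by move=> ->.
case; rewrite /pair_value /middle /=.
- by move=> ->; rewrite !rmul1; apply: LabelSame.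
- move=> X k i j r1 r2 e1 e2 hK; rewrite rmul1 -rmulA /= (tr _ _ hK).
  have hk : [&& k < size (prods G), i < nn k & j < nn k].
    move: v1 v2; rewrite e1 e2 !all_cat /= => /andP[_ /andP[/andP[-> ->] _]].
    by move=> /andP[_ /andP[/andP[_ ->] _]].
  have /and3P[kG _ _] := hk; apply: LabelProd e1 e2 _ hk.
  by have := path_table_lt kG hK; lia.
- move=> X s u a b k i j r1 r2 e1 e2 ab hc hK; rewrite -!rmulA (tr _ _ hK).
  have [hs bT] : s < size cs /\ b < T.
    by move: v2; rewrite e2 all_cat /= => /andP[_ /andP[/andP[-> ->] _]].
  have -> : (T - (a + (T - b))).-1 = b - a.+1 by lia.
  have [e1' hc'] := (e1, hc); apply: LabelDown e1 e2 _ hc _; first by rewrite ab.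
  have /(cycle_edge_valid co) := cycle_edge_mem co (u + a) hs; rewrite hc' => /andP[/= kG hj].
  by move: v1; rewrite e1' all_cat /= => /andP[_ /andP[_ /andP[/andP[-> ->] _]]].
- move=> X s u a b k i j r1 r2 e1 e2 ab hc hK; rewrite (tr _ _ hK).
  have [hs aT] : s < size cs /\ a < T.
    by move: v1; rewrite e1 all_cat /= => /andP[_ /andP[/andP[-> ->] _]].
  have -> : (T - (T - a + b)).-1 = a - b.+1 by lia.
  have [e2' hc'] := (e2, hc); apply: LabelUp e1 e2 _ hc _; first by rewrite ab.
  have /(cycle_edge_valid co) := cycle_edge_mem co (u + b) hs; rewrite hc' => /andP[/= kG hj].
  by move: v2; rewrite e2' all_cat /= hj => /andP[_ /andP[_ /andP[/andP[-> ->] _]]].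
Qed.

Lemma pair_match ls1 ls2 c : all valid_label ls1 -> all valid_label ls2 ->
  label_pair G cs L K ls1 ls2 c true -> exists j1 j2, matched ls1 ls2 j1 j2.
Proof.
move=> v1 v2; move e: true => b0 h; case: h e.
- move=> -> _; exists (end_join (size ls2)), (end_join (size ls2)).
  by split=> //; apply: mem_joins; apply: JoinEnd.
- move=> X k i j r1 r2 e1 e2 _ /and3P[_ hi hj] /esym hK.
  exists (prod_join false (size X) k i r1 j), (prod_join true (size X) k j r2 i); split=> //.
  + by apply: mem_joins; apply: (@JoinProd false ls1 X k i r1 j e1 hj hK).
  + by apply: mem_joins; apply: (@JoinProd true ls2 X k j r2 i e2 hi hK).
  + by rewrite /= e1 e2 !take_size_cat.
- move=> X s u a b k i j r1 r2 e1 e2 /andP[ab _] hc _ /esym hK.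
  have bT : b < T by move: v2; rewrite e2 all_cat /= => /andP[_ /andP[/andP[_ ->] _]].
  exists (size X, (4 + false, s, u, 0), a, op false (path_rel false k i j) (labels_val false r1)).
  exists (shallow_join true (size X) s u b r2); split=> //.
  + by apply: mem_joins; apply: (@JoinDeep false ls1 X s u a k i r1 j e1 hc hK).
  + by apply: mem_joins; apply: JoinShallow e2.
  + by rewrite /= e1 e2 !take_size_cat.
  + by rewrite /=; lia.
- move=> X s u a b k i j r1 r2 e1 e2 /andP[ab _] hc _ /esym hK.
  have aT : a < T by move: v1; rewrite e1 all_cat /= => /andP[_ /andP[/andP[_ ->] _]].
  exists (shallow_join false (size X) s u a r1).
  exists (size X, (4 + true, s, u, 0), b, op true (path_rel true k j i) (labels_val true r2)); split=> //.
  + by apply: mem_joins; apply: JoinShallow e1.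
  + by apply: mem_joins; apply: (@JoinDeep true ls2 X s u b k j r2 i e2 hc hK).
  + by rewrite /= e1 e2 !take_size_cat.
  + by rewrite /=; lia.
Qed.

Lemma fork_unique (X X' : seq tlabel) x y x' y' r1 r2 r1' r2' : x <> y -> x' <> y' ->
  X ++ x :: r1 = X' ++ x' :: r1' -> X ++ y :: r2 = X' ++ y' :: r2' ->
  [/\ X = X', x = x', y = y', r1 = r1' & r2 = r2'].
Proof.
move=> xy xy'; elim: X X' => [|z X IH] [|z' X'] /=.
- by move=> [-> ->] [-> ->].
- by move=> [e1 _] [e2 _]; case: xy; rewrite e1 e2.
- by move=> [e1 _] [e2 _]; case: xy'; rewrite -e1 -e2.
- by move=> [-> e1] [e2]; have [-> -> -> -> ->] := IH _ e1 e2.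
Qed.

(** Two labels part at one place only, and equal labels meet only at their end. So every reachable
    pair is emitted once, and emissions can be charged to the number of reachable pairs. *)
Lemma match_unique ls1 ls2 j1 j2 j1' j2' : all valid_label ls1 ->
  match_at ls1 ls2 j1 j2 -> match_at ls1 ls2 j1' j2' -> j1 = j1' /\ j2 = j2'.
Proof.
move=> v1.
have fork (X : seq tlabel) x y r1 r2 : x <> y -> X ++ x :: r1 <> X ++ y :: r2.
  by move=> xy e; have := cat_cons_head e.
have lt k i j X r : ls1 = X ++ ProdLabel k i :: r -> K k i j != set0 -> ProdLabel k i <> ProdLabel k j.
  move=> e hK [eij]; move: v1; rewrite e all_cat /= => /andP[_ /andP[/andP[kG _] _]].
  by have := path_table_lt kG hK; rewrite eij ltnn.
have ne s u a b : a < b -> RecLabel s u a <> RecLabel s u b /\ RecLabel s u b <> RecLabel s u a.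
  by move=> ab; split=> -[]; lia.
case=> [e|X k i j r1 r2 e1 e2 hK|X s u a b k i j r1 r2 e1 e2 ab hc hK|X s u a b k i j r1 r2 e1 e2 ab hc hK].
- case=> [_|X' k' i' j' r1' r2' e1' e2' hK'|X' s' u' a' b' k' i' j' r1' r2' e1' e2' ab' hc' hK'|X' s' u' a' b' k' i' j' r1' r2' e1' e2' ab' hc' hK'] //.
  + by case: (fork X' _ _ r1' r2' (lt _ _ _ _ _ e1' hK')); rewrite -e1' -e2'.
  + by case: (fork X' _ _ (ProdLabel k' i' :: r1') r2' (ne s' u' _ _ ab').1); rewrite -e1' -e2'.
  + by case: (fork X' _ _ r1' (ProdLabel k' j' :: r2') (ne s' u' _ _ ab').2); rewrite -e1' -e2'.
- have n1 := lt _ _ _ _ _ e1 hK.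
  case=> [e|X' k' i' j' r1' r2' e1' e2' hK'|X' s' u' a' b' k' i' j' r1' r2' e1' e2' ab' hc' hK'|X' s' u' a' b' k' i' j' r1' r2' e1' e2' ab' hc' hK'].
  + by case: (fork X _ _ r1 r2 n1); rewrite -e1 -e2.
  + have n2 := lt _ _ _ _ _ e1' hK'.
    rewrite e1 in e1'; rewrite e2 in e2'; have [-> [-> ->] [->] -> ->] := fork_unique n1 n2 e1' e2'.
    by [].
  + by rewrite e1 in e1'; rewrite e2 in e2'; have [] := fork_unique n1 (ne s' u' _ _ ab').1 e1' e2'.
  + by rewrite e1 in e1'; rewrite e2 in e2'; have [] := fork_unique n1 (ne s' u' _ _ ab').2 e1' e2'.
- have n1 := (ne s u _ _ ab).1.
  case=> [e|X' k' i' j' r1' r2' e1' e2' hK'|X' s' u' a' b' k' i' j' r1' r2' e1' e2' ab' hc' hK'|X' s' u' a' b' k' i' j' r1' r2' e1' e2' ab' hc' hK'].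
  + by case: (fork X _ _ (ProdLabel k i :: r1) r2 n1); rewrite -e1 -e2.
  + by have n2 := lt _ _ _ _ _ e1' hK'; rewrite e1 in e1'; rewrite e2 in e2'; have [] := fork_unique n1 n2 e1' e2'.
  + rewrite e1 in e1'; rewrite e2 in e2'; have [eX [es eu ea] [_ _ eb] [ek ei er1] er2] := fork_unique n1 (ne s' u' _ _ ab').1 e1' e2'.
    by subst; move: hc; rewrite hc' => -[->].
  + rewrite e1 in e1'; rewrite e2 in e2'; have [eX [es eu ea] [_ _ eb] _ _] := fork_unique n1 (ne s' u' _ _ ab').2 e1' e2'.
    by subst; lia.
- have n1 := (ne s u _ _ ab).2.
  case=> [e|X' k' i' j' r1' r2' e1' e2' hK'|X' s' u' a' b' k' i' j' r1' r2' e1' e2' ab' hc' hK'|X' s' u' a' b' k' i' j' r1' r2' e1' e2' ab' hc' hK'].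
  + by case: (fork X _ _ r1 (ProdLabel k j :: r2) n1); rewrite -e1 -e2.
  + by have n2 := lt _ _ _ _ _ e1' hK'; rewrite e1 in e1'; rewrite e2 in e2'; have [] := fork_unique n1 n2 e1' e2'.
  + rewrite e1 in e1'; rewrite e2 in e2'; have [eX [es eu ea] [_ _ eb] _ _] := fork_unique n1 (ne s' u' _ _ ab').1 e1' e2'.
    by subst; lia.
  + rewrite e1 in e1'; rewrite e2 in e2'; have [eX [es eu ea] [_ _ eb] er1 [ek ei er2]] := fork_unique n1 (ne s' u' _ _ ab').2 e1' e2'.
    by subst; move: hc; rewrite hc' => -[->].
Qed.

End Joins.

(** * Suffix values and the lists of joins *)

Section EntryProgram.
Variable A : automaton.
Notation P := (table_size A).

Definition eValue d := EA aLV (EG 24) (EG 27 :+ EC d).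

Definition fill_values b :=
  CArr aLV (EG 24) eSize (eone A) ;;
  CFor true 29 26 eSize
    (27 ::= eSize :- (EG 29 :+ EC 1) ;; load_label ;;
     CIf (EG 36) (30 ::= EG 37 ;; 31 ::= EG 38 ;; 32 ::= EG 39 ;; cycle_product A b)
       (33 ::= EA (step_array b) (EG 37) (EG 38)) ;;
     CArr aLV (EG 24) (EG 27) (ordered_mul A b (EG 33) (eValue 1))).

(** Row [2 * I + b] belongs to side [b] of the trie node [I]. *)
Definition eList (b : bool) := EG 43 :+ EG 43 :+ EC b.

Definition add_join b :=
  intern ;;
  CArr aEF (EG 41) (EC 0) (EG 24) ;; CArr aEF (EG 41) (EC 1) (EG 45) ;; CArr aEF (EG 41) (EC 2) (EG 46) ;;
  CArr aEF (EG 41) (EC 3) (EG 36) ;; CArr aEF (EG 41) (EC 4) (EG 37) ;; CArr aEF (EG 41) (EC 5) (EG 38) ;;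
  CArr aLS (eList b) (EA aCT (eList b) (EC 0)) (EG 41) ;;
  CArr aCT (eList b) (EC 0) (EA aCT (eList b) (EC 0) :+ EC 1) ;;
  41 ::= EG 41 :+ EC 1.

Definition put_join b w1 w2 w3 w4 key v :=
  36 ::= w1 ;; 37 ::= w2 ;; 38 ::= w3 ;; 39 ::= w4 ;; 45 ::= key ;; 46 ::= v ;; add_join b.

Definition path_expr (b : bool) k i j := if b then eK k j i else eK k i j.

Definition put_prod (b : bool) :=
  CFor true 29 26 (eNN (EG 47))
    (CIf (path_expr b (EG 47) (EG 48) (EG 29))
       (put_join b (EC 3) (EG 47) (if b then EG 29 else EG 48) (if b then EG 48 else EG 29) (EC 0)
          (if b then eValue 1 else emul A (eValue 1) (path_expr b (EG 47) (EG 48) (EG 29))))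
       CSkip).

Definition eNext := EA aLT (EG 24) (EG 27 :+ EC 1).
Definition deep_path b :=
  path_expr b (EI (eNext :+ EC 1)) (EI (eNext :+ EC 2)) (cycle_field 2 (EG 48 :+ EG 49)).

Definition put_deep (b : bool) :=
  30 ::= EG 47 ;;
  CIf (EIf (EG 27 :+ EC 1 :< eSize)
        (EIf (EI eNext) (EC 0) (EIf (cycle_field 1 (EG 48 :+ EG 49) :=? EI (eNext :+ EC 1)) (deep_path b) (EC 0)))
        (EC 0))
    (put_join b (EC (4 + b)) (EG 47) (EG 48) (EC 0) (EG 49) (ordered_mul A b (deep_path b) (eValue 2)))
    CSkip.

Definition put_shallow (b : bool) :=
  put_join b (EC (4 + ~~ b)) (EG 47) (EG 48) (EC 0) (EG rtop :- EG 49) (eValue 1).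

Definition put_label b :=
  42 ::= EA aCUR (EG 24) (EG 27) ;; load_label ;;
  47 ::= EG 37 ;; 48 ::= EG 38 ;; 49 ::= EG 39 ;;
  CIf (EG 36) (put_deep b ;; put_shallow b) (put_prod b).

Definition put_joins b :=
  CFor true 27 28 eSize (put_label b) ;;
  42 ::= EA aCUR (EG 24) (EG 27) ;;
  put_join b (EC 2) (EC 0) (EC 0) (EC 0) (EC 0) (eone A).

Variables (m t : nat) (G : spec m t) (cs : seq (seq (nat * nat))).
Variables (labs1 labs2 : seq (seq tlabel)) (inp : seq nat).
Hypotheses (co : cycle_ordering G cs) (wfG : wf_spec G).
Notation ev := (ev inp P).
Notation hrun := (hrun inp P).
Notation S := (size (enc_spec G cs)).
Notation layout := (layout G cs labs1 labs2 inp).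
Notation lab := (nth [::] (labs1 ++ labs2)).
Notation nlabs := (size (labs1 ++ labs2)).
Variables (L : 'I_m -> relation A) (T : nat).
Notation labels_val := (labels_val G cs L).
Notation valid_label := (valid_label G cs T).
Notation join := (join A).
Notation op := (@ordered_op A).

Definition caps s := 2 * period A * S <= rg s rcap.

Lemma caps_spec s : caps s -> S <= rg s rcap.
Proof.
rewrite /caps; apply: leq_trans; rewrite leq_pmull // muln_gt0 fact_gt0 //.
Qed.

Lemma full_tables_frame s s' : (forall a, a \in [:: aLam; aK; aKI; aKO] -> ar s' a = ar s a) ->
  full_tables G L s -> full_tables G L s'.
Proof.
move=> e [h1 h2]; split=> [M|k kG]; first by rewrite e.
have [h3 h4] := h2 k kG; split=> [i hi j hj|j hj]; first by rewrite e // h3.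
by rewrite !e //; apply: h4.
Qed.

Definition label_val b l := label_value cs (op b) (rone A) (step_value G L b) l.

Lemma labels_val_cons b l r : labels_val b (l :: r) = op b (label_val b l) (labels_val b r).
Proof.
rewrite -cat1s /labels_val /Submission.labels_val labels_value_cat ?labels_value1 //.
- exact: ordered_opl1.
- exact: ordered_opA.
- exact: ordered_op1.
Qed.

Lemma fill_valuesP b s x : layout s -> full_tables G L s -> caps s -> rg s 24 = x -> x < nlabs ->
    all valid_label (lab x) -> size (lab x) <= rg s rcap ->
  forall q, q <= size (lab x) -> ar (hrun (fill_values b) s) aLV x q = code (labels_val b (drop q (lab x))).
Proof.
move=> lay ft cap e24 hx hv hsz; rewrite /fill_values run_seqE.
set n := size (lab x); set s1 := hrun (CArr _ _ _ _) s.
have a1 : ar s1 = upd3 (ar s) aLV x n (code (rone A)).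
  by rewrite -[LHS]/(upd3 (ar s) aLV (rg s 24) (ev s eSize) (ev s (eone A))) (ev_size _ lay e24 hx) e24.
have r1 : rg s1 = rg s by [].
clearbody s1.
have lay1 : layout s1 by apply: layout_frame lay => a ha; rewrite a1; case: a ha => [|[|[|[|[|[|]]]]]].
pose J i s' := forall q, n - i <= q <= n -> ar s' aLV x q = code (labels_val b (drop q (lab x))).
set p := CFor _ _ _ _ _; suff : J n (hrun p s1) by move=> h q hq; apply: h; rewrite subnn.
apply: (run_loop (J := J) (n := n)) => //.
- by apply: for_count_capped; rewrite ?r1 //; apply: (ev_size _ lay1); rewrite ?r1.
- by move=> i u u' ea _ _ h q hq; rewrite ea; apply: h.
- move=> q; rewrite subn0 => hq; have eq : q = n by lia.
  by rewrite eq a1 /upd3 !eqxx drop_size.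
move=> i u hi e29 er ea hJ; do 3 rewrite run_seqE.
set q := n - (i + 1); have hq : q < n by rewrite /q; lia.
have layu : layout u by apply: layout_frame lay1 => a ha; rewrite ea; case: (b) a ha => -[|[|[|[|[|[|]]]]]].
have e24u : rg u 24 = x by rewrite er ?r1 //; case: (b).
have capu : caps u by rewrite /caps er ?r1 //; case: (b).
have ftu : full_tables G L u.
  apply: full_tables_frame ft => a ha; rewrite ea ?a1.
    by move: ha; rewrite !inE => /or4P[] /eqP->.
  by move: ha; rewrite !inE => /or4P[] /eqP->; case: (b).
set u1 := hrun (27 ::= _) u.
have e27 : rg u1 27 = q.
  by rewrite -[LHS]/(ev u eSize - (rg u 29 + 1)) (ev_size _ layu e24u hx) e29.
have [g1 ga1] : (forall v, v != 27 -> rg u1 v = rg u v) /\ ar u1 = ar u.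
  by split=> // v hv27; rewrite /u1 /= /upd (negbTE hv27).
clearbody u1.
have layu1 : layout u1 by apply: layout_frame layu => a _; rewrite ga1.
have hw := @load_labelP _ _ _ _ _ _ _ P u1 x q layu1 (etrans (g1 24 isT) e24u) e27 hx hq.
have ra := run_ar inp P (p := load_label) u1; have rr := run_rg inp P (p := load_label) u1.
set u2 := hrun load_label u1 in hw ra rr *; clearbody u2.
set l := nth tlabel0 (lab x) q in hw.
have vl : valid_label l by move/(all_nthP tlabel0): hv; apply.
set u3 := hrun (CIf _ _ _) u2.
have [v3 a3 r3] : [/\ rg u3 33 = code (label_val b l), ar u3 = ar u & forall v, v \in [:: 24; 27] -> rg u3 v = rg u1 v].
  have ea2 : ar u2 = ar u by apply: boolp.funext => a; rewrite ra // ga1.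
  case: l vl hw => [k j|c r a] /andP[v1 v2] [w1 w2 w3 w4].
    rewrite /u3 run_if0; last by rewrite /= w1.
    rewrite /= /upd /= w2 w3 ea2; split=> //; last first.
      by move=> v; rewrite !inE => /orP[]/eqP->; rewrite /= rr.
    by have [_ /(_ _ v1)[_ /(_ _ v2)[k1 k2]]] := ftu; case: (b).
  rewrite /u3 run_if1; last by rewrite /= w1.
  do 3 rewrite run_seqE; set u4 := hrun (32 ::= _) _.
  have [x30 x31 x32] : [/\ rg u4 30 = c, rg u4 31 = r & rg u4 32 = a] by [].
  have a4 : ar u4 = ar u by rewrite /u4 /= ea2.
  have r4 v : v \in [:: 0; 24; 27] -> rg u4 v = rg u1 v.
    by rewrite !inE => /or3P[] /eqP->; rewrite /u4 /= /upd /= rr.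
  clearbody u4.
  have [|||c1 c2 _ c3] := @cycle_productP A _ _ G cs labs1 labs2 inp co L b u4 c _ _ _ v1 x30.
  - by apply: layout_frame layu => a' _; rewrite a4.
  - by apply: full_tables_frame ftu => a' _; rewrite a4.
  - by rewrite r4 // g1.
  rewrite c1 x31 x32 c2; split=> // v hvv; rewrite c3 ?r4 //.
    by move: hvv; rewrite !inE => ->; rewrite orbT.
  by move: hvv; rewrite !inE => /orP[]/eqP->.
clearbody u3.
have a5 : ar (hrun (CArr aLV (EG 24) (EG 27) (ordered_mul A b (EG 33) (eValue 1))) u3) =
  upd3 (ar u) aLV x q (code (labels_val b (drop q (lab x)))).
  have x24 : rg u3 24 = x by rewrite r3 // g1.
  have x27 : rg u3 27 = q by rewrite r3.
  rewrite -[LHS]/(upd3 (ar u3) aLV (rg u3 24) (rg u3 27) (ev u3 (ordered_mul A b (EG 33) (eValue 1)))) x24 x27 a3.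
  congr upd3; rewrite (drop_nth tlabel0) // labels_val_cons; apply: ev_ordered_mul => //.
  rewrite -[LHS]/(ar u3 aLV (rg u3 24) (rg u3 27 + 1)) x24 x27 a3 addn1; apply: hJ.
  by rewrite /q; lia.
set u6 := hrun _ u3 in a5 *; clearbody u6 => q' hq'; rewrite a5 /upd3 !eqxx /=.
by case: eqP => [->//|ne]; apply: hJ; rewrite /q in ne; lia.
Qed.

Definition entry := (bool * nat * join)%type.
Definition entry0 : entry := (false, 0, (0, (0, 0, 0, 0), 0, rone A)).

Definition entry_at (s : hstate) e (en : entry) :=
  let: (_, x, (q, w, key, v)) := en in
  [/\ ar s aEF e 0 = x, ar s aEF e 1 = key, ar s aEF e 2 = code v, ar s aEF e 3 = w.1.1.1
    & ar s aEF e 4 = w.1.1.2 /\ ar s aEF e 5 = w.1.2].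

(** The trie node in whose list the entry stands: follow the label down to the depth of the join and
    then its name. Joins stand at the same node exactly when they share prefix and name. *)
Definition instance (s : hstate) (en : entry) := child s (ar s aCUR en.1.2 en.2.1.1.1) en.2.1.1.2.

Definition listing s (Es : seq entry) (b : bool) I :=
  [seq e <- iota 0 (size Es) | ((nth entry0 Es e).1.1 == b) && (instance s (nth entry0 Es e) == I)].

Definition entries_ok s (Es : seq entry) :=
  [/\ rg s 41 = size Es, forall e, e < size Es -> entry_at s e (nth entry0 Es e),
      forall e, e < size Es -> instance s (nth entry0 Es e) != 0
    & forall (b : bool) I, ar s aCT (I + I + b) 0 = size (listing s Es b I) /\
        forall p, p < size (listing s Es b I) -> ar s aLS (I + I + b) p = nth 0 (listing s Es b I) p].

Lemma instance_le s s' en : trie_le s s' -> ar s' aCUR en.1.2 = ar s aCUR en.1.2 ->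
  instance s en != 0 -> instance s' en = instance s en.
Proof. by move=> le e h; rewrite /instance e /child le. Qed.

Lemma eq_listing s s' Es Es' b I : size Es' = size Es ->
  (forall e, e < size Es -> (nth entry0 Es' e).1.1 = (nth entry0 Es e).1.1 /\
     instance s' (nth entry0 Es' e) = instance s (nth entry0 Es e)) ->
  listing s' Es' b I = listing s Es b I.
Proof.
move=> es h; rewrite /listing es; apply: eq_in_filter => e; rewrite mem_iota /= add0n => he.
by have [-> ->] := h e he.
Qed.

Lemma entries_ok_frame s s' Es : rg s' 41 = rg s 41 -> (forall a, a \in [:: aEF; aLS; aCT] -> ar s' a = ar s a) ->
  trie_le s s' -> (forall e, e < size Es -> let x := (nth entry0 Es e).1.2 in ar s' aCUR x = ar s aCUR x) ->
  entries_ok s Es -> entries_ok s' Es.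
Proof.
move=> e1 e2 le e3 [h1 h2 h3 h4].
have hi e : e < size Es -> instance s' (nth entry0 Es e) = instance s (nth entry0 Es e).
  by move=> he; apply: instance_le => //; [apply: e3 | apply: h3].
split.
- by rewrite e1.
- by move=> e /h2; rewrite /entry_at !e2.
- by move=> e he; rewrite hi // h3.
- by move=> b I; rewrite (@eq_listing s s' Es Es) ?e2 // => e he; rewrite hi.
Qed.

Lemma add_joinP b s Es x q w key v : trie_ok s -> entries_ok s Es -> word_at s w ->
    rg s 24 = x -> rg s 42 = ar s aCUR x q -> rg s 45 = key -> rg s 46 = code v ->
  let s' := hrun (add_join b) s in
  [/\ trie_ok s', trie_le s s' & entries_ok s' (rcons Es (b, x, (q, w, key, v)))].
Proof.
move=> tr [h1 h2 h3 h4] hw e24 e42 e45 e46; rewrite /add_join run_seqE.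
have [i1 i2 i3 i4] := internP inp P tr hw.
have ra := run_ar inp P (p := intern) s; have rr := run_rg inp P (p := intern) s.
set s1 := hrun intern s in i1 i2 i3 i4 ra rr *; clearbody s1.
set I := rg s1 43 in i3 i4; set n := size Es in h1.
set p := (X in hrun X s1).
have [a1 g1] : ar (hrun p s1) = upd3 (upd3 (upd3 (upd3 (upd3 (upd3 (upd3 (upd3 (ar s1)
    aEF n 0 x) aEF n 1 key) aEF n 2 (code v)) aEF n 3 w.1.1.1) aEF n 4 w.1.1.2) aEF n 5 w.1.2)
    aLS (I + I + b) (ar s1 aCT (I + I + b) 0) n) aCT (I + I + b) 0 (ar s1 aCT (I + I + b) 0 + 1) /\
   rg (hrun p s1) = upd (rg s1) 41 (n + 1).
  have [w1 w2 w3 _] := hw.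
  rewrite /p /= (rr 41) // (rr 24) // (rr 45) // (rr 46) // (rr 36) // (rr 37) // (rr 38) //.
  by rewrite h1 e24 e45 e46 w1 w2 w3; split.
set s' := hrun p s1 in a1 g1 *; clearbody s'.
have nx : ar s' aNX = ar s1 aNX by rewrite a1.
have cu : ar s' aCUR = ar s aCUR by rewrite a1 -(ra aCUR).
have le : trie_le s s' by move=> y c hc; rewrite nx i2.
have hi e : e < n -> instance s' (nth entry0 Es e) = instance s (nth entry0 Es e).
  by move=> he; apply: instance_le; rewrite ?cu //; apply: h3.
have hin : instance s' (b, x, (q, w, key, v)) = I.
  by rewrite /instance /= cu -e42 i3 /child nx.
have nthr e : e < n -> nth entry0 (rcons Es (b, x, (q, w, key, v))) e = nth entry0 Es e.
  by move=> he; rewrite nth_rcons he.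
have nthn : nth entry0 (rcons Es (b, x, (q, w, key, v))) n = (b, x, (q, w, key, v)).
  by rewrite nth_rcons ltnn eqxx.
have lst b' I' : listing s' (rcons Es (b, x, (q, w, key, v))) b' I' =
   if (b == b') && (I == I') then rcons (listing s Es b' I') n else listing s Es b' I'.
  rewrite /listing size_rcons iota_rcons filter_rcons nthn /= hin -/n.
  have -> : [seq e <- iota 0 n | ((nth entry0 (rcons Es (b, x, (q, w, key, v))) e).1.1 == b') &&
        (instance s' (nth entry0 (rcons Es (b, x, (q, w, key, v))) e) == I')] = listing s Es b' I'.
    by apply: eq_in_filter => e; rewrite mem_iota /= add0n => he; rewrite nthr // hi.
  by [].
have [c1 c2] := h4 b I; rewrite (ra aCT) // c1 in a1.
have ineq (b' : bool) I' : (I' + I' + b' == I + I + b) = (b == b') && (I == I').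
  by case: (b') (b) => -[] /=; apply/eqP/eqP; lia.
split=> //.
  by apply: trie_ok_frame i1 => //; rewrite g1.
split.
- by rewrite g1 size_rcons /upd /= addn1.
- move=> e; rewrite size_rcons ltnS leq_eqVlt => /orP[/eqP->|he].
    by rewrite nthn /entry_at a1 /upd3 /= !eqxx.
  have ne : (e == n) = false by rewrite ltn_eqF.
  rewrite nthr //; have := h2 e he; rewrite /entry_at a1 /upd3 /= ne /= (ra aEF) //.
- move=> e; rewrite size_rcons ltnS leq_eqVlt => /orP[/eqP->|he]; first by rewrite nthn hin.
  by rewrite nthr // hi // h3.
- move=> b' I'; have [c3 c4] := h4 b' I'; rewrite lst a1 /upd3 /= ineq.
  case hbI: ((b == b') && (I == I')) => /=; last by rewrite (ra aCT) // (ra aLS).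
  have [/eqP eb /eqP eI] := andP hbI; subst b'; rewrite -eI in c3 c4 *.
  rewrite size_rcons addn1; split=> // p'; rewrite ltnS leq_eqVlt => /orP[/eqP->|hp'].
    by rewrite eqxx nth_rcons ltnn eqxx.
  by rewrite ltn_eqF // nth_rcons hp' (ra aLS) // c4.
Qed.

End EntryProgram.

Lemma run_rg_sub inp P p s (l : seq nat) r : all (fun x => x \in l) (modr p) -> r \notin l -> rg (hrun inp P p s) r = rg s r.
Proof. by move=> /allP h hr; rewrite run_rg //; apply: contra hr; apply: h. Qed.

Lemma run_ar_sub inp P p s (l : seq nat) a : all (fun x => x \in l) (moda p) -> a \notin l -> ar (hrun inp P p s) a = ar s a.
Proof. by move=> /allP h ha; rewrite run_ar //; apply: contra ha; apply: h. Qed.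

Lemma run_for_rg inp P cl r rn e p s : rg (hrun inp P (CFor cl r rn e p) s) r = for_count inp P cl s e.
Proof. by rewrite run_forE /= /upd eqxx. Qed.

(** * Correctness of the creation of joins *)

Section PutJoins.
Variable A : automaton.
Notation P := (table_size A).
Variables (m t : nat) (G : spec m t) (cs : seq (seq (nat * nat))).
Variables (labs1 labs2 : seq (seq tlabel)) (inp : seq nat).
Hypotheses (co : cycle_ordering G cs) (wfG : wf_spec G).
Notation ev := (ev inp P).
Notation hrun := (hrun inp P).
Notation layout := (layout G cs labs1 labs2 inp).
Notation lab := (nth [::] (labs1 ++ labs2)).
Notation nlabs := (size (labs1 ++ labs2)).
Variables (L : 'I_m -> relation A) (T : nat).
Notation nn := (nn G).
Notation labels_val := (labels_val G cs L).
Notation valid_label := (valid_label G cs T).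
Notation joins := (joins G cs L T).
Notation joins_at := (joins_at G cs L T).
Notation join := (join A).
Notation op := (@ordered_op A).

Notation caps := (@caps A m t G cs).
Notation entry := (entry A).
Notation path_rel := (@path_rel m t G A L).
Notation put_join := (@put_join).

Definition good (s : hstate) (Es : seq entry) := trie_ok s /\ entries_ok s Es.

(** [put_join] evaluates its arguments one after the other, overwriting these registers as it goes;
    the later arguments must therefore not depend on them. *)
Definition steady (s : hstate) e v := forall s', ar s' = ar s ->
  (forall r, r \notin [:: 36; 37; 38; 39; 45; 46] -> rg s' r = rg s r) -> ev s' e = v.

Lemma put_joinP b s Es x q w1 w2 w3 w4 key ve v1 v2 v3 v4 kv v : good s Es ->
    rg s 24 = x -> rg s 42 = ar s aCUR x q ->
    steady s w1 v1 -> steady s w2 v2 -> steady s w3 v3 -> steady s w4 v4 -> steady s key kv ->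
    steady s ve (code v) ->
  let s' := hrun (put_join b w1 w2 w3 w4 key ve) s in
  good s' (rcons Es (b, x, (q, (v1, v2, v3, v4), kv, v))) /\ trie_le s s'.
Proof.
move=> [tr en] e24 e42 h1 h2 h3 h4 h5 h6; rewrite /put_join; do 6 rewrite run_seqE.
set s1 := hrun (36 ::= w1) s; set s2 := hrun (37 ::= w2) s1; set s3 := hrun (38 ::= w3) s2.
set s4 := hrun (39 ::= w4) s3; set s5 := hrun (45 ::= key) s4; set s6 := hrun (46 ::= ve) s5.
have fr : ar s6 = ar s /\ forall r, r \notin [:: 36; 37; 38; 39; 45; 46] -> rg s6 r = rg s r.
  split=> // r; rewrite !inE !negb_or => /and5P[/negbTE n1 /negbTE n2 /negbTE n3 /negbTE n4 /andP[/negbTE n5 /negbTE n6]].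
  by rewrite /s6 /s5 /s4 /s3 /s2 /s1 /= /upd n1 n2 n3 n4 n5 n6.
have st e u v0 : steady s e v0 -> ar u = ar s ->
    (forall r, r \notin [:: 36; 37; 38; 39; 45; 46] -> rg u r = rg s r) -> ev u e = v0.
  by move=> h; apply: h.
have f1 : ar s1 = ar s /\ forall r, r \notin [:: 36; 37; 38; 39; 45; 46] -> rg s1 r = rg s r.
  by split=> // r; rewrite !inE !negb_or => /andP[/negbTE n1 _]; rewrite /= /upd n1.
have f2 : ar s2 = ar s /\ forall r, r \notin [:: 36; 37; 38; 39; 45; 46] -> rg s2 r = rg s r.
  split=> // r hr; rewrite -f1.2 //; move: hr; rewrite !inE !negb_or => /and3P[_ /negbTE n1 _].
  by rewrite /s2 /= /upd n1.
have f3 : ar s3 = ar s /\ forall r, r \notin [:: 36; 37; 38; 39; 45; 46] -> rg s3 r = rg s r.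
  split=> // r hr; rewrite -f2.2 //; move: hr; rewrite !inE !negb_or => /and4P[_ _ /negbTE n1 _].
  by rewrite /s3 /= /upd n1.
have f4 : ar s4 = ar s /\ forall r, r \notin [:: 36; 37; 38; 39; 45; 46] -> rg s4 r = rg s r.
  split=> // r hr; rewrite -f3.2 //; move: hr; rewrite !inE !negb_or => /and5P[_ _ _ /negbTE n1 _].
  by rewrite /s4 /= /upd n1.
have f5 : ar s5 = ar s /\ forall r, r \notin [:: 36; 37; 38; 39; 45; 46] -> rg s5 r = rg s r.
  split=> // r hr; rewrite -f4.2 //; move: hr; rewrite !inE !negb_or => /and5P[_ _ _ _ /andP[/negbTE n1 _]].
  by rewrite /s5 /= /upd n1.
have k1 : ev s w1 = v1 by apply: h1.
have k2 := st _ _ _ h2 f1.1 f1.2; have k3 := st _ _ _ h3 f2.1 f2.2; have k4 := st _ _ _ h4 f3.1 f3.2.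
have k5 := st _ _ _ h5 f4.1 f4.2; have k6 := st _ _ _ h6 f5.1 f5.2.
have vals : [/\ word_at s6 (v1, v2, v3, v4), rg s6 45 = kv & rg s6 46 = code v].
  split; first split.
  - by rewrite -[LHS]/(ev s w1) k1.
  - by rewrite -[LHS]/(ev s1 w2) k2.
  - by rewrite -[LHS]/(ev s2 w3) k3.
  - by rewrite -[LHS]/(ev s3 w4) k4.
  - by rewrite -[LHS]/(ev s4 key) k5.
  - by rewrite -[LHS]/(ev s5 ve) k6.
clearbody s6; case: fr => fa fr; have [hw h45 h46] := vals.
have tr6 : trie_ok s6 by apply: trie_ok_frame tr; rewrite ?fa ?fr.
have en6 : entries_ok s6 Es.
  by apply: entries_ok_frame en; rewrite ?fr //; move=> *; rewrite fa.
have [||i1 i2 i3] := @add_joinP A m t G inp wfG b s6 Es x q _ kv v tr6 en6 hw _ _ h45 h46.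
- by rewrite fr.
- by rewrite fr // fa.
by split; [split | move=> v' c hc; rewrite i2 fa].
Qed.

Lemma ev_path b s ke ie je k i j : full_tables G L s -> ev s ke = k -> ev s ie = i -> ev s je = j ->
  k < size (prods G) -> i < nn k -> j < nn k -> ev s (path_expr b ke ie je) = code (path_rel b k i j).
Proof.
move=> [_ h] hk hi hj kG lti ltj; have [h1 _] := h k kG.
case: b; [have := h1 j ltj i lti | have := h1 i lti j ltj]; move=> <-;
  by rewrite -[LHS]/(ar s aK (ev s ke) (pair_code (ev s _) (ev s _))) hk hi hj.
Qed.

Definition context b s x :=
  [/\ layout s, full_tables G L s, caps s, rg s 24 = x /\ rg s rtop = T
    & forall q, q <= size (lab x) -> ar s aLV x q = code (labels_val b (drop q (lab x)))].

Lemma context_frame b s s' x : (forall a, a \notin [:: aNX; aEF; aLS; aCT] -> ar s' a = ar s a) ->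
  (forall r, r \in [:: rcap; 24; rtop] -> rg s' r = rg s r) -> context b s x -> context b s' x.
Proof.
move=> ha hr [c1 c2 c3 [c4 c5] c6]; split.
- by apply: layout_frame c1 => a lt; apply: ha; case: a lt => [|[|[|[|[|[|]]]]]].
- by apply: full_tables_frame c2 => a; rewrite !inE => /or4P[] /eqP->; apply: ha.
- by rewrite /Submission.caps hr.
- by rewrite !hr.
- by move=> q hq; rewrite ha // c6.
Qed.

Lemma good_frame s s' Es : ar s' = ar s -> rg s' 40 = rg s 40 -> rg s' 41 = rg s 41 ->
  good s Es -> good s' Es.
Proof.
move=> ea e40 e41 [h1 h2]; split; first by apply: trie_ok_frame h1; rewrite ?ea.
by apply: entries_ok_frame h2 => // [a _|v c _|e _]; rewrite ea.
Qed.

Definition mk b x (j : join) : entry := (b, x, j).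

Lemma put_prodP b s Es x q k i r : context b s x -> good s Es -> q < size (lab x) -> rg s 27 = q ->
    rg s 42 = ar s aCUR x q -> rg s 47 = k -> rg s 48 = i -> k < size (prods G) -> i < nn k ->
    drop q.+1 (lab x) = r ->
  let s' := hrun (put_prod A b) s in
  good s' (Es ++ map (mk b x) (prod_joins G cs L b q k i r (nn k))) /\ trie_le s s'.
Proof.
move=> ct gd hq e27 e42 e47 e48 kG hi hr; have [lay ft cap [e24 eT] hv] := ct.
pose J j s' := [/\ good s' (Es ++ map (mk b x) (prod_joins G cs L b q k i r j)), trie_le s s'
  & (forall a, a \notin [:: aNX; aEF; aLS; aCT] -> ar s' a = ar s a)].
suff : J (nn k) (hrun (put_prod A b) s) by case.
apply: (run_loop (J := J) (n := nn k)).
- apply: for_count_capped; first exact: (ev_nn (k := EG 47) lay e47 kG).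
  by apply: leq_trans (caps_spec cap); have [] := size_prod_spec cs kG.
- by case: (b).
- move=> j u u' ea _ er [[g1 g2] j2 j3]; split; last by move=> a ha; rewrite ea j3.
    apply: (@good_frame u u') => //; rewrite ?er //.
  by move=> v c hc; rewrite ea j2.
- by split=> //; rewrite /prod_joins /= cats0.
move=> j u hj e29 er _ [gu le ea].
have er' v : v \notin [:: 29; 26; 36; 37; 38; 39; 45; 46; 40; 43; 41] -> rg u v = rg s v.
  move=> hv'; apply: er; move: hv'; case: (b); rewrite !inE !negb_or => h;
    by repeat (case/andP: h => -> h || rewrite h).
have ctu : context b u x.
  by apply: context_frame ct => // v; rewrite !inE => /or3P[] /eqP->; rewrite er'.
have [layu ftu capu [e24u eTu] hvu] := ctu.
have kk u' : ar u' = ar u -> (forall v, v \notin [:: 36; 37; 38; 39; 45; 46] -> rg u' v = rg u v) ->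
    ev u' (path_expr b (EG 47) (EG 48) (EG 29)) = code (path_rel b k i j).
  move=> ea' era; apply: ev_path => //.
  - by apply: full_tables_frame ftu => a _; rewrite ea'.
  - by rewrite /= era // er'.
  - by rewrite /= era // er'.
  - by rewrite /= era.
have vv u' : ar u' = ar u -> (forall v, v \notin [:: 36; 37; 38; 39; 45; 46] -> rg u' v = rg u v) ->
    ev u' (eValue 1) = code (labels_val b r).
  by move=> ea' era; rewrite /= !era // (er' 24) // (er' 27) // e24 e27 ea' addn1 hvu // hr.
have pj : prod_joins G cs L b q k i r j.+1 = if path_rel b k i j != set0 then
    rcons (prod_joins G cs L b q k i r j) (prod_join G cs L b q k i r j) else prod_joins G cs L b q k i r j.
  by rewrite /prod_joins iota_rcons filter_rcons; case: ifP => //; rewrite map_rcons.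
have fin u' : (forall a, a \notin [:: aNX; aEF; aLS; aCT] -> ar u' a = ar u a) ->
    good u' (Es ++ map (mk b x) (prod_joins G cs L b q k i r j.+1)) /\ trie_le u u' -> J j.+1 u'.
  move=> ha [g1 g2]; split=> //; first exact: trie_le_trans le g2.
  by move=> a ha'; rewrite ha // ea.
rewrite pj in fin; have k0 := kk u erefl (fun _ _ => erefl).
have [z|nz] := eqVneq (path_rel b k i j) set0.
  rewrite run_if0; last by rewrite k0 z /code eqxx.
  apply: fin => //; rewrite z eqxx /=; split=> //; by apply: (@good_frame u).
rewrite run_if1; last by rewrite k0 code_eq0.
rewrite nz map_rcons -rcons_cat in fin.
set ut := tick u; have gt : good ut (Es ++ map (mk b x) (prod_joins G cs L b q k i r j)).
  by apply: (@good_frame u).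
apply: fin; first by move=> a ha; apply: run_ar_sub ha.
have -> : mk b x (prod_join G cs L b q k i r j) = (b, x, (q, (3, k, if b then j else i, if b then i else j), 0,
   if b then labels_val b r else ordered_op b (path_rel b k i j) (labels_val b r))) by [].
apply: put_joinP => //.
- by rewrite /= (er' 42) // e42 ea.
- by move=> u' ea' era; rewrite /= era // /= er'.
- by move=> u' ea' era; case: (b); rewrite /= era //= er'.
- by move=> u' ea' era; case: (b); rewrite /= era //= er'.
- move=> u' ea' era; case eb: (b); rewrite eb in kk vv; first exact: vv.
  by apply: (ev_emul (c := labels_val false r)); [apply: vv | apply: kk].
Qed.

Lemma put_shallowP b s Es x q c u a r : context b s x -> good s Es -> q < size (lab x) -> rg s 27 = q ->
    rg s 42 = ar s aCUR x q -> rg s 47 = c -> rg s 48 = u -> rg s 49 = a -> drop q.+1 (lab x) = r ->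
  let s' := hrun (put_shallow b) s in
  good s' (rcons Es (mk b x (shallow_join G cs L T b q c u a r))) /\ trie_le s s'.
Proof.
move=> [lay ft cap [e24 eT] hv] gd hq e27 e42 e47 e48 e49 hr; apply: put_joinP => //.
- by move=> u' _ er; rewrite /= er.
- by move=> u' _ er; rewrite /= er.
- by move=> u' _ er; rewrite /= !er // eT e49.
- by move=> u' ea er; rewrite /= !er // e24 e27 ea addn1 hv // hr.
Qed.

Lemma put_deepP b s Es x q c u a r : context b s x -> good s Es -> x < nlabs -> q < size (lab x) -> rg s 27 = q ->
    rg s 42 = ar s aCUR x q -> rg s 47 = c -> rg s 48 = u -> rg s 49 = a -> drop q.+1 (lab x) = r ->
    c < size cs -> all valid_label r ->
  let s' := hrun (put_deep A b) s in
  good s' (Es ++ map (mk b x) (deep_joins G cs L b q c u a r)) /\ trie_le s s'.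
Proof.
move=> ct gd hx hq e27 e42 e47 e48 e49 hr hc vr; have [lay ft cap [e24 eT] hv] := ct.
rewrite /put_deep run_seqE; set s1 := hrun (30 ::= EG 47) s.
have [a1 r30] : ar s1 = ar s /\ rg s1 30 = c by [].
have r1 v : v != 30 -> rg s1 v = rg s v by move=> nv; rewrite /= /upd (negbTE nv).
have ct1 : context b s1 x.
  by apply: context_frame ct => [a' _|v]; rewrite ?a1 // !inE => /or3P[] /eqP->.
have gd1 : good s1 Es by apply: (@good_frame s).
have le1 : trie_le s s1 by move=> v c' _; rewrite a1.
clearbody s1; set cond := EIf _ _ (EC 0).
have econd : ev s1 cond = if q.+1 < size (lab x) then
   ev s1 (EIf (EI eNext) (EC 0) (EIf (cycle_field 1 (EG 48 :+ EG 49) :=? EI (eNext :+ EC 1)) (deep_path b) (EC 0))) else 0.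
  rewrite /cond ev_if -[ev s1 (_ :< eSize)]/(nat_of_bool (rg s1 27 + 1 < ev s1 eSize)).
  have [lay1 _ _ [e24' _] _] := ct1.
  by rewrite (ev_size _ lay1 e24' hx) r1 // e27 addn1; case: (_ < _).
have skip : deep_joins G cs L b q c u a r = [::] -> ev s1 cond = 0 ->
   let s' := hrun (CIf cond (put_join b (EC (4 + b)) (EG 47) (EG 48) (EC 0) (EG 49) (ordered_mul A b (deep_path b) (eValue 2))) CSkip) s1 in
   good s' (Es ++ map (mk b x) (deep_joins G cs L b q c u a r)) /\ trie_le s s'.
  by move=> -> e0; rewrite run_if0 // cats0; split=> //; apply: (@good_frame s1).
case: r hr vr skip => [|l r'] hr vr skip.
  apply: skip => //; rewrite econd ifF //; apply/negbTE; rewrite -leqNgt.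
  by move/(congr1 size): hr; rewrite size_drop /=; lia.
have hq1 : q.+1 < size (lab x) by move/(congr1 size): hr; rewrite size_drop /=; lia.
have hl : nth tlabel0 (lab x) q.+1 = l by rewrite -[q.+1]addn0 -nth_drop hr.
have hr' : drop q.+2 (lab x) = r' by move/(congr1 behead): hr; rewrite -drop1 drop_drop add1n.
have next u' : ar u' = ar s -> rg u' 24 = x -> rg u' 27 = q -> at_ inp (ev u' eNext) (enc_tlabel l).
  move=> ea x24 x27; have [_ _ h] := lay; have [_ _ h3] := h x hx.
  by rewrite /= x24 x27 ea addn1 -hl; apply: h3.
have n0 u' i : ar u' = ar s -> rg u' 24 = x -> rg u' 27 = q -> i < 3 ->
    nth 0 inp (ev u' eNext + i) = nth 0 (enc_tlabel l) i.
  by move=> e1 e2 e3 hi; apply: next => //; case: (l) => * /=; lia.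
have x24 : rg s1 24 = x by rewrite r1.
have x27 : rg s1 27 = q by rewrite r1.
rewrite hq1 ev_if -[ev s1 (EI eNext)]/(nth 0 inp (ev s1 eNext)) -[ev s1 eNext]addn0 n0 // in econd.
case: l hr hl vr next n0 econd skip => [k i|c' u' a'] hr hl vr next n0 econd skip; last first.
  by apply: skip => //; rewrite econd.
have [/andP[kG hi] vr'] := andP vr.
have lay1 : layout s1 by case: ct1.
have path u' : ar u' = ar s -> rg u' 24 = x -> rg u' 27 = q -> rg u' 30 = c -> rg u' 48 = u -> rg u' 49 = a ->
   [/\ ev u' (cycle_field 1 (EG 48 :+ EG 49)) = (cycle_edge cs c (u + a)).1,
       ev u' (EI (eNext :+ EC 1)) = k
     & (cycle_edge cs c (u + a)).1 = k -> ev u' (deep_path b) = code (path_rel b k i (cycle_edge cs c (u + a)).2)].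
  move=> ea u24 u27 u30 u48 u49.
  have layu : layout u' by apply: layout_frame lay => a' _; rewrite ea.
  have [_] := ev_cycle_field A co (EG 48 :+ EG 49) layu hc u30.
  have -> : ev u' (EG 48 :+ EG 49) = u + a by rewrite /= u48 u49.
  move=> f1 f2; have f3 : ev u' (EI (eNext :+ EC 1)) = k by apply: (n0 u' 1).
  have f4 : ev u' (EI (eNext :+ EC 2)) = i by apply: (n0 u' 2).
  split=> // ek; apply: ev_path => //; first by apply: full_tables_frame ft => a' _; rewrite ea.
  have /(cycle_edge_valid co)/andP[_] := cycle_edge_mem co (u + a) hc.
  by rewrite ek.
have [f1 f2 f3] := path s1 a1 x24 x27 r30 (etrans (r1 48 isT) e48) (etrans (r1 49 isT) e49).
have {}econd : ev s1 cond = if (cycle_edge cs c (u + a)).1 == k then ev s1 (deep_path b) else 0.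
  rewrite econd -[LHS]/(ev s1 (EIf (cycle_field 1 (EG 48 :+ EG 49) :=? EI (eNext :+ EC 1)) (deep_path b) (EC 0))).
  by rewrite ev_ifeq f1 f2.
case: ((cycle_edge cs c (u + a)).1 =P k) econd => [ek|nk] econd; last first.
  by apply: skip => //; rewrite /deep_joins ifF //; apply/negP => /andP[/eqP].
rewrite f3 // in econd.
have [z|nz] := eqVneq (path_rel b k i (cycle_edge cs c (u + a)).2) set0.
  apply: skip; first by rewrite /deep_joins z eqxx andbF.
  by rewrite econd z /code eqxx.
have -> : deep_joins G cs L b q c u a (ProdLabel k i :: r') = [:: (q, (4 + b, c, u, 0), a,
    op b (path_rel b k i (cycle_edge cs c (u + a)).2) (labels_val b r'))].
  by rewrite /deep_joins ek eqxx nz.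
rewrite run_if1; last by rewrite econd code_eq0.
rewrite cats1; set ut := tick s1.
have gt : good ut Es by apply: (@good_frame s1).
have [|||||||h1 h2] := @put_joinP b ut Es x q (EC (4 + b)) (EG 47) (EG 48) (EC 0) (EG 49)
   (ordered_mul A b (deep_path b) (eValue 2)) (4 + b) c u 0 a
   (op b (path_rel b k i (cycle_edge cs c (u + a)).2) (labels_val b r')) gt x24 => //.
- by rewrite /= r1 // e42 a1.
- by move=> u' _ er; rewrite /= er //= r1.
- by move=> u' _ er; rewrite /= er //= r1.
- by move=> u' _ er; rewrite /= er //= r1.
- move=> u' ea er.
  have ea' : ar u' = ar s by rewrite ea.
  have [y24 y27 y30 y48 y49] : [/\ rg u' 24 = x, rg u' 27 = q, rg u' 30 = c, rg u' 48 = u & rg u' 49 = a].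
    split; rewrite er; first [exact: x24 | exact: x27 | exact: r30 | exact: etrans (r1 48 isT) e48 | exact: etrans (r1 49 isT) e49 | by []].
  have [_ _ g3] := path u' ea' y24 y27 y30 y48 y49.
  apply: ev_ordered_mul; first exact: g3.
  by rewrite /= y24 y27 ea' addn2 hv // hr'.
by split; [exact: h1 | exact: trie_le_trans le1 h2].
Qed.

Lemma put_labelP b s Es x q : context b s x -> good s Es -> x < nlabs -> q < size (lab x) -> rg s 27 = q ->
    all valid_label (lab x) ->
  let s' := hrun (put_label A b) s in
  good s' (Es ++ map (mk b x) (joins_at b (lab x) q)) /\ trie_le s s'.
Proof.
move=> ct gd hx hq e27 vl; have [lay _ _ [e24 eT] _] := ct.
rewrite /put_label; do 2 rewrite run_seqE; set s0 := hrun (42 ::= _) s.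
have [a0 z42] : ar s0 = ar s /\ rg s0 42 = ar s aCUR x q by split=> //; rewrite /s0 /= /upd /= e24 e27.
have r0 v : v != 42 -> rg s0 v = rg s v by move=> nv; rewrite /= /upd (negbTE nv).
clearbody s0.
have lay0 : layout s0 by apply: layout_frame lay => a _; rewrite a0.
have hw := @load_labelP _ _ _ _ _ _ _ P s0 x q lay0 (etrans (r0 24 isT) e24) (etrans (r0 27 isT) e27) hx hq.
have ra := run_ar inp P (p := load_label) s0; have rr := run_rg inp P (p := load_label) s0.
set s1 := hrun load_label s0 in hw ra rr *; clearbody s1.
do 3 rewrite run_seqE; set s2 := hrun (49 ::= _) _.
set l := nth tlabel0 (lab x) q in hw.
have [w1 w2 w3 w4] := hw.
have [y36 y47 y48 y49] : [/\ rg s2 36 = (label_word l).1.1.1, rg s2 47 = (label_word l).1.1.2,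
   rg s2 48 = (label_word l).1.2 & rg s2 49 = (label_word l).2] by [].
have a2 : ar s2 = ar s by apply: boolp.funext => a; rewrite -[LHS]/(ar s1 a) ra // a0.
have r2 v : v \notin [:: 36; 37; 38; 39; 42; 47; 48; 49] -> rg s2 v = rg s v.
  rewrite !inE !negb_or => h; have [n36 n37 n38 n39] : [/\ v != 36, v != 37, v != 38 & v != 39] by split; lia.
  rewrite -r0; last by lia.
  rewrite -rr; last by rewrite /= !inE !negb_or n36 n37 n38 n39.
  rewrite /s2 /= /upd !ifN //; lia.
have y42 : rg s2 42 = ar s2 aCUR x q by rewrite a2 -z42 -(rr 42).
clearbody s2.
have ct2 : context b s2 x.
  by apply: context_frame ct => [a' _|v]; rewrite ?a2 // !inE => /or3P[] /eqP->; rewrite r2.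
have gd2 : good s2 Es by apply: (@good_frame s) => //; rewrite r2.
have le2 : trie_le s s2 by move=> v c' _; rewrite a2.
have y27 : rg s2 27 = q by rewrite r2.
have edr := drop_nth tlabel0 hq; rewrite -/l in edr.
have vl' : all valid_label (l :: drop q.+1 (lab x)).
  by rewrite -edr; move: vl; rewrite -{1}(cat_take_drop q (lab x)) all_cat => /andP[].
have r0' : rg s2 36 = 0 -> hrun (CIf (EG 36) (put_deep A b ;; put_shallow b) (put_prod A b)) s2 =
    hrun (put_prod A b) (tick s2) by move=> e; apply: run_if0.
have r1' : rg s2 36 != 0 -> hrun (CIf (EG 36) (put_deep A b ;; put_shallow b) (put_prod A b)) s2 =
    hrun (put_deep A b ;; put_shallow b) (tick s2) by move=> e; apply: run_if1.
set u := hrun (CIf _ _ _) s2 in r0' r1' *; clearbody u.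
rewrite /joins_at /Submission.joins_at edr.
case: l w1 w2 w3 w4 y36 y47 y48 y49 vl' {hw edr} => [k i|c b0 a] _ _ _ _ y36 y47 y48 y49 vl';
  have [vl1 vl2] := andP vl'.
  rewrite (r0' y36).
  have [kG hi] := andP vl1; set st := tick s2.
  have ctt : context b st x by apply: context_frame ct2.
  have gdt : good st Es by apply: good_frame gd2.
  have [h1 h2] := put_prodP ctt gdt hq y27 y42 y47 y48 kG hi erefl.
  by split=> //; apply: trie_le_trans le2 h2.
rewrite r1' ?y36 // run_seqE; have [hc ha] := andP vl1; set st := tick s2.
have ctt : context b st x by apply: context_frame ct2.
have gdt : good st Es by apply: good_frame gd2.
have [h1 h2] := put_deepP ctt gdt hx hq y27 y42 y47 y48 y49 erefl hc vl2.
have ra' := @run_ar_sub inp P (put_deep A b) st [:: aNX; aEF; aLS; aCT] _ erefl.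
have rr' := @run_rg_sub inp P (put_deep A b) st [:: 30; 36; 37; 38; 39; 45; 46; 40; 43; 41] _ erefl.
set s3 := hrun (put_deep A b) st in h1 h2 ra' rr' *; clearbody s3.
have r3 v : v \notin [:: 30; 36; 37; 38; 39; 45; 46; 40; 43; 41] -> rg s3 v = rg s2 v.
  exact: rr'.
have a3 v : v \notin [:: aNX; aEF; aLS; aCT] -> ar s3 v = ar s2 v.
  exact: ra'.
have ct3 : context b s3 x.
  by apply: context_frame ct2 => [a' /a3->|v] //; rewrite !inE => /or3P[] /eqP->; rewrite r3.
have [|||||h3 h4] := @put_shallowP b s3 _ x q c b0 a _ ct3 h1 hq _ _ _ _ _ erefl; rewrite ?r3 ?a3 //.
rewrite map_rcons -rcons_cat; split=> //.
by apply: trie_le_trans h4; apply: trie_le_trans h2.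
Qed.

Lemma put_joinsP b s Es x : context b s x -> good s Es -> x < nlabs -> all valid_label (lab x) ->
    size (lab x) <= rg s rcap ->
  let s' := hrun (put_joins A b) s in
  good s' (Es ++ map (mk b x) (joins b (lab x))) /\ trie_le s s'.
Proof.
move=> ct gd hx vl hsz; have [lay _ _ [e24 eT] _] := ct.
rewrite /put_joins; do 2 rewrite run_seqE; set n := size (lab x).
pose J q s' := [/\ good s' (Es ++ map (mk b x) (flatten [seq joins_at b (lab x) q | q <- iota 0 q])),
  trie_le s s', context b s' x, ar s' aCUR = ar s aCUR & q = n -> rg s' 27 = n].
have : J n (hrun (CFor true 27 28 eSize (put_label A b)) s).
  pose J' q s' := [/\ good s' (Es ++ map (mk b x) (flatten [seq joins_at b (lab x) q | q <- iota 0 q])),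
    trie_le s s' & context b s' x /\ ar s' aCUR = ar s aCUR].
  suff : J' n (hrun (CFor true 27 28 eSize (put_label A b)) s).
    case=> j1 j2 [j3 j4]; split=> // _; rewrite run_for_rg.
    by apply: for_count_capped => //; apply: ev_size lay e24 hx.
  apply: (run_loop (J := J') (n := n)).
  - by apply: for_count_capped => //; apply: ev_size lay e24 hx.
  - by case: (b).
  - move=> i u u' ea _ er [j1 j2 [j3 j4]]; split.
    + by apply: (@good_frame u) => //; rewrite er.
    + by move=> v c hc; rewrite ea j2.
    + split; last by rewrite ea.
      by apply: context_frame j3 => [a' _|v]; rewrite ?ea // !inE => /or3P[] /eqP->; rewrite er.
  - by rewrite /J' /= cats0; split=> //; apply: trie_le_refl.
  move=> q u hq e27 _ _ [j1 j2 [j3 j4]]; have [h1 h2] := put_labelP j3 j1 hx hq e27 vl.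
  split.
  - by rewrite iota_rcons map_rcons flatten_rcons map_cat catA.
  - exact: trie_le_trans h2.
  - have ra' := @run_ar_sub inp P (put_label A b) u [:: aNX; aEF; aLS; aCT] _ _.
    split; last by rewrite ra' ?j4 //; case: (b).
    apply: context_frame j3 => [a' nv|v]; last first.
      by rewrite !inE => /or3P[] /eqP->; rewrite run_rg //; case: (b).
    by apply: ra' nv; case: (b).
set s1 := hrun (CFor _ _ _ _ _) s; clearbody s1 => -[g1 le1 ct1 c1 /(_ erefl) e27].
set s2 := hrun (42 ::= _) s1.
have [a2 z42] : ar s2 = ar s1 /\ rg s2 42 = ar s1 aCUR x n.
  by split=> //; rewrite /s2 /= /upd /= e27; have [_ _ _ [-> _] _] := ct1.
have r2 v : v != 42 -> rg s2 v = rg s1 v by move=> nv; rewrite /= /upd (negbTE nv).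
clearbody s2; have g2 := @good_frame s1 s2 _ a2 (r2 40 isT) (r2 41 isT) g1.
have sc v : steady s2 (EC v) v by [].
have [||h1 h2] := @put_joinP b s2 _ x n (EC 2) (EC 0) (EC 0) (EC 0) (EC 0) (eone A) 2 0 0 0 0 (rone A) g2
   _ _ (sc 2) (sc 0) (sc 0) (sc 0) (sc 0) (fun _ _ _ => erefl).
- by rewrite r2 //; have [_ _ _ [-> _] _] := ct1.
- by rewrite z42 a2.
rewrite /joins /Submission.joins map_rcons -rcons_cat; split=> //.
by apply: trie_le_trans h2; apply: trie_le_trans le1 _; apply: trie_le_refl; rewrite a2.
Qed.

End PutJoins.

(** The loop over the labels is the one that must not be capped: its count is the linear factor of
    the running time, while its capped body contributes a polynomial in the cap. *)
Lemma loop_time P r rn e p : capped p -> rcap \notin r :: rn :: modr p ->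
  exists d, forall inp s, tm (hrun inp P (CFor false r rn e p) s) <=
    tm s + 1 + ev inp P s e * (d * (rg s rcap).+1 ^ d).+1.
Proof.
move=> cp hr; have hp : rcap \notin modr p by move: hr; rewrite !inE !negb_or => /and3P[].
have [d hd] := capped_time P cp hp; exists d => inp s; rewrite run_forE /=.
set c := (d * _).+1; set s1 := tick _.
pose I i s' := tm s' <= tm s + 1 + i * c /\ rg s' rcap = rg s rcap.
have : I (ev inp P s e) (foldl (fun s i => hrun inp P p (tick (setr s r i))) s1 (iota 0 (ev inp P s e))).
  apply: run_for_inv.
    split; first by rewrite /= addn0 addn1.
    by rewrite /= /upd; move: hr; rewrite !inE !negb_or => /and3P[_ /negbTE-> _].
  move=> i s' _ [h1 h2]; set s2 := tick (setr s' r i).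
  have e2 : rg s2 rcap = rg s rcap.
    by rewrite -h2 /= /upd; move: hr; rewrite !inE !negb_or => /and3P[/negbTE-> _ _].
  split; last by rewrite run_rg.
  have := hd inp s2; rewrite e2 mulSn /c /=; lia.
by case.
Qed.

(** * Visiting the labels of both lists *)

Section Visits.
Variable A : automaton.
Notation P := (table_size A).

Definition eEnd := EA aCUR (EG 24) eSize.

(** A label that ends at a trie node already seen on the same side is a repetition and adds no
    joins. So repeated nodes in the lists produce no repeated answers. *)
Definition visit b :=
  trace ;;
  CIf (EA aSEEN (EC (nat_of_bool b)) eEnd) CSkip
    (CArr aSEEN (EC (nat_of_bool b)) eEnd (EC 1) ;; fill_values A b ;; put_joins A b) ;;
  24 ::= EG 24 :+ EC 1.

Definition visit_all :=
  24 ::= EC 0 ;; 40 ::= EC 0 ;; 41 ::= EC 0 ;;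
  CFor false 60 61 (EG rleft) (visit false) ;;
  CFor false 60 61 (EG rlab :- EG rleft) (visit true).

Variables (m t : nat) (G : spec m t) (cs : seq (seq (nat * nat))).
Variables (labs1 labs2 : seq (seq tlabel)) (inp : seq nat).
Hypotheses (co : cycle_ordering G cs) (wfG : wf_spec G).
Notation ev := (ev inp P).
Notation hrun := (hrun inp P).
Notation S := (size (enc_spec G cs)).
Notation layout := (layout G cs labs1 labs2 inp).
Notation lab := (nth [::] (labs1 ++ labs2)).
Notation nlabs := (size (labs1 ++ labs2)).
Variables (L : 'I_m -> relation A) (T : nat).
Notation valid_label := (valid_label G cs T).
Notation joins := (joins G cs L T).

Notation caps := (@caps A m t G cs).
Notation entry := (entry A).

Notation context := (@context A m t G cs labs1 labs2 inp L T).
Notation good := (@good A).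

Definition base s := [/\ layout s, full_tables G L s, caps s & rg s rtop = T].

Definition side x := size labs1 <= x.
Definition entries_of (xs : seq nat) : seq entry :=
  flatten [seq map (mk (side x) x) (joins (side x) (lab x)) | x <- xs].

Definition seen_ok s (xs : seq nat) := forall (b : bool) v,
  ar s aSEEN b v != 0 <-> exists2 x, x \in xs & side x = b /\ ar s aCUR x (size (lab x)) = v.

(** The positions in [xs] are those that added joins: one for every label and side among the first
    [n] positions. *)
Definition covers n (xs : seq nat) :=
  [/\ uniq xs, forall x, x \in xs -> x < n,
      forall x y, x \in xs -> y \in xs -> side x = side y -> lab x = lab y -> x = y
    & forall x, x < n -> exists2 y, y \in xs & side y = side x /\ lab y = lab x].

Definition visited s n (xs : seq nat) :=
  [/\ base s /\ rg s 24 = n, good s (entries_of xs), forall x, x < n -> traced s x (lab x), seen_ok s xs & covers n xs].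

Hypothesis lab_valid : forall x, x < nlabs -> all valid_label (lab x).
Hypothesis lab_size : forall x, x < nlabs -> size (lab x) <= 2 * S.

Lemma caps_size s x : caps s -> x < nlabs -> size (lab x) <= rg s rcap.
Proof.
move=> h hx; apply: leq_trans (lab_size hx) (leq_trans _ h).
by rewrite leq_mul2r -{1}[2]muln1 leq_mul2l fact_gt0 orbT.
Qed.

Lemma base_frame s s' : (forall a, a < 10 -> ar s' a = ar s a) -> rg s' rcap = rg s rcap ->
  rg s' rtop = rg s rtop -> base s -> base s'.
Proof.
move=> ha e0 e3 [h1 h2 h3 h4]; split.
- by apply: layout_frame h1 => a lt; apply: ha; apply: ltn_trans lt _.
- by apply: full_tables_frame h2 => a; rewrite !inE => /or4P[] /eqP->; apply: ha.
- by rewrite /Submission.caps e0.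
- by rewrite e3.
Qed.

Lemma mem_entries_of xs en : en \in entries_of xs -> en.1.2 \in xs.
Proof. by case/flattenP=> es /mapP[x hx ->] /mapP[j _ ->]. Qed.

Lemma nth_entries_of xs e : e < size (entries_of xs) -> (nth (entry0 A) (entries_of xs) e).1.2 \in xs.
Proof. by move=> he; apply: mem_entries_of; apply: mem_nth. Qed.

Lemma visitP b s n xs : visited s n xs -> n < nlabs -> side n = b ->
  exists xs', visited (hrun (visit b) s) n.+1 xs'.
Proof.
move=> [[bs e24] gd tr sn cv] hn hb; have [lay ft cap eT] := bs; have [g1 g2] := gd.
rewrite /visit; do 2 rewrite run_seqE.
have [t1 t2 t3 t4] := traceP P lay g1 e24 hn (caps_size cap hn).
have ra := @run_ar_sub inp P trace s [:: aNX; aCUR] _ erefl.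
have rr := @run_rg_sub inp P trace s [:: 27; 28; 36; 37; 38; 39; 40; 42; 43] _ erefl.
set s1 := hrun trace s in t1 t2 t3 t4 ra rr *; clearbody s1.
have bs1 : base s1.
  by apply: base_frame bs => [a lt||]; rewrite ?rr // ra //; case: a lt => [|[|[|[|[|[|[|[|[|[|]]]]]]]]]].
have [cu clt cinj ccov] := cv.
have old x : x < n -> ar s1 aCUR x = ar s aCUR x by move=> hx; apply: t4; rewrite neq_ltn hx.
have gd1 : good s1 (entries_of xs).
  split=> //; apply: entries_ok_frame g2 => //; first by rewrite rr.
    by move=> a; rewrite !inE => /or3P[] /eqP->; rewrite ra.
  by move=> e he x; apply: old; apply: clt; apply: nth_entries_of.
have tr1 x : x < n.+1 -> traced s1 x (lab x).
  rewrite ltnS leq_eqVlt => /orP[/eqP->|hx] //.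
  by apply: traced_le t2 _ (tr x hx); apply: old.
have sn1 : seen_ok s1 xs.
  move=> b' v; rewrite ra //; split.
    by move=> /(sn b' v)[x hx [h1 h2]]; exists x => //; rewrite old //; apply: clt.
  by move=> [x hx [h1 h2]]; apply/(sn b' v); exists x => //; rewrite -old //; apply: clt.
have [lay1 ft1 cap1 eT1] := bs1.
have e24' : rg s1 24 = n by rewrite rr.
have eEndE u : ar u = ar s1 -> rg u = rg s1 -> ev u eEnd = ar s1 aCUR n (size (lab n)).
  move=> ea er; have layu : layout u by apply: layout_frame lay1 => a _; rewrite ea.
  have e24u : rg u 24 = n by rewrite er.
  by rewrite -[LHS]/(ar u aCUR (rg u 24) (ev u eSize)) (ev_size P layu e24u hn) ea e24u.
set v := ar s1 aCUR n (size (lab n)) in eEndE.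
have ec : ev s1 (EA aSEEN (EC (nat_of_bool b)) eEnd) = ar s1 aSEEN b v.
  by rewrite -[LHS]/(ar s1 aSEEN b (ev s1 eEnd)) eEndE.
have fin u xs' : base u -> rg u 24 = n -> good u (entries_of xs') -> (forall x, x < n.+1 -> traced u x (lab x)) ->
   seen_ok u xs' -> covers n.+1 xs' -> visited (hrun (24 ::= EG 24 :+ EC 1) u) n.+1 xs'.
  move=> h1 h2 h3 h4 h5 h6; split=> //; first split.
  - by apply: base_frame h1.
  - by rewrite /= /upd /= h2 addn1.
have mem_same x : x < n -> side x = b -> ar s1 aCUR x (size (lab x)) = v -> lab x = lab n.
  move=> hx hbx /(traced_prefix t1 (tr1 x (leqW hx)) (tr1 n (ltnSn n)) (leqnn _) (leqnn _))[_].
  by rewrite !take_size.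
have [h0|h0] := eqVneq (ar s1 aSEEN b v) 0.
  rewrite run_if0; last by rewrite ec.
  do 2 rewrite run_seqE; set s2 := hrun (CArr aSEEN _ _ _) (tick s1).
  have [a2 r2] : ar s2 = upd3 (ar s1) aSEEN b v 1 /\ rg s2 = rg s1.
    by split=> //; rewrite -[LHS]/(upd3 (ar s1) aSEEN b (ev (tick s1) eEnd) 1) eEndE.
  clearbody s2.
  have a2' a : a != aSEEN -> ar s2 a = ar s1 a.
    by move=> ha; rewrite a2 /upd3; apply: boolp.funext => x; apply: boolp.funext => y; rewrite (negbTE ha).
  have bs2 : base s2 by apply: base_frame bs1 => [a lt||]; rewrite ?r2 // a2' // neq_ltn (leq_trans lt).
  have [lay2 ft2 cap2 eT2] := bs2.
  have gd2 : good s2 (entries_of xs).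
    case: gd1 => k1 k2; split; first by apply: trie_ok_frame k1; rewrite ?a2' ?r2.
    apply: entries_ok_frame k2; rewrite ?r2 //.
    - by move=> a; rewrite !inE => /or3P[] /eqP->; rewrite a2'.
    - by apply: trie_le_refl; rewrite a2'.
    - by move=> e _ x; rewrite a2'.
  have e24'' : rg s2 24 = n by rewrite r2.
  have fv := fill_valuesP co wfG b lay2 ft2 cap2 e24'' hn (lab_valid hn) (caps_size cap2 hn).
  have ra3 : forall a, a \notin [:: aLV] -> ar (hrun (fill_values A b) s2) a = ar s2 a.
    by move=> a; apply: run_ar_sub; case: (b).
  have rr3 : forall r, r \notin [:: 26; 27; 29; 30; 31; 32; 33; 34; 35; 36; 37; 38; 39] ->
     rg (hrun (fill_values A b) s2) r = rg s2 r.
    by move=> r; apply: run_rg_sub; case: (b).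
  set s3 := hrun (fill_values A b) s2 in fv ra3 rr3 *; clearbody s3.
  have bs3 : base s3.
    by apply: base_frame bs2 => [a lt||]; rewrite ?rr3 // ra3 // inE neq_ltn (leq_trans lt).
  have [lay3 ft3 cap3 eT3] := bs3.
  have gd3 : good s3 (entries_of xs).
    case: gd2 => k1 k2; split; first by apply: trie_ok_frame k1; rewrite ?ra3 ?rr3.
    apply: entries_ok_frame k2; rewrite ?rr3 //.
    - by move=> a; rewrite !inE => /or3P[] /eqP->; rewrite ra3.
    - by apply: trie_le_refl; rewrite ra3.
    - by move=> e _ x; rewrite ra3.
  have ct3 : context b s3 n by split=> //; rewrite rr3.
  have [p1 p2] := put_joinsP co wfG ct3 gd3 hn (lab_valid hn) (caps_size cap3 hn).
  have ra4 : forall a, a \notin [:: aNX; aEF; aLS; aCT] -> ar (hrun (put_joins A b) s3) a = ar s3 a.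
    by move=> a; apply: run_ar_sub; case: (b).
  have rr4 : forall r, r \in [:: rcap; rtop; 24] -> rg (hrun (put_joins A b) s3) r = rg s3 r.
    by move=> r; rewrite !inE => /or3P[] /eqP->; rewrite run_rg //; case: (b).
  set s4 := hrun (put_joins A b) s3 in p1 p2 ra4 rr4 *; clearbody s4.
  have le4 : trie_le s1 s4.
    by move=> a c hc; rewrite p2 ra3 // a2' //.
  have cur4 : ar s4 aCUR = ar s1 aCUR by rewrite ra4 // ra3 // a2'.
  exists (rcons xs n); apply: fin.
  - apply: base_frame bs3 => [a lt||]; rewrite ?rr4 // ra4 //.
    by case: a lt => [|[|[|[|[|[|[|[|[|[|]]]]]]]]]].
  - by rewrite rr4 // rr3 // e24''.
  - by rewrite /entries_of map_rcons flatten_rcons hb.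
  - by move=> x hx; apply: traced_le le4 _ (tr1 x hx); rewrite cur4.
  - move=> b' v'; rewrite cur4 ra4 // ra3 // a2 /upd3 eqxx /=; split.
      case: ifP => [/andP[/eqP eb /eqP ->] _|_ /sn1[x hx h]].
        exists n; first by rewrite mem_rcons mem_head.
        by rewrite hb; split=> //; case: (b) (b') eb => -[].
      by exists x => //; rewrite mem_rcons inE hx orbT.
    case=> x; rewrite mem_rcons inE => /orP[/eqP->|hx] [h1 h2].
      by rewrite -h1 hb -h2 !eqxx.
    by case: ifP => // _; apply/sn1; exists x.
  - have nin : forall y, y \in xs -> side y = side n -> lab y = lab n -> False.
      move=> y hy h1 h2; have : ar s1 aSEEN b v != 0; last by rewrite h0.
      apply/sn1; exists y => //; rewrite h1; split=> //.
      rewrite h2 /v; apply: (traced_same t1 _ (tr1 n (ltnSn n))) => //.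
      by rewrite -h2; apply: tr1; apply: leqW; apply: clt.
    split.
    + by rewrite rcons_uniq cu andbT; apply/negP => /clt; rewrite ltnn.
    + by move=> x; rewrite mem_rcons inE => /orP[/eqP->|/clt]; [exact: ltnSn | exact: leqW].
    + move=> x y; rewrite !mem_rcons !inE => /orP[/eqP->|hx] /orP[/eqP->|hy] //.
      * by move=> h1 h2; case: (nin y).
      * by move=> h1 h2; case: (nin x).
      * exact: cinj.
    + move=> x; rewrite ltnS leq_eqVlt => /orP[/eqP->|/ccov[y hy h]].
        by exists n => //; rewrite mem_rcons mem_head.
      by exists y => //; rewrite mem_rcons inE hy orbT.
rewrite run_if1; last by rewrite ec.
exists xs; apply: fin => //.
have [x hx [h1 h2]] : exists2 x, x \in xs & side x = b /\ ar s1 aCUR x (size (lab x)) = v.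
  by apply/sn1.
split=> //.
- by move=> y /clt; apply: leqW.
- move=> y; rewrite ltnS leq_eqVlt => /orP[/eqP->|/ccov //].
  by exists x => //; rewrite hb; split=> //; apply: mem_same => //; apply: clt.
Qed.

Definition fresh s := forall a x y, a \in [:: aNX; aSEEN; aCT] -> ar s a x y = 0.

Lemma visit_allP s : base s -> fresh s -> rg s rleft = size labs1 -> rg s rlab = nlabs ->
  exists xs, visited (hrun visit_all s) nlabs xs.
Proof.
move=> bs fr eL eN; rewrite /visit_all; do 4 rewrite run_seqE.
set s0 := hrun (41 ::= EC 0) _.
have [a0 z24 z40 z41] : [/\ ar s0 = ar s, rg s0 24 = 0, rg s0 40 = 0 & rg s0 41 = 0] by [].
have r0 v : v \notin [:: 24; 40; 41] -> rg s0 v = rg s v.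
  rewrite !inE !negb_or => /and3P[/negbTE n1 /negbTE n2 /negbTE n3].
  by rewrite /s0 /= /upd n1 n2 n3.
clearbody s0.
have v0 : visited s0 0 [::].
  split=> //.
  - by split=> //; apply: base_frame bs => [a _||]; rewrite ?a0 // r0.
  - split.
      by split=> [v c|v c v' c']; rewrite a0 fr // inE eqxx.
    split; [by rewrite z41 | by [] | by [] |] => b I; split; last by [].
    by rewrite a0 fr // !inE eqxx !orbT.
  - by move=> b v; rewrite a0 fr ?inE ?eqxx ?orbT //; split=> // -[x].
have step b u n xs c : visited u n xs -> n + c <= nlabs -> (forall x, n <= x < n + c -> side x = b) ->
    forall e, ev u e = c -> exists xs', visited (hrun (CFor false 60 61 e (visit b)) u) (n + c) xs'.
  move=> vu hc hs e he.
  pose J i s' := exists xs', visited s' (n + i) xs'.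
  apply: (run_loop (J := J) (n := c)) => //.
  - move=> i u1 u2 ea _ er [xs' [[h1 h1'] h2 h3 h4 h5]]; exists xs'; split=> //.
    + by split; [apply: base_frame h1 => [a _||]; rewrite ?ea // er | rewrite er].
    + by apply: good_frame h2; rewrite ?ea // er.
    + by move=> x /h3; apply: traced_le; [apply: trie_le_refl; rewrite ea | rewrite ea].
    + by move=> b' v; rewrite ea; apply: h4.
  - by exists xs; rewrite addn0.
  move=> i u1 hi _ _ _ [xs' hv]; rewrite /J addnS; apply: (visitP hv); first by lia.
  by apply: hs; rewrite leq_addr ltn_add2l.
have [|||xs1 v1] := step false s0 0 [::] (size labs1) v0 _ _ (EG rleft).
- by rewrite add0n size_cat leq_addr.
- by move=> x; rewrite add0n /side /= => hx; apply/negbTE; rewrite -ltnNge.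
- by rewrite /= r0.
have ee : rg (hrun (CFor false 60 61 (EG rleft) (visit false)) s0) rleft = size labs1 /\
   rg (hrun (CFor false 60 61 (EG rleft) (visit false)) s0) rlab = nlabs.
  by split; rewrite run_rg // r0.
set s1 := hrun (CFor _ _ _ _ _) s0 in v1 ee *; clearbody s1.
have [|||xs2 v2] := step true s1 _ xs1 (size labs2) v1 _ _ (EG rlab :- EG rleft).
- by rewrite add0n size_cat.
- by move=> x /andP[]; rewrite add0n /side.
- by rewrite /= ee.1 ee.2 size_cat addKn.
by exists xs2; rewrite add0n -size_cat in v2.
Qed.

End Visits.

(** * Elimination *)

Section TimedLoops.
Variables (inp : seq nat) (P : nat).
Notation ev := (ev inp P).
Notation hrun := (hrun inp P).

(* [k] is a budget: it grows by more than the time of an iteration. *)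
Lemma run_loop_time (J : nat -> nat -> hstate -> Prop) r rn e p n s :
    ev s e = n -> [&& r != rn, r \notin modr p & rn \notin modr p] ->
    (forall i k s s', ar s' = ar s -> ou s' = ou s ->
       (forall v, v \notin [:: r; rn] -> rg s' v = rg s v) -> J i k s -> J i k s') ->
    J 0 0 s ->
    (forall i k s', i < n -> rg s' r = i -> J i k s' ->
       exists2 k', J i.+1 k' (hrun p s') & tm (hrun p s') + k < tm s' + k') ->
  exists2 k, J n k (hrun (CFor false r rn e p) s) & tm (hrun (CFor false r rn e p) s) <= (tm s).+1 + k.
Proof.
move=> en /and3P[h1 h2 h3] st J0 step; rewrite run_forE /= en; set s1 := tick _.
pose I i s' := exists2 k, J i k s' & tm s' <= (tm s).+1 + k.
have : I n (foldl (fun s i => hrun p (tick (setr s r i))) s1 (iota 0 n)).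
  apply: run_for_inv.
    exists 0; last by rewrite addn0.
    apply: st J0 => // v; rewrite !inE negb_or => /andP[_ hv].
    by rewrite /= /upd (negbTE hv).
  move=> i s' hi [k i1 i2]; set s2 := tick _.
  have [||k' j1 j2] := step i k s2 hi.
  - by rewrite /= /upd eqxx.
  - apply: st i1 => // v; rewrite !inE negb_or => /andP[hv _].
    by rewrite /= /upd (negbTE hv).
  by exists k' => //; move: j2; rewrite /=; lia.
move=> [k k1 k2]; exists k => //.
apply: st k1 => // v; rewrite !inE negb_or => /andP[hv _].
by rewrite /= /upd (negbTE hv).
Qed.

End TimedLoops.

(** * One sweep over two lists, independently of the machine *)

Section Sweeps.
Variables (key : nat -> nat) (T : nat).

Definition oriented (c : bool) (a b : nat) := if c then (b, a) else (a, b).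
Definition pend (l : bool -> seq nat) (p : nat * nat) :=
  [&& p.1 \in l false, p.2 \in l true & key p.1 + key p.2 < T].

Definition drained (l0 l : bool -> seq nat) (em : seq (nat * nat)) :=
  [/\ uniq em, forall b, uniq (l b), forall b, {subset l b <= l0 b},
      forall p, pend l0 p = (p \in em) || pend l p & forall p, p \in em -> ~~ pend l p].

Definition swept c a (l l' : bool -> seq nat) es :=
  [/\ perm_eq (l c) (a :: l' c), forall x, x \in l c -> key a <= key x,
      l' (~~ c) = [seq x <- l (~~ c) | key a + key x < T]
    & es = [seq oriented c a x | x <- l' (~~ c)]].

(** All pending pairs with [a] are emitted, so [a] can go. An [x] of the other list whose key is too
    large for the least key [key a] is too large for every key of [l c], so dropping it loses no
    pair. *)
Lemma drained_sweep c a l0 l l' es em : swept c a l l' es -> drained l0 l em -> drained l0 l' (em ++ es).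
Proof.
move=> [h1 h2 h3 h4] [d1 d2 d3 d4 d5].
have m1 x : (x \in l c) = (x == a) || (x \in l' c) by rewrite (perm_mem h1) inE.
have m2 x : (x \in l' (~~ c)) = (x \in l (~~ c)) && (key a + key x < T) by rewrite h3 mem_filter andbC.
have /andP[na ul] : uniq (a :: l' c) by rewrite -(perm_uniq h1).
have mes p : (p \in es) = if c then (p.2 == a) && (p.1 \in l' (~~ c)) else (p.1 == a) && (p.2 \in l' (~~ c)).
  rewrite h4; case: p => x y; apply/mapP/idP => [[z hz ->]|].
    by rewrite /oriented; case: (c) hz => /= hz; rewrite eqxx.
  rewrite /oriented; case: (c) => /= /andP[/eqP-> h]; first by exists x.
  by exists y.
have split_pend p : pend l p = (p \in es) || pend l' p /\ (p \in es -> ~~ pend l' p).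
  rewrite mes /pend; case: (c) m1 m2 h2 na => /= m1 m2 h2 na; rewrite ?m1 ?m2.
    split; last by case/andP=> /eqP-> _; rewrite (negbTE na) andbF.
    case: eqP => [->|_] /=; first by rewrite (negbTE na) andbF orbF addnC.
    case h : (p.2 \in l' true); rewrite ?andbF //= .
    have := h2 p.2; rewrite m1 h orbT => /(_ isT); case: (p.1 \in _) => //=; lia.
  split; last by case/andP=> /eqP-> _; rewrite (negbTE na).
  case: eqP => [->|_] /=; first by rewrite (negbTE na) orbF.
  case h : (p.1 \in l' false); rewrite ?andbF //= .
  have := h2 p.1; rewrite m1 h orbT => /(_ isT); case: (p.2 \in _) => //=; lia.
have ues : uniq es.
  rewrite h4 map_inj_uniq; first by rewrite h3 filter_uniq.
  by move=> x y; rewrite /oriented; case: (c) => -[].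
split.
- rewrite cat_uniq d1 ues andbT /=; apply/hasPn => p hp; apply/negP => /d5.
  by have [-> _] := split_pend p; rewrite hp.
- move=> b; case: (eqVneq b c) => [->|]; first exact: ul.
  by case: b; case: (c) h3 => //= h3 _; rewrite h3 filter_uniq.
- move=> b x hx; apply: d3; case: (eqVneq b c) hx => [->|]; first by rewrite m1 => ->; rewrite orbT.
  by case: b; case: (c) m2 => //= m2 _; rewrite m2 => /andP[].
- by move=> p; rewrite d4 mem_cat; have [-> _] := split_pend p; rewrite orbA.
- move=> p; rewrite mem_cat => /orP[/d5|]; last by have [_] := split_pend p.
  by have [-> _] := split_pend p; rewrite negb_or => /andP[].
Qed.

Lemma foldl_argmin (k : nat -> nat) n : 0 < n ->
  let p := foldl (fun x i => if k i < k x then i else x) 0 (iota 0 n) in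
  p < n /\ forall i, i < n -> k p <= k i.
Proof.
elim: n => // n IH _; rewrite iota_rcons foldl_rcons /=; set p := foldl _ _ _ in IH *.
case: n @p IH => [|n] p IH.
  by rewrite /p /=; case: ifP => _; split=> // -[].
have [h1 h2] := IH isT; case: ifP => h; split=> //; try by lia.
  move=> i; rewrite ltnS leq_eqVlt => /orP[/eqP->//|/h2]; lia.
by move=> i; rewrite ltnS leq_eqVlt => /orP[/eqP->|/h2 //]; lia.
Qed.

(** Removal in constant time: the last entry moves to the freed place. *)
Definition swap_out (l : seq nat) p := take (size l).-1 (set_nth 0 l p (last 0 l)).

Lemma swap_outP l p : p < size l -> [/\ perm_eq l (nth 0 l p :: swap_out l p), size (swap_out l p) = (size l).-1
  & forall q, q < (size l).-1 -> nth 0 (swap_out l p) q = if q == p then nth 0 l (size l).-1 else nth 0 l q].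
Proof.
move=> hp; rewrite /swap_out; split; last first.
- by move=> q hq; rewrite nth_take // nth_set_nth /= -nth_last.
- by rewrite size_takel // size_set_nth leq_max leq_pred orbT.
case/lastP: l hp => // l z; rewrite size_rcons ltnS last_rcons /= => hp.
have setc (B C : seq nat) x : set_nth 0 (B ++ x :: C) (size B) z = B ++ z :: C by elim: B => //= b B ->.
rewrite nth_rcons; case: (ltngtP p (size l)) hp => // [hp|->] _; last first.
  have -> : set_nth 0 (rcons l z) (size l) z = rcons l z by rewrite -cats1 setc.
  by rewrite -cats1 take_size_cat // cats1 perm_rcons.
have [B [C [x [el ep]]]] : exists B C x, l = B ++ x :: C /\ p = size B.
  exists (take p l), (drop p.+1 l), (nth 0 l p).
  by rewrite -drop_nth // cat_take_drop size_takel // ltnW.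
rewrite {}el {}ep nth_cat ltnn subnn /= rcons_cat rcons_cons setc.
have -> : take (size (B ++ x :: C)) (B ++ z :: rcons C z) = B ++ z :: C.
  by rewrite -cats1 -cat_cons catA take_size_cat // !size_cat.
by rewrite -[x :: rcons C z]/([:: x] ++ rcons C z) perm_catCA perm_cons perm_cat2l perm_rcons.
Qed.

End Sweeps.

(** * The elimination program and its running time *)

Section Elimination.
Variable emit : hcmd.

Definition row (b : hexpr) := EG 72 :+ EG 72 :+ b.
Definition eCount b := EA aCT (row b) (EC 0).
Definition eItem b p := EA aLS (row b) p.
Definition eKey e := EA aEF e (EC 1).
Definition eOther := EC 1 :- EG 73.

Definition find_pivot :=
  acc_loop false 76 77 75 (eCount (EG 73)) (EC 0)
    (EIf (eKey (eItem (EG 73) (EG 76)) :< eKey (eItem (EG 73) (EG 75))) (EG 76) (EG 75)).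

Definition remove_pivot :=
  78 ::= eItem (EG 73) (EG 75) ;;
  CArr aLS (row (EG 73)) (EG 75) (eItem (EG 73) (eCount (EG 73) :- EC 1)) ;;
  CArr aCT (row (EG 73)) (EC 0) (eCount (EG 73) :- EC 1).

Definition keep_item :=
  CArr aLS (row eOther) (EG 79) (EG 82) ;; 79 ::= EG 79 :+ EC 1 ;;
  83 ::= EIf (EG 73) (EG 82) (EG 78) ;; 84 ::= EIf (EG 73) (EG 78) (EG 82) ;; emit.

Definition filter_step :=
  82 ::= eItem eOther (EG 80) ;;
  CIf (eKey (EG 78) :+ eKey (EG 82) :< EG rtop) keep_item CSkip.

Definition filter_other :=
  79 ::= EC 0 ;; CFor false 80 81 (eCount eOther) filter_step ;;
  CArr aCT (row eOther) (EC 0) (EG 79).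

Definition sweep :=
  CIf (EIf (eCount (EC 0)) (eCount (EC 1)) (EC 0))
    (73 ::= (eCount (EC 1) :< eCount (EC 0)) ;; find_pivot ;; remove_pivot ;; filter_other)
    CSkip.

(** Every sweep over two nonempty lists shortens the shorter one, so the initial length of the left
    list is a sufficient number of sweeps. Once a list is empty, the remaining sweeps take constant
    time. *)
Definition drain := CFor false 74 85 (eCount (EC 0)) sweep.
(** The trie nodes that carry lists are numbered from 1, as the root is not the child for any
    name. *)
Definition eliminate := CFor false 70 71 (EG 40) (72 ::= EG 70 :+ EC 1 ;; drain).

Variables (inp : seq nat) (P : nat).
Notation ev := (ev inp P).
Notation hrun := (hrun inp P).
Variables (s0 : hstate) (w : nat * nat -> seq nat) (E : nat) (valid : nat * nat -> Prop).
Notation key := (fun e => ar s0 aEF e 1).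
Notation T := (rg s0 rtop).

Definition agree s := (forall a, a \notin [:: aLS; aCT] -> ar s a = ar s0 a) /\
  (forall v, v \in [:: rcap; rtop; 40] -> rg s v = rg s0 v).

Hypotheses (emit_regs : all (fun v => (v \notin [:: rcap; rtop; 40]) && (v < 70)) (modr emit))
  (emit_arrs : moda emit = [::])
  (emit_out : forall s, agree s -> valid (rg s 83, rg s 84) -> ou (hrun emit s) = ou s ++ w (rg s 83, rg s 84))
  (emit_time : forall s, agree s -> tm (hrun emit s) <= tm s + E).

Definition holds s I (l : bool -> seq nat) := forall b : bool,
  ar s aCT (I + I + b) 0 = size (l b) /\
  forall p, p < size (l b) -> ar s aLS (I + I + b) p = nth 0 (l b) p.

Definition other_rows I s s' := forall (J : nat) (b : bool) p, J != I ->
  ar s' aCT (J + J + b) p = ar s aCT (J + J + b) p /\ ar s' aLS (J + J + b) p = ar s aLS (J + J + b) p.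

Lemma row_eq I J (b c : bool) : (J + J + b == I + I + c) = (J == I) && (b == c).
Proof. by case: b c => -[] /=; apply/eqP/andP => [h|[/eqP h1 /eqP h2]] //; try split; apply/eqP || idtac; lia. Qed.

Lemma emit_rg s v : (v \in [:: rcap; rtop; 40]) || (69 < v) -> rg (hrun emit s) v = rg s v.
Proof.
move=> h; apply: run_rg; apply/negP => hv; have /andP[] := allP emit_regs v hv.
by case/orP: h => [->//|h _ h']; move: h h'; lia.
Qed.

Lemma agree_frame s s' : (forall a, a \notin [:: aLS; aCT] -> ar s' a = ar s a) ->
  (forall v, v \in [:: rcap; rtop; 40] -> rg s' v = rg s v) -> agree s -> agree s'.
Proof. by move=> h1 h2 [h3 h4]; split=> [a ha|v hv]; [rewrite h1 ?h3 | rewrite h2 ?h4]. Qed.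

Lemma filter_otherP s I (c : bool) a (l : seq nat) : agree s -> rg s 72 = I -> rg s 73 = c -> rg s 78 = a ->
    ar s aCT (I + I + ~~ c) 0 = size l -> (forall p, p < size l -> ar s aLS (I + I + ~~ c) p = nth 0 l p) ->
    (forall x, x \in l -> key a + key x < T -> valid (oriented c a x)) ->
  let s' := hrun filter_other s in let l' := [seq x <- l | key a + key x < T] in
  [/\ agree s', rg s' 72 = I, 
      ar s' aCT (I + I + ~~ c) 0 = size l' /\ (forall p, p < size l' -> ar s' aLS (I + I + ~~ c) p = nth 0 l' p),
      (forall J (b : bool) p, ~~ ((J == I) && (b == ~~ c)) -> ar s' aCT (J + J + b) p = ar s aCT (J + J + b) p /\
          ar s' aLS (J + J + b) p = ar s aLS (J + J + b) p)
    & ou s' = ou s ++ flatten [seq w (oriented c a x) | x <- l'] /\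
      tm s' <= tm s + 4 + size l * 10 + E * size l'].
Proof.
move=> ag e72 e73 e78 ct ls va; rewrite /filter_other; do 2 rewrite run_seqE.
set s1 := hrun (79 ::= EC 0) s.
have [a1 o1 t1 z1] : [/\ ar s1 = ar s, ou s1 = ou s, tm s1 = (tm s).+1 & rg s1 79 = 0] by [].
have r1 v : v != 79 -> rg s1 v = rg s v by move=> h; rewrite /s1 /= /upd (negbTE h).
clearbody s1.
pose kp i := [seq x <- take i l | key a + key x < T].
have kps i : i < size l -> kp i.+1 = if key a + key (nth 0 l i) < T then rcons (kp i) (nth 0 l i) else kp i.
  by move=> hi; rewrite /kp (take_nth 0 hi) filter_rcons.
have kp_le i : size (kp i) <= i.
  by rewrite /kp size_filter; apply: leq_trans (count_size _ _) _; rewrite size_take_min geq_minl.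
have eo u : rg u 73 = c -> rg u 72 = I -> ev u (row eOther) = I + I + ~~ c.
  by move=> h1 h2; rewrite /= h1 h2; case: (c).
pose J i k u := [/\ [/\ agree u, rg u 72 = I, rg u 73 = c, rg u 78 = a & rg u 79 = size (kp i)],
  ar u aCT = ar s aCT, (forall q p, q != I + I + ~~ c -> ar u aLS q p = ar s aLS q p),
  (forall p, p < size (kp i) -> ar u aLS (I + I + ~~ c) p = nth 0 (kp i) p) /\
  (forall p, i <= p < size l -> ar u aLS (I + I + ~~ c) p = nth 0 l p)
  & ou u = ou s ++ flatten [seq w (oriented c a x) | x <- kp i] /\ k = i * 10 + E * size (kp i)].
have [|||||k0 [[j1 j2 j3 j4 j5] j6 j7 [j8 j9] [j10 j11]] tk] := @run_loop_time inp P J 80 81 (eCount eOther) filter_step (size l) s1.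
- by rewrite -[LHS]/(ar s1 aCT (ev s1 (row eOther)) 0) eo ?r1 // a1.
- have hn v : v \in [:: 80; 81] -> v \notin modr emit.
    by move=> hv; apply/negP => h; have /andP[_] := allP emit_regs v h; move: hv; rewrite !inE => /orP[]/eqP->.
  by rewrite /= !(inE, mem_cat) !negb_or !hn.
- move=> i k u u' ea eo' er [[h1 h2 h3 h4 h5] h6 h7 h8 h9]; split; rewrite ?ea ?eo' ?er //.
  by split; rewrite ?er //; apply: agree_frame h1 => [x _|v]; rewrite ?ea // !inE => /or3P[]/eqP->; rewrite er.
- rewrite /J /kp take0 /= a1 o1 z1 !r1 // muln0 cats0; split=> //.
  by split=> //; apply: agree_frame ag => [x _|v]; rewrite ?a1 // !inE => /or3P[]/eqP->; rewrite r1.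
- move=> i k u hi e80 [[h1 h2 h3 h4 h5] h6 h7 [h8 h8'] [h9 h10]].
  rewrite /filter_step; do 1 rewrite run_seqE; set x := nth 0 l i.
  set u1 := hrun (82 ::= _) u.
  have [b1 o1' t1'] : [/\ ar u1 = ar u, ou u1 = ou u & tm u1 = (tm u).+1] by [].
  have e82 : rg u1 82 = x.
    rewrite -[LHS]/(ar u aLS (ev u (row eOther)) (rg u 80)) eo // e80 h8' ?leqnn //.
  have r2 v : v != 82 -> rg u1 v = rg u v by move=> h; rewrite /u1 /= /upd (negbTE h).
  clearbody u1.
  have ag1 : agree u1.
    by apply: agree_frame h1 => [y _|v]; rewrite ?b1 // !inE => /or3P[]/eqP->; rewrite r2.
  have ec : ev u1 (eKey (EG 78) :+ eKey (EG 82) :< EG rtop) = (key a + key x < T).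
    by rewrite -[LHS]/((ar u1 aEF (rg u1 78) 1 + ar u1 aEF (rg u1 82) 1 < rg u1 rtop) : nat) ag1.1 // (ag1.2 rtop) // e82 r2 // h4.
  case hk : (key a + key x < T).
    rewrite run_if1; last by rewrite ec hk.
    rewrite /keep_item; do 4 rewrite run_seqE; set u2 := hrun (84 ::= _) _.
    have [c1 c2 c3] : [/\ ar u2 = upd3 (ar u) aLS (I + I + ~~ c) (size (kp i)) x, ou u2 = ou u & tm u2 = tm u + 6].
      split=> //; last by rewrite /u2 /= t1'; lia.
      rewrite -[LHS]/(upd3 (ar u1) aLS (ev (tick u1) (row eOther)) (rg u1 79) (rg u1 82)) eo ?(r2 72) ?(r2 73) //= (r2 79) //.
      by rewrite b1 h5 e82.
    have r3 v : v \notin [:: 79; 82; 83; 84] -> rg u2 v = rg u v.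
      rewrite !inE !negb_or => /and4P[/negbTE n1 n2 /negbTE n3 /negbTE n4].
      by rewrite /u2 /= /upd n1 n3 n4 r2.
    have c4 : rg u2 79 = (size (kp i)).+1 by rewrite /u2 /= /upd /= r2 // h5 addn1.
    have c5 : (rg u2 83, rg u2 84) = oriented c a x.
      by rewrite /u2 /= /upd /= (r2 73) // (r2 78) // h3 h4 e82; case: (c).
    clearbody u2.
    have ag2 : agree u2.
      split=> [y hy|v hv]; last by rewrite r3 ?h1.2 //; move: hv; rewrite !inE => /or3P[]/eqP->.
      rewrite c1 /upd3 -(h1.1 y hy); apply: boolp.funext => p; apply: boolp.funext => q.
      by move: hy; rewrite !inE negb_or => /andP[/negbTE-> _].
    have o3 := emit_out ag2; rewrite c5 in o3.
    have a3 : ar (hrun emit u2) = ar u2 by apply: boolp.funext => y; apply: run_ar; rewrite emit_arrs.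
    have t3 := emit_time ag2.
    have r4 : forall v, (v \in [:: rcap; rtop; 40]) || (69 < v) -> rg (hrun emit u2) v = rg u2 v by move=> v; apply: emit_rg.
    set u3 := hrun emit u2 in o3 a3 t3 r4 *; clearbody u3.
    exists (i.+1 * 10 + E * size (kp i.+1)).
      rewrite /J kps // hk size_rcons; split.
      + split; try by rewrite r4 // r3.
        by apply: agree_frame ag2 => [y _|v hv]; rewrite ?a3 // r4 ?hv.
      + by rewrite a3 c1 /upd3 -h6; apply: boolp.funext => p; apply: boolp.funext => q.
      + move=> q p hq; rewrite a3 c1 /upd3 /= (negbTE hq) /=; exact: h7.
      + split=> p hp; rewrite a3 c1 /upd3 /= eqxx /=.
          by rewrite nth_rcons; case: (ltngtP p (size (kp i))) hp => //; [move=> h _; apply: h8 | lia].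
        case: eqP => [e|_]; first by have := kp_le i; lia.
        by apply: h8'; lia.
      + split=> //; rewrite o3; last by apply: va => //; apply: mem_nth.
        by rewrite c2 h9 map_rcons flatten_rcons catA.
    by rewrite h10 kps // hk size_rcons; lia.
  rewrite run_if0; last by rewrite ec hk.
  exists (i.+1 * 10 + E * size (kp i.+1)); last by rewrite h10 kps // hk /= t1'; lia.
  rewrite /J kps // hk /= b1 o1' !r2 //; split=> //.
  by split=> // p hp; apply: h8'; lia.
set u := hrun (CFor _ _ _ _ _) s1 in j1 j2 j3 j4 j5 j6 j7 j8 j9 j10 tk *; clearbody u.
rewrite -/(kp (size l)) in j5 *; have ek : kp (size l) = [seq x <- l | key a + key x < T] by rewrite /kp take_size.
set u' := hrun (CArr _ _ _ _) u.
have [f1 f2 f3 f4] : [/\ ar u' = upd3 (ar u) aCT (I + I + ~~ c) 0 (size (kp (size l))), ou u' = ou u, tm u' = (tm u).+1 & rg u' = rg u].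
  by split=> //; rewrite -[LHS]/(upd3 (ar u) aCT (ev u (row eOther)) 0 (rg u 79)) eo // j5.
clearbody u'; rewrite -ek; split=> //.
- apply: agree_frame j1 => [y|v _]; last by rewrite f4.
  rewrite f1 !inE negb_or => /andP[_ /negbTE hy]; rewrite /upd3; apply: boolp.funext => p; apply: boolp.funext => q.
  by rewrite hy.
- by rewrite f4.
- by rewrite f1 /upd3 /= !eqxx /=; split.
- move=> J' b p; rewrite -row_eq => hb; rewrite f1 /upd3 /= (negbTE hb) /= j6; split=> //; exact: j7.
- by split; [rewrite f2 j10 | rewrite f3; lia].
Qed.

Notation pend := (pend key T).
Notation swept := (swept key T).
Notation drained := (drained key T).

Lemma sweepP s I l : agree s -> rg s 72 = I -> holds s I l -> (forall p, pend l p -> valid p) ->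
  let s' := hrun sweep s in
  exists l' es k, [/\ [/\ agree s', rg s' 72 = I & holds s' I l'], other_rows I s s',
    ou s' = ou s ++ flatten (map w es), tm s' <= tm s + k
  & (l false = [::] \/ l true = [::]) /\ [/\ l' = l, es = [::] & k = 2] \/
    exists c a, [/\ swept c a l l' es, size (l c) <= size (l (~~ c))
      & k = 20 + size (l (~~ c)) * 12 + E * size es]].
Proof.
move=> ag e72 ho va; rewrite /sweep.
have er u (b : bool) : ar u = ar s -> rg u 72 = I -> ev u (eCount (EC b)) = size (l b).
  by move=> h1 h2; rewrite -[LHS]/(ar u aCT (rg u 72 + rg u 72 + b) 0) h1 h2; have [] := ho b.
have ec : ev s (EIf (eCount (EC false)) (eCount (EC true)) (EC 0)) = if size (l false) != 0 then size (l true) else 0.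
  by rewrite ev_if !er.
have [|ne] := eqVneq (if size (l false) != 0 then size (l true) else 0) 0.
  move=> e0; rewrite run_if0; last exact: (etrans ec e0).
  exists l, [::], 2; rewrite /= cats0; split=> //; first by rewrite addn2.
  left; split=> //; move: e0; case: eqP => [/size0nil|_ /size0nil]; by [left | right].
have [n0 n1] : 0 < size (l false) /\ 0 < size (l true) by move: ne; case: (size (l false)) => [|n]; case: (size (l true)).
have n2 b : 0 < size (l b) by case: b.
rewrite run_if1; last by rewrite ec.
pose c := size (l true) < size (l false).
have lec : size (l c) <= size (l (~~ c)) by rewrite /c; case: ltnP => // /ltnW.
do 3 rewrite run_seqE; set s1 := hrun (73 ::= _) _.
have [a1 o1 t1 e73] : [/\ ar s1 = ar s, ou s1 = ou s, tm s1 = tm s + 2 & rg s1 73 = c].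
  split=> //; first by rewrite /s1 /=; lia.
  by rewrite -[LHS]/((ev (tick s) (eCount (EC true)) < ev (tick s) (eCount (EC false))) : nat) !er.
have r1 v : v != 73 -> rg s1 v = rg s v by move=> h; rewrite /s1 /= /upd (negbTE h).
clearbody s1.
have er1 u : ar u = ar s -> rg u 72 = I -> rg u 73 = c -> ev u (eCount (EG 73)) = size (l c).
  by move=> h1 h2 h3; rewrite -[LHS]/(ar u aCT (rg u 72 + rg u 72 + rg u 73) 0) h1 h2 h3; have [] := ho c.
pose ky i := ar s aEF (ar s aLS (I + I + c) i) 1.
have [p1 p2 p3 p4] := @run_acc inp P nat id (fun x i => if ky i < ky x then i else x) 0 (size (l c))
  false 76 77 75 (eCount (EG 73)) (EC 0)
  (EIf (eKey (eItem (EG 73) (EG 76)) :< eKey (eItem (EG 73) (EG 75))) (EG 76) (EG 75)) s1 isT erefl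
  (er1 _ a1 (etrans (r1 72 isT) e72) e73)
  (fun x i s' _ q1 q2 q3 q4 => ltac:(by rewrite ev_if /= q3 a1 q1 q2 !q4 // e73 r1 // e72 /ky; case: ltnP)).
rewrite -/find_pivot in p1 p2 p3 p4.
have pt : tm (hrun find_pivot s1) <= tm s1 + 2 + size (l c) * 2.
  rewrite /find_pivot /acc_loop run_seqE; set s2 := hrun (75 ::= _) s1.
  have [|||||k hk tk] := @run_loop_time inp P (fun i k _ => k = i * 2) 76 77 (eCount (EG 73))
    (75 ::= EIf (eKey (eItem (EG 73) (EG 76)) :< eKey (eItem (EG 73) (EG 75))) (EG 76) (EG 75)) (size (l c)) s2 => //.
  - by apply: er1 => //; rewrite -[LHS]/(rg s1 72) r1.
  - by move=> i k u _ _ ->; exists (i.+1 * 2) => //=; lia.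
  by apply: leq_trans tk _; rewrite hk /s2 /=; lia.
set pv := foldl _ _ _ in p1; set s2 := hrun find_pivot s1 in p1 p2 p3 p4 pt *.
have [pvl pvm] := foldl_argmin ky (n2 c); rewrite -/pv in pvl pvm; clearbody s2.
set a := nth 0 (l c) pv; have [hc1 hc2] := ho c.
have kyE i : i < size (l c) -> ky i = key (nth 0 (l c) i).
  by move=> hi; rewrite /ky hc2 // ag.1.
have amin x : x \in l c -> key a <= key x.
  by move=> /(nthP 0)[i hi <-]; rewrite /a -!kyE //; apply: pvm.
rewrite /remove_pivot; do 2 rewrite run_seqE; set s3 := hrun (78 ::= _) s2.
have [z72 z73 z75] : [/\ rg s2 72 = I, rg s2 73 = c & rg s2 75 = pv] by split; [rewrite p4 // r1 | rewrite p4 | rewrite p1].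
have [b1 b2 b3 b4] : [/\ ar s3 = ar s, ou s3 = ou s, tm s3 = (tm s2).+1 & rg s3 78 = a].
  rewrite /s3 /= /upd /= p2 p3 o1 a1; split=> //.
  by rewrite z72 z73 z75 hc2.
have b5 v : v != 78 -> rg s3 v = rg s2 v by move=> h; rewrite /s3 /= /upd (negbTE h).
clearbody s3; set s4 := hrun (CArr aLS _ _ _) s3.
have [d1 d2 d3 d4] : [/\ ar s4 = upd3 (ar s) aLS (I + I + c) pv (nth 0 (l c) (size (l c)).-1), ou s4 = ou s, tm s4 = (tm s3).+1 & rg s4 = rg s3].
  split=> //; rewrite -[LHS]/(upd3 (ar s3) aLS (rg s3 72 + rg s3 72 + rg s3 73) (rg s3 75)
    (ar s3 aLS (rg s3 72 + rg s3 72 + rg s3 73) (ev s3 (eCount (EG 73)) - 1))) er1 ?b5 // ?z72 ?z73 //.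
  by rewrite z75 b1 subn1 hc2 // prednK ?n2.
clearbody s4; set s5 := hrun (CArr aCT _ _ _) s4.
have [f1 f2 f3 f4] : [/\ ar s5 = upd3 (ar s4) aCT (I + I + c) 0 (size (l c)).-1, ou s5 = ou s, tm s5 = (tm s4).+1 & rg s5 = rg s3].
  split=> //; rewrite -[LHS]/(upd3 (ar s4) aCT (rg s4 72 + rg s4 72 + rg s4 73) 0
    (ar s4 aCT (rg s4 72 + rg s4 72 + rg s4 73) 0 - 1)) d4 !b5 // z72 z73 d1 /= subn1.
  by rewrite -hc1.
clearbody s5.
have ne5 : (I + I + ~~ c == I + I + c) = false by rewrite row_eq eqxx; case: (c).
have r5 v : v \notin [:: 73; 75; 76; 77; 78] -> rg s5 v = rg s v.
  rewrite !inE !negb_or => /and5P[h1 h2 h3 h4 h5]; rewrite f4 b5 // p4 ?r1 // !inE !negb_or h2 h3 h4 //.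
have ag5 : agree s5.
  apply: agree_frame ag => [y|v].
    rewrite !inE negb_or => /andP[/negbTE h1 /negbTE h2]; rewrite f1 d1 /upd3.
    by apply: boolp.funext => q; apply: boolp.funext => q'; rewrite h1 h2.
  by rewrite !inE => /or3P[]/eqP->; rewrite r5.
have [||||||q1 q2 [q3 q4] q5 [q6 q7]] := @filter_otherP s5 I c a (l (~~ c)) ag5.
- by rewrite r5.
- by rewrite f4 b5.
- by rewrite f4.
- by rewrite f1 d1 /upd3 /= ne5; have [] := ho (~~ c).
- by move=> p hp; rewrite f1 d1 /upd3 /= ne5; have [_] := ho (~~ c); apply.
- move=> x hx hk; apply: va; rewrite /Submission.pend.
  have ha : a \in l c by apply: mem_nth.
  by rewrite /oriented; case: (c) hx ha => /= -> -> //=; rewrite addnC.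
set s6 := hrun (filter_other) s5 in q1 q2 q3 q4 q5 q6 q7 *; clearbody s6.
have [w1 w2 w3] := swap_outP pvl.
set l1 := [seq x <- l (~~ c) | _] in q3 q4 q6 q7.
exists (fun b => if b == c then swap_out (l c) pv else l1), [seq oriented c a x | x <- l1],
  (20 + size (l (~~ c)) * 12 + E * size [seq oriented c a x | x <- l1]).
have nc : (~~ c == c) = false by case: (c).
split.
- split=> // b; case: (eqVneq b c) => [->|nb].
    have [g1 _] := q5 I c 0 (ltac:(by rewrite eqxx; case: (c))); rewrite g1 f1 /upd3 /= !eqxx /= w2; split=> // p hp.
    have [_ ->] := q5 I c p (ltac:(by rewrite eqxx; case: (c))).
    rewrite f1 d1 /upd3 /= !eqxx /= w3 //; case: eqP => // _; apply: hc2.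
    exact: leq_trans hp (leq_pred _).
  by have -> : b = ~~ c by case: (b) (c) nb => -[].
- move=> J b p hJ; have [|-> ->] := q5 J b p; first by rewrite (negbTE hJ).
  by rewrite f1 d1 /upd3 /= !row_eq (negbTE hJ).
- by rewrite q6 f2 -map_comp.
- by rewrite size_map; move: q7 pt; lia.
right; exists c, a; split=> //; split=> //; first by rewrite eqxx.
- by rewrite nc.
- by rewrite nc.
Qed.

(** A sweep costs time linear in the longer list; the search for the pivot in the shorter list is
    covered by this, which is the reason for choosing the shorter one. Each entry scanned in the
    longer list is either emitted with the pivot or dropped. The potential [12 * sz l] pays for the
    dropped entries, and the factor 12 in [12 + E] for the emitted ones. *)
Lemma drainP s I l0 : agree s -> rg s 72 = I -> holds s I l0 -> (forall b, uniq (l0 b)) ->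
    (forall p, pend l0 p -> valid p) ->
  let s' := hrun drain s in
  exists em, [/\ uniq em, forall p, (p \in em) = pend l0 p, agree s' /\ other_rows I s s',
    ou s' = ou s ++ flatten (map w em)
  & tm s' <= (tm s).+1 + 34 * (size (l0 false) + size (l0 true)) + (12 + E) * size em].
Proof.
move=> ag e72 ho ul va; rewrite /drain; set n0 := size (l0 false).
pose sz (l : bool -> seq nat) := size (l false) + size (l true).
pose J i k u := exists l em, [/\ [/\ agree u, rg u 72 = I & holds u I l], other_rows I s u /\
    minn (size (l false)) (size (l true)) <= n0 - i, drained l0 l em, 
    ou u = ou s ++ flatten (map w em) & k + 12 * sz l = i * 22 + 12 * sz l0 + (12 + E) * size em].
have hn v : 69 < v -> v \notin modr emit.
  by move=> hv; apply/negP => h; have /andP[_] := allP emit_regs v h; move: hv; lia.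
have [|||||k [l [em [[j1 j2 j3] [j4 j5] [d1 d2 d3 d4 d5] j7 j8]]] tk] := @run_loop_time inp P J 74 85 (eCount (EC 0)) sweep n0 s.
- by rewrite -[LHS]/(ar s aCT (rg s 72 + rg s 72 + false) 0) e72; have [] := ho false.
- by rewrite /= !(inE, mem_cat) !negb_or !hn.
- move=> i k u u' ea eo er [l [em [[h1 h2 h3] [h4 h5] h6 h7 h8]]]; exists l, em; split=> //.
  + split; rewrite ?er //; last by move=> b; rewrite ea; apply: h3.
    by apply: agree_frame h1 => [x _|v]; rewrite ?ea // !inE => /or3P[]/eqP->; rewrite er.
  + by split=> // J' b p hJ; rewrite ea; apply: h4.
  + by rewrite eo.
- exists l0, [::]; split=> //; last by rewrite muln0 addn0.
  + by split=> //; rewrite subn0 geq_minl.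
  + by split; [by [] | exact: ul | by move=> b x | by move=> p | by move=> p].
  + by rewrite cats0.
- move=> i k u hi _ [l [em [[h1 h2 h3] [h4 h5] h6 h7 h8]]].
  have va' p : pend l p -> valid p by move=> hp; apply: va; have [_ _ _ -> _] := h6; rewrite hp orbT.
  have [l' [es [k' [[g1 g2 g3] g4 g5 g6 g7]]]] := sweepP h1 h2 h3 va'.
  set u' := hrun sweep u in g1 g2 g3 g4 g5 g6 *; clearbody u'.
  have orw : other_rows I s u'.
    by move=> J' b p hJ; have [-> ->] := g4 J' b p hJ; apply: h4.
  case: g7 => [[le [el ee ek]]|[c [a [sw lec ek]]]].
    subst l' es k'; exists (k + 22); last by lia.
    exists l, em; split=> //; last by lia.
      by split=> //; case: le => ->; rewrite ?minn0 ?min0n.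
    by rewrite g5 h7 /= cats0.
  have [w1 w2 w3 w4] := sw.
  have e1 := perm_size w1; rewrite /= in e1.
  have e2 : size es = size (l' (~~ c)) by rewrite w4 size_map.
  have e3 : size (l' (~~ c)) <= size (l (~~ c)) by rewrite w3 size_filter count_size.
  have eqs (f : bool -> seq nat) : sz f = size (f c) + size (f (~~ c)) by rewrite /sz; case: (c) => //=; rewrite addnC.
  have eqm (f : bool -> seq nat) : minn (size (f false)) (size (f true)) = minn (size (f c)) (size (f (~~ c))).
    by case: (c) => //=; rewrite minnC.
  exists (k + (22 + 12 * (sz l - sz l') + (12 + E) * size es)).
    exists l', (em ++ es); split=> //.
    + by split=> //; move: h5; rewrite !eqm; lia.
    + exact: drained_sweep sw h6.
    + by rewrite g5 h7 map_cat flatten_cat catA.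
    + by rewrite size_cat mulnDr; move: h8; rewrite !eqs; lia.
  by rewrite !eqs mulnDl; move: g6; rewrite ek; lia.
exists em; split=> //.
- move=> p; rewrite d4; have -> : pend l p = false; last by rewrite orbF.
  move: j5; rewrite subnn /Submission.pend; case e0 : (l false) => [|x y] //=; case e1 : (l true) => [|x' y'] /=; last by rewrite minnSS.
  by rewrite andbF.
- apply: leq_trans tk _; move: j8; rewrite /sz -/n0; set z := (12 + E) * _; lia.
Qed.

Variables (lst : nat -> bool -> seq nat).
Hypotheses (lst_holds : forall I, 0 < I -> holds s0 I (lst I)) (lst_uniq : forall I b, uniq (lst I b))
  (lst_disj : forall I J b x, x \in lst I b -> x \in lst J b -> I = J)
  (lst_valid : forall I p, 0 < I -> pend (lst I) p -> valid p).

Lemma eliminateP : let s' := hrun eliminate s0 in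
  exists em, [/\ uniq em, forall p, p \in em <-> exists2 I, 0 < I <= rg s0 40 & pend (lst I) p,
    ou s' = ou s0 ++ flatten (map w em)
  & tm s' <= (tm s0).+1 + 4 * rg s0 40 + 34 * \sum_(i < rg s0 40) (size (lst i.+1 false) + size (lst i.+1 true))
      + (12 + E) * size em].
Proof.
rewrite /eliminate; set n := rg s0 40.
pose J i k u := exists em, [/\ agree u, uniq em, forall p, p \in em <-> exists2 I, 0 < I <= i & pend (lst I) p,
  ou u = ou s0 ++ flatten (map w em) /\ (forall I (b : bool) p, i < I -> ar u aCT (I + I + b) p = ar s0 aCT (I + I + b) p /\
     ar u aLS (I + I + b) p = ar s0 aLS (I + I + b) p)
  & k = 4 * i + 34 * \sum_(j < i) (size (lst j.+1 false) + size (lst j.+1 true)) + (12 + E) * size em].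
have hn v : 69 < v -> v \notin modr emit.
  by move=> hv; apply/negP => h; have /andP[_] := allP emit_regs v h; move: hv; lia.
have [|||||k [em [j1 j2 j3 [j4 _] j5]] tk] := @run_loop_time inp P J 70 71 (EG 40) (72 ::= EG 70 :+ EC 1 ;; drain) n s0 => //.
- by rewrite /= !(inE, mem_cat) !negb_or !hn.
- move=> i k u u' ea eo er [em [h1 h2 h3 [h4 h4'] h5]]; exists em; split=> //.
  + by apply: agree_frame h1 => [x _|v]; rewrite ?ea // !inE => /or3P[]/eqP->; rewrite er.
  + by rewrite eo ea.
- exists [::]; split=> //; last by rewrite big_ord0 !muln0.
  + by move=> p; split=> // -[I]; case: I.
  + by rewrite cats0; split.
- move=> i k u hi e70 [em [h1 h2 h3 [h4 h4'] h5]]; rewrite run_seqE; set u1 := hrun (72 ::= _) u.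
  have [a1 o1 t1 e72] : [/\ ar u1 = ar u, ou u1 = ou u, tm u1 = (tm u).+1 & rg u1 72 = i.+1].
    by split=> //; rewrite /u1 /= /upd /= e70 addn1.
  have r1 v : v != 72 -> rg u1 v = rg u v by move=> h; rewrite /u1 /= /upd (negbTE h).
  clearbody u1.
  have ag1 : agree u1 by apply: agree_frame h1 => [x _|v]; rewrite ?a1 // !inE => /or3P[]/eqP->; rewrite r1.
  have ho1 : holds u1 i.+1 (lst i.+1).
    move=> b; have [z1 z2] := lst_holds (ltn0Sn i) b; rewrite a1; split.
      by have [-> _] := h4' i.+1 b 0 (ltnSn i).
    by move=> p hp; have [_ ->] := h4' i.+1 b p (ltnSn i); apply: z2.
  have [es [g1 g2 [g3 g4] g5 g6]] := drainP ag1 e72 ho1 (lst_uniq i.+1) (fun p => lst_valid (ltn0Sn i)).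
  set u2 := hrun drain u1 in g3 g4 g5 g6 *; clearbody u2.
  exists (k + (4 + 34 * (size (lst i.+1 false) + size (lst i.+1 true)) + (12 + E) * size es)); last by lia.
  exists (em ++ es); split=> //.
  + rewrite cat_uniq h2 g1 andbT /=; apply/hasPn => p; rewrite g2 => /and3P[hp _ _]; apply/negP => /h3[I hI /and3P[hp' _ _]].
    by have := lst_disj hp hp'; lia.
  + move=> p; rewrite mem_cat g2; split.
      by case/orP=> [/h3[I hI hp]|hp]; [exists I => //; lia | exists i.+1 => //; lia].
    case=> I /andP[I0]; rewrite leq_eqVlt => /orP[/eqP->->|hI hp]; first by rewrite orbT.
    by apply/orP; left; apply/h3; exists I => //; lia.
  + split; first by rewrite g5 o1 h4 map_cat flatten_cat catA.
    move=> I b p hI; have [|-> ->] := g4 I b p; first by rewrite neq_ltn hI orbT.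
    by rewrite a1; apply: h4'; apply: ltnW.
  + by rewrite h5 big_ord_recr /= size_cat !mulnDr; lia.
exists em; split=> //.
by apply: leq_trans tk _; rewrite j5; lia.
Qed.

End Elimination.

(** * Uniqueness of the relation of two labels *)

Section Unique.
Variables (m t : nat) (G : spec m t) (cs : seq (seq (nat * nat))).
Variables (A : automaton) (L : 'I_m -> relation A) (K : nat -> nat -> nat -> relation A).

Lemma label_pair_unique ls1 ls2 c b c' b' :
  label_pair G cs L K ls1 ls2 c b -> label_pair G cs L K ls1 ls2 c' b' -> c = c' /\ b = b'.
Proof.
have fork (X : seq tlabel) x y r1 r2 : x <> y -> X ++ x :: r1 <> X ++ y :: r2.
  by move=> xy e; have := cat_cons_head e.
have np k i j : i != j -> ProdLabel k i <> ProdLabel k j by move=> /eqP ij [].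
have n1 s u a x y : (x < y) && a -> RecLabel s u x <> RecLabel s u y by move=> /andP[xy _] [e]; lia.
have n2 s u a x y : (y < x) && a -> RecLabel s u x <> RecLabel s u y by move=> /andP[xy _] [e]; lia.
case=> [e|X k i j r1 r2 e1 e2 ij h|X s u x y k i j r1 r2 e1 e2 xy hc h|X s u x y k i j r1 r2 e1 e2 xy hc h];
  case=> [e'|X' k' i' j' r1' r2' e1' e2' ij' h'|X' s' u' x' y' k' i' j' r1' r2' e1' e2' xy' hc' h'|X' s' u' x' y' k' i' j' r1' r2' e1' e2' xy' hc' h'];
  try by []; try (by case: (fork _ _ _ _ _ (np _ _ _ ij')  (etrans (esym e1') (etrans e e2'))));
  try (by case: (fork _ _ _ _ _ (n1 _ _ _ _ _ xy')  (etrans (esym e1') (etrans e e2'))));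
  try (by case: (fork _ _ _ _ _ (n2 _ _ _ _ _ xy')  (etrans (esym e1') (etrans e e2'))));
  try (by case: (fork _ _ _ _ _ (np _ _ _ ij)  (etrans (esym e1) (etrans e' e2))));
  try (by case: (fork _ _ _ _ _ (n1 _ _ _ _ _ xy)  (etrans (esym e1) (etrans e' e2))));
  try (by case: (fork _ _ _ _ _ (n2 _ _ _ _ _ xy)  (etrans (esym e1) (etrans e' e2)))).
- by have [_ [<- <-] [<-] <- <-] := fork_unique (np _ _ _ ij) (np _ _ _ ij') (etrans (esym e1) e1') (etrans (esym e2) e2').
- by have [] := fork_unique (np _ _ _ ij) (n1 _ _ _ _ _ xy') (etrans (esym e1) e1') (etrans (esym e2) e2').
- by have [] := fork_unique (np _ _ _ ij) (n2 _ _ _ _ _ xy') (etrans (esym e1) e1') (etrans (esym e2) e2').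
- by have [] := fork_unique (n1 _ _ _ _ _ xy) (np _ _ _ ij') (etrans (esym e1) e1') (etrans (esym e2) e2').
- have [_ [es eu ex] [_ _ ey] [ek ei er1] er2] := fork_unique (n1 _ _ _ _ _ xy) (n1 _ _ _ _ _ xy') (etrans (esym e1) e1') (etrans (esym e2) e2').
  by subst; move: hc; rewrite hc' => -[->].
- have [_ [es eu ex] [_ _ ey] _ _] := fork_unique (n1 _ _ _ _ _ xy) (n2 _ _ _ _ _ xy') (etrans (esym e1) e1') (etrans (esym e2) e2').
  by subst; lia.
- by have [] := fork_unique (n2 _ _ _ _ _ xy) (np _ _ _ ij') (etrans (esym e1) e1') (etrans (esym e2) e2').
- have [_ [es eu ex] [_ _ ey] _ _] := fork_unique (n2 _ _ _ _ _ xy) (n1 _ _ _ _ _ xy') (etrans (esym e1) e1') (etrans (esym e2) e2').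
  by subst; lia.
- have [_ [es eu ex] [_ _ ey] er1 [ek ei er2]] := fork_unique (n2 _ _ _ _ _ xy) (n2 _ _ _ _ _ xy') (etrans (esym e1) e1') (etrans (esym e2) e2').
  by subst; move: hc; rewrite hc' => -[->].
Qed.

End Unique.

(** * Evaluating a matched pair and emitting the answer *)

Section Emission.
Variable A : automaton.
Notation P := (table_size A).

Definition eField e c := EA aEF e (EC c).

Definition emit_label e :=
  53 ::= e ;;
  CFor true 54 55 (EA aEP (EG 53) (EC 0) :- EA aLP (EG 53) (EC 0))
    (CEmit (EI (EA aLP (EG 53) (EC 0) :+ EG 54))).

Definition eval_middle :=
  CIf (eField (EG 83) 3 :=? EC 4) (cycle_product_from A (EG 31 :+ (EG 51 :+ EC 1)) true)
    (CIf (eField (EG 83) 3 :=? EC 5) (cycle_product_from A (EG 31 :+ (EG 52 :+ EC 1)) false)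
      (33 ::= eone A)).

Definition emit_pair :=
  30 ::= eField (EG 83) 4 ;; 31 ::= eField (EG 83) 5 ;;
  51 ::= eField (EG 83) 1 ;; 52 ::= eField (EG 84) 1 ;;
  32 ::= EG rtop :- (EG 51 :+ EG 52) :- EC 1 ;;
  eval_middle ;;
  33 ::= emul A (emul A (eField (EG 83) 2) (EG 33)) (eField (EG 84) 2) ;;
  CIf (eaccept A (EG 33)) (emit_label (eField (EG 83) 0) ;; emit_label (eField (EG 84) 0)) CSkip.

Variables (m t : nat) (G : spec m t) (cs : seq (seq (nat * nat))).
Variables (labs1 labs2 : seq (seq tlabel)) (inp : seq nat).
Hypotheses (co : cycle_ordering G cs) (wfG : wf_spec G).
Notation ev := (ev inp P).
Notation hrun := (hrun inp P).
Notation S := (size (enc_spec G cs)).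
Notation layout := (layout G cs labs1 labs2 inp).
Notation lab := (nth [::] (labs1 ++ labs2)).
Notation nlabs := (size (labs1 ++ labs2)).
Variables (L : 'I_m -> relation A) (T : nat).
Notation base := (@base A m t G cs labs1 labs2 inp L T).
Notation middle := (@middle m t G cs A L T).
Notation pair_value := (@pair_value m t G cs A L T).

Lemma size_enc_label ls : size (enc_label ls) <= 4 * size ls + 1.
Proof.
rewrite /enc_label /enc_seq /= addn1 ltnS; elim: ls => //= l ls IH.
by rewrite size_cat mulnS leq_add //; case: l.
Qed.

Lemma emit_labelP s e x : layout s -> ev s e = x -> x < nlabs -> size (enc_label (lab x)) <= rg s rcap ->
  let s' := hrun (emit_label e) s in
  [/\ ou s' = ou s ++ enc_label (lab x), ar s' = ar s & forall v, v \notin [:: 53; 54; 55] -> rg s' v = rg s v].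
Proof.
move=> lay ee hx hcap; rewrite /emit_label run_seqE; set s1 := hrun (53 ::= e) s.
have [a1 o1 e53] : [/\ ar s1 = ar s, ou s1 = ou s & rg s1 53 = x] by rewrite -ee.
have r1 v : v != 53 -> rg s1 v = rg s v by move=> h; rewrite /s1 /= /upd (negbTE h).
clearbody s1; have [_ _ /(_ x hx)[h1 h2 _]] := lay; set W := enc_label (lab x) in h1 h2 hcap *.
pose J i u := ou u = ou s ++ take i W /\ ar u = ar s.
have [] : J (size W) (hrun (CFor true 54 55 (EA aEP (EG 53) (EC 0) :- EA aLP (EG 53) (EC 0))
    (CEmit (EI (EA aLP (EG 53) (EC 0) :+ EG 54)))) s1).
  apply: (run_loop (J := J)) => //.
  - apply: for_count_capped; last by rewrite r1.
    by rewrite -[LHS]/(ar s1 aEP (rg s1 53) 0 - ar s1 aLP (rg s1 53) 0) e53 a1 h2 addKn.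
  - by move=> i u u' ea eo _ [j1 j2]; split; rewrite ?eo ?ea.
  - by split; rewrite ?take0 ?cats0.
  move=> i u hi e54 er _ [j1 j2]; split=> //.
  rewrite -[LHS]/(rcons (ou u) (nth 0 inp (ar u aLP (rg u 53) 0 + rg u 54))) e54 er // e53 j2 h1 //.
  by rewrite j1 (take_nth 0) // -rcons_cat.
rewrite take_size => j1 j2; split=> // v; rewrite !inE !negb_or => /and3P[n1 n2 n3].
by rewrite run_rg ?r1 // !inE !negb_or n2 n3.
Qed.

Lemma emit_pairP s (b1 b2 : bool) x y j1 j2 : base s -> 8 * S + 1 <= rg s rcap ->
    entry_at s (rg s 83) (b1, x, j1) -> entry_at s (rg s 84) (b2, y, j2) ->
    x < nlabs -> y < nlabs -> size (lab x) <= 2 * S -> size (lab y) <= 2 * S ->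
    (j1.1.1.2.1.1.1 \in [:: 4; 5] -> j1.1.1.2.1.1.2 < size cs) ->
  ou (hrun emit_pair s) = ou s ++ if raccept (pair_value j1 j2) then enc_label (lab x) ++ enc_label (lab y) else [::].
Proof.
case: j1 => [[[q1 [[[w0 w1] w2] w3]] k1] v1]; case: j2 => [[[q2 [[[w0' w1'] w2'] w3']] k2] v2].
move=> bs cap8 ex ey hx hy sx sy hw; case: bs => lay ft cap eT.
have [x1 x2 x3 x4 [x5 x6]] : [/\ ar s aEF (rg s 83) 0 = x, ar s aEF (rg s 83) 1 = k1,
   ar s aEF (rg s 83) 2 = code v1, ar s aEF (rg s 83) 3 = w0
  & ar s aEF (rg s 83) 4 = w1 /\ ar s aEF (rg s 83) 5 = w2] by exact: ex.
have [y1 y2 y3] : [/\ ar s aEF (rg s 84) 0 = y, ar s aEF (rg s 84) 1 = k2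
  & ar s aEF (rg s 84) 2 = code v2] by case: ey.
have {}hw : w0 \in [:: 4; 5] -> w1 < size cs by exact: hw.
rewrite -[pair_value _ _]/(rmul (rmul v1 (middle (w0, w1, w2, w3) k1 k2)) v2).
rewrite /emit_pair; do 5 rewrite run_seqE; set s1 := hrun (32 ::= _) _.
have [a1 o1] : ar s1 = ar s /\ ou s1 = ou s by [].
have [e30 e31 e51 e52 e32] : [/\ rg s1 30 = w1, rg s1 31 = w2, rg s1 51 = k1, rg s1 52 = k2 & rg s1 32 = (T - (k1 + k2)).-1].
  by split; [exact: x5 | exact: x6 | exact: x2 | exact: y2 | rewrite -subn1 -x2 -y2 -eT].
have r1 v : v \notin [:: 30; 31; 51; 52; 32] -> rg s1 v = rg s v.
  rewrite !inE !negb_or => /and5P[/negbTE n1 /negbTE n2 /negbTE n3 /negbTE n4 /negbTE n5].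
  by rewrite /s1 /= /upd n1 n2 n3 n4 n5.
clearbody s1; rewrite run_seqE; set s2 := hrun eval_middle s1.
have [v33 a2 o2 r2] : [/\ rg s2 33 = code (middle (w0, w1, w2, w3) k1 k2), ar s2 = ar s, ou s2 = ou s
    & forall v, v \notin [:: 34; 35; 33] -> rg s2 v = rg s1 v].
  have cond u c : ar u = ar s -> rg u 83 = rg s 83 -> ev u (eField (EG 83) 3 :=? EC c) = (w0 == c).
    by move=> h1 h2; rewrite -[LHS]/((ar u aEF (rg u 83) 3 == c) : nat) h1 h2 x4.
  have lay1 u : ar u = ar s -> layout u by move=> h; apply: layout_frame lay => a _; rewrite h.
  have ft1 u : ar u = ar s -> full_tables G L u by move=> h; apply: full_tables_frame ft => a _; rewrite h.
  have -> : middle (w0, w1, w2, w3) k1 k2 =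
      if w0 == 4 then cycle_val G cs L true w1 (w2 + k1.+1) (T - (k1 + k2)).-1
      else if w0 == 5 then cycle_val G cs L false w1 (w2 + k2.+1) (T - (k1 + k2)).-1 else rone A by [].
  rewrite /s2 /eval_middle; case: (eqVneq w0 4) => [e4|n4].
    rewrite run_if1; last by rewrite cond ?r1 // e4.
    have [||||||c1 c2 c3 c4] := @cycle_product_fromP A _ _ G cs labs1 labs2 inp co L (EG 31 :+ (EG 51 :+ EC 1)) (w2 + k1.+1) true (tick s1) w1.
    - exact: lay1.
    - exact: ft1.
    - by rewrite -[rg _ _]/(rg s1 rcap) r1.
    - by apply: hw; rewrite e4.
    - exact: e30.
    - by move=> u _ hr; rewrite -[LHS]/(rg u 31 + (rg u 51 + 1)) !hr // -[rg _ 31]/(rg s1 31) -[rg _ 51]/(rg s1 51) e31 e51 addn1.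
    split; [by rewrite c1 -e32 | by rewrite c2 -a1 | by rewrite c3 -o1 | exact: c4].
  rewrite run_if0; last by rewrite cond ?r1 // (negbTE n4).
  case: (eqVneq w0 5) => [e5|n5].
    rewrite run_if1; last by rewrite cond ?r1 // e5.
    have [||||||c1 c2 c3 c4] := @cycle_product_fromP A _ _ G cs labs1 labs2 inp co L (EG 31 :+ (EG 52 :+ EC 1)) (w2 + k2.+1) false (tick (tick s1)) w1.
    - exact: lay1.
    - exact: ft1.
    - by rewrite -[rg _ _]/(rg s1 rcap) r1.
    - by apply: hw; rewrite e5.
    - exact: e30.
    - by move=> u _ hr; rewrite -[LHS]/(rg u 31 + (rg u 52 + 1)) !hr // -[rg _ 31]/(rg s1 31) -[rg _ 52]/(rg s1 52) e31 e52 addn1.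
    split; [by rewrite c1 -e32 | by rewrite c2 -a1 | by rewrite c3 -o1 | exact: c4].
  rewrite run_if0; last by rewrite cond ?r1 // (negbTE n5).
  split=> // v; rewrite !inE !negb_or => /and3P[_ _ /negbTE h].
  by rewrite /= /upd h.
clearbody s2; rewrite run_seqE; set s3 := hrun (33 ::= _) s2; set c := rmul _ v2.
have e33 : rg s3 33 = code c.
  have e83 : rg s2 83 = rg s 83 by rewrite r2 // r1.
  have e84 : rg s2 84 = rg s 84 by rewrite r2 // r1.
  rewrite -[LHS]/(ev s2 (emul A (emul A (eField (EG 83) 2) (EG 33)) (eField (EG 84) 2))).
  apply: ev_emul; first apply: ev_emul => //.
  - by rewrite -[LHS]/(ar s2 aEF (rg s2 83) 2) a2 e83.
  - by rewrite -[LHS]/(ar s2 aEF (rg s2 84) 2) a2 e84.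
have [a3 o3] : ar s3 = ar s /\ ou s3 = ou s by [].
have r3 v : v \notin [:: 30; 31; 51; 52; 32; 33; 34; 35] -> rg s3 v = rg s v.
  rewrite !inE !negb_or => /and5P[n1 n2 n3 n4 /and4P[n5 n6 n7 n8]].
  by rewrite /s3 /= /upd (negbTE n6) r2 ?r1 // !inE !negb_or ?n1 ?n2 ?n3 ?n4 ?n5 ?n6 ?n7 ?n8.
clearbody s3.
have ea : ev s3 (eaccept A (EG 33)) = raccept c by apply: ev_eaccept.
case hac : (raccept c); last by rewrite run_if0 ?ea ?hac // cats0 -o3.
rewrite run_if1 ?ea ?hac // run_seqE.
have lay3 : layout (tick s3) by apply: layout_frame lay => a _; rewrite /= a3.
have szl z : size (lab z) <= 2 * S -> size (enc_label (lab z)) <= rg s rcap.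
  by move=> h; apply: leq_trans (size_enc_label _) _; apply: leq_trans cap8; lia.
have [||o4 a4 r4] := @emit_labelP (tick s3) (eField (EG 83) 0) x lay3 _ hx.
- by rewrite -[LHS]/(ar s3 aEF (rg s3 83) 0) a3 r3.
- by rewrite -[rg _ _]/(rg s3 rcap) r3 // szl.
set s4 := hrun (emit_label _) (tick s3) in o4 a4 r4 *; clearbody s4.
have lay4 : layout s4 by apply: layout_frame lay3 => a _; rewrite a4.
have [||o5 _ _] := @emit_labelP s4 (eField (EG 84) 0) y lay4 _ hy.
- by rewrite -[LHS]/(ar s4 aEF (rg s4 84) 0) a4 -[ar _]/(ar s3) a3 r4 // -[rg _ _]/(rg s3 84) r3.
- by rewrite r4 // -[rg _ _]/(rg s3 rcap) r3 // szl.
by rewrite o5 o4 -[ou (tick s3)]/(ou s3) o3 catA.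
Qed.

End Emission.

(** * Answers and running time *)

Section Answers.
Variable A : automaton.
Notation P := (table_size A).
Variables (m t : nat) (G : spec m t) (cs : seq (seq (nat * nat))).
Variables (labs1 labs2 : seq (seq tlabel)) (inp : seq nat).
Hypotheses (co : cycle_ordering G cs) (wfG : wf_spec G).
Notation hrun := (hrun inp P).
Notation S := (size (enc_spec G cs)).
Notation lab := (nth [::] (labs1 ++ labs2)).
Notation nlabs := (size (labs1 ++ labs2)).
Variables (L : 'I_m -> relation A) (T : nat).
Hypothesis T0 : 0 < T.
Notation K := (path_table G L).
Notation valid_label := (valid_label G cs T).
Notation joins := (joins G cs L T).
Notation base := (@base A m t G cs labs1 labs2 inp L T).
Notation entries_of := (@entries_of A m t G cs labs1 labs2 L T).
Notation visited := (@visited A m t G cs labs1 labs2 inp L T).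
Notation pair_value := (@pair_value m t G cs A L T).
Notation side := (side labs1).
Notation matched := (matched G cs L T).

Hypothesis lab_valid : forall x, x < nlabs -> all valid_label (lab x).
Hypothesis lab_size : forall x, x < nlabs -> size (lab x) <= 2 * S.

Definition connected p := `[< exists c, label_pair G cs L K (lab p.1) (lab p.2) c true >].
Definition accepted p := `[< exists2 c, label_pair G cs L K (lab p.1) (lab p.2) c true & raccept c >].

Lemma entriesP xs en : en \in entries_of xs <->
  [/\ en.1.2 \in xs, en.1.1 = side en.1.2 & en.2 \in joins en.1.1 (lab en.1.2)].
Proof.
split=> [/flattenP[es /mapP[x hx ->] /mapP[j hj ->]]|]; first by [].
case: en => [[b x] j] /= [hx -> hj]; apply/flattenP; exists (map (mk (side x) x) (joins (side x) (lab x))).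
  by apply: map_f.
exact: (map_f (mk (side x) x)).
Qed.

Lemma entries_uniq xs : uniq xs -> uniq (entries_of xs).
Proof.
elim: xs => //= x xs IH /andP[hx /IH u]; rewrite /Submission.entries_of /= cat_uniq u andbT; apply/andP; split.
  rewrite map_inj_uniq; first exact: joins_uniq.
  by move=> j j' [].
by apply/hasPn => en /entriesP[h _ _]; apply: contra hx => /mapP[j _ e]; move: h; rewrite e.
Qed.

Lemma joins_size b ls j : j \in joins b ls -> j.1.1.1 <= size ls.
Proof.
rewrite mem_rcons inE => /orP[/eqP->//|/flattenP[js /mapP[q]]].
by rewrite mem_iota /= add0n => hq -> /joins_at_depth ->; apply: ltnW.
Qed.

(** An entry has one side and one trie node, so it is counted in a single list. The elimination
    therefore costs time linear in the number of joins in addition to the emitted pairs. *)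
Lemma sum_listing s (Es : seq (entry A)) n :
  \sum_(i < n) (size (listing s Es false i.+1) + size (listing s Es true i.+1)) <= size Es.
Proof.
have e i : size (listing s Es false i) + size (listing s Es true i) =
  \sum_(e <- iota 0 (size Es)) (instance s (nth (entry0 A) Es e) == i).
  rewrite /listing !size_filter; elim: (iota _ _) => [|e l IH] /=; first by rewrite big_nil.
  rewrite big_cons -IH; case: (nth _ _ _) => -[[] x] j /=; lia.
under eq_bigr do rewrite e.
rewrite exchange_big /=; apply: (@leq_trans (\sum_(e <- iota 0 (size Es)) 1)).
  apply: leq_sum => e' _; set I := instance _ _.
  elim: n => [|n IH]; first by rewrite big_ord0.
  rewrite big_ord_recr /=; case: eqP => [eI|]; last by rewrite addn0.
  by rewrite big1 // => i _; rewrite eI eqSS gtn_eqF.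
by rewrite sum1_size size_iota.
Qed.

Lemma match_tag ls1 ls2 j1 j2 : all valid_label ls1 -> all valid_label ls2 -> matched ls1 ls2 j1 j2 ->
  j1.1.1.2.1.1.1 \in [:: 4; 5] -> j1.1.1.2.1.1.2 < size cs.
Proof.
move=> v1 v2 /(matchedP wfG T0 v1 v2)[e|X k i j r1 r2 e1 e2 hK|X s u a b k i j r1 r2 e1 e2 ab hc hK|X s u a b k i j r1 r2 e1 e2 ab hc hK] //= _.
  by move: v1; rewrite e1 all_cat /= => /andP[_ /andP[/andP[-> _] _]].
by move: v1; rewrite e1 all_cat /= => /andP[_ /andP[/andP[-> _] _]].
Qed.

(** Pairs pending in a common list correspond to matching joins, and by uniqueness of the match
    these correspond to connected pairs of positions. So [size ps] counts connected pairs, accepted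
    or not, and the time is linear in it. *)
Lemma eliminate_emitP d s xs : (forall s, tm (hrun (emit_pair A) s) <= tm s + d * (rg s rcap).+1 ^ d) ->
    visited s nlabs xs -> 8 * S + 1 <= rg s rcap ->
  let s' := hrun (eliminate (emit_pair A)) s in
  exists ps : seq (nat * nat), [/\ uniq ps,
     forall x y, (x, y) \in ps <-> [/\ x \in xs, y \in xs, side x = false, side y = true & connected (x, y)],
     ou s' = ou s ++ flatten [seq enc_label (lab p.1) ++ enc_label (lab p.2) | p <- ps & accepted p]
   & tm s' <= (tm s).+1 + 4 * rg s 40 + 34 * rg s 41 + (12 + d * (rg s rcap).+1 ^ d) * size ps].
Proof.
move=> ht [[bs e24] [g1 [g2 g3 g4 g5]] tr sn [cu clt cinj ccov]] cap8.
set Es := entries_of xs in g2 g3 g4 g5.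
pose en e := nth (entry0 A) Es e.
have enP e : e < size Es -> [/\ (en e).1.2 \in xs, (en e).1.1 = side (en e).1.2 & (en e).2 \in joins (en e).1.1 (lab (en e).1.2)].
  by move=> he; apply/entriesP; apply: mem_nth.
pose key e := ar s aEF e 1.
have keyE e : e < size Es -> key e = (en e).2.1.2.
  by move=> he; have := g3 e he; rewrite -/(en e); case: (en e) => [[b x] [[[q w] k] v]] [].
pose lst I b := listing s Es b I.
have mlst I b e : (e \in lst I b) = [&& e < size Es, (en e).1.1 == b & instance s (en e) == I].
  by rewrite mem_filter mem_iota add0n /= andbC.
pose rel p := [/\ p.1 < size Es, p.2 < size Es, (en p.1).1.1 = false, (en p.2).1.1 = true
   & matched (lab (en p.1).1.2) (lab (en p.2).1.2) (en p.1).2 (en p.2).2].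
(* A node of the trie determines its parent and the word leading to it: standing at a common node
   means equal names and equal parents, hence equal depths and prefixes. *)
have relP p : rel p <-> exists2 I, 0 < I <= rg s 40 & pend key (rg s rtop) (lst I) p.
  have eT : rg s rtop = T by case: bs.
  rewrite /pend eT; split.
    case=> h1 h2 b1 b2 [m1 m2 [eq et] ew hk].
    have [x1 s1 j1] := enP _ h1; have [x2 s2 j2] := enP _ h2.
    have i12 : instance s (en p.2) = instance s (en p.1).
      rewrite /instance ew -eq; congr (child _ _ _).
      set q := (en p.1).2.1.1.1 in eq et *.
      have q1 : q <= size (lab (en p.1).1.2) := joins_size m1.
      have q2 : q <= size (lab (en p.2).1.2) by rewrite eq (joins_size m2).
      have t1 : traced s (en p.1).1.2 (take q (lab (en p.1).1.2)).
        have [z1 z2] := tr _ (clt _ x1); split=> // r; rewrite size_takel // => hr.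
        by rewrite nth_take //; apply: z2; apply: leq_trans hr q1.
      have t2 : traced s (en p.2).1.2 (take q (lab (en p.1).1.2)).
        rewrite et -eq; have [z1 z2] := tr _ (clt _ x2); split=> // r; rewrite size_takel // => hr.
        by rewrite nth_take //; apply: z2; apply: leq_trans hr q2.
      by apply: (traced_same g1 t2 t1); rewrite size_takel.
    exists (instance s (en p.1)).
      rewrite lt0n g4 //=; case: g1 => + _; exact.
    by rewrite !mlst h1 h2 b1 b2 i12 !eqxx !keyE.
  move=> [I /andP[I0 _]]; rewrite !mlst => /and3P[/and3P[h1 /eqP b1 /eqP i1] /and3P[h2 /eqP b2 /eqP i2] hk].
  have [x1 s1 j1] := enP _ h1; have [x2 s2 j2] := enP _ h2.
  rewrite b1 in j1; rewrite b2 in j2; split=> //; rewrite !keyE // in hk; split=> //.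
    have [_ inj] := g1.
    have [] := inj (ar s aCUR (en p.1).1.2 (en p.1).2.1.1.1) (word_code (en p.1).2.1.1.2) (ar s aCUR (en p.2).1.2 (en p.2).2.1.1.1) (word_code (en p.2).2.1.1.2).
    - by rewrite -/(child _ _ _) -/(instance _ _) i1 -lt0n.
    - by rewrite -!/(child _ _ _) -!/(instance _ _) i1 i2.
    by move=> e _; apply: (traced_prefix g1 (tr _ (clt _ x1)) (tr _ (clt _ x2)) (joins_size j1) (joins_size j2)).
  have [_ inj] := g1.
  have [|_ /word_code_inj //] := inj (ar s aCUR (en p.1).1.2 (en p.1).2.1.1.1) (word_code (en p.1).2.1.1.2) (ar s aCUR (en p.2).1.2 (en p.2).2.1.1.1) (word_code (en p.2).2.1.1.2) _ (etrans i1 (esym i2)).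
  by rewrite -/(child _ _ _) -/(instance _ _) i1 -lt0n.
pose w p := if raccept (pair_value (en p.1).2 (en p.2).2) then enc_label (lab (en p.1).1.2) ++ enc_label (lab (en p.2).1.2) else [::].
have [||||||||em [m1 m2 m3 m4]] := @eliminateP (emit_pair A) inp P s w (d * (rg s rcap).+1 ^ d) rel _ _ _ _ lst.
- by [].
- by [].
- move=> u [ua ur]; set e0 := rg u 83; set e1 := rg u 84 => -[h1 h2 b1 b2 hm].
  have [x1 s1 j1] := enP _ h1; have [x2 s2 j2] := enP _ h2; rewrite /= in h1 h2 b1 b2 hm x1 x2.
  have bu : base u.
    apply: base_frame bs => [a ha||]; rewrite ?ur // ua // !inE negb_or.
    by case: a ha => [|[|[|[|[|[|[|[|[|[|]]]]]]]]]].
  have ent e : e < size Es -> entry_at u e ((en e).1.1, (en e).1.2, (en e).2).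
    move=> he; have := g3 e he; rewrite -/(en e); case: (en e) => [[b x] [[[q w'] k] v]].
    by rewrite /entry_at ua.
  rewrite -[w _]/(if raccept (pair_value (en e0).2 (en e1).2) then enc_label (lab (en e0).1.2) ++ enc_label (lab (en e1).1.2) else [::]).
  apply: (emit_pairP co wfG bu _ (ent _ h1) (ent _ h2)); rewrite ?ur //.
  + exact: clt.
  + exact: clt.
  + by apply/lab_size/clt.
  + by apply/lab_size/clt.
  + by apply: match_tag hm; apply/lab_valid/clt.
- by move=> u [_ ur]; rewrite -(ur rcap) //; apply: ht.
- by move=> I I0 b; apply: g5.
- by move=> I b; rewrite filter_uniq // iota_uniq.
- by move=> I J b x; rewrite !mlst => /and3P[_ _ /eqP<-] /and3P[_ _ /eqP<-].
- move=> I p I0 hp; apply/relP; exists I => //; rewrite I0 /=.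
  move: hp; rewrite /pend mlst => /andP[/and3P[_ _ /eqP <-] _]; case: g1 => + _; exact.
have {}m2 p : p \in em <-> rel p by rewrite relP m2.
pose f (p : nat * nat) := ((en p.1).1.2, (en p.2).1.2).
have uEs : uniq Es by apply: entries_uniq.
have finj : {in em &, injective f}.
  move=> [a b] [a' b'] /m2[/= h1 h2 b1 b2 hm] /m2[/= h1' h2' b1' b2' hm'] [ea eb].
  have [x1 _ _] := enP _ h1; have [x2 _ _] := enP _ h2.
  rewrite -ea -eb in hm'; have v1 := lab_valid (clt _ x1); have v2 := lab_valid (clt _ x2).
  have [e1 e2] := match_unique wfG T0 v1 (matchedP wfG T0 v1 v2 hm) (matchedP wfG T0 v1 v2 hm').
  congr (_, _); apply/eqP; rewrite -(nth_uniq (entry0 A) _ _ uEs) // -/(en _) -/(en _).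
    by apply/eqP; move: ea b1 b1' e1; case: (en a) => [[? ?] ?]; case: (en a') => [[? ?] ?] /= -> -> -> ->.
  by apply/eqP; move: eb b2 b2' e2; case: (en b) => [[? ?] ?]; case: (en b') => [[? ?] ?] /= -> -> -> ->.
exists (map f em); split.
- by rewrite map_inj_in_uniq.
- move=> x y; split.
    case/mapP=> p /m2[h1 h2 b1 b2 hm] [-> ->].
    have [x1 s1 _] := enP _ h1; have [x2 s2 _] := enP _ h2; split=> //; [by rewrite -s1 | by rewrite -s2 |].
    apply/asboolP; exists (pair_value (en p.1).2 (en p.2).2); apply: match_pair => //; try exact/lab_valid/clt.
    by apply: (matchedP wfG T0 _ _ hm); exact/lab_valid/clt.
  case=> hx hy sx sy /asboolP[c hc].
  have v1 := lab_valid (clt _ hx); have v2 := lab_valid (clt _ hy).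
  have [j1 [j2 hm]] := pair_match wfG T0 v1 v2 hc.
  have [k1 k2 _ _ _] := hm.
  have E1 : (false, x, j1) \in Es by apply/entriesP.
  have E2 : (true, y, j2) \in Es by apply/entriesP.
  have [e1 he1 n1] : exists2 e, e < size Es & en e = (false, x, j1).
    by exists (index (false, x, j1) Es); rewrite ?index_mem // /en nth_index.
  have [e2 he2 n2] : exists2 e, e < size Es & en e = (true, y, j2).
    by exists (index (true, y, j2) Es); rewrite ?index_mem // /en nth_index.
  clearbody en; apply/mapP; exists (e1, e2); last by rewrite /f n1 n2.
  apply/m2; split; rewrite -?[(e1, e2).1]/e1 -?[(e1, e2).2]/e2 ?n1 ?n2 //.
- rewrite m3; congr (_ ++ _).
  have key1 p : p \in em -> w p = if accepted (f p) then enc_label (lab (f p).1) ++ enc_label (lab (f p).2) else [::].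
    move=> /m2[h1 h2 b1 b2 hm]; have [x1 _ _] := enP _ h1; have [x2 _ _] := enP _ h2.
    have v1 := lab_valid (clt _ x1); have v2 := lab_valid (clt _ x2).
    have hp := match_pair wfG co T0 v1 v2 (matchedP wfG T0 v1 v2 hm).
    rewrite /w; congr (if _ then _ else _); apply/idP/asboolP => [h|[c hc ha]]; first by exists (pair_value (en p.1).2 (en p.2).2).
    by have [-> _] := label_pair_unique hp hc.
  elim: (em) key1 => //= p l IH hl; rewrite hl ?mem_head // IH; last by move=> q hq; apply: hl; rewrite inE hq orbT.
  by case: ifP.
- rewrite size_map; apply: leq_trans m4 _; rewrite leq_add2r leq_add2l leq_mul2l /=.
  by rewrite g2; apply: sum_listing.
Qed.

End Answers.

Fixpoint counts_by_one r (p : hcmd) : bool :=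
  match p with
  | CSet r' e => (r' != r) || (if e is EO Add (EG r'') (EC 1) then r'' == r else false)
  | CSeq p q | CIf _ p q => counts_by_one r p && counts_by_one r q
  | CFor _ r' rn _ p => [&& r' != r, rn != r & counts_by_one r p]
  | _ => true
  end.

(** A register that grows only in steps of one is bounded by the elapsed time. This bounds the
    number of trie nodes and the number of joins by the time already spent on creating them. *)
Lemma counter_le inp P r p s : counts_by_one r p ->
  rg (hrun inp P p s) r + tm s <= rg s r + tm (hrun inp P p s).
Proof.
elim: p s => //=; try by (move=> *; rewrite addnS leqnSn).
- move=> r' e s h; rewrite /upd; case: eqP => [er|_]; last by rewrite addnS leqnSn.
  by move: h; rewrite er eqxx; case: e => // -[] // [] // r'' [] // [|[|]] //= /eqP->; lia.
- by move=> p IHp q IHq s /andP[hp hq]; have := IHp s hp; have := IHq (hrun inp P p s) hq; lia.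
- by move=> e p IHp q IHq s /andP[hp hq]; case: ifP => _; [have := IHp (tick s) hp | have := IHq (tick s) hq]; rewrite /=; lia.
- move=> cl r' rn e p IHp s /and3P[h1 h2 h3]; rewrite /upd eq_sym (negbTE h1).
  apply: (run_for_inv (I := fun i u => rg u r + tm s <= rg s r + tm u)) => [|i u _ hu].
    by rewrite /= /upd eq_sym (negbTE h2) addnS leqnSn.
  by have := IHp (tick (setr u r' i)) h3; rewrite /= /upd eq_sym (negbTE h1); lia.
Qed.

Lemma uniq_flatten_nth (X : eqType) (ss : seq (seq X)) :
  (forall i, i < size ss -> uniq (nth [::] ss i)) ->
  (forall i j x, i < size ss -> j < size ss -> x \in nth [::] ss i -> x \in nth [::] ss j -> i = j) ->
  uniq (flatten ss).
Proof.
elim: ss => //= s ss IH h1 h2; rewrite cat_uniq (h1 0) // IH ?andbT /=.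
- apply/hasPn => x /flattenP[s' /(nthP [::])[j hj <-] hx]; apply/negP => hs.
  by have := h2 0 j.+1 x isT hj hs hx.
- by move=> i hi; apply: (h1 i.+1).
- by move=> i j x hi hj hx hy; have [] := h2 i.+1 j.+1 x hi hj hx hy.
Qed.

(** * Sizes of the encodings and well-formed labels *)

Section Bounds.
Variables (m t : nat) (G : spec m t) (cs : seq (seq (nat * nat))).
Hypotheses (wfG : wf_spec G) (cgG : coarse_grained G) (slG : strictly_linear G) (co : cycle_ordering G cs).
Notation S := (size (enc_spec G cs)).

(** The cycles are vertex-disjoint and each edge has its own source module, so all cycles together
    have at most [m] edges. Without this the listed cycles could make the input exceed every
    polynomial in the size of the specification. *)
Lemma size_cycles : size (flatten cs) <= m /\ size cs <= m.
Proof.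
have hp s : s < size cs -> pg_cycle G (nth [::] cs s).
  by move=> hs; apply: (allP co.1); apply: mem_nth.
have u : uniq (flatten [seq map (pg_src G) c | c <- cs]).
  apply: uniq_flatten_nth => [i|i j M]; rewrite size_map => hi.
    by rewrite (nth_map [::]) //; have /and4P[_ _ _] := hp i hi.
  move=> hj; rewrite !(nth_map [::]) // => h1 h2.
  have e : nth [::] cs i =i nth [::] cs j.
    case: (slG (hp i hi) (hp j hj)) => // /hasPn /(_ M h2).
    by move=> /negP[]; exact: h1.
  have [s [_ un]] := co.2 _ (hp j hj).
  by rewrite -(un i) // (un j).
have le : size (flatten cs) <= m.
  rewrite -(size_map (pg_src G)) map_flatten -(card_uniqP u).
  by apply: leq_trans (max_card _) _; rewrite card_ord.
split=> //; apply: leq_trans le.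
have ne : forall c, c \in cs -> 0 < size c.
  by move=> c /(allP co.1)/and4P[h _ _ _]; rewrite lt0n size_eq0.
elim: (cs) ne => //= c l IH ne; rewrite size_cat.
have := ne c (mem_head _ _); have := IH (fun c' hc => ne c' (ltac:(by rewrite inE hc orbT))); lia.
Qed.

Lemma size_enc_spec_le : S <= 10 * (spec_size G).+1.
Proof.
have [h1 h2] := size_cycles.
have e1 : size (enc_seq (fun M => [:: nat_of_bool (M \in composite G)]) (enum 'I_m)) = m.+1.
  by rewrite /enc_seq /= (size_flatten_const (c := 1)) // size_enum_ord mul1n.
have e2 : size (enc_seq (enc_seq (fun e : nat * nat => [:: e.1; e.2])) cs) = (size cs + 2 * size (flatten cs)).+1.
  rewrite /enc_seq /=; congr _.+1; elim: (cs) => //= c l IH.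
  by rewrite !size_cat /= (size_flatten_const (c := 2)) // IH mulnDr; lia.
have e3 : size (enc_seq (fun p : 'I_m * graph nat m t => nat_of_ord p.1 :: enc_graph p.2) (prods G)) <=
    (3 * \sum_(p <- prods G) (size (nodes p.2) + size (edges p.2)).+1).+1.
  rewrite /enc_seq /=; rewrite ltnS; elim: (prods G) => [|p l IH]; first by rewrite big_nil.
  have eg (W : graph nat m t) : size (enc_graph W) = 2 + size (nodes W) + 3 * size (edges W).
    rewrite /enc_graph /enc_seq size_cat /= (size_flatten_const (c := 1)) // (size_flatten_const (c := 3)) //; lia.
  rewrite big_cons; set f := fun p : 'I_m * graph nat m t => _; move: IH; rewrite -/f => IH.
  have -> : flatten (map f (p :: l)) = f p ++ flatten (map f l) by [].
  rewrite size_cat -[size (f p)]/(size (enc_graph p.2)).+1 eg.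
  have E a b c e : a <= 3 * c -> (2 + b + 3 * e).+1 + a <= 3 * ((b + e).+1 + c) by lia.
  exact: E.
have E x y : x <= (3 * y).+1 -> 2 + (m.+1 + (x + (size cs + 2 * size (flatten cs)).+1)) <= 10 * (m + t + y).+1.
  by lia.
by rewrite /enc_spec !size_cat e1 e2; apply: E.
Qed.

(** The part of [valid_label] that depends on the specification only; the bound [T] on the indices
    is found when the labels are read. *)
Definition wf_label (l : tlabel) :=
  match l with
  | ProdLabel k i => (k < size (prods G)) && (i < nn G k)
  | RecLabel s _ _ => s < size cs
  end.

Lemma wf_labels M a : addr_ok G a -> all wf_label (labels G cs M a).
Proof.
have first N : all wf_label (first_label G cs N).
  by rewrite /first_label; case: ifP => //= h; rewrite andbT.
elim: a => [|e a IH] //= /and3P[/andP[e1 e2] _ /IH h]; rewrite /extend; case: ifP => _.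
  elim: (labels G cs M a) h => // l ls IHl /= /andP[h1 h2].
  by case: l h1 => [k i|s u i] /= h1; case: ls IHl h2 => [|l ls] IHl h2; rewrite /= ?h1 ?IHl.
by rewrite all_cat h /= e1 e2 first.
Qed.

Lemma valid_wf_label T ls : all wf_label ls -> (forall q, q < size ls -> index_lt (nth tlabel0 ls q) T) ->
  all (valid_label G cs T) ls.
Proof.
move=> /(all_nthP tlabel0) h1 h2; apply/(all_nthP tlabel0) => q hq; have := h1 q hq; have := h2 q hq.
by case: (nth _ _ _) => //= s u a -> ->.
Qed.

End Bounds.

Lemma size_enc_input m t (G : spec m t) cs labs1 labs2 : let S := size (enc_spec G cs) in
    (forall x, x < size (labs1 ++ labs2) -> size (nth [::] (labs1 ++ labs2) x) <= 2 * S) ->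
  size (enc_input G cs labs1 labs2) <= S + 2 + size (labs1 ++ labs2) * (8 * S + 1).
Proof.
cbv zeta; rewrite /enc_input; move: (enc_spec G cs) => sp h; rewrite !size_cat /enc_seq /=.
have E a b c e : a + b <= c -> e + (a.+1 + b.+1) <= e + 2 + c by lia.
apply: E; rewrite -[size labs1 + _]size_cat.
rewrite -size_cat -flatten_cat -map_cat; elim: (labs1 ++ labs2) h => // l ls IH h.
have -> : flatten (map enc_label (l :: ls)) = enc_label l ++ flatten (map enc_label ls) by [].
rewrite size_cat -[size (l :: ls)]/(size ls).+1 mulSn; apply: leq_add.
  by apply: leq_trans (size_enc_label _) _; have := h 0 isT; rewrite /=; lia.
by apply: IH => x; apply: (h x.+1).
Qed.

(** The cap is [2 * period A + 10] times the size of the encoded specification. It covers the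
    reduced number of steps along a cycle as well as the length of an encoded label. It is formed by
    repeated addition, since [tame] does not admit products. *)
Definition setup (A : automaton) :=
  rcap ::= EC 0 ;; CFor false 10 11 (EG rspec) (rcap ::= EG rcap :+ EC (2 * period A + 10)).

Definition search A :=
  read_input true ;; setup A ;; fill_tables A ;; visit_all A ;; eliminate (emit_pair A).

Lemma setupP inp P A s : let s' := hrun inp P (setup A) s in
  [/\ rg s' rcap = rg s rspec * (2 * period A + 10), ar s' = ar s, ou s' = ou s,
      forall v, v \notin [:: rcap; 10; 11] -> rg s' v = rg s v & tm s' <= tm s + 2 + 2 * rg s rspec].
Proof.
rewrite /setup run_seqE; set s1 := hrun _ _ (rcap ::= EC 0) s; set cc := 2 * _ + 10.
have [a1 o1 t1 z1] : [/\ ar s1 = ar s, ou s1 = ou s, tm s1 = (tm s).+1 & rg s1 rcap = 0] by [].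
have r1 v : v != rcap -> rg s1 v = rg s v by move=> h; rewrite /s1 /= /upd (negbTE h).
clearbody s1 cc.
pose J i k u := [/\ k = i * 2, rg u rcap = i * cc, ar u = ar s & ou u = ou s].
have [|||||k [j1 j2 j3 j4] tk] := @run_loop_time inp P J 10 11 (EG rspec) (rcap ::= EG rcap :+ EC cc) (rg s rspec) s1 => //.
- exact: r1.
- by move=> i k u u' ea eo er [h1 h2 h3 h4]; split; rewrite ?ea ?eo ?er.
- move=> i k u _ _ [h1 h2 h3 h4]; exists (i.+1 * 2); last by rewrite h1 /=; lia.
  by split=> //; rewrite /= /upd /= h2 mulSn addnC.
split=> //; last by apply: leq_trans tk _; rewrite j1 t1; lia.
by move=> v; rewrite !inE !negb_or => /and3P[h1 h2 h3]; rewrite run_rg ?r1 // !inE !negb_or h2 h3.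
Qed.

(** The constant [C] is chosen from the automaton before any specification is given: it collects the
    degrees of the capped parts and the factor between the cap and the size of the encoded
    specification. *)
Lemma searchP A R : recognizes A R -> exists C, forall m t (G : spec m t) cs labs1 labs2 s,
  let inp := enc_input G cs labs1 labs2 in
  let lab := nth [::] (labs1 ++ labs2) in
  let n := size (labs1 ++ labs2) in
  let S := size (enc_spec G cs) in
  let L := module_code G A in
  wf_spec G -> coarse_grained G -> cycle_ordering G cs ->
  (forall x, x < n -> all (wf_label G cs) (lab x)) -> (forall x, x < n -> size (lab x) <= 2 * S) ->
  (forall k x y, ar s k x y = 0) ->
  let s' := hrun inp (table_size A) (search A) s in
  exists xs (ps : seq (nat * nat)), [/\ covers labs1 labs2 n xs, uniq ps,
     forall x y, (x, y) \in ps <-> [/\ x \in xs, y \in xs, side labs1 x = false, side labs1 y = true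
        & connected G cs labs1 labs2 L (x, y)],
     ou s' = ou s ++ flatten [seq enc_label (lab p.1) ++ enc_label (lab p.2) | p <- ps & accepted G cs labs1 labs2 L p]
   & tm s' <= tm s + C * S.+1 ^ C * (n + size ps).+1].
Proof.
move=> RA; pose P := table_size A.
have [d1 h1] : exists d, forall inp s, tm (hrun inp P (fill_tables A) s) <= tm s + d * (rg s rcap).+1 ^ d.
  exact: capped_time.
have [d2 h2] := @loop_time P 60 61 (EG rleft) (visit A false) isT isT.
have [d3 h3] := @loop_time P 60 61 (EG rlab :- EG rleft) (visit A true) isT isT.
have [d4 h4] : exists d, forall inp s, tm (hrun inp P (emit_pair A) s) <= tm s + d * (rg s rcap).+1 ^ d.
  exact: capped_time.
pose cc := 2 * period A + 10; pose d := (d1 + d2 + d3 + d4).+1.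
exists (1000 * (d * cc ^ d) + d) => m t G cs labs1 labs2 s inp lab n S L wfG cgG co wl szl ar0.
rewrite /search; do 4 rewrite run_seqE.
have [[_ e4] [e5 e2] lay [eT idx] t1] := read_inputP P (erefl inp) true s.
have o1 := run_ou inp P (p := read_input true) s isT.
have ra1 := @run_ar_sub inp P (read_input true) s [:: aPP; aPE; aCP; aLP; aLT; aEP] _ erefl.
set s1 := hrun _ _ (read_input true) s in e4 e5 e2 lay eT idx t1 o1 ra1 *; clearbody s1.
have [f1 f2 f3 f4 f5] := setupP inp P A s1.
set s2 := hrun _ _ (setup A) s1 in f1 f2 f3 f4 f5 *; clearbody s2; rewrite e4 -/cc -/S in f1 f5.
set T := rg s1 rtop in eT idx.
have S0 : 0 < S by [].
have lay2 : layout G cs labs1 labs2 inp s2 by apply: layout_frame (lay isT) => a _; rewrite f2.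
have capS : 2 * period A * S <= S * cc by rewrite mulnC leq_mul2l leq_addr orbT.
have cap8 : 8 * S + 1 <= S * cc.
  rewrite /cc mulnDr; apply: leq_trans (leq_addl _ _); lia.
have cap2 : capped_spec G cs s2.
  rewrite /capped_spec f1 -/S leq_pmulr //; rewrite /cc; lia.
have ft := fill_tablesP (erefl inp) wfG cgG RA lay2 cap2.
have ra3 : forall a, a \notin [:: aLam; aK; aKI; aKO] -> ar (hrun inp P (fill_tables A) s2) a = ar s2 a.
  by move=> a; apply: run_ar_sub.
have rr3 : forall v, v \in [:: rcap; rtop; rleft; rlab] -> rg (hrun inp P (fill_tables A) s2) v = rg s2 v.
  by move=> v; rewrite !inE => /or4P[] /eqP->; rewrite run_rg.
have o3 := run_ou inp P (p := fill_tables A) s2 isT.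
have t3 := h1 inp s2; rewrite f1 in t3.
set s3 := hrun _ _ (fill_tables A) s2 in ft ra3 rr3 o3 t3 *; clearbody s3.
have bs3 : base G cs labs1 labs2 inp L T s3.
  split=> //.
  - by apply: layout_frame lay2 => a ha; rewrite ra3 //; case: a ha => [|[|[|[|[|[|]]]]]].
  - by rewrite /caps rr3 // f1.
  - by rewrite rr3 // f4.
have fr3 : fresh s3.
  by move=> a x y; rewrite !inE => /or3P[] /eqP->; rewrite ra3 // f2 ra1.
have vl x : x < n -> all (valid_label G cs T) (lab x).
  by move=> hx; apply: valid_wf_label (wl x hx) _ => q; apply: idx.
have [||xs vis] := visit_allP co wfG vl szl bs3 fr3.
- by rewrite rr3 // f4.
- by rewrite rr3 // f4 // e2 size_cat.
have [t4 n40 n41] : [/\ tm (hrun inp P (visit_all A) s3) <= tm s3 + 5 + n * (d2 * (S * cc).+1 ^ d2 + d3 * (S * cc).+1 ^ d3).+2,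
   rg (hrun inp P (visit_all A) s3) 40 + tm s3 <= tm (hrun inp P (visit_all A) s3)
  & rg (hrun inp P (visit_all A) s3) 41 + tm s3 <= tm (hrun inp P (visit_all A) s3)].
  rewrite /visit_all; do 4 rewrite run_seqE; set u0 := hrun _ _ (41 ::= EC 0) _.
  have [z0 z40 z41] : [/\ tm u0 = tm s3 + 3, rg u0 40 = 0 & rg u0 41 = 0] by split=> //; rewrite /u0 /=; lia.
  have [y0 y1 y2] : [/\ rg u0 rcap = S * cc, rg u0 rleft = size labs1 & rg u0 rlab = n].
    by split; rewrite -[LHS]/(rg s3 _) rr3 // ?f1 // f4 // e2 /n size_cat.
  clearbody u0; have q1 := h2 inp u0; have c1 := @counter_le inp P 40 (CFor false 60 61 (EG rleft) (visit A false)) u0 isT.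
  have c1' := @counter_le inp P 41 (CFor false 60 61 (EG rleft) (visit A false)) u0 isT.
  have rr : forall v, v \in [:: rcap; rleft; rlab] -> rg (hrun inp P (CFor false 60 61 (EG rleft) (visit A false)) u0) v = rg u0 v.
    by move=> v; rewrite !inE => /or3P[] /eqP->; rewrite run_rg.
  set u1 := hrun _ _ (CFor _ _ _ _ _) u0 in q1 c1 c1' rr *; clearbody u1.
  have q2 := h3 inp u1; have c2 := @counter_le inp P 40 (CFor false 60 61 (EG rlab :- EG rleft) (visit A true)) u1 isT.
  have c2' := @counter_le inp P 41 (CFor false 60 61 (EG rlab :- EG rleft) (visit A true)) u1 isT.
  set u2 := hrun _ _ (CFor _ _ _ _ _) u1 in q2 c2 c2' *; clearbody u2.
  rewrite -[ev _ _ _ _]/(rg u0 rleft) y0 y1 in q1.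
  rewrite -[ev _ _ _ _]/(rg u1 rlab - rg u1 rleft) !rr // y0 y1 y2 in q2.
  have en : n = size labs1 + size labs2 by rewrite /n size_cat.
  rewrite en addKn in q2; split; [|lia|lia].
  set p2 := d2 * _ in q1 *; set p3 := d3 * _ in q2 *; rewrite en; nia.
have rc4 : rg (hrun inp P (visit_all A) s3) rcap = S * cc by rewrite run_rg // rr3 // f1.
have o4 := run_ou inp P (p := visit_all A) s3 isT.
set s4 := hrun _ _ (visit_all A) s3 in vis t4 n40 n41 rc4 o4 *; clearbody s4.
have [|ps [g1 g2 g3 g4]] := eliminate_emitP co wfG eT vl szl (h4 inp) vis _.
  by rewrite rc4.
exists xs, ps; split=> //; first by case: vis.
  by rewrite g3 o4 o3 f3 o1.
apply: leq_trans g4 _; rewrite rc4.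
(* [Z] dominates the four polynomial bounds and the size [S] itself, so that the rest of the
   estimate is linear in [Z] times [n + N]. *)
set N := size ps; pose X := (S * cc).+1; pose Z := d * X ^ d.
have X0 : 0 < X by [].
have leZ e : e <= d -> e * X ^ e <= Z.
  by move=> he; apply: leq_mul => //; rewrite leq_pexp2l.
have SZ : S < Z.
  have : X ^ 1 <= X ^ d by rewrite leq_pexp2l.
  rewrite expn1 /Z => hX; apply: leq_trans (leq_trans hX _); last by rewrite leq_pmull.
  by rewrite /X ltnS leq_pmulr // /cc; lia.
have z1 : d1 * X ^ d1 <= Z by apply: leZ; rewrite /d; lia.
have z2 : d2 * X ^ d2 <= Z by apply: leZ; rewrite /d; lia.
have z3 : d3 * X ^ d3 <= Z by apply: leZ; rewrite /d; lia.
have z4 : d4 * X ^ d4 <= Z by apply: leZ; rewrite /d; lia.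
have sz := size_enc_input szl; rewrite -/inp -/S -/n in sz.
rewrite -/X in t3 t4 *; move: z1 z2 z3 z4 t3 t4.
move: (d1 * _) (d2 * _) (d3 * _) (d4 * _) => y1 y2 y3 y4 z1 z2 z3 z4 t3 t4.
have nS : n * (8 * S + 1) <= n * (9 * Z) by rewrite leq_mul2l; apply/orP; right; lia.
have nV : n * (y2 + y3).+2 <= n * (4 * Z) by rewrite leq_mul2l; apply/orP; right; lia.
have nN : (12 + y4) * N <= 13 * Z * N by rewrite leq_mul2r; apply/orP; right; lia.
apply: (@leq_trans (tm s + 1000 * Z * (n + N).+1)).
  have -> : 1000 * Z * (n + N).+1 = 1000 * (n * Z) + 1000 * (Z * N) + 1000 * Z by lia.
  have e9 : n * (9 * Z) = 9 * (n * Z) by lia.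
  have e10 : n * (4 * Z) = 4 * (n * Z) by lia.
  have e11 : 13 * Z * N = 13 * (Z * N) by lia.
  rewrite e9 in nS; rewrite e10 in nV; rewrite e11 in nN; lia.
rewrite leq_add2l leq_mul2r; apply/orP; right.
have cc0 : 0 < cc by rewrite /cc; lia.
have XS : X <= cc * S.+1 by rewrite /X mulnS [cc * S]mulnC; lia.
have ZS : Z <= d * cc ^ d * S.+1 ^ d.
  by rewrite /Z -mulnA leq_mul2l -expnMn leq_exp2r ?XS ?orbT.
apply: (@leq_trans (1000 * (d * cc ^ d) * S.+1 ^ d)); first by rewrite -mulnA leq_mul2l ZS.
by apply: leq_mul; [apply: leq_addr | rewrite leq_pexp2l // leq_addl].
Qed.

(** * From positions in the lists to nodes of the run *)

Section Query.
Variables (R : regex) (A : automaton) (RA : recognizes A R).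
Variables (m t : nat) (G : spec m t) (cs : seq (seq (nat * nat))) (g : graph addr m t) (l1 l2 : seq addr).
Hypotheses (wfG : wf_spec G) (cgG : coarse_grained G) (slG : strictly_linear G) (co : cycle_ordering G cs).
Hypotheses (safe : safe_query R G) (runG : run G g).
Hypotheses (sub1 : {subset l1 <= node_ids g}) (sub2 : {subset l2 <= node_ids g}).
Notation psi := (psiV G cs).
Notation labs1 := (map psi l1).
Notation labs2 := (map psi l2).
Notation n := (size (labs1 ++ labs2)).
Notation lab := (nth [::] (labs1 ++ labs2)).
Notation S := (size (enc_spec G cs)).
Notation L := (module_code G A).
Notation node := (nth [::] (l1 ++ l2)).
Notation connected := (connected G cs labs1 labs2 L).
Notation accepted := (accepted G cs labs1 labs2 L).

Lemma labE x : x < n -> lab x = psi (node x) /\ node x \in node_ids g.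
Proof.
rewrite -map_cat size_map => hx; split; first exact: nth_map.
by have := mem_nth [::] hx; rewrite mem_cat => /orP[/sub1|/sub2].
Qed.

Lemma lab_wf x : x < n -> all (wf_label G cs) (lab x).
Proof.
move=> /labE[-> /(run_addr_ok wfG cgG runG) h].
by rewrite (psiV_labels co h); apply: wf_labels.
Qed.

Lemma lab_size x : x < n -> size (lab x) <= 2 * S.
Proof.
move=> /labE[-> h]; apply: leq_trans (size_psiV wfG cgG co runG h) _.
have -> : S = 2 + (m.+1 + size (enc_seq (fun p : 'I_m * graph nat m t => nat_of_ord p.1 :: enc_graph p.2) (prods G) ++
    enc_seq (enc_seq (fun e : nat * nat => [:: e.1; e.2])) cs)).
  rewrite /enc_spec 2!size_cat; congr (_ + (_ + _)).
  by rewrite /enc_seq /= (size_flatten_const (c := 1)) // size_enum_ord mul1n.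
by move: (size _) => z; lia.
Qed.

Lemma answer_facts x y : x < n -> y < n ->
  [/\ connected (x, y) <-> reachable g (node x) (node y), accepted (x, y) <-> rpq R g (node x) (node y)
    & lab x = lab y -> node x = node y].
Proof.
move=> /labE[ex hx] /labE[ey hy]; have [D RD safeD] := safe.
have [c [b [lp rq rc inj]]] := label_pairP wfG cgG slG co RA RD
  (iter_round_sound wfG cgG safeD (A := A) (r := m)) (fun M => @module_code_total _ _ _ wfG cgG A D safeD M)
  (fun k i j kG hi _ => path_tableE wfG cgG L j kG hi) runG hx hy.
rewrite -ex -ey in lp inj; split=> //.
  split; first by move/asboolP=> [c' /(label_pair_unique lp)[_ eb]]; apply/rc; rewrite eb.
  by move/rc=> hb; apply/asboolP; exists c; rewrite -hb.
split; first by move/asboolP=> [c' /(label_pair_unique lp)[<- _]]; move/rq.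
move=> h; have hb : b by apply/rc; case: h => p hp _; exists p.
by apply/asboolP; exists c; [rewrite -hb | apply/rq].
Qed.

Variables (xs : seq nat) (ps : seq (nat * nat)).
Hypotheses (cov : covers labs1 labs2 n xs) (ups : uniq ps).
Hypothesis psP : forall x y, (x, y) \in ps <->
  [/\ x \in xs, y \in xs, side labs1 x = false, side labs1 y = true & connected (x, y)].

Definition nodes_of (p : nat * nat) := (node p.1, node p.2).

Lemma ps_lt p : p \in ps -> p.1 < n /\ p.2 < n.
Proof. by case: p => x y /psP[hx hy _ _ _]; have [_ h _ _] := cov; split; apply: h. Qed.

Lemma side_node x : x < n -> if side labs1 x then node x \in l2 else node x \in l1.
Proof.
rewrite -map_cat size_map size_cat /side size_map nth_cat => hx.
case: (ltnP x (size l1)) => h; first exact: mem_nth.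
by apply: mem_nth; rewrite ltn_subLR.
Qed.

Lemma nodes_of_inj : {in ps &, injective nodes_of}.
Proof.
move=> [x y] [x' y'] hp hp' [ex ey]; have [h1 h2] := ps_lt hp; have [h1' h2'] := ps_lt hp'.
have [_ _ inj _] := cov; move/psP: hp => [hx hy sx sy _]; move/psP: hp' => [hx' hy' sx' sy' _].
congr (_, _); apply: inj => //; rewrite ?sx ?sy //.
  by rewrite (labE h1).1 (labE h1').1 ex.
by rewrite (labE h2).1 (labE h2').1 ey.
Qed.

(** A position that was skipped as a repetition is represented by an earlier one with the same
    label, and equal labels belong to equal nodes. *)
Lemma covered u (b : bool) : u \in (if b then l2 else l1) -> exists2 x, x \in xs & side labs1 x = b /\ node x = u.
Proof.
move=> hu; have [_ hlt _ hcov] := cov.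
have [x0 [hx0 s0 n0]] : exists x, [/\ x < n, side labs1 x = b & node x = u].
  case: b hu => hu; [exists (size l1 + index u l2) | exists (index u l1)];
    rewrite -map_cat !size_map size_cat /side size_map ?ltn_add2l ?leq_addr ?index_mem ?hu.
    by rewrite nth_cat ltnNge leq_addr /= addKn nth_index.
  split; [by apply: ltn_addr; rewrite index_mem | by apply/negbTE; rewrite -ltnNge index_mem |].
  by rewrite nth_cat index_mem hu nth_index.
have [y hy [sy ly]] := hcov x0 hx0; exists y => //; split; first by rewrite sy.
by have [_ _ ->] := answer_facts (hlt y hy) hx0.
Qed.

Lemma mem_nodes_of (Q : pred (nat * nat)) (Q' : addr -> addr -> Prop) :
    (forall p, p \in ps -> Q p <-> Q' (node p.1) (node p.2)) ->
    (forall u v, Q' u v -> reachable g u v) ->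
  forall u v, (u, v) \in [seq nodes_of p | p <- ps & Q p] <-> [/\ u \in l1, v \in l2 & Q' u v].
Proof.
move=> hQ hr u v; split.
  case/mapP=> p; rewrite mem_filter => /andP[hq hp] [-> ->].
  have [h1 h2] := ps_lt hp; have := side_node h1; have := side_node h2.
  case: p hp hq h1 h2 => x y hp hq h1 h2 /=; move/psP: (hp) => [_ _ -> -> _] h3 h4; split=> //.
  by apply/(hQ _ hp).
case=> hu hv hq; have [x hx [sx nx]] := @covered u false hu; have [y hy [sy ny]] := @covered v true hv.
have [_ hlt _ _] := cov.
have hp : (x, y) \in ps.
  apply/psP; split=> //; have [h _ _] := answer_facts (hlt x hx) (hlt y hy).
  by apply/h; rewrite nx ny; apply: hr.
apply/mapP; exists (x, y); last by rewrite /nodes_of nx ny.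
by rewrite mem_filter hp andbT; apply/(hQ _ hp); rewrite nx ny.
Qed.

Lemma perm_nodes_of (Q : pred (nat * nat)) (Q' : addr -> addr -> Prop) :
    (forall p, p \in ps -> Q p <-> Q' (node p.1) (node p.2)) ->
    (forall u v, Q' u v -> reachable g u v) ->
  perm_eq [seq nodes_of p | p <- ps & Q p] [seq uv <- all_pairs l1 l2 | `[< Q' uv.1 uv.2 >]].
Proof.
move=> hQ hr; apply: uniq_perm.
- rewrite map_inj_in_uniq ?filter_uniq // => p p'; rewrite !mem_filter => /andP[_ hp] /andP[_ hp'].
  exact: nodes_of_inj.
- by rewrite filter_uniq // undup_uniq.
move=> [u v]; rewrite mem_filter mem_undup; apply/idP/idP.
  move/(mem_nodes_of hQ hr)=> [hu hv hq]; apply/andP; split; first exact/asboolP.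
  by apply/allpairsP; exists (u, v).
case/andP=> /asboolP hq /allpairsP[[u' v'] /= [hu hv [eu ev]]].
by apply/(mem_nodes_of hQ hr); rewrite eu ev in hq *; split.
Qed.

Lemma size_ps : size ps = num_reachable g l1 l2.
Proof.
rewrite /num_reachable -(perm_size (perm_nodes_of (Q := predT) (Q' := reachable g) _ _)) //.
  by rewrite size_map filter_predT.
move=> [x y] hp; have [h1 h2] := ps_lt hp; have [h _ _] := answer_facts h1 h2.
by split=> // _; apply/h; move/psP: hp => [].
Qed.

Lemma perm_answers : perm_eq [seq nodes_of p | p <- ps & accepted p] (rpq_answers R g l1 l2).
Proof.
apply: perm_nodes_of; last by move=> u v [p hp _]; exists p.
by move=> [x y] hp; have [h1 h2] := ps_lt hp; have [_ h _] := answer_facts h1 h2.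
Qed.

Lemma output_answers : flatten [seq enc_label (lab p.1) ++ enc_label (lab p.2) | p <- ps & accepted p] =
  enc_output [seq (psi uv.1, psi uv.2) | uv <- [seq nodes_of p | p <- ps & accepted p]].
Proof.
rewrite /enc_output -!map_comp; congr flatten; apply/eq_in_map => p; rewrite mem_filter => /andP[_ hp].
by have [h1 h2] := ps_lt hp; rewrite /= (labE h1).1 (labE h2).1.
Qed.

(** This crude bound serves the word size, where the running time has to be polynomial in the input;
    the time bound keeps the exact number of pairs. *)
Lemma size_ps_le : size ps <= n * n.
Proof.
have : size ps <= size [seq (x, y) | x <- iota 0 n, y <- iota 0 n].
  apply: uniq_leq_size => // -[x y] /ps_lt[/= h1 h2].
  by apply/allpairsP; exists (x, y); rewrite !mem_iota !add0n.
by rewrite size_allpairs size_iota.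
Qed.

End Query.

(** [X] stands for the base of [word_bound]. As [X] is at least 2, a constant factor [K] is absorbed
    by [X ^ K], and the exponent depends on [R] only. *)
Lemma word_bound_le W C S n N I B X : S <= I -> n <= I -> N <= n * n -> I + B + 2 <= X ->
  I + B + W * (10 * I + 20) + W * (C * S.+1 ^ C * (n + N).+1) + W + 2 <= X ^ (1 + 31 * W + W * C + (C + 3)).
Proof.
move=> SI nI Nn hX; set K := 1 + 31 * W + W * C.
have X2 : 2 <= X by lia.
have X0 : 0 < X by lia.
have e1 : (n + N).+1 <= X ^ 3.
  have h : n.+2 * n.+2 <= X * X by apply: leq_mul; lia.
  have : X * X <= X ^ 3 by rewrite -[X * X]/(X ^ 2) leq_pexp2l.
  by apply: leq_trans; apply: leq_trans h; lia.
have e2 : S.+1 ^ C <= X ^ C by case: (C) => // C'; rewrite leq_exp2r //; lia.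
have e3 : C * S.+1 ^ C * (n + N).+1 <= C * X ^ (C + 3).
  by rewrite -mulnA leq_mul2l expnD leq_mul ?orbT.
have e4 : X <= X ^ (C + 3) by rewrite -{1}[X]expn1 leq_pexp2l // addnS.
have e5 := leq_mul (leqnn W) e3; rewrite mulnA in e5.
have e6 : W * (10 * I + 20) <= W * (30 * X ^ (C + 3)) by rewrite leq_mul2l; apply/orP; right; lia.
have e7 : W <= W * X ^ (C + 3) by rewrite leq_pmulr // expn_gt0 X0.
rewrite expnD; set Y := X ^ (C + 3) in e4 e5 e6 e7 *.
apply: (@leq_trans (K * Y)); last first.
  rewrite leq_mul2r; apply/orP; right; apply: ltnW; apply: leq_trans (ltn_expl K (isT : 1 < 2)) _.
  by case: (K) => // K'; rewrite leq_exp2r.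
have -> : K * Y = Y + 31 * (W * Y) + W * C * Y by rewrite /K; lia.
have e8 : W * (30 * Y) = 30 * (W * Y) by lia.
rewrite e8 in e6; lia.
Qed.

Lemma time_le W C S n N I Z : I <= S + 2 + n * (8 * S + 1) -> S <= 10 * Z.+1 ->
  W * (10 * I + 20) + 2 + W * (C * S.+1 ^ C * (n + N).+1) <=
  (W * (150 + C) + 2) * 11 ^ C.+1 * Z.+1 ^ C.+1 * (n + N).+1.
Proof.
move=> hI hS; set Y := S.+1 ^ C.+1 * (n + N).+1.
have S1 : S.+1 <= S.+1 ^ C.+1 by rewrite -{1}[S.+1]expn1 leq_pexp2l.
have e1 : 10 * I + 20 <= 150 * Y.
  apply: (@leq_trans (150 * (S.+1 * (n + N).+1))); last by rewrite leq_mul2l leq_mul2r S1 !orbT.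
  apply: (@leq_trans (150 * (S.+1 * n.+1))); last by rewrite leq_mul2l leq_mul2l ltnS leq_addr !orbT.
  have := leq_mul (leqnn 10) hI; nia.
have e2 : C * S.+1 ^ C * (n + N).+1 <= C * Y.
  by rewrite -mulnA /Y expnS leq_mul2l -mulnA leq_pmull ?orbT.
have Y0 : 0 < Y by rewrite /Y muln_gt0 expn_gt0.
have e3 := leq_mul (leqnn W) e1; have e4 := leq_mul (leqnn W) e2.
apply: (@leq_trans ((W * (150 + C) + 2) * Y)).
  have -> : (W * (150 + C) + 2) * Y = W * (150 * Y) + W * (C * Y) + 2 * Y by lia.
  lia.
(* From [S <= 10 * Z.+1] follows [S.+1 <= 11 * Z.+1], whence the factor [11 ^ C.+1]. *)
rewrite /Y mulnA leq_mul2r -mulnA leq_mul2l -expnMn leq_exp2r //; apply/orP; right; apply/orP; right.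
by lia.
Qed.

(* R is fixed: the program and the constants depend on R only. *)
Theorem mainTheorem2 (R : regex) :
  exists (prog : cmd) (w c d : nat),
  forall (m t : nat) (G : spec m t) (cs : seq (seq (nat * nat)))
         (g : graph addr m t) (l1 l2 : seq addr),
    wf_spec G -> coarse_grained G -> strictly_linear G ->
    cycle_ordering G cs ->
    regex_over t R -> safe_query R G ->
    run G g ->
    {subset l1 <= node_ids g} -> {subset l2 <= node_ids g} ->
    let psi := psiV G cs in
    let inp := enc_input G cs (map psi l1) (map psi l2) in
    exists (s : mstate) (time : nat) (ans : seq (addr * addr)),
      [/\ exec (word_bound w (size (nodes g)) inp) prog (start_state inp) s time,
          perm_eq ans (rpq_answers R g l1 l2),
          out s = enc_output [seq (psi uv.1, psi uv.2) | uv <- ans]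
        & time <= c * (spec_size G).+1 ^ d
                  * (size l1 + size l2 + num_reachable g l1 l2).+1].
Proof.
have [A RA] := regex_automaton R; have [C hC] := searchP RA.
(* [W] bounds the weights of both passes and is also the modulus by which the arrays are
   interleaved, so it exceeds every array name. *)
set P := table_size A in hC; pose W := (weight_cmd P (read_input false) + weight_cmd P (search A)).+1.
(* [X ^ k] bounds the contents of the memory and the registers; the further exponent [W] in the word
   bound is the degree of intermediate results. *)
pose k := 1 + 31 * W + W * C + (C + 3).
(* After the measuring pass the cursor [rcur] equals the length of the input. It is copied to
   register 0, and from then on the arrays have an address. *)
exists (Seq (compile_cmd P W false (read_input false))
  (Seq (Assign 0 (Reg rcur.+1)) (compile_cmd P W true (search A)))).
exists (k * W), ((W * (150 + C) + 2) * 11 ^ C.+1), C.+1.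
move=> m t G cs g l1 l2 wfG cgG slG co _ safe runG sub1 sub2 psi inp.
set S := size (enc_spec G cs); set n := size (map psi l1 ++ map psi l2).
have en : n = size l1 + size l2 by rewrite /n size_cat !size_map.
pose h0 := HState (fun=> 0) (fun _ _ _ => 0) [::] 0.
have [[c1 _] _ _ _ t1] := read_inputP P (erefl inp) false h0.
have a1 : forall q x y, ar (hrun inp P (read_input false) h0) q x y = 0.
  by move=> q x y; rewrite run_ar.
have o1 := run_ou inp P (p := read_input false) h0 isT.
have ok1 : ok_cmd false (read_input false) by [].
have ok2 : ok_cmd true (search A) by [].
have lsz := @lab_size m t G cs g l1 l2 wfG cgG co runG sub1 sub2.
have lwf := @lab_wf m t G cs g l1 l2 wfG cgG co runG sub1 sub2.
have [xs [ps [cov ups psP ou2 t2]]] := hC m t G cs (map psi l1) (map psi l2) (hrun inp P (read_input false) h0) wfG cgG co lwf lsz a1.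
have szps := size_ps RA wfG cgG slG co safe runG sub1 sub2 cov ups psP.
have permA := perm_answers RA wfG cgG slG co safe runG sub1 sub2 cov ups psP.
have outA := output_answers sub1 sub2 cov psP.
have lps := size_ps_le cov ups psP.
have sinp := size_enc_input lsz.
rewrite -/psi -/inp -/S -/n in t2 ou2 szps permA outA lps sinp.
set N := size ps in t2 szps lps.
set s1 := hrun inp P (read_input false) h0 in c1 t1 a1 o1 t2 ou2 *.
set s2 := hrun inp P (search A) s1 in t2 ou2 *.
set mx := \max_(x <- inp) x; pose M := size inp + mx.
have SI : S <= size inp by rewrite /inp /enc_input size_cat leq_addr.
have nI : n <= size inp.
  rewrite /inp /enc_input !size_cat /n size_cat.
  have h l : size l <= size (enc_seq enc_label l) by apply: size_enc_seq.
  by apply: leq_trans (leq_addl _ _); apply: leq_add.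
have I0 : 0 < size inp by [].
set X := size (nodes g) + size inp + mx + 2.
have hX : size inp + mx + 2 <= X by rewrite /X; lia.
have key := @word_bound_le W C S n N (size inp) mx X SI nI lps hX.
have hB q : q <= size inp + mx + W * (10 * size inp + 20) + W * (C * S.+1 ^ C * (n + N).+1) + W + 2 ->
    q ^ W <= word_bound (k * W) (size (nodes g)) inp.
  move=> hq; rewrite /word_bound -/mx -/X expnM leq_exp2r //; exact: leq_trans hq key.
set B := word_bound _ _ _ in hB *.
have inM a : a \in inp -> a <= M.
  by move=> ha; apply: leq_trans (leq_addl _ _); rewrite /mx (big_rem a) //= leq_maxl.
have sim0 : simulates inp W false (size inp) h0 (start_state inp) by split.
have bd0 : bounded h0 M by split.
have w1 : weight_cmd P (read_input false) <= W by rewrite /W; lia.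
have w2 : weight_cmd P (search A) <= W by rewrite /W; lia.
have t1' : tm s1 <= 10 * size inp + 20 by move: t1; rewrite [tm h0]/=; lia.
have T1 := leq_mul (leqnn W) t1'.
have [|x1 [n1 [ex1 sm1 le1 bd1]]] := simulation (leqnn _) I0 w1 ok1 sim0 bd0 inM (leq_addr _ _) (B := B).
  by apply: hB; rewrite -/s1 [tm h0]/= subn0 /M; lia.
rewrite -/s1 [tm h0]/= subn0 in sm1 le1 bd1.
clearbody s1; have [rx1 ox1 mx1] := sm1.
pose x2 := MState (upd (regs x1) 0 (size inp)) (Defs.mem x1) (out x1).
have ex2 : exec B (Assign 0 (Reg rcur.+1)) x1 x2 2.
  apply: exec_assign; rewrite [eval _ _ _]/= rx1 c1 /word ifT //.
  apply: leq_trans (hB (size inp).+1 _); last by rewrite /M in inM *; lia.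
  by rewrite -{1}[(size inp).+1]expn1 leq_pexp2l // /W.
(* The first pass has not written to memory, so the cells above the input are still 0, as the empty
   arrays of [s1] require. *)
have sm2 : simulates inp W true (size inp) s1 x2.
  split; [by move=> r; exact: rx1 | exact: ox1 |].
  split=> [||q a b hq]; [by [] | by move=> a _; exact: mx1 |].
  by rewrite -[LHS]/(Defs.mem x1 _) mx1 a1 nth_default // /cell leq_addr.
have T2 : W * (tm s2 - tm s1) <= W * (C * S.+1 ^ C * (n + N).+1).
  by rewrite leq_mul2l; apply/orP; right; move: t2; lia.
have [|x3 [n3 [ex3 sm3 le3 _]]] := simulation (leqnn _) I0 w2 ok2 sm2 bd1 (fun a ha => leq_trans (inM a ha) (leq_addr _ _)) (leq_trans (leq_addr _ _) (leq_addr _ _)) (B := B).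
  by apply: hB; rewrite -/s2 /M; lia.
rewrite -/s2 in sm3 le3; clearbody s2.
exists x3, (n1 + (2 + n3)), [seq nodes_of l1 l2 p | p <- ps & accepted G cs (map psi l1) (map psi l2) (module_code G A) p].
split=> //.
- by apply: exec_seq ex1 _; apply: exec_seq ex2 ex3.
- by have [_ -> _] := sm3; rewrite ou2 o1 outA.
rewrite -szps -en -/N; apply: leq_trans (time_le W C N sinp (size_enc_spec_le wfG cgG slG co)); rewrite -/S.
lia.
Qed.
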